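(* Let $0<\eta\le2$, $0<\alpha<1$, $\omega\ge0$, and let $A$ be a densely defined closed linear operator on a Banach space $X$. If $\{S_{\eta,\eta}(t)\}_{t>0}$ is a $(g_\eta,g_\eta)$-regularized resolvent family generated by $A\in\mathcal{C}^{\eta,\eta}(\omega)$, then $A\in\mathcal{C}^{\alpha\eta,\alpha\eta}(\omega^{1/\alpha})$ generates the $(g_{\alpha\eta},g_{\alpha\eta})$-regularized resolvent family $$S_{\alpha\eta,\alpha\eta}(t)x:=\int_0^\infty\psi_{\alpha,0}(t,s)S_{\eta,\eta}(s)x\,ds,\qquad t>0,\ x\in X.$$ In particular: (i) If $A$ generates a $C_0$-semigroup $\{T(t)\}_{t>0}$ (i.e. a $(g_1,g_1)$-regularized resolvent family) satisfying $\|T(t)\|\le Me^{\omega t}$, $t\ge0$, then $A\in\mathcal{C}^{\alpha,\alpha}(\omega^{1/\alpha})$ generates the $(g_\alpha,g_\alpha)$-regularized resolvent family $$S_{\alpha,\alpha}(t)x:=\int_0^\infty\psi_{\alpha,0}(t,s)T(s)x\,ds,\qquad t>0,\ x\in X.$$ (ii) Let $\beta\in(1,2]$ and let $\{S_{\beta,\beta}(t)\}_{t>0}$ be a $(g_\beta,g_\beta)$-regularized resolvent family generated by $A\in\mathcal{C}^{\beta,\beta}(\omega)$. Then $A\in\mathcal{C}^{1,1}(\omega^\beta)$ generates the $C_0$-semigroup $$T(t)x:=\int_0^\infty\psi_{\frac1\beta,0}(t,s)S_{\beta,\beta}(s)x\,ds,\qquad t>0,\ x\in X.$$ In the case that $A$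 is the generator of an exponentially bounded sine function $(S(t))_{t>0}$, $\|S(t)\|\le Me^{\omega t}$ for $t\ge0$ (i.e. $(S(t))_{t>0}$ is a $(g_2,g_2)$-regularized resolvent family generated by $A$), then $A$ generates the $C_0$-semigroup $$T(t)x:=\frac{1}{2\sqrt{\pi}}\,t^{-3/2}\int_0^\infty s\,e^{-s^2/(4t)}S(s)x\,ds,\qquad t>0,\ x\in X,$$ with exponential bound $\omega^2$.
   Context: For $\gamma>0$, $g_\gamma(t):=t^{\gamma-1}/\Gamma(\gamma)$, $t>0$. Wright function: for $\lambda>-1$, $\mu\in\mathbb{C}$, $W_{\lambda,\mu}(z):=\sum_{n=0}^\infty \frac{z^n}{n!\,\Gamma(\lambda n+\mu)}$, $z\in\mathbb{C}$ (with $1/\Gamma=0$ at the poles of $\Gamma$). Scaled Wright function: for $0<\alpha<1$, $\beta\ge0$, $\psi_{\alpha,\beta}(t,s):=t^{\beta-1}W_{-\alpha,\beta}(-st^{-\alpha})$, $t>0$, $s\in\mathbb{C}$; in particular $\psi_{\alpha,0}(t,s)=t^{-1}W_{-\alpha,0}(-st^{-\alpha})$, and $\psi_{\frac12,0}(t,s)=\frac{1}{2\sqrt{\pi}}t^{-3/2}s\,e^{-s^2/(4t)}$ for $t,s>0$. $\mathcal{B}(X)$ is the space of bounded linear operators on $X$. Let $a,b>0$. A family $\{S_{a,b}(t)\}_{t>0}\subset\mathcal{B}(X)$ is a $(g_a,g_b)$-regularized resolvent family generated by the densely defined closed operator $A$ if: (a) $S_{a,b}(t)$ is strongly continuous for $t>0$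 and $\lim_{t\to0^+}S_{a,b}(t)x/g_b(t)=x$ for all $x\in X$; (b) $S_{a,b}(t)A\subset AS_{a,b}(t)$ for $t>0$, i.e. for $x\in D(A)$, $S_{a,b}(t)x\in D(A)$ and $AS_{a,b}(t)x=S_{a,b}(t)Ax$; (c) $S_{a,b}(t)x=g_b(t)x+A\left(\int_0^t g_a(t-s)S_{a,b}(s)x\,ds\right)$ for all $x\in X$, $t>0$. For $\omega\ge0$, $A\in\mathcal{C}^{a,b}(\omega)$ means that $A$ generates a $(g_a,g_b)$-regularized resolvent family $\{S_{a,b}(t)\}_{t>0}$ such that $S_{a,b}(\cdot)x\in L^1_{loc}([0,\infty),X)$ for all $x\in X$ and which is Laplace transformable of parameter $\omega$, i.e. $\int_0^\infty e^{-\lambda t}S_{a,b}(t)x\,dt$ converges (as $\lim_{\tau\to\infty}\int_0^\tau$) for all $x\in X$ and all $\Re\lambda>\omega$. In the exponential bounds $\|T(t)\|\le Me^{\omega t}$ and $\|S(t)\|\le Me^{\omega t}$, $M>0$ is a constant. A semigroup $T$ has exponential bound $\omega^2$ if $\|T(t)\|\le M'e^{\omega^2t}$ for all $t>0$ and some constant $M'>0$. *)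

(* Defs.v *)
(* Stdlib reals and Coquelicot. *)
From Stdlib Require Import Reals ZArith.
From Coquelicot Require Import Coquelicot.
Open Scope R_scope.

(** * Special functions *)

(* Integrals over the half-line and over (0, t) are improper Riemann integrals,
   with limits at both ends: the integrands below are continuous in the
   interior but may be singular at the ends, and convergence at infinity may
   be merely conditional. *)

Definition is_half_line_int {V : NormedModule R_AbsRing} (f : R -> V) (v : V) :=
  is_RInt_gen f (at_right 0) (Rbar_locally p_infty) v.

Definition ex_half_line_int {V : NormedModule R_AbsRing} (f : R -> V) :=
  exists v, is_half_line_int f v.

Definition half_line_int {V : CompleteNormedModule R_AbsRing} (f : R -> V) : V :=
  RInt_gen f (at_right 0) (Rbar_locally p_infty).

(* Meaningful for 0 < x only; see [rGamma] for other arguments. *)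
Definition Gamma (x : R) : R :=
  half_line_int (fun t : R => Rpower t (x - 1) * exp (- t)).

Fixpoint rising (x : R) (m : nat) : R :=
  match m with
  | O => 1
  | S k => rising x k * (x + INR k)
  end.

(* The entire function 1 / Gamma on the real line, through
   Gamma (x + m) = x (x + 1) ... (x + m - 1) Gamma x, with m = 0 if 0 < x
   and m such that 0 < x + m otherwise.  At the poles x = 0, -1, -2, ... of
   Gamma one factor vanishes, so that the value is 0. *)
Definition rGamma (x : R) : R :=
  let m := Z.to_nat (up (- x)) in rising x m / Gamma (x + INR m).

(* t ^ (c - 1) / Gamma c, for 0 < c and 0 < t *)
Definition g (c t : R) : R := Rpower t (c - 1) / Gamma c.

(* W_{l,m}(z), for -1 < l and real m, z *)
Definition Wright (l m z : R) : R :=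
  PSeries (fun n => rGamma (l * INR n + m) / INR (fact n)) z.

(* The scaled Wright function psi_{a,b}(t,s), for 0 < t and real s *)
Definition psi (a b t s : R) : R :=
  Rpower t (b - 1) * Wright (- a) b (- s * Rpower t (- a)).

(* x ^ y for 0 <= x and 0 < y ([Rpower 0 y] is 1, not 0) *)
Definition rpow (x y : R) : R := if Rlt_dec 0 x then Rpower x y else 0.

Definition cexp (z : C) : C :=
  (exp (Re z) * cos (Im z), exp (Re z) * sin (Im z)).

(** * Restriction of scalars *)

(* Coquelicot integrates functions with values in a real Banach space; this is
   the real Banach space underlying a complex one, on the same carrier. *)

Section Realification.

Variable X : CompleteNormedModule C_AbsRing.

Definition rscal (r : R) (x : X) : X := scal (RtoC r : C_AbsRing) x.

Lemma rscal_assoc (r s : R) (x : X) :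
  rscal r (rscal s x) = rscal (mult (r : R_AbsRing) s) x.
Proof.
unfold rscal; rewrite scal_assoc; f_equal.
apply (eq_sym (RtoC_mult r s)).
Qed.

Lemma rscal_one (x : X) : rscal (one : R_AbsRing) x = x.
Proof. exact (scal_one x). Qed.

Lemma rscal_distr_l (r : R) (x y : X) :
  rscal r (plus x y) = plus (rscal r x) (rscal r y).
Proof. exact (scal_distr_l (RtoC r : C_AbsRing) x y). Qed.

Lemma rscal_distr_r (r s : R) (x : X) :
  rscal (plus (r : R_AbsRing) s) x = plus (rscal r x) (rscal s x).
Proof.
refine (eq_trans _ (scal_distr_r (RtoC r : C_AbsRing) (RtoC s) x)).
exact (f_equal (fun c : C_AbsRing => scal c x) (RtoC_plus r s)).
Qed.

Definition real_module_mixin : ModuleSpace.mixin_of R_Ring X :=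
  ModuleSpace.Mixin R_Ring X rscal
    rscal_assoc rscal_one rscal_distr_l rscal_distr_r.

Definition real_module_class : ModuleSpace.class_of R_Ring X :=
  ModuleSpace.Class R_Ring X (AbelianGroup.class X) real_module_mixin.

Definition real_aux_class : NormedModuleAux.class_of R_AbsRing X :=
  NormedModuleAux.Class R_AbsRing X real_module_class (UniformSpace.class X).

Definition real_aux : NormedModuleAux R_AbsRing :=
  NormedModuleAux.Pack R_AbsRing X real_aux_class X.

Lemma rscal_norm (r : R_AbsRing) (x : real_aux) :
  norm (scal r x : X) <= abs r * norm (x : X).
Proof.
replace (abs r) with (abs (RtoC r : C_AbsRing)).
- exact (norm_scal (RtoC r : C_AbsRing) (x : X)).
- exact (Cmod_R r).
Qed.

Definition real_norm_mixin : NormedModule.mixin_of R_AbsRing real_aux :=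
  NormedModule.Mixin R_AbsRing real_aux
    (fun x => norm (x : X)) (norm_factor (V := X))
    (norm_triangle (V := X)) rscal_norm (norm_compat1 (V := X))
    (norm_compat2 (V := X)) (norm_eq_zero (V := X)).

Definition real_normed_class : NormedModule.class_of R_AbsRing X :=
  NormedModule.Class R_AbsRing X real_aux_class real_norm_mixin.

Definition realify : CompleteNormedModule R_AbsRing :=
  CompleteNormedModule.Pack R_AbsRing X
    (CompleteNormedModule.Class R_AbsRing X real_normed_class
       (CompleteSpace.class X)) X.

End Realification.

(** * Unbounded operators *)

Record linear_operator (X : NormedModule C_AbsRing) := {
  dom : X -> Prop;
  (* the values outside of [dom] are irrelevant *)
  op :> X -> X;
  dom_zero : dom zero;
  dom_plus : forall x y, dom x -> dom y -> dom (plus x y);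
  dom_scal : forall (c : C_AbsRing) x, dom x -> dom (scal c x);
  op_plus : forall x y, dom x -> dom y -> op (plus x y) = plus (op x) (op y);
  op_scal : forall (c : C_AbsRing) x, dom x -> op (scal c x) = scal c (op x)
}.

Arguments dom {X} l x.
Arguments op {X} l x.

Definition densely_defined {X : NormedModule C_AbsRing} (A : linear_operator X) :=
  forall (x : X) (eps : posreal), exists y, dom A y /\ ball x eps y.

Definition closed_operator {X : NormedModule C_AbsRing} (A : linear_operator X) :=
  closed (fun p : X * X => dom A (fst p) /\ snd p = A (fst p)).

(** * Regularized resolvent families *)

(* A family {S(t)}_{t > 0} is a function R -> X -> X of which only the values
   at positive times matter.  [is_linear] includes boundedness. *)
Record resolvent_family {X : CompleteNormedModule C_AbsRing} (a b : R)
    (A : linear_operator X) (S : R -> X -> X) : Prop := {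
  resolvent_bounded : forall t, 0 < t -> is_linear (S t);
  resolvent_continuous : forall x t, 0 < t -> continuous (fun s : R => S s x) t;
  resolvent_initial : forall x,
    filterlim (fun t : R => scal (RtoC (/ g b t) : C_AbsRing) (S t x))
      (at_right 0) (locally x);
  resolvent_commute : forall t x, 0 < t -> dom A x ->
    dom A (S t x) /\ A (S t x) = S t (A x);
  resolvent_equation : forall t x, 0 < t ->
    exists y : X,
      is_RInt_gen (V := realify X)
        (fun s : R => scal (RtoC (g a (t - s)) : C_AbsRing) (S s x))
        (at_right 0) (at_left t) y
      /\ dom A y
      /\ S t x = plus (scal (RtoC (g b t) : C_AbsRing) x) (A y)
}.

(* Local integrability on [0, oo) of a function that is continuous on (0, oo):
   its norm has a finite integral over each (0, T). *)
Definition L1_loc {X : NormedModule C_AbsRing} (f : R -> X) :=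
  forall T, 0 < T ->
    ex_RInt_gen (fun t : R => norm (f t)) (at_right 0) (at_point T).

Definition laplace_transformable {X : CompleteNormedModule C_AbsRing} (w : R)
    (S : R -> X -> X) :=
  forall (x : X) (l : C), w < Re l ->
    ex_half_line_int (V := realify X)
      (fun t : R => scal (cexp (- (l * t))%C : C_AbsRing) (S t x)).

(* A belongs to C^{a,b}(w), and S is the family that it generates (A generates
   at most one). *)
Definition generates_in_class {X : CompleteNormedModule C_AbsRing} (a b w : R)
    (A : linear_operator X) (S : R -> X -> X) :=
  resolvent_family a b A S
  /\ (forall x, L1_loc (fun t => S t x))
  /\ laplace_transformable w S.

(* C_0-semigroups and sine functions are taken as (g_1,g_1)- and
   (g_2,g_2)-regularized resolvent families. *)
Definition generates_semigroup {X : CompleteNormedModule C_AbsRing}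
    (A : linear_operator X) (T : R -> X -> X) := resolvent_family 1 1 A T.

Definition generates_sine_function {X : CompleteNormedModule C_AbsRing}
    (A : linear_operator X) (S : R -> X -> X) := resolvent_family 2 2 A S.

Definition exp_bounded {X : NormedModule C_AbsRing} (M w : R) (S : R -> X -> X) :=
  forall t x, 0 < t -> norm (S t x) <= M * exp (w * t) * norm x.

(** * Subordination *)

Definition kernel_converges {X : CompleteNormedModule C_AbsRing}
    (k : R -> R -> R) (S : R -> X -> X) :=
  forall t x, 0 < t ->
    ex_half_line_int (V := realify X)
      (fun s : R => scal (RtoC (k t s) : C_AbsRing) (S s x)).

Definition kernel_int {X : CompleteNormedModule C_AbsRing}
    (k : R -> R -> R) (S : R -> X -> X) (t : R) (x : X) : X :=
  half_line_int (V := realify X)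
    (fun s : R => scal (RtoC (k t s) : C_AbsRing) (S s x)).

(* Main.v *)
Require Import Defs.
From Stdlib Require Import Reals Lra Lia ZArith Classical ClassicalEpsilon FunctionalExtensionality.
From Coquelicot Require Import Coquelicot.
Open Scope R_scope.

(** The family T(t) = S_{al eta, al eta}(t) is S seen through the kernel
    psi_{al,0}(t,s), whose Laplace transform in t is exp(- s u^al). As the
    Laplace transform of S is (u^eta - A)^(-1), that of T should be
    (u^(al eta) - A)^(-1), which is what is required of the generated family.
    The proof checks the resolvent equation of T directly, in the time domain.

    Only the primitive F(s) of the orbit S(.)x has a useful bound,
    |F(s)| <= C |x| s^eta e^(mu s) for mu > w: it follows from the convergence of
    the Laplace integral ([prim_growth]), and the uniform boundedness principle
    makes it linear in x ([prim_orbit_growth]). Integration by parts then writes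
    T(t)x as the absolutely convergent integral of k(t,s) F(s), where
    k = - d/ds psi_{al,0} ([kint_parts]). With b = al eta:
    - Convolution of k with g_b in t amounts to a right convolution with g_eta
      in s ([kernel_convolution]), so that g_b * T is the integral of k against
      g_eta * F ([kint_convolution]).
    - The resolvent equation of S, once integrated, says that A maps (g_eta * F)(s)
      to F(s) - g_(eta+1)(s) x ([integrated_resolvent]).
    - The integral of k(t,s) g_(eta+1)(s) is g_b(t) ([kernel_g]).
    As A is closed, A (g_b * T)(t) = T(t)x - g_b(t) x. The last identity also
    yields the behaviour of T at t = 0 ([kint_initial]).

    What is needed of the kernel comes from contour integrals of
    u^nu exp(t u - s u^al). The reflection formula of the Gamma function makes
    the Wright series such an integral over the negative real axis
    ([wright_series]); the contour is rotated to the imaginary axis and shifted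
    to any vertical line Re u = c ([vint_indep]). On that line k is bounded by a
    multiple of exp(c t - (1 - th) s c^al) ([K_bound]), which beats the growth of F
    as soon as w < c^al; this is why the growth rate w of S becomes w^(1/al)
    ([kint_bound]), and convolutions turn into multiplications by powers of u.

    The statements on semigroups are the cases eta = 1 and al = 1/eta. For the
    sine function psi_{1/2,0} is a Gaussian ([psi_half]), and completing the square
    gives the exponential bound w^2 itself ([weierstrass_bound]). *)

Notation RNM := (CompleteNormedModule R_AbsRing).

(** * Limits and norms *)

Lemma filterlim_eps {T : Type} {V : RNM} (F : (T -> Prop) -> Prop) {FF : Filter F}
    (f : T -> V) (l : V) :
  (forall eps, 0 < eps -> F (fun x => norm (minus (f x) l) <= eps)) ->
  filterlim f F (locally l).
Proof.
intros H.
apply (proj2 (filterlim_locally_ball_norm f l)). intros eps.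
generalize (H (eps / 2) (is_pos_div_2 eps)).
apply filter_imp. intros x Hx. unfold ball_norm.
apply Rle_lt_trans with (1 := Hx). generalize (cond_pos eps); lra.
Qed.

Lemma filterlim_eps_inv {T : Type} {V : RNM} (F : (T -> Prop) -> Prop) {FF : Filter F}
    (f : T -> V) (l : V) :
  filterlim f F (locally l) ->
  forall eps, 0 < eps -> F (fun x => norm (minus (f x) l) <= eps).
Proof.
intros H eps He.
generalize (proj1 (filterlim_locally_ball_norm f l) H (mkposreal eps He)).
apply filter_imp. intros x Hx. apply Rlt_le. exact Hx.
Qed.

Lemma filterlim_norm_le {T : Type} {V : RNM} (F : (T -> Prop) -> Prop) {FF : ProperFilter F}
    (f : T -> V) (l x0 : V) (e : R) :
  filterlim f F (locally l) -> F (fun x => norm (minus (f x) x0) <= e) ->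
  norm (minus l x0) <= e.
Proof.
intros H H0.
apply (filterlim_le (F := F) (fun x => norm (minus (f x) x0)) (fun _ => e)
   (norm (minus l x0)) e).
- exact H0.
- apply (filterlim_comp _ _ _ (fun x => minus (f x) x0) norm F (locally (minus l x0))).
  + apply (filterlim_comp_2 (F := F) (G := locally l) (H := locally (opp x0)) f (fun _ => opp x0)).
    * exact H.
    * apply filterlim_const.
    * exact (filterlim_plus l (opp x0)).
  + exact (filterlim_norm (minus l x0)).
- apply filterlim_const.
Qed.

Lemma norm_tri {V : RNM} (x y : V) : norm (plus x y) <= norm x + norm y.
Proof. exact (norm_triangle x y). Qed.

Lemma norm_minus_sym {V : RNM} (x y : V) : norm (minus x y) = norm (minus y x).
Proof.
rewrite <- (norm_opp (minus x y)). f_equal. apply opp_minus.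
Qed.

Lemma norm_minus_tri {V : RNM} (x y z : V) :
  norm (minus x z) <= norm (minus x y) + norm (minus y z).
Proof.
replace (minus x z) with (plus (minus x y) (minus y z)).
- apply norm_tri.
- unfold minus. rewrite plus_assoc. f_equal.
  rewrite <- plus_assoc, plus_opp_l. apply plus_zero_r.
Qed.

Lemma filterlim_norm_le0 {T : Type} {V : RNM} (F : (T -> Prop) -> Prop) {FF : ProperFilter F}
    (f : T -> V) (l : V) (e : R) :
  filterlim f F (locally l) -> F (fun x => norm (f x) <= e) -> norm l <= e.
Proof.
intros H H0.
apply (filterlim_le (F := F) (fun x => norm (f x)) (fun _ => e) (norm l) e).
- exact H0.
- exact (filterlim_comp _ _ _ f norm F _ _ H (filterlim_norm l)).
- apply filterlim_const.
Qed.

Lemma eq_of_norm_le {V : RNM} (x y : V) (C : R) :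
  (forall eps, 0 < eps -> norm (minus x y) <= C * eps) -> x = y.
Proof.
intros H.
assert (Hz : norm (minus x y) = 0).
{ apply Rle_antisym; [|apply norm_ge_0].
  apply Rnot_lt_le. intros Hp.
  assert (HC : 0 < Rabs C + 1) by (generalize (Rabs_pos C); lra).
  assert (He : 0 < norm (minus x y) / 2 / (Rabs C + 1)).
  { apply Rdiv_lt_0_compat; lra. }
  generalize (H _ He). intros H1.
  assert (C * (norm (minus x y) / 2 / (Rabs C + 1)) <= norm (minus x y) / 2).
  { apply Rle_trans with ((Rabs C + 1) * (norm (minus x y) / 2 / (Rabs C + 1))).
    - apply Rmult_le_compat_r; [lra|]. generalize (Rle_abs C); lra.
    - right. field. lra. }
  lra. }
assert (Hm : minus x y = zero) by exact (norm_eq_zero _ Hz).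
transitivity (plus (minus x y) y).
- unfold minus. now rewrite <- plus_assoc, plus_opp_l, plus_zero_r.
- rewrite Hm. apply plus_zero_l.
Qed.

(** * Improper integrals with integrable majorants *)

(** One-sided neighbourhoods of the left end of an interval, and, below, of
    the right end; for 0, p_infty and finite t they are the filters of the
    half-line integrals and of the integrals over (0, t). *)
Definition lo (a : Rbar) : (R -> Prop) -> Prop :=
  match a with Finite r => at_right r | _ => Rbar_locally a end.
Definition hi (b : Rbar) : (R -> Prop) -> Prop :=
  match b with Finite r => at_left r | _ => Rbar_locally b end.

Global Instance lo_proper a : ProperFilter (lo a).
Proof. destruct a; apply _. Qed.
Global Instance hi_proper a : ProperFilter (hi a).
Proof. destruct a; apply _. Qed.

Definition inn (a b : Rbar) (x : R) := Rbar_lt a x /\ Rbar_lt x b.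

Lemma inn_between a b x y z : inn a b x -> inn a b y -> x <= z <= y -> inn a b z.
Proof.
intros [H1 H2] [H3 H4] [H5 H6]. split.
- apply Rbar_lt_le_trans with x; [exact H1 | exact H5].
- apply Rbar_le_lt_trans with y; [exact H6 | exact H4].
Qed.

Lemma lo_inn a b x0 : inn a b x0 -> lo a (fun x => inn a b x /\ x <= x0).
Proof.
intros [H1 H2]. destruct a as [a| |]; simpl in *.
- assert (He : 0 < x0 - a) by lra.
  exists (mkposreal _ He). intros x Hx Hax.
  unfold ball in Hx; simpl in Hx; unfold AbsRing_ball, abs, minus, plus, opp in Hx; simpl in Hx.
  apply Rabs_lt_between in Hx.
  assert (x < x0) by lra.
  split; [|lra]. split; [exact Hax|].
  apply Rbar_lt_trans with x0; [assumption|assumption].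
- contradiction.
- exists x0. intros x Hx. split; [|lra]. split; [exact I|].
  apply Rbar_lt_trans with x0; assumption.
Qed.

Lemma hi_inn a b y0 : inn a b y0 -> hi b (fun y => inn a b y /\ y0 <= y).
Proof.
intros [H1 H2]. destruct b as [b| |]; simpl in *.
- assert (He : 0 < b - y0) by lra.
  exists (mkposreal _ He). intros x Hx Hax.
  unfold ball in Hx; simpl in Hx; unfold AbsRing_ball, abs, minus, plus, opp in Hx; simpl in Hx.
  apply Rabs_lt_between in Hx.
  assert (y0 < x) by lra.
  split; [|lra]. split; [|exact Hax].
  apply Rbar_lt_trans with y0; [assumption|assumption].
- exists y0. intros x Hx. split; [|lra]. split; [|exact I].
  apply Rbar_lt_trans with y0; assumption.
- contradiction.
Qed.

Lemma inn_exists a b : Rbar_lt a b -> exists x, inn a b x.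
Proof.
destruct a as [a| |]; destruct b as [b| |]; simpl; try contradiction; intros H.
- exists ((a + b) / 2). split; simpl; lra.
- exists (a + 1). split; simpl; auto; lra.
- exists (b - 1). split; simpl; auto; lra.
- exists 0. split; simpl; auto.
Qed.

Lemma cont_ex_RInt {V : RNM} a b (f : R -> V) x y :
  (forall z, inn a b z -> continuous f z) -> inn a b x -> inn a b y -> ex_RInt f x y.
Proof.
intros Hf Hx Hy. apply ex_RInt_continuous. intros z Hz. apply Hf.
destruct (Rle_dec x y) as [H|H].
- rewrite Rmin_left, Rmax_right in Hz by lra. now apply inn_between with x y.
- rewrite Rmin_right, Rmax_left in Hz by lra. now apply inn_between with y x.
Qed.

Lemma cont_ex_RInt_R a b (f : R -> R) x y :
  (forall z, inn a b z -> continuous f z) -> inn a b x -> inn a b y -> ex_RInt f x y.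
Proof. exact (cont_ex_RInt (V := R_CompleteNormedModule) a b f x y). Qed.

(** Integrability on the open interval (a, b) of a nonnegative continuous
    function, by bounded partial integrals: no limit has to be exhibited. *)
Definition Intg (a b : Rbar) (h : R -> R) :=
  Rbar_lt a b /\ (forall x, inn a b x -> continuous h x /\ 0 <= h x) /\
  exists M, forall x y, inn a b x -> inn a b y -> x <= y -> RInt h x y <= M.

Lemma Intg_ex_RInt a b h x y : Intg a b h -> inn a b x -> inn a b y -> ex_RInt h x y.
Proof.
intros [_ [H _]]. apply cont_ex_RInt_R. intros z Hz. now apply H.
Qed.

Lemma Intg_RInt_pos a b h x y :
  Intg a b h -> inn a b x -> inn a b y -> x <= y -> 0 <= RInt h x y.
Proof.
intros H Hx Hy Hxy. apply RInt_ge_0; [exact Hxy|now apply Intg_ex_RInt with a b|].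
intros z Hz. apply H. apply inn_between with x y; auto; lra.
Qed.

(** The supremum of the integrals over compact subintervals is approached, so
    that all of the mass outside of a suitable compact subinterval is small. *)
Lemma Intg_tail a b h : Intg a b h -> forall eps, 0 < eps ->
  exists x0 y0, inn a b x0 /\ inn a b y0 /\ x0 <= y0 /\
    forall x y, inn a b x -> inn a b y -> x <= x0 -> y0 <= y ->
      RInt h x x0 + RInt h y0 y <= eps.
Proof.
intros HI eps He. assert (HI' := HI). destruct HI' as [Hab [Hh [M HM]]].
set (E := fun m => exists x y, inn a b x /\ inn a b y /\ x <= y /\ m = RInt h x y).
destruct (completeness E) as [m [Hm1 Hm2]].
- exists M. intros m [x [y [Hx [Hy [Hxy ->]]]]]. auto.
- destruct (inn_exists _ _ Hab) as [x Hx]. exists (RInt h x x), x, x.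
  repeat split; auto; try apply Hx. lra.
- destruct (classic (exists x0 y0, inn a b x0 /\ inn a b y0 /\ x0 <= y0 /\ m - eps < RInt h x0 y0))
    as [[x0 [y0 [Hx0 [Hy0 [Hxy Hgt]]]]]|Hno].
  + exists x0, y0. repeat split; try apply Hx0; try apply Hy0; auto.
    intros x y Hx Hy H1 H2.
    assert (Hle : RInt h x y <= m).
    { apply Hm1. exists x, y. repeat split; try apply Hx; try apply Hy. lra. }
    rewrite <- (RInt_Chasles h x x0 y) in Hle by (now apply Intg_ex_RInt with a b).
    rewrite <- (RInt_Chasles h x0 y0 y) in Hle by (now apply Intg_ex_RInt with a b).
    unfold plus in Hle; simpl in Hle. lra.
  + exfalso.
    assert (m <= m - eps); [|lra].
    apply Hm2. intros z [x [y [Hx [Hy [Hxy ->]]]]].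
    apply Rnot_lt_le. intros Hlt. apply Hno. exists x, y. auto.
Qed.

Definition dominated {V : RNM} a b (f : R -> V) (h : R -> R) :=
  Intg a b h /\ forall x, inn a b x -> continuous f x /\ norm (f x) <= h x.

Definition II {V : RNM} (a b : Rbar) (f : R -> V) : V := RInt_gen f (lo a) (hi b).

Lemma dominated_ex_RInt {V : RNM} a b (f : R -> V) h x y :
  dominated a b f h -> inn a b x -> inn a b y -> ex_RInt f x y.
Proof.
intros [_ H]. apply cont_ex_RInt. intros z Hz. apply H, Hz.
Qed.

Lemma dominated_norm_RInt {V : RNM} a b (f : R -> V) h x y :
  dominated a b f h -> inn a b x -> inn a b y -> x <= y ->
  norm (RInt f x y) <= RInt h x y.
Proof.
intros H Hx Hy Hxy.
apply (norm_RInt_le f h x y); auto.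
- intros z Hz. apply H. now apply inn_between with x y.
- apply RInt_correct. now apply dominated_ex_RInt with a b h.
- apply (@RInt_correct R_CompleteNormedModule). apply Intg_ex_RInt with a b; auto. apply H.
Qed.

Lemma plus_minus_mid_G {G : AbelianGroup} (p q r : G) : minus (plus p (plus q r)) q = plus p r.
Proof.
unfold minus. rewrite <- (plus_assoc p), <- (plus_assoc q), (plus_comm r (opp q)), (plus_assoc q), plus_opp_r, plus_zero_l.
reflexivity.
Qed.

Lemma plus_minus_mid {V : RNM} (p q r : V) : minus (plus p (plus q r)) q = plus p r.
Proof. exact (plus_minus_mid_G p q r). Qed.

Lemma dominated_near {V : RNM} a b (f : R -> V) h eps x0 y0 x y :
  dominated a b f h ->
  (forall x y, inn a b x -> inn a b y -> x <= x0 -> y0 <= y ->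
      RInt h x x0 + RInt h y0 y <= eps) ->
  inn a b x0 -> inn a b y0 -> x0 <= y0 ->
  inn a b x -> inn a b y -> x <= x0 -> y0 <= y ->
  norm (minus (RInt f x y) (RInt f x0 y0)) <= eps.
Proof.
intros H Ht Hx0 Hy0 Hxy Hx Hy H1 H2.
rewrite <- (RInt_Chasles f x x0 y) by (now apply dominated_ex_RInt with a b h).
rewrite <- (RInt_Chasles f x0 y0 y) by (now apply dominated_ex_RInt with a b h).
rewrite plus_minus_mid.
apply Rle_trans with (1 := norm_tri _ _).
apply Rle_trans with (2 := Ht x y Hx Hy H1 H2).
apply Rplus_le_compat; apply dominated_norm_RInt with a b; auto.
Qed.

Lemma prod_inn a b x0 y0 : inn a b x0 -> inn a b y0 ->
  filter_prod (lo a) (hi b)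
    (fun p => inn a b (fst p) /\ inn a b (snd p) /\ fst p <= x0 /\ y0 <= snd p).
Proof.
intros Hx Hy.
apply Filter_prod with (1 := lo_inn a b x0 Hx) (2 := hi_inn a b y0 Hy).
intros x y [H1 H2] [H3 H4]. simpl. auto.
Qed.

Lemma is_RInt_gen_of_lim {V : RNM} a b (f : R -> V) v : Rbar_lt a b ->
  (forall x, inn a b x -> continuous f x) ->
  filterlim (fun p => RInt f (fst p) (snd p)) (filter_prod (lo a) (hi b)) (locally v) ->
  is_RInt_gen f (lo a) (hi b) v.
Proof.
intros Hab Hc Hl P HP.
destruct (inn_exists _ _ Hab) as [z Hz].
assert (HlP : filter_prod (lo a) (hi b) (fun p => P (RInt f (fst p) (snd p)))) by exact (Hl P HP).
generalize (filter_and _ _ (prod_inn a b z z Hz Hz) HlP).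
unfold filtermapi. apply filter_imp. intros [x y] [[H1 [H2 [H3 H4]]] H5]. simpl in *.
exists (RInt f x y). split; auto.
apply RInt_correct. now apply cont_ex_RInt with a b.
Qed.

Lemma lim_of_is_RInt_gen {V : RNM} a b (f : R -> V) v :
  is_RInt_gen f (lo a) (hi b) v ->
  filterlim (fun p => RInt f (fst p) (snd p)) (filter_prod (lo a) (hi b)) (locally v).
Proof.
intros H P HP. generalize (H P HP). unfold filtermapi, filtermap. apply filter_imp.
intros [x y] [z [H1 H2]]. simpl in *. now rewrite (is_RInt_unique _ _ _ _ H1).
Qed.

(** The tails of h control the differences of partial integrals of f, so
    that these form a Cauchy filter. *)
Lemma dominated_correct {V : RNM} a b (f : R -> V) h :
  dominated a b f h -> is_RInt_gen f (lo a) (hi b) (II a b f).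
Proof.
intros H. apply RInt_gen_correct.
assert (Hl : exists v, filterlim (fun p => RInt f (fst p) (snd p)) (filter_prod (lo a) (hi b)) (locally v)).
{ apply filterlim_locally_cauchy. intros eps.
  destruct (Intg_tail a b h (proj1 H) (eps / 4)) as [x0 [y0 [Hx0 [Hy0 [Hxy Ht]]]]].
  { generalize (cond_pos eps); lra. }
  exists (fun p => inn a b (fst p) /\ inn a b (snd p) /\ fst p <= x0 /\ y0 <= snd p).
  split; [now apply prod_inn|].
  intros [x y] [x' y'] [H1 [H2 [H3 H4]]] [H1' [H2' [H3' H4']]]. simpl in *.
  refine (norm_compat1 (V := V) _ _ _ _).
  change (norm (minus (RInt f x' y') (RInt f x y)) < eps).
  apply Rle_lt_trans with (eps / 4 + eps / 4).
  - apply Rle_trans with (1 := norm_minus_tri _ (RInt f x0 y0) _).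
    apply Rplus_le_compat.
    + now apply dominated_near with a b h.
    + rewrite norm_minus_sym. now apply dominated_near with a b h.
  - generalize (cond_pos eps); lra. }
destruct Hl as [v Hv]. exists v.
apply is_RInt_gen_of_lim; auto.
- apply H.
- intros x Hx. now apply H.
Qed.

Lemma II_unique {V : RNM} a b (f : R -> V) v :
  is_RInt_gen f (lo a) (hi b) v -> II a b f = v.
Proof. apply is_RInt_gen_unique; apply _. Qed.

Lemma II_approx {V : RNM} a b (f : R -> V) h eps x0 y0 :
  dominated a b f h ->
  (forall x y, inn a b x -> inn a b y -> x <= x0 -> y0 <= y ->
      RInt h x x0 + RInt h y0 y <= eps) ->
  inn a b x0 -> inn a b y0 -> x0 <= y0 ->
  norm (minus (II a b f) (RInt f x0 y0)) <= eps.
Proof.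
intros H Ht Hx0 Hy0 Hxy.
apply (filterlim_norm_le (filter_prod (lo a) (hi b)) (fun p => RInt f (fst p) (snd p))).
- apply lim_of_is_RInt_gen. now apply dominated_correct with h.
- generalize (prod_inn a b x0 y0 Hx0 Hy0). apply filter_imp.
  intros [x y] [H1 [H2 [H3 H4]]]. simpl in *. now apply dominated_near with a b h.
Qed.

Lemma II_norm_M {V : RNM} a b (f : R -> V) h M :
  dominated a b f h ->
  (forall x y, inn a b x -> inn a b y -> x <= y -> RInt h x y <= M) ->
  norm (II a b f) <= M.
Proof.
intros H HM.
apply (filterlim_norm_le0 (filter_prod (lo a) (hi b)) (fun p => RInt f (fst p) (snd p))).
- apply lim_of_is_RInt_gen. now apply dominated_correct with h.
- destruct (inn_exists _ _ (proj1 (proj1 H))) as [z Hz].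
  generalize (prod_inn a b z z Hz Hz). apply filter_imp.
  intros [x y] [H1 [H2 [H3 H4]]]. simpl in *.
  apply Rle_trans with (RInt h x y).
  + apply dominated_norm_RInt with a b; auto. lra.
  + apply HM; auto. lra.
Qed.

Lemma Intg_dominated a b h : Intg a b h -> dominated (V := R_CompleteNormedModule) a b h h.
Proof.
intros H. split; auto. intros x Hx. destruct H as [_ [H _]]. split; [now apply H|].
unfold norm; simpl; unfold abs; simpl. rewrite Rabs_pos_eq; [lra|now apply H].
Qed.

Lemma Intg_RInt_le_II a b h x y : Intg a b h -> inn a b x -> inn a b y -> x <= y ->
  RInt h x y <= II (V := R_CompleteNormedModule) a b h.
Proof.
intros H Hx Hy Hxy.
apply (filterlim_le (F := filter_prod (lo a) (hi b)) (fun _ => RInt h x y)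
   (fun p => RInt h (fst p) (snd p)) (RInt h x y) (II (V := R_CompleteNormedModule) a b h)).
- generalize (prod_inn a b x y Hx Hy). apply filter_imp.
  intros [x' y'] [H1 [H2 [H3 H4]]]. simpl in *.
  rewrite <- (RInt_Chasles h x' x y') by (now apply Intg_ex_RInt with a b).
  rewrite <- (RInt_Chasles h x y y') by (now apply Intg_ex_RInt with a b).
  generalize (Intg_RInt_pos a b h x' x H H1 Hx H3) (Intg_RInt_pos a b h y y' H Hy H2 H4).
  unfold plus; simpl; lra.
- apply filterlim_const.
- apply (lim_of_is_RInt_gen (V := R_CompleteNormedModule)). apply dominated_correct with h. now apply Intg_dominated.
Qed.

Lemma II_norm {V : RNM} a b (f : R -> V) h :
  dominated a b f h -> norm (II a b f) <= II (V := R_CompleteNormedModule) a b h.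
Proof.
intros H. apply II_norm_M with (1 := H).
intros x y Hx Hy Hxy. apply Intg_RInt_le_II; auto. apply H.
Qed.

Lemma II_pos a b h : Intg a b h -> 0 <= II (V := R_CompleteNormedModule) a b h.
Proof.
intros H. destruct (inn_exists _ _ (proj1 H)) as [z Hz].
apply Rle_trans with (RInt h z z).
- apply Intg_RInt_pos with a b; auto; lra.
- apply Intg_RInt_le_II; auto; lra.
Qed.

(** * Integrable majorants *)

Lemma Intg_le a b h k C : Intg a b k ->
  (forall x, inn a b x -> continuous h x /\ 0 <= h x <= C * k x) -> Intg a b h.
Proof.
intros Hk H. assert (Hk' := Hk). destruct Hk' as [Hab [_ [M HM]]].
split; [exact Hab|]. split.
- intros x Hx. split; apply H; exact Hx.
- exists (Rabs C * M). intros x y Hx Hy Hxy.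
  assert (Hex := Intg_ex_RInt a b k x y Hk Hx Hy).
  apply Rle_trans with (RInt (fun z => scal (Rabs C) (k z)) x y).
  + apply RInt_le; auto.
    * apply (cont_ex_RInt (V := R_CompleteNormedModule) a b); auto. intros z Hz. now apply H.
    * apply (ex_RInt_scal (V := R_CompleteNormedModule)). exact Hex.
    * intros z Hz. assert (Hi : inn a b z) by (apply inn_between with x y; auto; lra).
      apply Rle_trans with (C * k z); [now apply H|].
      apply Rmult_le_compat_r; [apply Hk; exact Hi|apply Rle_abs].
  + rewrite (RInt_scal (V := R_CompleteNormedModule)) by exact Hex.
    apply Rmult_le_compat_l; [apply Rabs_pos|auto].
Qed.

Lemma Intg_scal a b h C : 0 <= C -> Intg a b h -> Intg a b (fun x => C * h x).
Proof.
intros HC H. apply Intg_le with h C; auto.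
intros x Hx. destruct H as [_ [H _]]. split.
- apply (continuous_scal_r (V := R_NormedModule) C h x). now apply H.
- split; [|lra]. apply Rmult_le_pos; auto. now apply H.
Qed.

Lemma Intg_plus a b h k : Intg a b h -> Intg a b k -> Intg a b (fun x => h x + k x).
Proof.
intros Hh Hk. assert (Hh' := Hh). assert (Hk' := Hk).
destruct Hh' as [Hab [H1 [M HM]]]. destruct Hk' as [_ [H2 [N HN]]].
split; auto. split.
- intros x Hx. split.
  + apply (continuous_plus (V := R_NormedModule)); [now apply H1|now apply H2].
  + generalize (proj2 (H1 x Hx)) (proj2 (H2 x Hx)); lra.
- exists (M + N). intros x y Hx Hy Hxy.
  rewrite (RInt_plus (V := R_CompleteNormedModule)).
  + apply Rplus_le_compat; auto.
  + now apply Intg_ex_RInt with a b.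
  + now apply Intg_ex_RInt with a b.
Qed.

(** The partial integrals up to m are limits of partial integrals on either
    side, hence obey the same bounds. *)
Lemma Intg_split a b m h : inn a b m -> (forall x, inn a b x -> continuous h x) ->
  Intg a m h -> Intg m b h ->
  Intg a b h.
Proof.
intros Hm Hc H1 H2.
assert (Hpos : forall x, inn a b x -> 0 <= h x).
{ intros x Hx. destruct (Rlt_dec x m) as [Hl|Hl].
  - apply H1. split; [apply Hx|exact Hl].
  - destruct (Rlt_dec m x) as [Hr|Hr].
    + apply H2. split; [exact Hr|apply Hx].
    + assert (x = m) by lra. subst x.
      apply (filterlim_le (F := lo m) (fun _ => 0) h 0 (h m)).
      * destruct (inn_exists m b (proj2 Hm)) as [z Hz].
        generalize (lo_inn m b z Hz). apply filter_imp. intros x [Hx' _]. now apply H2.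
      * apply filterlim_const.
      * apply filterlim_filter_le_1 with (2 := Hc m Hm). apply filter_le_within. }
split; [|split].
- apply Rbar_lt_trans with m; apply Hm.
- auto.
- destruct H1 as [Ha [H1 [M HM]]]. destruct H2 as [Hb [H2 [N HN]]].
  assert (HexR : forall x y, inn a b x -> inn a b y -> ex_RInt h x y).
  { intros x y Hx Hy. now apply (cont_ex_RInt (V := R_CompleteNormedModule) a b). }
  assert (HL : forall x, inn a b x -> x <= m -> RInt h x m <= M).
  { intros x Hx Hxm. destruct Hxm as [Hxm| ->].
    2:{ rewrite RInt_point. destruct (inn_exists a m Ha) as [z Hz].
        generalize (HM z z Hz Hz (Rle_refl z)). rewrite RInt_point. auto. }
    apply Rnot_lt_le. intros Hgt.
    assert (Hcont : continuous (fun y => RInt h x y) m).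
    { apply (continuous_RInt_1 (V := R_CompleteNormedModule) h x m (fun y => RInt h x y)).
      assert (HO : locally m (fun z => inn a b z)).
      { destruct Hm as [Hma Hmb]. apply filter_and.
        - apply (open_Rbar_gt' m a); exact Hma.
        - apply (open_Rbar_lt' m b); exact Hmb. }
      generalize HO. apply filter_imp. intros z Hz.
      apply (@RInt_correct R_CompleteNormedModule). now apply HexR. }
    assert (Hle : RInt h x m <= M); [|lra].
    apply (filterlim_le (F := hi m) (fun y => RInt h x y) (fun _ => M) (RInt h x m) M).
    - assert (Hx' : inn a m x) by (split; [apply Hx|exact Hxm]).
      generalize (hi_inn a m x Hx'). apply filter_imp. intros y [Hy Hxy]. now apply HM.
    - apply filterlim_filter_le_1 with (2 := Hcont). apply filter_le_within.
    - apply filterlim_const. }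
  assert (HR : forall y, inn a b y -> m <= y -> RInt h m y <= N).
  { intros y Hy Hym. destruct Hym as [Hym|<-].
    2:{ rewrite RInt_point. destruct (inn_exists m b Hb) as [z Hz].
        generalize (HN z z Hz Hz (Rle_refl z)). rewrite RInt_point. auto. }
    assert (Hcont : continuous (fun z => RInt h z y) m).
    { apply (continuous_ext_loc (T := R_UniformSpace) (U := R_UniformSpace) _ (fun z => opp (RInt h y z))).
      { assert (HO : locally m (fun z => inn a b z)).
        { destruct Hm as [Hma Hmb]. apply filter_and.
          - apply (open_Rbar_gt' m a); exact Hma.
          - apply (open_Rbar_lt' m b); exact Hmb. }
        generalize HO. apply filter_imp. intros z Hz.
        apply (opp_RInt_swap (V := R_CompleteNormedModule)). now apply HexR. }
      apply (continuous_opp (V := R_CompleteNormedModule)).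
      apply (continuous_RInt_1 (V := R_CompleteNormedModule) h y m (fun z => RInt h y z)).
      assert (HO : locally m (fun z => inn a b z)).
      { destruct Hm as [Hma Hmb]. apply filter_and.
        - apply (open_Rbar_gt' m a); exact Hma.
        - apply (open_Rbar_lt' m b); exact Hmb. }
      generalize HO. apply filter_imp. intros z Hz.
      apply (@RInt_correct R_CompleteNormedModule). now apply HexR. }
    apply (filterlim_le (F := lo m) (fun z => RInt h z y) (fun _ => N) (RInt h m y) N).
    - assert (Hy' : inn m b y) by (split; [exact Hym|apply Hy]).
      generalize (lo_inn m b y Hy'). apply filter_imp. intros z [Hz Hzy]. now apply HN.
    - apply filterlim_filter_le_1 with (2 := Hcont). apply filter_le_within.
    - apply filterlim_const. }
  exists (M + N). intros x y Hx Hy Hxy.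
  assert (HM0 : 0 <= M).
  { destruct (inn_exists a m Ha) as [z Hz].
        generalize (HM z z Hz Hz (Rle_refl z)). rewrite RInt_point. auto. }
  assert (HN0 : 0 <= N).
  { destruct (inn_exists m b Hb) as [z Hz].
        generalize (HN z z Hz Hz (Rle_refl z)). rewrite RInt_point. auto. }
  destruct (Rle_dec x m) as [Hxm|Hxm]; destruct (Rle_dec m y) as [Hmy|Hmy].
  + rewrite <- (RInt_Chasles h x m y) by (now apply HexR).
    apply Rplus_le_compat; auto.
  + assert (RInt h x y <= M); [|lra]. apply HM; auto; split; try apply Hx; try apply Hy; simpl; lra.
  + assert (RInt h x y <= N); [|lra]. apply HN; auto; split; try apply Hx; try apply Hy; simpl; lra.
  + lra.
Qed.

Lemma Intg_primitive a b h H M : Rbar_lt a b ->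
  (forall x, inn a b x -> continuous h x /\ 0 <= h x) ->
  (forall x, inn a b x -> is_derive H x (h x)) ->
  (forall x, inn a b x -> Rabs (H x) <= M) -> Intg a b h.
Proof.
intros Hab Hc Hd HM. split; auto. split; auto.
exists (2 * M). intros x y Hx Hy Hxy.
assert (HR : is_RInt h x y (minus (H y) (H x))).
{ apply (is_RInt_derive (V := R_CompleteNormedModule)); rewrite Rmin_left, Rmax_right by lra; intros z Hz;
  assert (inn a b z) by (now apply inn_between with x y).
  - now apply Hd.
  - now apply Hc. }
rewrite (is_RInt_unique _ _ _ _ HR). unfold minus, plus, opp; simpl.
generalize (Rabs_le_between (H x) M) (Rabs_le_between (H y) M) (HM x Hx) (HM y Hy).
intros [A1 _] [A2 _] A3 A4. apply A1 in A3. apply A2 in A4. lra.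
Qed.

Notation RC := R_CompleteNormedModule.

(** * Integrals with a parameter *)

(** Joint continuity is what lets compact intervals of one variable be
    treated uniformly in the other. *)
Definition jcont {V : UniformSpace} (f : R -> R -> V) (x y : R) :=
  continuous (fun p : R * R => f (fst p) (snd p)) (x, y).

Lemma plus_minus_l {G : AbelianGroup} (p q : G) : minus (plus p q) p = q.
Proof.
unfold minus. now rewrite plus_comm, plus_assoc, plus_opp_l, plus_zero_l.
Qed.

Lemma jcont_r {V : UniformSpace} (f : R -> R -> V) x y : jcont f x y -> continuous (f x) y.
Proof.
intros H.
apply (continuous_comp_2 (fun _ : R => x) (fun y : R => y) f y).
- apply continuous_const.
- apply continuous_id.
- exact H.
Qed.

Lemma jcont_l {V : UniformSpace} (f : R -> R -> V) x y :
  jcont f x y -> continuous (fun z => f z y) x.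
Proof.
intros H.
apply (continuous_comp_2 (fun x : R => x) (fun _ : R => y) f x).
- apply continuous_id.
- apply continuous_const.
- exact H.
Qed.

Lemma jcont_swap {V : UniformSpace} (f : R -> R -> V) x y :
  jcont f x y -> jcont (fun a b => f b a) y x.
Proof.
intros H. unfold jcont.
apply (continuous_comp_2 (fun p : R * R => snd p) (fun p : R * R => fst p) f (y, x)).
- apply continuous_snd.
- apply continuous_fst.
- exact H.
Qed.

Lemma continuous_eps {V : RNM} (f : R -> V) x :
  (forall eps, 0 < eps -> locally x (fun y => norm (minus (f y) (f x)) <= eps)) ->
  continuous f x.
Proof. intros H. now apply filterlim_eps; [apply _|]. Qed.

Lemma RInt_diff_le {V : RNM} (f g : R -> V) x y e : x <= y ->
  ex_RInt f x y -> ex_RInt g x y ->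
  (forall z, x <= z <= y -> norm (minus (f z) (g z)) <= e) ->
  norm (minus (RInt f x y) (RInt g x y)) <= (y - x) * e.
Proof.
intros Hxy Hf Hg H.
apply (norm_RInt_le_const (fun z => minus (f z) (g z)) x y); auto.
exact (is_RInt_minus f g x y _ _ (RInt_correct f x y Hf) (RInt_correct g x y Hg)).
Qed.

(** Uniform convergence takes care of a compact subinterval, and the majorant
    of the rest. *)
Lemma dominated_convergence {U : Type} {V : RNM} (F : (U -> Prop) -> Prop) {FF : ProperFilter F} a b
    (f : U -> R -> V) (g : R -> V) (h : R -> R) :
  Intg a b h ->
  F (fun i => forall x, inn a b x -> continuous (f i) x /\ norm (f i x) <= h x) ->
  (forall x y, inn a b x -> inn a b y -> x <= y -> forall eps, 0 < eps ->
     F (fun i => forall z, x <= z <= y -> norm (minus (f i z) (g z)) <= eps)) ->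
  dominated a b g h /\ filterlim (fun i => II a b (f i)) F (locally (II a b g)).
Proof.
intros Hh HF Hu.
assert (Hg : dominated a b g h).
{ split; auto. intros x Hx. split.
  - destruct (inn_exists a x (proj1 Hx)) as [x1 Hx1].
    destruct (inn_exists x b (proj2 Hx)) as [x2 Hx2].
    assert (Hi1 : inn a b x1).
    { split; [apply Hx1|]. apply Rbar_lt_trans with x; [apply Hx1|apply Hx]. }
    assert (Hi2 : inn a b x2).
    { split; [|apply Hx2]. apply Rbar_lt_trans with x; [apply Hx|apply Hx2]. }
    destruct Hx1 as [_ Hx1]. destruct Hx2 as [Hx2 _]. simpl in Hx1, Hx2.
    apply continuous_eps. intros eps He.
    assert (H12 : x1 <= x2) by lra.
    destruct (filter_ex _ (filter_and _ _ HF (Hu x1 x2 Hi1 Hi2 H12 (eps / 3) ltac:(lra))))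
      as [i [Hc Hn]].
    assert (HL : locally x (fun y => norm (minus (f i y) (f i x)) <= eps / 3)).
    { apply (filterlim_eps_inv (locally x) (f i) (f i x)); [|lra]. now apply Hc. }
    assert (HO : locally x (fun z => inn x1 x2 z)).
    { apply filter_and; [apply (open_Rbar_gt' x x1)|apply (open_Rbar_lt' x x2)]; simpl; lra. }
    generalize (filter_and _ _ HL HO). apply filter_imp.
    intros y [Hy [Hy1 Hy2]]. simpl in Hy1, Hy2.
    apply Rle_trans with (1 := norm_minus_tri _ (f i y) _).
    apply Rle_trans with (eps / 3 + (eps / 3 + eps / 3)); [|lra].
    apply Rplus_le_compat.
    + rewrite norm_minus_sym. apply Hn. lra.
    + apply Rle_trans with (1 := norm_minus_tri _ (f i x) _).
      apply Rplus_le_compat; auto. apply Hn. lra.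
  - apply (filterlim_norm_le0 F (fun i => f i x)).
    + apply filterlim_eps; [apply _|]. intros eps He.
      generalize (Hu x x Hx Hx (Rle_refl x) eps He). apply filter_imp.
      intros i Hi. apply Hi. lra.
    + generalize HF. apply filter_imp. intros i Hi. now apply Hi. }
split; auto.
apply filterlim_eps; [apply _|]. intros eps He.
destruct (Intg_tail a b h Hh (eps / 4) ltac:(lra)) as [x0 [y0 [Hx0 [Hy0 [Hxy Ht]]]]].
assert (He' : 0 < eps / 2 / (y0 - x0 + 1)) by (apply Rdiv_lt_0_compat; lra).
generalize (filter_and _ _ HF (Hu x0 y0 Hx0 Hy0 Hxy _ He')). apply filter_imp.
intros i [Hc Hn].
assert (Hd : dominated a b (f i) h) by (split; auto).
apply Rle_trans with (1 := norm_minus_tri _ (RInt (f i) x0 y0) _).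
apply Rle_trans with (eps / 4 + (eps / 2 + eps / 4)); [|lra].
apply Rplus_le_compat; [now apply II_approx with h|].
apply Rle_trans with (1 := norm_minus_tri _ (RInt g x0 y0) _).
apply Rplus_le_compat; [|rewrite norm_minus_sym; now apply II_approx with h].
apply Rle_trans with ((y0 - x0) * (eps / 2 / (y0 - x0 + 1))).
- apply RInt_diff_le; auto; eapply dominated_ex_RInt; eauto.
- apply Rle_trans with ((y0 - x0 + 1) * (eps / 2 / (y0 - x0 + 1))).
  + apply Rmult_le_compat_r; lra.
  + right. field. lra.
Qed.

(** The tube lemma, by compactness of the segment. *)
Lemma jcont_uniform {V : RNM} (f : R -> R -> V) x0 y1 y2 eps : 0 < eps ->
  (forall y, y1 <= y <= y2 -> jcont f x0 y) ->
  locally x0 (fun x => forall y, y1 <= y <= y2 -> norm (minus (f x y) (f x0 y)) <= eps).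
Proof.
intros He H.
assert (Hd : forall y, exists d : posreal, y1 <= y <= y2 ->
  forall x' y', Rabs (x' - x0) < d -> Rabs (y' - y) < d ->
    norm (minus (f x' y') (f x0 y)) <= eps / 2).
{ intros y. destruct (classic (y1 <= y <= y2)) as [Hy|Hy].
  - generalize (filterlim_eps_inv (locally (x0, y)) (fun p : R * R => f (fst p) (snd p)) (f x0 y)
      (H y Hy) (eps / 2) ltac:(lra)).
    intros [d Hd]. exists d. intros _ x' y' Hx' Hy'.
    apply (Hd (x', y')). split; assumption.
  - exists (mkposreal 1 Rlt_0_1). tauto. }
destruct (choice _ Hd) as [delta Hdelta].
destruct (compactness_value_1d y1 y2 delta) as [d Hc].
exists d. intros x Hx' y Hy. assert (Hx : Rabs (x - x0) < d) by exact Hx'.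
generalize (Hc y Hy). intros Hnn. apply NNPP in Hnn.
destruct Hnn as [t [Ht [Hyt Hdt]]].
apply Rle_trans with (1 := norm_minus_tri _ (f x0 t) _).
apply Rle_trans with (eps / 2 + eps / 2); [|lra].
apply Rplus_le_compat.
- apply Hdelta; auto. apply Rlt_le_trans with (1 := Hx). exact Hdt.
- rewrite norm_minus_sym. apply Hdelta; auto.
  replace (x0 - x0) with 0 by ring. rewrite Rabs_R0. apply cond_pos.
Qed.

Lemma II_continuous {V : RNM} a b (f : R -> R -> V) (h : R -> R) x0 :
  Intg a b h ->
  locally x0 (fun x => forall y, inn a b y -> continuous (f x) y /\ norm (f x y) <= h y) ->
  (forall y, inn a b y -> jcont f x0 y) ->
  continuous (fun x => II a b (f x)) x0.
Proof.
intros Hh HF Hj. unfold continuous.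
apply (dominated_convergence (locally x0) a b f (f x0) h); auto.
intros x y Hx Hy Hxy eps He. apply jcont_uniform; auto.
intros z Hz. apply Hj. now apply inn_between with x y.
Qed.

Lemma RInt_continuous_param {V : RNM} (f : R -> R -> V) a b c d x0 y1 y2 :
  (forall x y, inn a b x -> inn c d y -> jcont f x y) ->
  inn a b x0 -> inn c d y1 -> inn c d y2 -> y1 <= y2 ->
  continuous (fun x => RInt (f x) y1 y2) x0.
Proof.
intros H Hx Hy1 Hy2 Hy. apply continuous_eps. intros eps He.
assert (He' : 0 < eps / (y2 - y1 + 1)) by (apply Rdiv_lt_0_compat; lra).
assert (HO : locally x0 (fun z => inn a b z)).
{ apply filter_and; [apply (open_Rbar_gt' x0 a)|apply (open_Rbar_lt' x0 b)]; apply Hx. }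
assert (HT := jcont_uniform f x0 y1 y2 _ He' (fun y Hy => H x0 y Hx (inn_between c d y1 y2 y Hy1 Hy2 Hy))).
generalize (filter_and _ _ HO HT). apply filter_imp. intros x [Hix Hn].
apply Rle_trans with ((y2 - y1) * (eps / (y2 - y1 + 1))).
- apply RInt_diff_le; auto; apply cont_ex_RInt with c d; auto; intros z Hz;
  apply jcont_r; auto.
- apply Rle_trans with ((y2 - y1 + 1) * (eps / (y2 - y1 + 1))).
  + apply Rmult_le_compat_r; lra.
  + right. field. lra.
Qed.

Lemma is_derive_eps {V : RNM} (f : R -> V) x (l : V) :
  (forall eps, 0 < eps -> locally x (fun y =>
     norm (minus (minus (f y) (f x)) (scal (y - x) l)) <= eps * Rabs (y - x))) ->
  is_derive f x l.
Proof.
intros H. split.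
- apply is_linear_scal_l.
- intros x' Hx'.
  assert (Hxx : x = x') by exact (is_filter_lim_locally_unique x x' Hx').
  subst x'. intros eps. exact (H eps (cond_pos eps)).
Qed.

Lemma locally_inn a b x : inn a b x -> locally x (fun z => inn a b z).
Proof.
intros Hx. apply filter_and; [apply (open_Rbar_gt' x a)|apply (open_Rbar_lt' x b)]; apply Hx.
Qed.

Lemma derive_zero_const {V : RNM} (f : R -> V) a b : a <= b ->
  (forall x, a <= x <= b -> is_derive f x zero) -> f b = f a.
Proof.
intros Hab H.
assert (HR : is_RInt (fun _ : R => zero : V) a b (minus (f b) (f a))).
{ apply (is_RInt_derive f (fun _ => zero)); rewrite Rmin_left, Rmax_right by lra; intros x Hx.
  - auto.
  - apply continuous_const. }
assert (HZ : is_RInt (fun _ : R => zero : V) a b zero).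
{ generalize (is_RInt_const (V := V) a b zero).
  assert (E : scal (b - a) (zero : V) = zero) by exact (scal_zero_r (V := V) (b - a)).
  intros HE. exact (eq_rect _ (is_RInt (fun _ : R => zero : V) a b) HE _ E). }
assert (Hm : minus (f b) (f a) = zero).
{ rewrite <- (is_RInt_unique _ _ _ _ HR). exact (is_RInt_unique _ _ _ _ HZ). }
transitivity (plus (minus (f b) (f a)) (f a)).
- unfold minus. now rewrite <- plus_assoc, plus_opp_l, plus_zero_r.
- rewrite Hm. apply plus_zero_l.
Qed.

Lemma norm_oppV {V : RNM} (x : V) : norm (opp x) = norm x.
Proof. exact (norm_opp x). Qed.

Lemma norm_zeroV {V : RNM} : norm (zero : V) = 0.
Proof. exact norm_zero. Qed.

Lemma scal_zeroV {V : RNM} (k : R) : scal k (zero : V) = zero.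
Proof. exact (scal_zero_r k). Qed.

Lemma norm_RInt_le_abs {V : RNM} (f : R -> V) x y e : ex_RInt f x y ->
  (forall z, Rmin x y <= z <= Rmax x y -> norm (f z) <= e) ->
  norm (RInt f x y) <= Rabs (y - x) * e.
Proof.
intros Hex H. destruct (Rle_dec x y) as [Hxy|Hxy].
- rewrite Rmin_left, Rmax_right in H by lra. rewrite Rabs_pos_eq by lra.
  apply (norm_RInt_le_const f x y); auto. now apply RInt_correct.
- rewrite Rmin_right, Rmax_left in H by lra.
  rewrite <- (opp_RInt_swap f y x) by now apply ex_RInt_swap.
  rewrite (norm_oppV (RInt f y x)), Rabs_minus_sym, Rabs_pos_eq by lra.
  apply (norm_RInt_le_const f y x); auto; [lra|].
  apply RInt_correct. now apply ex_RInt_swap.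
Qed.

(** Both sides, as functions of the end x2, have the same derivative. *)
Lemma fubini_compact {V : RNM} (f : R -> R -> V) a b c d x1 x2 y1 y2 :
  (forall x y, inn a b x -> inn c d y -> jcont f x y) ->
  inn a b x1 -> inn a b x2 -> inn c d y1 -> inn c d y2 -> x1 <= x2 -> y1 <= y2 ->
  RInt (fun x => RInt (f x) y1 y2) x1 x2 = RInt (fun y => RInt (fun x => f x y) x1 x2) y1 y2.
Proof.
intros H Hx1 Hx2 Hy1 Hy2 Hx Hy.
set (L := fun X => RInt (fun x => RInt (f x) y1 y2) x1 X).
set (G := fun X y => RInt (fun x => f x y) x1 X).
set (Rr := fun X => RInt (G X) y1 y2).
assert (HexL : forall u v, inn a b u -> inn a b v -> ex_RInt (fun x => RInt (f x) y1 y2) u v).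
{ intros u v Hu Hv. apply cont_ex_RInt with a b; auto.
  intros z Hz. now apply RInt_continuous_param with a b c d. }
assert (Hexx : forall y u v, inn c d y -> inn a b u -> inn a b v -> ex_RInt (fun x => f x y) u v).
{ intros y u v Hyy Hu Hv. apply cont_ex_RInt with a b; auto.
  intros z Hz. apply jcont_l. now apply H. }
assert (Hexy : forall x u v, inn a b x -> inn c d u -> inn c d v -> ex_RInt (f x) u v).
{ intros y u v Hyy Hu Hv. apply cont_ex_RInt with c d; auto.
  intros z Hz. apply jcont_r. now apply H. }
assert (HexG : forall X, inn a b X -> x1 <= X -> ex_RInt (G X) y1 y2).
{ intros X HX HxX. apply cont_ex_RInt with c d; auto. intros z Hz.
  apply (RInt_continuous_param (fun y x => f x y) c d a b); auto.
  intros y x Hyy Hxx. apply jcont_swap. now apply H. }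
enough (Hmain : minus (L x2) (Rr x2) = minus (L x1) (Rr x1)).
{ assert (H0 : minus (L x1) (Rr x1) = zero).
  { unfold L, Rr, G. rewrite RInt_point.
    rewrite (RInt_ext (fun y => RInt (fun x => f x y) x1 x1) (fun _ => zero)).
    - rewrite RInt_const.
      assert (E : scal (y2 - y1) (zero : V) = zero) by exact (scal_zero_r (V := V) (y2 - y1)).
      refine (eq_trans (f_equal (minus zero) E) _). exact (minus_eq_zero (zero : V)).
    - intros y _. apply RInt_point. }
  apply eq_of_norm_le with 0. intros eps He.
  change (norm (minus (L x2) (Rr x2)) <= 0 * eps). rewrite Hmain, H0.
  rewrite Rmult_0_l. right. exact norm_zeroV. }
apply (derive_zero_const (fun X => minus (L X) (Rr X)) x1 x2 Hx).
intros X HX.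
assert (HiX : inn a b X) by now apply inn_between with x1 x2.
assert (HL : is_derive L X (RInt (f X) y1 y2)).
{ apply (is_derive_RInt (fun x => RInt (f x) y1 y2) L x1 X).
  - generalize (locally_inn a b X HiX). apply filter_imp. intros z Hz.
    apply RInt_correct. now apply HexL.
  - now apply RInt_continuous_param with a b c d. }
assert (HexG' : forall X, inn a b X -> ex_RInt (G X) y1 y2).
{ intros X' HX'. destruct (Rle_dec x1 X') as [Hl|Hl]; [now apply HexG|].
  apply (ex_RInt_ext (fun y => opp (RInt (fun x => f x y) X' x1))).
  - intros y Hyy. rewrite Rmin_left, Rmax_right in Hyy by lra.
    apply opp_RInt_swap. apply Hexx; auto. apply inn_between with y1 y2; auto; lra.
  - apply (ex_RInt_opp (V := V)). apply cont_ex_RInt with c d; auto. intros z Hz.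
    apply (RInt_continuous_param (fun y x => f x y) c d a b); auto; [|lra].
    intros y x Hyy Hxx. apply jcont_swap. now apply H. }
assert (HR : is_derive Rr X (RInt (f X) y1 y2)).
{ apply is_derive_eps. intros eps He.
  assert (He' : 0 < eps / (y2 - y1 + 1)) by (apply Rdiv_lt_0_compat; lra).
  assert (HT := jcont_uniform f X y1 y2 _ He' (fun y Hy => H X y HiX (inn_between c d y1 y2 y Hy1 Hy2 Hy))).
  destruct (filter_and _ _ (locally_inn a b X HiX) HT) as [dl Hdl].
  exists dl. intros X' HX'.
  assert (HiX' : inn a b X') by now apply Hdl.
  assert (Hbt : forall z, Rmin X X' <= z <= Rmax X X' -> ball X dl z).
  { intros z Hz. assert (HX2 : Rabs (X' - X) < dl) by exact HX'.
    change (Rabs (z - X) < dl). apply Rle_lt_trans with (2 := HX2).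
    destruct (Rle_dec X X') as [Ho|Ho].
    - rewrite Rmin_left, Rmax_right in Hz by lra. rewrite (Rabs_pos_eq (z - X)) by lra.
      rewrite (Rabs_pos_eq (X' - X)) by lra. lra.
    - rewrite Rmin_right, Rmax_left in Hz by lra. rewrite (Rabs_left1 (z - X)) by lra.
      rewrite (Rabs_left1 (X' - X)) by lra. lra. }
  assert (Heq : minus (minus (Rr X') (Rr X)) (scal (X' - X) (RInt (f X) y1 y2)) =
    RInt (fun y => RInt (fun x => minus (f x y) (f X y)) X X') y1 y2).
  { unfold Rr.
    rewrite <- (RInt_minus (V := V)) by now apply HexG'.
    rewrite <- (RInt_scal (V := V)) by now apply Hexy.
    rewrite <- (RInt_minus (V := V)).
    - apply RInt_ext. intros y Hyy. rewrite Rmin_left, Rmax_right in Hyy by lra.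
      assert (Hiy : inn c d y) by (apply inn_between with y1 y2; auto; lra).
      unfold G. rewrite <- (RInt_Chasles (fun x => f x y) x1 X X') by now apply Hexx.
      rewrite (RInt_minus (V := V)); [|now apply Hexx|apply (ex_RInt_const (V := V))].
      rewrite (RInt_const (V := V)).
      f_equal.
      exact (plus_minus_l (RInt (fun x => f x y) x1 X) (RInt (fun x => f x y) X X')).
    - apply (ex_RInt_minus (V := V)); now apply HexG'.
    - apply (ex_RInt_scal (V := V)). now apply Hexy. }
  rewrite Heq.
  apply Rle_trans with ((y2 - y1) * (Rabs (X' - X) * (eps / (y2 - y1 + 1)))).
  - apply (norm_RInt_le_const (fun y => RInt (fun x => minus (f x y) (f X y)) X X') y1 y2); auto.
    + intros y Hyy. apply norm_RInt_le_abs.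
      * apply (ex_RInt_minus (V := V)); [|apply (ex_RInt_const (V := V))].
        apply Hexx; auto. now apply inn_between with y1 y2.
      * intros z Hz. apply Hdl; auto.
    + apply RInt_correct.
      apply (ex_RInt_ext (fun y => minus (minus (G X' y) (G X y)) (scal (X' - X) (f X y)))).
      * intros y Hyy. rewrite Rmin_left, Rmax_right in Hyy by lra.
        assert (Hiy : inn c d y) by (apply inn_between with y1 y2; auto; lra).
        unfold G. rewrite <- (RInt_Chasles (fun x => f x y) x1 X X') by now apply Hexx.
        rewrite (RInt_minus (V := V)); [|now apply Hexx|apply (ex_RInt_const (V := V))].
        rewrite (RInt_const (V := V)).
        f_equal.
        exact (plus_minus_l (RInt (fun x => f x y) x1 X) (RInt (fun x => f x y) X X')).
      * apply (ex_RInt_minus (V := V)); [apply (ex_RInt_minus (V := V)); now apply HexG'|].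
        apply (ex_RInt_scal (V := V)). now apply Hexy.
  - replace ((y2 - y1) * (Rabs (X' - X) * (eps / (y2 - y1 + 1))))
      with ((y2 - y1) * (eps / (y2 - y1 + 1)) * Rabs (X' - X)) by ring.
    apply Rmult_le_compat_r; [apply Rabs_pos|].
    apply Rle_trans with ((y2 - y1 + 1) * (eps / (y2 - y1 + 1))).
    + apply Rmult_le_compat_r; lra.
    + right. field. lra. }
generalize (is_derive_minus L Rr X _ _ HL HR).
assert (Hz : minus (RInt (f X) y1 y2) (RInt (f X) y1 y2) = zero) by apply minus_eq_zero.
intros Hd. exact (eq_rect _ (is_derive (fun X => minus (L X) (Rr X)) X) Hd _ Hz).
Qed.

(** Since the majorant is a product, the mass outside of a large compact
    rectangle is small, uniformly in each variable; on the rectangle the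
    integrands are continuous. *)
Lemma fubini {V : RNM} a b c d (f : R -> R -> V) (p q : R -> R) :
  Intg a b p -> Intg c d q ->
  (forall x y, inn a b x -> inn c d y -> jcont f x y /\ norm (f x y) <= p x * q y) ->
  dominated a b (fun x => II c d (f x)) (fun x => II (V := RC) c d q * p x) /\
  dominated c d (fun y => II a b (fun x => f x y)) (fun y => II (V := RC) a b p * q y) /\
  II a b (fun x => II c d (f x)) = II c d (fun y => II a b (fun x => f x y)).
Proof.
assert (Half : forall a b c d (f : R -> R -> V) (p q : R -> R),
  Intg a b p -> Intg c d q ->
  (forall x y, inn a b x -> inn c d y -> jcont f x y /\ norm (f x y) <= p x * q y) ->
  dominated a b (fun x => II c d (f x)) (fun x => II (V := RC) c d q * p x) /\
  forall eps x0 y0 c0 d0,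
    inn a b x0 -> inn a b y0 -> x0 <= y0 -> inn c d c0 -> inn c d d0 -> c0 <= d0 -> 0 <= eps ->
    (forall x y, inn a b x -> inn a b y -> x <= x0 -> y0 <= y ->
      RInt p x x0 + RInt p y0 y <= eps) ->
    (forall x y, inn c d x -> inn c d y -> x <= c0 -> d0 <= y ->
      RInt q x c0 + RInt q d0 y <= eps) ->
    norm (minus (II a b (fun x => II c d (f x))) (RInt (fun x => RInt (f x) c0 d0) x0 y0))
      <= (II (V := RC) c d q + II (V := RC) a b p) * eps).
{ clear. intros a b c d f p q Hp Hq H.
  assert (Hpp : forall x, inn a b x -> 0 <= p x) by (intros x Hx; now apply Hp).
  assert (HQ : 0 <= II (V := RC) c d q) by now apply II_pos.
  assert (HP : 0 <= II (V := RC) a b p) by now apply II_pos.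
  assert (Hs : forall x, inn a b x -> dominated c d (f x) (fun y => p x * q y)).
  { intros x Hx. split.
    - apply Intg_scal; auto.
    - intros y Hy. split; [apply jcont_r|]; now apply H. }
  assert (HIq : forall k, 0 <= k -> II (V := RC) c d (fun y => k * q y) = k * II (V := RC) c d q).
  { intros k Hk. apply (II_unique (V := RC)).
    apply (is_RInt_gen_scal (V := RC) q k). apply dominated_correct with q. now apply Intg_dominated. }
  assert (HD : dominated a b (fun x => II c d (f x)) (fun x => II (V := RC) c d q * p x)).
  { split; [now apply Intg_scal|]. intros x Hx. split.
    - apply II_continuous with (fun y => (p x + 1) * q y).
      + apply Intg_scal; auto. generalize (Hpp x Hx); lra.
      + assert (Hc : continuous p x) by now apply Hp.
        assert (H1 := filterlim_eps_inv (V := RC) (locally x) p (p x) Hc 1 Rlt_0_1).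
        generalize (filter_and _ _ H1 (locally_inn a b x Hx)). apply filter_imp.
        intros z [Hz1 Hz2] y Hy. split; [apply jcont_r; now apply H|].
        apply Rle_trans with (p z * q y); [now apply H|].
        apply Rmult_le_compat_r; [now apply Hq|].
        assert (Hz3 : Rabs (p z - p x) <= 1) by exact Hz1.
        apply Rabs_le_between in Hz3. lra.
      + intros y Hy. now apply H.
    - rewrite Rmult_comm, <- HIq by auto. apply II_norm. auto. }
  split; auto.
  intros eps x0 y0 c0 d0 Hx0 Hy0 Hxy Hc0 Hd0 Hcd Heps Htp Htq.
  apply Rle_trans with (1 := norm_minus_tri _ (RInt (fun x => II c d (f x)) x0 y0) _).
  rewrite Rmult_plus_distr_r. apply Rplus_le_compat.
  - apply II_approx with (fun x => II (V := RC) c d q * p x); auto.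
    intros x y Hx Hy H1 H2.
    assert (E : forall u v, inn a b u -> inn a b v ->
       RInt (fun x => II (V := RC) c d q * p x) u v = II (V := RC) c d q * RInt p u v).
    { intros u v Hu Hv. apply (RInt_scal (V := RC)). now apply Intg_ex_RInt with a b. }
    rewrite !E, <- Rmult_plus_distr_l by auto. apply Rmult_le_compat_l; auto.
  - assert (Hex2 : ex_RInt (fun x => RInt (f x) c0 d0) x0 y0).
    { apply cont_ex_RInt with a b; auto. intros z Hz.
      apply RInt_continuous_param with a b c d; auto. intros; now apply H. }
    assert (Hex1 : ex_RInt (fun x => II c d (f x)) x0 y0) by now apply dominated_ex_RInt with (1 := HD).
    rewrite <- (RInt_minus (V := V)) by auto.
    apply Rle_trans with (RInt (fun x => eps * p x) x0 y0).
    + apply (norm_RInt_le (fun x => minus (II c d (f x)) (RInt (f x) c0 d0)) (fun x => eps * p x) x0 y0); auto.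
      * intros x Hx. assert (Hix : inn a b x) by now apply inn_between with x0 y0.
        rewrite Rmult_comm.
        apply II_approx with (fun y => p x * q y); auto.
        intros u v Hu Hv H1 H2.
        assert (E : forall u v, inn c d u -> inn c d v ->
          RInt (fun y => p x * q y) u v = p x * RInt q u v).
        { intros u' v' Hu' Hv'. apply (RInt_scal (V := RC)). now apply Intg_ex_RInt with c d. }
        rewrite !E, <- Rmult_plus_distr_l by auto. apply Rmult_le_compat_l; auto.
      * apply RInt_correct. now apply (ex_RInt_minus (V := V)).
      * apply (RInt_correct (V := RC)). apply (ex_RInt_scal (V := RC)). now apply Intg_ex_RInt with a b.
    + assert (E : RInt (fun x => eps * p x) x0 y0 = eps * RInt p x0 y0).
      { apply (RInt_scal (V := RC)). now apply Intg_ex_RInt with a b. }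
      rewrite E, Rmult_comm. apply Rmult_le_compat_r; auto. now apply Intg_RInt_le_II. }
intros Hp Hq H.
destruct (Half a b c d f p q Hp Hq H) as [HD1 HA1].
assert (H' : forall y x, inn c d y -> inn a b x ->
  jcont (fun y x => f x y) y x /\ norm (f x y) <= q y * p x).
{ intros y x Hy Hx. split; [apply jcont_swap; now apply H|].
  rewrite Rmult_comm. now apply H. }
destruct (Half c d a b (fun y x => f x y) q p Hq Hp H') as [HD2 HA2].
split; auto. split; auto.
apply eq_of_norm_le with ((II (V := RC) c d q + II (V := RC) a b p) + (II (V := RC) a b p + II (V := RC) c d q)).
intros eps He.
destruct (Intg_tail a b p Hp eps He) as [x0 [y0 [Hx0 [Hy0 [Hxy Htp]]]]].
destruct (Intg_tail c d q Hq eps He) as [c0 [d0 [Hc0 [Hd0 [Hcd Htq]]]]].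
apply Rle_trans with (1 := norm_minus_tri _ (RInt (fun x => RInt (f x) c0 d0) x0 y0) _).
rewrite Rmult_plus_distr_r. apply Rplus_le_compat.
- apply HA1; auto. lra.
- rewrite norm_minus_sym.
  rewrite (fubini_compact f a b c d x0 y0 c0 d0) by (auto; intros; now apply H).
  apply HA2; auto. lra.
Qed.

(** * Contour deformation *)

(** Green's formula for a closed form f dr + g dt, where d is the common value
    of the two mixed derivatives. *)
Lemma green {V : RNM} (f g d : R -> R -> V) a b c e r1 r2 t1 t2 :
  (forall r t, inn a b r -> inn c e t ->
    is_derive (fun t => f r t) t (d r t) /\ is_derive (fun r => g r t) r (d r t) /\
    jcont d r t /\ continuous (fun r => f r t) r /\ continuous (fun t => g r t) t) ->
  inn a b r1 -> inn a b r2 -> inn c e t1 -> inn c e t2 -> r1 <= r2 -> t1 <= t2 ->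
  minus (RInt (fun r => f r t2) r1 r2) (RInt (fun r => f r t1) r1 r2) =
  RInt (fun t => minus (g r2 t) (g r1 t)) t1 t2.
Proof.
intros H Hr1 Hr2 Ht1 Ht2 Hr Ht.
assert (HexF : forall t, inn c e t -> ex_RInt (fun r => f r t) r1 r2).
{ intros t Hit. apply cont_ex_RInt with a b; auto. intros z Hz. now apply H. }
rewrite <- (RInt_minus (V := V)) by auto.
transitivity (RInt (fun r => RInt (d r) t1 t2) r1 r2).
- apply RInt_ext. intros r Hrr. rewrite Rmin_left, Rmax_right in Hrr by lra.
  assert (Hir : inn a b r) by (apply inn_between with r1 r2; auto; lra).
  symmetry. apply is_RInt_unique.
  apply (is_RInt_derive (fun t => f r t) (d r)); rewrite Rmin_left, Rmax_right by lra; intros t Htt;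
  assert (Hit : inn c e t) by (apply inn_between with t1 t2; auto).
  + now apply H.
  + apply jcont_r. now apply H.
- rewrite (fubini_compact d a b c e) by (auto; intros; now apply H).
  apply RInt_ext. intros t Htt. rewrite Rmin_left, Rmax_right in Htt by lra.
  assert (Hit : inn c e t) by (apply inn_between with t1 t2; auto; lra).
  apply is_RInt_unique.
  apply (is_RInt_derive (fun r => g r t) (fun r => d r t)); rewrite Rmin_left, Rmax_right by lra; intros r Hrr;
  assert (Hir : inn a b r) by (apply inn_between with r1 r2; auto).
  + now apply H.
  + apply (jcont_l d r t). now apply H.
Qed.

(** The integral of a closed form does not change when the contributions of
    the two ends tend to 0. *)
Lemma contour_shift {V : RNM} (f g d : R -> R -> V) a b c e t1 t2 v1 v2 : Rbar_lt a b ->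
  (forall r t, inn a b r -> inn c e t ->
    is_derive (fun t => f r t) t (d r t) /\ is_derive (fun r => g r t) r (d r t) /\
    jcont d r t /\ continuous (fun r => f r t) r /\ continuous (fun t => g r t) t) ->
  inn c e t1 -> inn c e t2 -> t1 <= t2 ->
  (forall eps, 0 < eps -> lo a (fun r => forall t, t1 <= t <= t2 -> norm (g r t) <= eps)) ->
  (forall eps, 0 < eps -> hi b (fun r => forall t, t1 <= t <= t2 -> norm (g r t) <= eps)) ->
  is_RInt_gen (fun r => f r t1) (lo a) (hi b) v1 ->
  is_RInt_gen (fun r => f r t2) (lo a) (hi b) v2 -> v1 = v2.
Proof.
intros Hab H Ht1 Ht2 Ht Hlo Hhi H1 H2.
apply lim_of_is_RInt_gen in H1. apply lim_of_is_RInt_gen in H2.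
apply eq_of_norm_le with (2 + 2 * (t2 - t1)). intros eps He.
destruct (inn_exists a b Hab) as [z Hz].
assert (HB : filter_prod (lo a) (hi b) (fun p =>
   (forall t, t1 <= t <= t2 -> norm (g (fst p) t) <= eps) /\
   (forall t, t1 <= t <= t2 -> norm (g (snd p) t) <= eps))).
{ apply Filter_prod with (1 := Hlo eps He) (2 := Hhi eps He). simpl. auto. }
destruct (filter_ex _ (filter_and _ _ (filter_and _ _ (prod_inn a b z z Hz Hz) HB)
   (filter_and _ _ (filterlim_eps_inv _ _ _ H1 eps He) (filterlim_eps_inv _ _ _ H2 eps He))))
  as [[x y] [[[Hx [Hy [Hxz Hzy]]] [B1 B2]] [N1 N2]]]. simpl in *.
apply Rle_trans with (1 := norm_minus_tri _ (RInt (fun r => f r t1) x y) _).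
replace ((2 + 2 * (t2 - t1)) * eps) with (eps + ((t2 - t1) * (eps + eps) + eps)) by ring.
apply Rplus_le_compat; [rewrite norm_minus_sym; auto|].
apply Rle_trans with (1 := norm_minus_tri _ (RInt (fun r => f r t2) x y) _).
apply Rplus_le_compat; auto.
rewrite norm_minus_sym.
rewrite (green f g d a b c e x y t1 t2) by (auto; lra).
apply (norm_RInt_le_const (fun t => minus (g y t) (g x t)) t1 t2); auto.
- intros t Htt. unfold minus. apply Rle_trans with (1 := norm_tri _ _).
  apply Rplus_le_compat; auto. rewrite norm_oppV. auto.
- apply RInt_correct. apply (ex_RInt_minus (V := V)); apply cont_ex_RInt with c e; auto;
  intros t Hit; now apply H.
Qed.

(** * Changes of variable and integration by parts *)

Lemma is_RInt_gen_subst {V : RNM} a b c d (f : R -> V) (g dg : R -> R) v : Rbar_lt c d ->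
  (forall x, inn c d x -> inn a b (g x) /\ is_derive g x (dg x) /\ continuous dg x) ->
  (forall x, inn a b x -> continuous f x) ->
  filterlim g (lo c) (lo a) -> filterlim g (hi d) (hi b) ->
  is_RInt_gen f (lo a) (hi b) v ->
  is_RInt_gen (fun y => scal (dg y) (f (g y))) (lo c) (hi d) v.
Proof.
intros Hcd Hg Hf Hlo Hhi Hv.
apply lim_of_is_RInt_gen in Hv.
apply is_RInt_gen_of_lim; auto.
- intros x Hx. apply (continuous_scal (V := V)); [now apply Hg|].
  apply (continuous_comp g f).
  + apply (ex_derive_continuous (V := R_NormedModule)). exists (dg x). now apply Hg.
  + apply Hf. now apply Hg.
- intros P HP.
  assert (HQ : filter_prod (lo a) (hi b) (fun p => P (RInt f (fst p) (snd p)))) by exact (Hv P HP).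
  destruct HQ as [Q1 Q2 HQ1 HQ2 HQ].
  destruct (inn_exists c d Hcd) as [z Hz].
  apply Filter_prod with (fun x => Q1 (g x) /\ inn c d x /\ x <= z) (fun x => Q2 (g x) /\ inn c d x /\ z <= x).
  + apply filter_and; [exact (Hlo Q1 HQ1)|now apply lo_inn].
  + apply filter_and; [exact (Hhi Q2 HQ2)|now apply hi_inn].
  + intros x y [Hx1 [Hx2 Hx3]] [Hy1 [Hy2 Hy3]]. simpl.
    rewrite RInt_comp with (f := f) (g := g).
    * exact (HQ (g x) (g y) Hx1 Hy1).
    * rewrite Rmin_left, Rmax_right by lra. intros t Ht. apply Hf, Hg.
      now apply inn_between with x y.
    * rewrite Rmin_left, Rmax_right by lra. intros t Ht.
      apply Hg. now apply inn_between with x y.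
Qed.

Lemma is_RInt_gen_reflect {V : RNM} (f : R -> V) t v : 0 < t ->
  (forall x, 0 < x < t -> continuous f x) ->
  is_RInt_gen f (lo 0) (hi t) v ->
  is_RInt_gen (fun s => f (t - s)) (lo 0) (hi t) v.
Proof.
intros Ht Hf Hv. apply lim_of_is_RInt_gen in Hv.
assert (Hc : forall x, 0 < x < t -> continuous (fun s => f (t - s)) x).
{ intros x Hx. apply (continuous_comp (fun s => t - s) f).
  - apply (ex_derive_continuous (V := R_NormedModule)). auto_derive. auto.
  - apply Hf. lra. }
apply is_RInt_gen_of_lim; auto.
intros P HP.
assert (HQ : filter_prod (lo 0) (hi t) (fun p => P (RInt f (fst p) (snd p)))) by exact (Hv P HP).
destruct HQ as [Q1 Q2 HQ1 HQ2 HQ].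
assert (Hz : inn 0 t (t / 2)) by (split; simpl; lra).
apply Filter_prod with (fun x => Q2 (t - x) /\ inn 0 t x /\ x <= t / 2) (fun x => Q1 (t - x) /\ inn 0 t x /\ t / 2 <= x).
+ apply filter_and; [|now apply lo_inn].
  destruct HQ2 as [e He]. exists e. intros x Hx Hx0. apply He; [|lra].
  assert (Hx' : Rabs (x - 0) < e) by exact Hx.
  change (Rabs (t - x - t) < e). replace (t - x - t) with (- (x - 0)) by ring. now rewrite Rabs_Ropp.
+ apply filter_and; [|now apply hi_inn].
  destruct HQ1 as [e He]. exists e. intros x Hx Hx0. apply He; [|lra].
  assert (Hx' : Rabs (x - t) < e) by exact Hx.
  change (Rabs (t - x - 0) < e). replace (t - x - 0) with (- (x - t)) by ring. now rewrite Rabs_Ropp.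
+ intros x y [Hx1 [Hx2 Hx3]] [Hy1 [Hy2 Hy3]]. simpl.
  destruct Hx2 as [Hx2 Hx4]. destruct Hy2 as [Hy2 Hy4]. simpl in *.
  assert (E : RInt (fun s => f (t - s)) x y = RInt f (t - y) (t - x)).
  { assert (Hcx : forall z, Rmin x y <= z <= Rmax x y -> 0 < z < t).
    { rewrite Rmin_left, Rmax_right by lra. intros z Hzz. lra. }
    assert (E0 := RInt_comp (V := V) f (fun s => t - s) (fun _ => -1) x y).
    assert (E1 : RInt (fun s => opp (f (t - s))) x y = RInt f (t - x) (t - y)).
    { rewrite <- E0.
      - apply RInt_ext. intros s _. symmetry. exact (scal_opp_one (V := V) (f (t - s))).
      - intros s Hs. apply Hf. apply Hcx in Hs. lra.
      - intros s Hs. split; [|apply continuous_const].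
        auto_derive; auto. }
    rewrite <- (opp_RInt_swap f (t - x) (t - y)).
    2:{ apply ex_RInt_continuous. intros z Hzz. rewrite Rmin_right, Rmax_left in Hzz by lra.
        apply Hf. lra. }
    rewrite <- E1. rewrite (RInt_opp (V := V) (fun s => f (t - s)) x y).
    2:{ apply (ex_RInt_continuous (V := V)). intros z Hzz. apply Hc. now apply Hcx. }
    symmetry. exact (opp_opp (RInt (fun s => f (t - s)) x y)). }
  rewrite E. exact (HQ _ _ Hy1 Hx1).
Qed.

(** Lets a convolution over (0, t) be computed over an interval that does
    not depend on t. *)
Lemma is_RInt_gen_cut {V : RNM} (f : R -> V) b t v : 0 < t -> Rbar_lt t b ->
  (forall x, inn 0 b x -> continuous f x) -> (forall x, t <= x -> f x = zero) ->
  is_RInt_gen f (lo 0) (hi b) v ->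
  is_RInt_gen f (lo 0) (hi t) v.
Proof.
intros Ht Htb Hc Hz Hv. apply lim_of_is_RInt_gen in Hv.
apply is_RInt_gen_of_lim; auto.
{ intros x [Hx1 Hx2]. apply Hc. split; auto. now apply Rbar_lt_trans with t. }
apply filterlim_eps; [apply _|]. intros eps He.
assert (Hit : inn 0 b t) by (split; auto).
assert (Hex : forall x y, inn 0 b x -> inn 0 b y -> ex_RInt f x y).
{ intros x y Hx Hy. now apply (cont_ex_RInt (V := V) 0 b). }
assert (HcR : continuous (fun y => RInt f t y) t).
{ apply (continuous_RInt_1 (V := V) f t t (fun y => RInt f t y)).
  generalize (locally_inn 0 b t Hit). apply filter_imp.
  intros z Hz'. apply RInt_correct. now apply Hex. }
assert (H2 : hi t (fun y => norm (minus (RInt f t y) (RInt f t t)) <= eps / 2)).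
{ generalize (filterlim_eps_inv (locally t) _ _ HcR (eps / 2) ltac:(lra)).
  intros [e Hle]. exists e. intros x Hx _. now apply Hle. }
assert (H1 := filterlim_eps_inv _ _ _ Hv (eps / 2) ltac:(lra)).
destruct H1 as [Q1 Q2 HQ1 HQ2 HQ].
assert (Hi : inn 0 t (t / 2)) by (split; simpl; lra).
assert (HI1 := lo_inn 0 t (t / 2) Hi). assert (HI2 := hi_inn 0 t (t / 2) Hi).
apply Filter_prod with (1 := filter_and _ _ HQ1 HI1) (2 := filter_and _ _ H2 HI2).
intros x y [Hx1 [Hx2 Hx3]] [Hy1 [Hy2 Hy3]]. simpl.
assert (HI3 : hi b (fun z => inn 0 b z /\ t < z)).
{ destruct (inn_exists t b Htb) as [z0 [Hz0 Hz0']].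
  assert (Hiz : inn 0 b z0) by (split; auto; simpl in *; lra).
  generalize (hi_inn 0 b z0 Hiz). apply filter_imp. intros z [Hz1 Hz2]. split; auto. simpl in Hz0. lra. }
destruct (filter_ex _ (filter_and _ _ HQ2 HI3)) as [y' [Hy'1 [Hy'3 Hy'2]]].
generalize (HQ x y' Hx1 Hy'1). simpl. intros HN.
destruct Hx2 as [Hx2 Hx2']. destruct Hy2 as [Hy2 Hy2'].
assert (Hix : inn 0 b x) by (split; auto; now apply Rbar_lt_trans with t).
assert (Hiy : inn 0 b y) by (split; auto; now apply Rbar_lt_trans with t).
simpl in Hx2, Hx2', Hy2, Hy2'.
assert (Hzz : RInt f t y' = zero).
{ transitivity (RInt (fun _ : R => zero : V) t y').
  - apply RInt_ext. intros z Hz'. rewrite Rmin_left, Rmax_right in Hz' by lra. apply Hz. lra.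
  - rewrite (RInt_const (V := V)). exact (scal_zeroV (y' - t)). }
assert (Ey : RInt f x y' = RInt f x t).
{ rewrite <- (RInt_Chasles f x t y') by auto. rewrite Hzz.
  exact (plus_zero_r (RInt f x t)). }
rewrite Ey in HN.
apply Rle_trans with (1 := norm_minus_tri _ (RInt f x t) _).
apply Rle_trans with (eps / 2 + eps / 2); [|lra]. apply Rplus_le_compat; auto.
rewrite <- (RInt_Chasles f x t y) by auto.
replace (norm (minus (plus (RInt f x t) (RInt f t y)) (RInt f x t)))
  with (norm (minus (RInt f t y) (RInt f t t))); auto.
f_equal. rewrite RInt_point.
transitivity (RInt f t y); [exact (minus_zero_r (RInt f t y))|].
symmetry. exact (plus_minus_l (RInt f x t) (RInt f t y)).
Qed.

(** The identity on compact intervals is a hypothesis, so that no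
    differentiability is required of the integrands themselves. *)
Lemma is_RInt_gen_parts {V : RNM} a b (f g H : R -> V) la lb v : Rbar_lt a b ->
  (forall x, inn a b x -> continuous f x) ->
  (forall x y, inn a b x -> inn a b y -> x <= y ->
     RInt f x y = plus (minus (H y) (H x)) (RInt g x y)) ->
  filterlim H (lo a) (locally la) -> filterlim H (hi b) (locally lb) ->
  is_RInt_gen g (lo a) (hi b) v ->
  is_RInt_gen f (lo a) (hi b) (plus (minus lb la) v).
Proof.
intros Hab Hc HE Hla Hlb Hv. apply lim_of_is_RInt_gen in Hv.
apply is_RInt_gen_of_lim; auto.
destruct (inn_exists a b Hab) as [z Hz].
apply (filterlim_ext_loc (fun p => plus (minus (H (snd p)) (H (fst p))) (RInt g (fst p) (snd p)))).
{ generalize (prod_inn a b z z Hz Hz). apply filter_imp. intros [x y] [H1 [H2 [H3 H4]]].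
  simpl in *. symmetry. apply HE; auto; lra. }
apply (filterlim_comp_2 (F := filter_prod (lo a) (hi b)) (G := locally (minus lb la)) (H := locally v)
   (fun p => minus (H (snd p)) (H (fst p))) (fun p => RInt g (fst p) (snd p)) plus).
- apply (filterlim_comp_2 (F := filter_prod (lo a) (hi b)) (G := locally lb) (H := locally (opp la))
   (fun p => H (snd p)) (fun p => opp (H (fst p))) plus).
  + exact (filterlim_comp _ _ _ snd H (filter_prod (lo a) (hi b)) (hi b) (locally lb) filterlim_snd Hlb).
  + apply (filterlim_comp _ _ _ (fun p => H (fst p)) opp (filter_prod (lo a) (hi b)) (locally la) (locally (opp la))).
    * exact (filterlim_comp _ _ _ fst H (filter_prod (lo a) (hi b)) (lo a) (locally la) filterlim_fst Hla).
    * exact (filterlim_opp la).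
  + exact (filterlim_plus lb (opp la)).
- exact Hv.
- exact (filterlim_plus (minus lb la) v).
Qed.

(** * Powers and exponentials *)

Lemma deriv_cont (f : R -> R) x : ex_derive f x -> continuous f x.
Proof. exact (ex_derive_continuous (V := R_NormedModule) f x). Qed.

Lemma Rpower_pos x y : 0 < Rpower x y.
Proof. apply exp_pos. Qed.

Lemma cont_Rpower x y : 0 < x -> continuous (fun z => Rpower z y) x.
Proof. intros H. apply deriv_cont. unfold Rpower. auto_derive. auto. Qed.

Lemma is_derive_Rpower x y : 0 < x -> is_derive (fun z => Rpower z y) x (y * Rpower x (y - 1)).
Proof.
intros H. unfold Rpower. auto_derive; auto.
replace ((y - 1) * ln x) with (y * ln x + - ln x) by ring.
rewrite exp_plus, exp_Ropp, exp_ln by auto. field. lra.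
Qed.

Lemma exp_le x y : x <= y -> exp x <= exp y.
Proof. intros [H|<-]; [left; now apply exp_increasing|lra]. Qed.

Lemma ln_le_sub x : 0 < x -> ln x <= x - 1.
Proof.
intros H. rewrite <- (ln_exp (x - 1)). apply ln_le; auto.
generalize (exp_ineq1_le (x - 1)). lra.
Qed.

(** The maximum of m ln x - k x is at x = m / k. *)
Lemma Rpower_le_exp m k : 0 < m -> 0 < k -> exists C, 0 < C /\ forall x, 0 < x ->
  Rpower x m <= C * exp (k * x).
Proof.
intros Hm Hk. exists (exp (m * ln (m / k) - m)). split; [apply exp_pos|].
intros x Hx. rewrite <- exp_plus. unfold Rpower. apply exp_le.
assert (Hp : 0 < k * x / m) by (apply Rdiv_lt_0_compat; auto; now apply Rmult_lt_0_compat).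
assert (H := ln_le_sub _ Hp).
assert (E : ln (k * x / m) = ln x - ln (m / k)).
{ rewrite <- ln_div; try apply Rdiv_lt_0_compat; auto.
  f_equal. field. lra. }
rewrite E in H.
apply (Rmult_le_compat_l m) in H; [|lra].
replace (m * (k * x / m - 1)) with (k * x - m) in H by (field; lra). lra.
Qed.

Lemma sublinear al s k : 0 < al < 1 -> 0 <= s -> 0 < k ->
  exists C, forall x, 0 < x -> s * Rpower x al <= k * x + C.
Proof.
intros Hal Hs Hk.
set (r := Rpower (s / k + 1) (1 / (1 - al))).
assert (Hr : 0 < r) by apply Rpower_pos.
assert (Hsk : 0 <= s / k) by (apply Rmult_le_pos; auto; left; now apply Rinv_0_lt_compat).
assert (Hr1 : Rpower r (1 - al) = s / k + 1).
{ unfold r. rewrite Rpower_mult. replace (1 / (1 - al) * (1 - al)) with 1 by (field; lra).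
  apply Rpower_1. lra. }
exists (s * Rpower r al). intros x Hx.
destruct (Rle_dec x r) as [H|H].
- assert (Rpower x al <= Rpower r al) by (apply Rle_Rpower_l; lra).
  assert (s * Rpower x al <= s * Rpower r al) by now apply Rmult_le_compat_l.
  assert (0 < k * x) by now apply Rmult_lt_0_compat. lra.
- assert (Hge : s / k + 1 <= Rpower x (1 - al)).
  { rewrite <- Hr1. apply Rle_Rpower_l; lra. }
  assert (Ex : x = Rpower x al * Rpower x (1 - al)).
  { rewrite <- Rpower_plus. replace (al + (1 - al)) with 1 by ring. now rewrite Rpower_1. }
  assert (Hp := Rpower_pos x al).
  assert (0 <= s * Rpower r al) by (apply Rmult_le_pos; auto; left; apply Rpower_pos).
  assert (s * Rpower x al <= k * x); [|lra].
  rewrite Ex at 2.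
  replace (k * (Rpower x al * Rpower x (1 - al))) with (k * Rpower x (1 - al) * Rpower x al) by ring.
  apply Rmult_le_compat_r; [lra|].
  apply Rle_trans with (k * (s / k + 1)).
  + replace (k * (s / k + 1)) with (s + k) by (field; lra). lra.
  + apply Rmult_le_compat_l; lra.
Qed.

Lemma Intg_powers h C a b : 0 < a -> 0 < b ->
  (forall x, 0 < x -> continuous h x /\ 0 <= h x) ->
  (forall x, 0 < x <= 1 -> h x <= C * Rpower x (a - 1)) ->
  (forall x, 1 <= x -> h x <= C * Rpower x (- 1 - b)) ->
  Intg 0 p_infty h.
Proof.
intros Ha Hb Hh H0 H1.
apply Intg_split with 1.
- split; simpl; auto; lra.
- intros x [Hx _]. now apply Hh.
- apply Intg_le with (fun x => Rpower x (a - 1)) C.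
  + apply Intg_primitive with (fun x => / a * Rpower x a) (/ a * 1).
    * simpl; lra.
    * intros x [Hx _]. simpl in Hx. split; [now apply cont_Rpower|left; apply Rpower_pos].
    * intros x [Hx _]. simpl in Hx.
      replace (Rpower x (a - 1)) with (/ a * (a * Rpower x (a - 1))) by (field; lra).
      apply is_derive_scal. now apply is_derive_Rpower.
    * intros x [Hx Hx1]. simpl in Hx, Hx1. rewrite Rabs_pos_eq.
      -- apply Rmult_le_compat_l; [left; now apply Rinv_0_lt_compat|].
         apply Rle_trans with (Rpower 1 a); [apply Rle_Rpower_l; lra|].
         unfold Rpower; rewrite ln_1, Rmult_0_r, exp_0. lra.
      -- left. apply Rmult_lt_0_compat; [now apply Rinv_0_lt_compat|apply Rpower_pos].
  + intros x [Hx Hx1]. simpl in Hx, Hx1. split; [now apply Hh|]. split; [now apply Hh|]. apply H0. lra.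
- apply Intg_le with (fun x => Rpower x (- 1 - b)) C.
  + apply Intg_primitive with (fun x => - / b * Rpower x (- b)) (/ b).
    * simpl; auto.
    * intros x [Hx _]. simpl in Hx. split; [apply cont_Rpower; lra|left; apply Rpower_pos].
    * intros x [Hx _]. simpl in Hx.
      replace (Rpower x (- 1 - b)) with (- / b * (- b * Rpower x (- b - 1))).
      2:{ replace (- b - 1) with (- 1 - b) by ring. field. lra. }
      apply is_derive_scal. apply is_derive_Rpower. lra.
    * intros x [Hx _]. simpl in Hx.
      assert (Hib : 0 < / b) by now apply Rinv_0_lt_compat.
      rewrite Rabs_mult, Rabs_Ropp, (Rabs_pos_eq (/ b)) by lra.
      rewrite Rabs_pos_eq by (left; apply Rpower_pos).
      apply Rle_trans with (/ b * 1); [|lra]. apply Rmult_le_compat_l; [lra|].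
      unfold Rpower. apply Rle_trans with (exp 0); [|rewrite exp_0; lra]. apply exp_le.
      assert (0 <= ln x) by (rewrite <- ln_1; apply ln_le; lra).
      assert (0 <= b * ln x) by (apply Rmult_le_pos; lra). lra.
  + intros x [Hx _]. simpl in Hx. split; [apply Hh; lra|]. split; [apply Hh; lra|]. apply H1. lra.
Qed.

Lemma Rpower_1_l y : Rpower 1 y = 1.
Proof. unfold Rpower. now rewrite ln_1, Rmult_0_r, exp_0. Qed.

Lemma Rpower_le_1 x y : 0 < x <= 1 -> 0 <= y -> Rpower x y <= 1.
Proof.
intros Hx Hy. rewrite <- (Rpower_1_l y). apply Rle_Rpower_l; lra.
Qed.

Lemma Intg_stretch nu k al : - 1 < nu -> 0 < k -> 0 < al ->
  Intg 0 p_infty (fun x => Rpower x nu * exp (- (k * Rpower x al))).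
Proof.
intros Hnu Hk Hal.
destruct (Rpower_le_exp ((nu + 2) / al) k) as [C [HC HCx]]; auto.
{ apply Rdiv_lt_0_compat; lra. }
apply Intg_powers with (C + 1) (nu + 1) 1; try lra.
- intros x Hx. split.
  + apply deriv_cont. unfold Rpower. auto_derive. auto.
  + apply Rmult_le_pos; left; [apply Rpower_pos|apply exp_pos].
- intros x Hx. replace (nu + 1 - 1) with nu by ring. rewrite Rmult_comm.
  apply Rmult_le_compat_r; [left; apply Rpower_pos|].
  apply Rle_trans with 1; [|lra]. rewrite <- exp_0. apply exp_le.
  assert (0 < k * Rpower x al) by (apply Rmult_lt_0_compat; auto; apply Rpower_pos). lra.
- intros x Hx.
  assert (H := HCx (Rpower x al) (Rpower_pos x al)).
  rewrite Rpower_mult in H. replace (al * ((nu + 2) / al)) with (nu + 2) in H by (field; lra).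
  replace (Rpower x nu) with (Rpower x (nu + 2) * Rpower x (- 1 - 1)).
  2:{ rewrite <- Rpower_plus. f_equal. ring. }
  rewrite exp_Ropp.
  replace (Rpower x (nu + 2) * Rpower x (-1 - 1) * / exp (k * Rpower x al))
    with (Rpower x (nu + 2) * / exp (k * Rpower x al) * Rpower x (-1 - 1)) by ring.
  apply Rmult_le_compat_r; [left; apply Rpower_pos|].
  assert (He := exp_pos (k * Rpower x al)).
  apply Rmult_le_reg_r with (exp (k * Rpower x al)); auto.
  rewrite Rmult_assoc, Rinv_l, Rmult_1_r by lra.
  apply Rle_trans with (1 := H). apply Rmult_le_compat_r; lra.
Qed.

Lemma Intg_gamma a k : 0 < a -> 0 < k ->
  Intg 0 p_infty (fun x => Rpower x (a - 1) * exp (- (k * x))).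
Proof.
intros Ha Hk.
apply Intg_le with (fun x => Rpower x (a - 1) * exp (- (k * Rpower x 1))) 1.
- apply Intg_stretch; lra.
- intros x [Hx _]. simpl in Hx. split.
  + apply deriv_cont. unfold Rpower. auto_derive. auto.
  + rewrite Rpower_1 by auto. split; [|lra].
    apply Rmult_le_pos; left; [apply Rpower_pos|apply exp_pos].
Qed.

Lemma Intg_pow_0 T a : 0 < T -> 0 < a -> Intg 0 T (fun x => Rpower x (a - 1)).
Proof.
intros HT Ha.
apply Intg_primitive with (fun x => / a * Rpower x a) (/ a * Rpower T a).
- simpl; lra.
- intros x [Hx _]. simpl in Hx. split; [now apply cont_Rpower|left; apply Rpower_pos].
- intros x [Hx _]. simpl in Hx.
  replace (Rpower x (a - 1)) with (/ a * (a * Rpower x (a - 1))) by (field; lra).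
  apply is_derive_scal. now apply is_derive_Rpower.
- intros x [Hx Hx1]. simpl in Hx, Hx1.
  assert (Hib : 0 < / a) by now apply Rinv_0_lt_compat.
  assert (Hp := Rpower_pos x a).
  rewrite Rabs_pos_eq by (apply Rmult_le_pos; lra).
  apply Rmult_le_compat_l; [lra|]. apply Rle_Rpower_l; lra.
Qed.

Lemma Intg_pow_T T a : 0 < T -> 0 < a -> Intg 0 T (fun x => Rpower (T - x) (a - 1)).
Proof.
intros HT Ha.
apply Intg_primitive with (fun x => - / a * Rpower (T - x) a) (/ a * Rpower T a).
- simpl; lra.
- intros x [_ Hx]. simpl in Hx. split; [|left; apply Rpower_pos].
  apply deriv_cont. unfold Rpower. auto_derive. lra.
- intros x [_ Hx]. simpl in Hx.
  replace (Rpower (T - x) (a - 1)) with (- / a * (-1 * (a * Rpower (T - x) (a - 1)))) by (field; lra).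
  apply is_derive_scal.
  apply (is_derive_comp (V := R_NormedModule) (fun z => Rpower z a) (fun x => T - x)).
  + apply is_derive_Rpower. lra.
  + auto_derive; auto.
- intros x [Hx Hx1]. simpl in Hx, Hx1.
  assert (Hib : 0 < / a) by now apply Rinv_0_lt_compat.
  assert (Hp := Rpower_pos (T - x) a).
  rewrite Rabs_mult, Rabs_Ropp, !Rabs_pos_eq by lra.
  apply Rmult_le_compat_l; [lra|]. apply Rle_Rpower_l; lra.
Qed.

Lemma Rpower_bound a x1 x2 : 0 < x1 -> exists C, 0 < C /\ forall x, x1 <= x <= x2 -> Rpower x a <= C.
Proof.
intros H. exists (Rpower x1 a + Rpower x2 a).
split; [generalize (Rpower_pos x1 a) (Rpower_pos x2 a); lra|].
intros x Hx.
destruct (Rle_dec 0 a) as [Ha|Ha].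
- assert (Rpower x a <= Rpower x2 a) by (apply Rle_Rpower_l; lra).
  generalize (Rpower_pos x1 a); lra.
- assert (Rpower x a <= Rpower x1 a).
  { unfold Rpower. apply exp_le. assert (ln x1 <= ln x) by (apply ln_le; lra).
    assert (0 <= - a * (ln x - ln x1)) by (apply Rmult_le_pos; lra). lra. }
  generalize (Rpower_pos x2 a); lra.
Qed.

Lemma Intg_beta t a b : 0 < t -> 0 < a -> 0 < b ->
  Intg 0 t (fun x => Rpower (t - x) (a - 1) * Rpower x (b - 1)).
Proof.
intros Ht Ha Hb.
destruct (Rpower_bound (a - 1) (t / 2) t) as [C1 [HC1 H1]]; [lra|].
destruct (Rpower_bound (b - 1) (t / 2) t) as [C2 [HC2 H2]]; [lra|].
apply Intg_le with (fun x => Rpower x (b - 1) + Rpower (t - x) (a - 1)) (C1 + C2).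
- apply Intg_plus; [now apply Intg_pow_0|now apply Intg_pow_T].
- intros x [Hx Hxt]. simpl in Hx, Hxt. split.
  + apply deriv_cont. unfold Rpower. auto_derive. split; auto; lra.
  + assert (Hp := Rpower_pos x (b - 1)). assert (Hq := Rpower_pos (t - x) (a - 1)).
    split; [apply Rmult_le_pos; lra|].
    destruct (Rle_dec x (t / 2)).
    * assert (Rpower (t - x) (a - 1) <= C1) by (apply H1; lra).
      apply Rle_trans with (C1 * Rpower x (b - 1)).
      -- apply Rmult_le_compat_r; lra.
      -- assert (0 <= C2 * Rpower x (b - 1)) by (apply Rmult_le_pos; lra).
         assert (0 <= (C1 + C2) * Rpower (t - x) (a - 1)) by (apply Rmult_le_pos; lra). lra.
    * assert (Rpower x (b - 1) <= C2) by (apply H2; lra).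
      apply Rle_trans with (Rpower (t - x) (a - 1) * C2).
      -- apply Rmult_le_compat_l; lra.
      -- assert (0 <= C1 * Rpower (t - x) (a - 1)) by (apply Rmult_le_pos; lra).
         assert (0 <= (C1 + C2) * Rpower x (b - 1)) by (apply Rmult_le_pos; lra). lra.
Qed.

(** * The Gamma and Beta functions *)

Lemma Gamma_correct x : 0 < x ->
  is_RInt_gen (V := RC) (fun t => Rpower t (x - 1) * exp (- t)) (lo 0) (hi p_infty) (Gamma x).
Proof.
intros Hx. apply (dominated_correct (V := RC) 0 p_infty _ (fun t => Rpower t (x - 1) * exp (- t))).
apply Intg_dominated.
apply Intg_le with (fun t => Rpower t (x - 1) * exp (- (1 * t))) 1.
- apply Intg_gamma; lra.
- intros t [Ht _]. simpl in Ht. split.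
  + apply deriv_cont. unfold Rpower. auto_derive. auto.
  + rewrite !Rmult_1_l. split; [|lra]. apply Rmult_le_pos; left; [apply Rpower_pos|apply exp_pos].
Qed.

Lemma is_RInt_gen_scale {V : RNM} (f : R -> V) v k : 0 < k ->
  (forall x, 0 < x -> continuous f x) ->
  is_RInt_gen f (lo 0) (hi p_infty) v ->
  is_RInt_gen (fun y => scal k (f (k * y))) (lo 0) (hi p_infty) v.
Proof.
intros Hk Hf Hv.
apply (is_RInt_gen_subst 0 p_infty 0 p_infty f (fun y => k * y) (fun _ => k)); auto.
- simpl; auto.
- intros x [Hx _]. simpl in Hx. split; [split; simpl; auto; now apply Rmult_lt_0_compat|].
  split; [|apply continuous_const]. auto_derive; auto. ring.
- intros x [Hx _]. now apply Hf.
- intros P [e He].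
  assert (Hd : 0 < e / k) by (apply Rdiv_lt_0_compat; auto; apply cond_pos).
  exists (mkposreal _ Hd). intros x Hx Hx0.
  assert (Hx' : Rabs (x - 0) < e / k) by exact Hx.
  apply He; [|now apply Rmult_lt_0_compat].
  change (Rabs (k * x - 0) < e). replace (k * x - 0) with (k * (x - 0)) by ring.
  rewrite Rabs_mult, (Rabs_pos_eq k) by lra.
  replace (pos e) with (k * (e / k)) by (field; lra). now apply Rmult_lt_compat_l.
- intros P [M HM]. exists (M / k). intros x Hx. apply HM.
  replace M with (k * (M / k)) by (field; lra). now apply Rmult_lt_compat_l.
Qed.

Lemma Gamma_scale a k : 0 < a -> 0 < k ->
  is_RInt_gen (V := RC) (fun v => Rpower v (a - 1) * exp (- (k * v))) (lo 0) (hi p_infty)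
    (Rpower k (- a) * Gamma a).
Proof.
intros Ha Hk.
assert (H := is_RInt_gen_scale (V := RC) _ _ k Hk (fun x Hx => proj1 (conj (deriv_cont (fun t => Rpower t (a - 1) * exp (- t)) x ltac:(unfold Rpower; auto_derive; auto)) I)) (Gamma_correct a Ha)).
apply (is_RInt_gen_scal (V := RC) _ (Rpower k (- a))) in H.
revert H. apply (is_RInt_gen_ext (V := RC)).
destruct (inn_exists 0 p_infty I) as [z Hz].
generalize (prod_inn 0 p_infty z z Hz Hz). apply filter_imp.
intros [x y] [[Hx _] [[Hy _] [H3 H4]]] v Hv. simpl in *.
rewrite Rmin_left, Rmax_right in Hv by lra.
unfold scal; simpl; unfold mult; simpl.
assert (Hv0 : 0 < v) by lra.
unfold Rpower. rewrite ln_mult by auto.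
replace ((a - 1) * (ln k + ln v)) with ((a - 1) * ln k + (a - 1) * ln v) by ring.
rewrite exp_plus.
replace (- a * ln k) with (- ((a - 1) * ln k) + - ln k) by ring.
rewrite exp_plus, !exp_Ropp, exp_ln by auto. field.
repeat split; try (apply Rgt_not_eq, exp_pos); lra.
Qed.

Lemma is_RInt_gen_ext_inn {V : RNM} a b (f g : R -> V) v : Rbar_lt a b ->
  (forall x, inn a b x -> f x = g x) ->
  is_RInt_gen f (lo a) (hi b) v -> is_RInt_gen g (lo a) (hi b) v.
Proof.
intros Hab He. apply is_RInt_gen_ext.
destruct (inn_exists a b Hab) as [z Hz].
generalize (prod_inn a b z z Hz Hz). apply filter_imp.
intros [x y] [H1 [H2 [H3 H4]]] t Ht. simpl in *.
rewrite Rmin_left, Rmax_right in Ht by lra. apply He.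
apply inn_between with x y; auto; lra.
Qed.

Notation CC := C_R_CompleteNormedModule.

(** * Complex-valued functions of real variables *)

Lemma is_derive_Rmult (f g : R -> R) x df dg : is_derive f x df -> is_derive g x dg ->
  is_derive (fun t => f t * g t) x (df * g x + f x * dg).
Proof.
intros Hf Hg. exact (is_derive_mult f g x df dg Hf Hg Rmult_comm).
Qed.

Lemma C_is_derive (f : R -> C) x (l : C) :
  is_derive (fun t => Re (f t)) x (Re l) -> is_derive (fun t => Im (f t)) x (Im l) ->
  is_derive (V := CC) f x l.
Proof.
intros H1 H2.
assert (H3 := is_derive_scal_l (V := CC) _ _ _ (RtoC 1) H1).
assert (H4 := is_derive_scal_l (V := CC) _ _ _ Ci H2).
assert (H5 := is_derive_plus (V := CC) _ _ _ _ _ H3 H4).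
assert (E : forall z : C, plus (scal (Re z) (RtoC 1 : CC)) (scal (Im z) (Ci : CC)) = (z : CC)).
{ intros [a b]. unfold plus, scal; simpl. unfold prod_plus, prod_scal; simpl.
  unfold plus, scal, mult; simpl. unfold mult; simpl. f_equal; ring. }
rewrite E in H5. apply is_derive_ext with (2 := H5). intros t. apply E.
Qed.

Lemma C_is_derive_Re (f : R -> C) x (l : C) :
  is_derive (V := CC) f x l -> is_derive (fun t => Re (f t)) x (Re l).
Proof.
intros H.
apply (filterdiff_comp (V := CC) (W := R_NormedModule) f Re (fun y => scal y (l : CC)) Re) in H.
- apply filterdiff_ext_lin with (1 := H). intros y. destruct l. reflexivity.
- apply filterdiff_linear. apply is_linear_fst.
Qed.

Lemma C_is_derive_Im (f : R -> C) x (l : C) :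
  is_derive (V := CC) f x l -> is_derive (fun t => Im (f t)) x (Im l).
Proof.
intros H.
apply (filterdiff_comp (V := CC) (W := R_NormedModule) f Im (fun y => scal y (l : CC)) Im) in H.
- apply filterdiff_ext_lin with (1 := H). intros y. destruct l. reflexivity.
- apply filterdiff_linear. apply is_linear_snd.
Qed.

Lemma is_derive_Cmult (f g : R -> C) x (df dg : C) :
  is_derive (V := CC) f x df -> is_derive (V := CC) g x dg ->
  is_derive (V := CC) (fun t => (f t * g t)%C) x (df * g x + f x * dg)%C.
Proof.
intros Hf Hg.
assert (F1 := C_is_derive_Re _ _ _ Hf). assert (F2 := C_is_derive_Im _ _ _ Hf).
assert (G1 := C_is_derive_Re _ _ _ Hg). assert (G2 := C_is_derive_Im _ _ _ Hg).
apply C_is_derive.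
- replace (Re (df * g x + f x * dg)%C) with
   ((Re df * Re (g x) + Re (f x) * Re dg) - (Im df * Im (g x) + Im (f x) * Im dg)) by (simpl; unfold Re, Im; ring).
  exact (is_derive_minus (V := R_NormedModule) _ _ _ _ _ (is_derive_Rmult _ _ _ _ _ F1 G1) (is_derive_Rmult _ _ _ _ _ F2 G2)).
- replace (Im (df * g x + f x * dg)%C) with
   ((Re df * Im (g x) + Re (f x) * Im dg) + (Im df * Re (g x) + Im (f x) * Re dg)) by (simpl; unfold Re, Im; ring).
  exact (is_derive_plus (V := R_NormedModule) _ _ _ _ _ (is_derive_Rmult _ _ _ _ _ F1 G2) (is_derive_Rmult _ _ _ _ _ F2 G1)).
Qed.

Lemma is_derive_Cplus (f g : R -> C) x (df dg : C) :
  is_derive (V := CC) f x df -> is_derive (V := CC) g x dg ->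
  is_derive (V := CC) (fun t => (f t + g t)%C) x (df + dg)%C.
Proof. exact (is_derive_plus (V := CC) f g x df dg). Qed.

Lemma is_derive_Cminus (f g : R -> C) x (df dg : C) :
  is_derive (V := CC) f x df -> is_derive (V := CC) g x dg ->
  is_derive (V := CC) (fun t => (f t - g t)%C) x (df - dg)%C.
Proof. exact (is_derive_minus (V := CC) f g x df dg). Qed.

Lemma is_derive_Cconst (c : C) x : is_derive (V := CC) (fun _ : R => c) x (RtoC 0).
Proof. exact (is_derive_const (V := CC) c x). Qed.

Lemma is_derive_Cscal (c : C) (g : R -> C) x (dg : C) :
  is_derive (V := CC) g x dg -> is_derive (V := CC) (fun t => (c * g t)%C) x (c * dg)%C.
Proof.
intros Hg. assert (H := is_derive_Cmult _ _ _ _ _ (is_derive_Cconst c x) Hg).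
replace (c * dg)%C with (RtoC 0 * g x + c * dg)%C by ring. exact H.
Qed.

Lemma is_derive_cexp (z : R -> C) x (l : C) :
  is_derive (V := CC) z x l -> is_derive (V := CC) (fun t => cexp (z t)) x (l * cexp (z x))%C.
Proof.
intros H. assert (H1 := C_is_derive_Re _ _ _ H). assert (H2 := C_is_derive_Im _ _ _ H).
assert (E1 : is_derive (fun t => exp (Re (z t))) x (Re l * exp (Re (z x)))).
{ apply (is_derive_comp (V := R_NormedModule) exp (fun t => Re (z t))); auto. apply is_derive_exp. }
assert (E2 : is_derive (fun t => cos (Im (z t))) x (Im l * - sin (Im (z x)))).
{ apply (is_derive_comp (V := R_NormedModule) cos (fun t => Im (z t))); auto. apply is_derive_cos. }
assert (E3 : is_derive (fun t => sin (Im (z t))) x (Im l * cos (Im (z x)))).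
{ apply (is_derive_comp (V := R_NormedModule) sin (fun t => Im (z t))); auto. apply is_derive_sin. }
apply C_is_derive.
- replace (Re (l * cexp (z x))%C) with
    (Re l * exp (Re (z x)) * cos (Im (z x)) + exp (Re (z x)) * (Im l * - sin (Im (z x)))) by (simpl; unfold Re, Im; ring).
  exact (is_derive_Rmult _ _ _ _ _ E1 E2).
- replace (Im (l * cexp (z x))%C) with
    (Re l * exp (Re (z x)) * sin (Im (z x)) + exp (Re (z x)) * (Im l * cos (Im (z x)))) by (simpl; unfold Re, Im; ring).
  exact (is_derive_Rmult _ _ _ _ _ E1 E3).
Qed.

Lemma C_continuous {T : UniformSpace} (f : T -> C) x :
  continuous (fun t => Re (f t)) x -> continuous (fun t => Im (f t)) x ->
  continuous (U := CC) f x.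
Proof.
intros H1 H2 P [e He].
assert (HL1 := H1 (fun u => ball (Re (f x)) e u) (locally_ball _ e)).
assert (HL2 := H2 (fun u => ball (Im (f x)) e u) (locally_ball _ e)).
unfold filtermap in *. generalize (filter_and _ _ HL1 HL2).
apply filter_imp. intros t [A B]. apply He. split; [exact A|exact B].
Qed.

Lemma C_continuous_Re {T : UniformSpace} (f : T -> C) x :
  continuous (U := CC) f x -> continuous (fun t => Re (f t)) x.
Proof.
intros H. apply (continuous_comp f (fun z : R * R => fst z) x H).
destruct (f x) as [a b]. apply continuous_fst.
Qed.

Lemma C_continuous_Im {T : UniformSpace} (f : T -> C) x :
  continuous (U := CC) f x -> continuous (fun t => Im (f t)) x.
Proof.
intros H. apply (continuous_comp f (fun z : R * R => snd z) x H).
destruct (f x) as [a b]. apply continuous_snd.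
Qed.

Lemma continuous_Rmult {T : UniformSpace} (f g : T -> R) x :
  continuous f x -> continuous g x -> continuous (fun t => f t * g t) x.
Proof. intros Hf Hg. exact (continuous_mult (K := R_AbsRing) f g x Hf Hg). Qed.

Lemma continuous_Rplus {T : UniformSpace} (f g : T -> R) x :
  continuous f x -> continuous g x -> continuous (fun t => f t + g t) x.
Proof. intros Hf Hg. exact (continuous_plus (V := R_NormedModule) f g x Hf Hg). Qed.

Lemma continuous_Rminus {T : UniformSpace} (f g : T -> R) x :
  continuous f x -> continuous g x -> continuous (fun t => f t - g t) x.
Proof. intros Hf Hg. exact (continuous_minus (V := R_NormedModule) f g x Hf Hg). Qed.

Lemma continuous_Ropp {T : UniformSpace} (f : T -> R) x :
  continuous f x -> continuous (fun t => - f t) x.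
Proof. intros Hf. exact (continuous_opp (V := R_NormedModule) f x Hf). Qed.

Lemma continuous_Rcomp {T : UniformSpace} (g : R -> R) (f : T -> R) x :
  ex_derive g (f x) -> continuous f x -> continuous (fun t => g (f t)) x.
Proof. intros Hg Hf. apply (continuous_comp f g); auto. now apply deriv_cont. Qed.

Lemma continuous_exp' {T : UniformSpace} (f : T -> R) x :
  continuous f x -> continuous (fun t => exp (f t)) x.
Proof. apply (continuous_Rcomp exp). auto_derive. auto. Qed.

Lemma continuous_ln' {T : UniformSpace} (f : T -> R) x :
  0 < f x -> continuous f x -> continuous (fun t => ln (f t)) x.
Proof. intros H. apply (continuous_Rcomp ln). auto_derive. auto. Qed.

Lemma continuous_Rpower' {T : UniformSpace} (f : T -> R) y x :
  0 < f x -> continuous f x -> continuous (fun t => Rpower (f t) y) x.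
Proof. intros H. apply (continuous_Rcomp (fun z => Rpower z y)). unfold Rpower. auto_derive. auto. Qed.

Lemma continuous_Cmult {T : UniformSpace} (f g : T -> C) x :
  continuous (U := CC) f x -> continuous (U := CC) g x -> continuous (U := CC) (fun t => (f t * g t)%C) x.
Proof.
intros Hf Hg.
assert (F1 := C_continuous_Re _ _ Hf). assert (F2 := C_continuous_Im _ _ Hf).
assert (G1 := C_continuous_Re _ _ Hg). assert (G2 := C_continuous_Im _ _ Hg).
apply C_continuous.
- exact (continuous_Rminus _ _ _ (continuous_Rmult _ _ _ F1 G1) (continuous_Rmult _ _ _ F2 G2)).
- exact (continuous_Rplus _ _ _ (continuous_Rmult _ _ _ F1 G2) (continuous_Rmult _ _ _ F2 G1)).
Qed.

Lemma continuous_Cplus {T : UniformSpace} (f g : T -> C) x :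
  continuous (U := CC) f x -> continuous (U := CC) g x -> continuous (U := CC) (fun t => (f t + g t)%C) x.
Proof. intros Hf Hg. exact (continuous_plus (V := CC) f g x Hf Hg). Qed.

Lemma continuous_Cminus {T : UniformSpace} (f g : T -> C) x :
  continuous (U := CC) f x -> continuous (U := CC) g x -> continuous (U := CC) (fun t => (f t - g t)%C) x.
Proof. intros Hf Hg. exact (continuous_minus (V := CC) f g x Hf Hg). Qed.

Lemma continuous_Copp {T : UniformSpace} (f : T -> C) x :
  continuous (U := CC) f x -> continuous (U := CC) (fun t => (- f t)%C) x.
Proof. intros Hf. exact (continuous_opp (V := CC) f x Hf). Qed.

Lemma continuous_Cconst {T : UniformSpace} (c : C) (x : T) :
  continuous (U := CC) (fun _ => c) x.
Proof. apply continuous_const. Qed.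

Lemma continuous_RtoC {T : UniformSpace} (f : T -> R) x :
  continuous f x -> continuous (U := CC) (fun t => RtoC (f t)) x.
Proof. intros H. apply C_continuous; [exact H|apply continuous_const]. Qed.

Lemma continuous_cexp {T : UniformSpace} (f : T -> C) x :
  continuous (U := CC) f x -> continuous (U := CC) (fun t => cexp (f t)) x.
Proof.
intros H. assert (F1 := C_continuous_Re _ _ H). assert (F2 := C_continuous_Im _ _ H).
apply C_continuous; (apply continuous_Rmult; [now apply continuous_exp'|]).
- apply (continuous_Rcomp cos); auto. auto_derive. auto.
- apply (continuous_Rcomp sin); auto. auto_derive. auto.
Qed.

(** * The complex exponential *)

Lemma cexp_plus z w : cexp (z + w)%C = (cexp z * cexp w)%C.
Proof.
destruct z as [a b]. destruct w as [c d]. unfold cexp, Cplus, Cmult, Re, Im; simpl.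
rewrite exp_plus, cos_plus, sin_plus. f_equal; ring.
Qed.

Lemma cexp_RtoC x : cexp (RtoC x) = RtoC (exp x).
Proof. unfold cexp, RtoC, Re, Im; simpl. rewrite cos_0, sin_0. f_equal; ring. Qed.

Lemma Cmod_cexp z : Cmod (cexp z) = exp (Re z).
Proof.
unfold Cmod, cexp; simpl.
replace (exp (Re z) * cos (Im z) * (exp (Re z) * cos (Im z) * 1) +
   exp (Re z) * sin (Im z) * (exp (Re z) * sin (Im z) * 1))
  with ((exp (Re z))² * ((sin (Im z))² + (cos (Im z))²)) by (unfold Rsqr; ring).
rewrite sin2_cos2, Rmult_1_r. apply sqrt_Rsqr. left. apply exp_pos.
Qed.

Lemma norm_CC (z : C) : norm (z : CC) = Cmod z.
Proof. symmetry. apply Cmod_norm. Qed.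

(** The integrands of all contour integrals below, in the logarithmic variable
    z = log u; in terms of u this is u^nu exp(t u - s u^al). *)
Definition fz (nu t s al : R) (z : C) : C :=
  cexp (RtoC nu * z + RtoC t * cexp z - RtoC s * cexp (RtoC al * z))%C.

Definition dfz (nu t s al : R) (z : C) : C :=
  ((RtoC nu + RtoC t * cexp z - RtoC (s * al) * cexp (RtoC al * z)) * fz nu t s al z)%C.

Lemma is_derive_fz nu t s al (z : R -> C) x (l : C) :
  is_derive (V := CC) z x l ->
  is_derive (V := CC) (fun y => fz nu t s al (z y)) x (l * dfz nu t s al (z x))%C.
Proof.
intros H. unfold fz, dfz.
replace (l * _)%C with ((RtoC nu * l + RtoC t * (l * cexp (z x)) - RtoC s * (RtoC al * l * cexp (RtoC al * z x))) *
  fz nu t s al (z x))%C.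
2:{ unfold fz. rewrite (RtoC_mult s al). ring. }
apply is_derive_cexp. apply is_derive_Cminus; [apply is_derive_Cplus|].
- now apply is_derive_Cscal.
- apply is_derive_Cscal. now apply is_derive_cexp.
- apply is_derive_Cscal. apply is_derive_cexp. now apply is_derive_Cscal.
Qed.

Ltac ccont :=
  repeat match goal with
  | |- @continuous ?T _ (fun _ => ?c) ?x => exact (@continuous_Cconst T c x)
  | |- @continuous ?T _ (fun t => Cplus (@?a t) (@?b t)) ?x => apply (@continuous_Cplus T a b x)
  | |- @continuous ?T _ (fun t => Cminus (@?a t) (@?b t)) ?x => apply (@continuous_Cminus T a b x)
  | |- @continuous ?T _ (fun t => Cmult (@?a t) (@?b t)) ?x => apply (@continuous_Cmult T a b x)
  | |- @continuous ?T _ (fun t => Copp (@?a t)) ?x => apply (@continuous_Copp T a x)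
  | |- @continuous ?T _ (fun t => cexp (@?a t)) ?x => apply (@continuous_cexp T a x)
  | |- @continuous ?T _ (fun t => RtoC (@?a t)) ?x => apply (@continuous_RtoC T a x)
  end; try assumption.

Lemma continuous_fz {T : UniformSpace} nu t s al (f : T -> C) x :
  continuous (U := CC) f x -> continuous (U := CC) (fun y => fz nu t s al (f y)) x.
Proof.
intros H. unfold fz. ccont.
Qed.

Lemma continuous_dfz {T : UniformSpace} nu t s al (f : T -> C) x :
  continuous (U := CC) f x -> continuous (U := CC) (fun y => dfz nu t s al (f y)) x.
Proof.
intros H. unfold dfz, fz. ccont.
Qed.

Lemma fz_shift nu m t s al z : (fz nu t s al z * cexp (RtoC m * z))%C = fz (nu + m) t s al z.
Proof.
unfold fz. rewrite <- cexp_plus. f_equal. rewrite RtoC_plus. ring.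
Qed.

Lemma Cmod_fz_polar nu t s al r phi : 0 < r ->
  Cmod (fz nu t s al (ln r, phi)) =
  Rpower r nu * exp (t * (r * cos phi) - s * (Rpower r al * cos (al * phi))).
Proof.
intros Hr. unfold fz. rewrite Cmod_cexp. unfold Rpower. rewrite <- exp_plus. f_equal.
unfold cexp; simpl.
replace (al * ln r - 0 * phi) with (al * ln r) by ring.
replace (al * phi + 0 * ln r) with (al * phi) by ring.
unfold Re, Im; simpl.
replace (al * ln r - 0 * phi) with (al * ln r) by ring.
replace (al * phi + 0 * ln r) with (al * phi) by ring.
rewrite exp_ln by auto. ring.
Qed.

Lemma small_pow_0 C a eps : 0 < a -> 0 < eps ->
  lo 0 (fun r => 0 < r <= 1 /\ C * Rpower r a <= eps).
Proof.
intros Ha He.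
set (e := eps / (Rabs C + 1)).
assert (HC : 0 < Rabs C + 1) by (generalize (Rabs_pos C); lra).
assert (Hee : 0 < e) by now apply Rdiv_lt_0_compat.
assert (Hi : inn 0 1 (Rmin (1 / 2) (Rpower e (/ a)))).
{ split; simpl.
  - apply Rmin_glb_lt; [lra|apply Rpower_pos].
  - apply Rle_lt_trans with (1 := Rmin_l _ _). lra. }
generalize (lo_inn 0 1 _ Hi). apply filter_imp.
intros r [[H0 H1] H2]. simpl in *. split; [lra|].
assert (H3 : r <= Rpower e (/ a)) by (apply Rle_trans with (1 := H2); apply Rmin_r).
assert (H4 : Rpower r a <= e).
{ apply Rle_trans with (Rpower (Rpower e (/ a)) a); [apply Rle_Rpower_l; lra|].
  rewrite Rpower_mult, Rinv_l, Rpower_1 by lra. lra. }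
assert (Hp := Rpower_pos r a).
apply Rle_trans with ((Rabs C + 1) * e).
- apply Rle_trans with ((Rabs C + 1) * Rpower r a).
  + apply Rmult_le_compat_r; [lra|]. generalize (Rle_abs C); lra.
  + apply Rmult_le_compat_l; lra.
- unfold e. right. field. lra.
Qed.

Lemma small_pow_oo C b eps : 0 < b -> 0 < eps ->
  hi p_infty (fun r => 1 <= r /\ C * Rpower r (- b) <= eps).
Proof.
intros Hb He.
set (e := eps / (Rabs C + 1)).
assert (HC : 0 < Rabs C + 1) by (generalize (Rabs_pos C); lra).
assert (Hee : 0 < e) by now apply Rdiv_lt_0_compat.
exists (Rmax 1 (Rpower e (- / b))). intros r Hr.
assert (H1 : 1 < r) by (apply Rle_lt_trans with (2 := Hr); apply Rmax_l).
assert (H2 : Rpower e (- / b) < r) by (apply Rle_lt_trans with (2 := Hr); apply Rmax_r).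
split; [lra|].
assert (H4 : Rpower r (- b) <= e).
{ replace e with (Rpower (Rpower e (- / b)) (- b)).
  - rewrite !(Rpower_Ropp _ b). apply Rinv_le_contravar; [apply Rpower_pos|].
    apply Rle_Rpower_l; [lra|]. split; [apply Rpower_pos|lra].
  - rewrite Rpower_mult. replace (- / b * - b) with 1 by (field; lra). now apply Rpower_1. }
assert (Hp := Rpower_pos r (- b)).
apply Rle_trans with ((Rabs C + 1) * e).
- apply Rle_trans with ((Rabs C + 1) * Rpower r (- b)).
  + apply Rmult_le_compat_r; [lra|]. generalize (Rle_abs C); lra.
  + apply Rmult_le_compat_l; lra.
- unfold e. right. field. lra.
Qed.

Lemma Gamma_pos x : 0 < x -> 0 < Gamma x.
Proof.
intros Hx.
assert (HI : Intg 0 p_infty (fun t => Rpower t (x - 1) * exp (- (1 * t)))) by (apply Intg_gamma; lra).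
assert (E : Gamma x = II (V := RC) 0 p_infty (fun t => Rpower t (x - 1) * exp (- (1 * t)))).
{ rewrite <- (II_unique (V := RC) _ _ _ _ (Gamma_correct x Hx)). symmetry.
  apply (II_unique (V := RC)).
  apply (is_RInt_gen_ext_inn (V := RC) 0 p_infty (fun t => Rpower t (x - 1) * exp (- t))); simpl; auto.
  - intros t _. now rewrite Rmult_1_l.
  - rewrite (II_unique (V := RC) _ _ _ _ (Gamma_correct x Hx)). now apply Gamma_correct. }
rewrite E.
apply Rlt_le_trans with (RInt (fun t => Rpower t (x - 1) * exp (- (1 * t))) 1 2).
- apply RInt_gt_0; [lra| |].
  + intros t Ht. apply Rmult_lt_0_compat; [apply Rpower_pos|apply exp_pos].
  + intros t Ht. apply deriv_cont. unfold Rpower. auto_derive. lra.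
- apply Intg_RInt_le_II; auto; try (split; simpl; auto; lra). lra.
Qed.

Lemma Rinv_cancel_l (g x : R) : g <> 0 -> g * (/ g * x) = x.
Proof. intros. field. auto. Qed.

Lemma Rinv_cancel_r (g x : R) : g <> 0 -> / g * (g * x) = x.
Proof. intros. field. auto. Qed.

Lemma is_RInt_gen_zero {V : RNM} a b : Rbar_lt a b ->
  is_RInt_gen (fun _ => zero : V) (lo a) (hi b) zero.
Proof.
intros Hab. apply is_RInt_gen_of_lim; auto.
- intros; apply continuous_const.
- apply (filterlim_ext (fun _ => zero)).
  + intros [u v]. simpl. rewrite (RInt_const (V := V)). symmetry. exact (scal_zeroV (V := V) (v - u)).
  + apply filterlim_const.
Qed.

Lemma is_RInt_gen_ftc {V : RNM} a b (f H : R -> V) la lb : Rbar_lt a b ->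
  (forall x, inn a b x -> continuous f x /\ is_derive H x (f x)) ->
  filterlim H (lo a) (locally la) -> filterlim H (hi b) (locally lb) ->
  is_RInt_gen f (lo a) (hi b) (minus lb la).
Proof.
intros Hab Hf Hla Hlb.
assert (E : plus (minus lb la) zero = minus lb la) by exact (plus_zero_r (minus lb la)).
rewrite <- E.
apply (is_RInt_gen_parts a b f (fun _ => zero) H); auto.
- intros x Hx. now apply Hf.
- intros x y Hx Hy Hxy.
  rewrite (RInt_const (V := V)).
  transitivity (minus (H y) (H x)).
  + apply is_RInt_unique. apply (is_RInt_derive H f); rewrite Rmin_left, Rmax_right by lra; intros z Hz;
    apply Hf; now apply inn_between with x y.
  + symmetry. refine (eq_trans (f_equal (plus (minus (H y) (H x))) (scal_zeroV (y - x))) _).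
    exact (plus_zero_r (minus (H y) (H x))).
- now apply is_RInt_gen_zero.
Qed.

Lemma lo_filterlim_cont {V : UniformSpace} (f : R -> V) (x : R) l :
  continuous f x -> f x = l -> filterlim f (lo x) (locally l).
Proof.
intros H <-. apply filterlim_filter_le_1 with (2 := H). apply filter_le_within.
Qed.

Lemma exp_small_oo k eps : 0 < k -> 0 < eps -> hi p_infty (fun x => 0 < x /\ exp (- (k * x)) <= eps).
Proof.
intros Hk He.
destruct (Rpower_le_exp 1 k) as [C [HC HCx]]; try lra.
generalize (small_pow_oo C 1 eps Rlt_0_1 He). apply filter_imp. intros r [Hr Hr2].
assert (Hr0 : 0 < r) by lra. split; auto.
generalize (HCx r Hr0). rewrite Rpower_1 by auto. intros H.
apply Rle_trans with (2 := Hr2). rewrite Rpower_Ropp, Rpower_1 by auto.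
apply Rmult_le_reg_r with r; auto. replace (C * / r * r) with C by (field; lra).
apply Rmult_le_reg_r with (exp (k * r)); [apply exp_pos|].
replace (exp (- (k * r)) * r * exp (k * r)) with (r * (exp (- (k * r)) * exp (k * r))) by ring.
rewrite <- exp_plus, Rplus_opp_l, exp_0, Rmult_1_r. exact H.
Qed.

Lemma exp_le_Rpower m k : 0 < m -> 0 < k -> exists C, 0 < C /\ forall x, 0 < x ->
  exp (- (k * x)) <= C * Rpower x (- m).
Proof.
intros Hm Hk. destruct (Rpower_le_exp m k Hm Hk) as [C [HC HCx]].
exists C. split; auto. intros x Hx. rewrite exp_Ropp, Rpower_Ropp.
assert (He := exp_pos (k * x)). assert (Hp := Rpower_pos x m).
apply Rmult_le_reg_r with (exp (k * x)); auto. rewrite Rinv_l by lra.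
apply Rmult_le_reg_r with (Rpower x m); auto.
replace (C * / Rpower x m * exp (k * x) * Rpower x m) with (C * exp (k * x)) by (field; lra).
rewrite Rmult_1_l. auto.
Qed.

(** Integrate x^(a+b-1) u^(b-1) e^(-x(1+u)) in both orders. *)
Lemma Beta_integral a b : 0 < a -> 0 < b ->
  is_RInt_gen (V := RC) (fun u => Rpower u (b - 1) * Rpower (1 + u) (- (a + b))) (lo 0) (hi p_infty)
    (Gamma a * Gamma b / Gamma (a + b)).
Proof.
intros Ha Hb.
set (f := fun x u => Rpower x (a + b - 1) * Rpower u (b - 1) * exp (- (x * (1 + u)))).
(* m < a + b for integrability in x at 0, b < m for that in u at infinity *)
set (m := b + a / 2).
destruct (exp_le_Rpower m (1 / 2)) as [C [HC HCx]]; [unfold m; lra|lra|].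
set (p := fun x => C * (Rpower x (a / 2 - 1) * exp (- (1 / 2 * x)))).
set (q := fun u => Rpower u (b - 1) * Rpower (1 + u) (- m)).
assert (Hp : Intg 0 p_infty p) by (apply Intg_scal; [lra|apply Intg_gamma; lra]).
assert (Hq : Intg 0 p_infty q).
{ apply Intg_powers with 1 b (a / 2); try lra.
  - intros u Hu. split.
    + apply deriv_cont. unfold q, Rpower. auto_derive. lra.
    + apply Rmult_le_pos; left; apply Rpower_pos.
  - intros u Hu. unfold q. rewrite Rmult_1_l.
    apply Rle_trans with (Rpower u (b - 1) * 1); [|lra].
    apply Rmult_le_compat_l; [left; apply Rpower_pos|].
    rewrite Rpower_Ropp. apply Rle_trans with (/ 1); [|lra]. apply Rinv_le_contravar; [lra|].
    apply Rle_trans with (Rpower 1 m); [rewrite Rpower_1_l; lra|]. apply Rle_Rpower_l; unfold m; lra.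
  - intros u Hu. unfold q. rewrite Rmult_1_l.
    replace (- 1 - a / 2) with ((b - 1) + - m) by (unfold m; ring). rewrite Rpower_plus.
    apply Rmult_le_compat_l; [left; apply Rpower_pos|].
    rewrite !Rpower_Ropp. apply Rinv_le_contravar; [apply Rpower_pos|].
    apply Rle_Rpower_l; unfold m; lra. }
destruct (fubini (V := RC) 0 p_infty 0 p_infty f p q Hp Hq) as [_ [D2 E]].
{ intros x u [Hx _] [Hu _]. simpl in Hx, Hu. split.
  - unfold jcont, f. apply continuous_Rmult; [apply continuous_Rmult|].
    + apply (continuous_Rpower' (fun p : R * R => fst p)); [exact Hx|apply continuous_fst].
    + apply (continuous_Rpower' (fun p : R * R => snd p)); [exact Hu|apply continuous_snd].
    + apply continuous_exp'. apply continuous_Ropp. apply continuous_Rmult; [apply continuous_fst|].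
      apply continuous_Rplus; [apply continuous_const|apply continuous_snd].
  - unfold norm; simpl; unfold abs; simpl.
    rewrite Rabs_pos_eq by (repeat apply Rmult_le_pos; left; apply exp_pos).
    assert (Hxu : 0 < x * (1 + u)) by (apply Rmult_lt_0_compat; lra).
    unfold f, p, q.
    replace (C * (Rpower x (a / 2 - 1) * exp (- (1 / 2 * x))) * (Rpower u (b - 1) * Rpower (1 + u) (- m)))
      with (Rpower x (a + b - 1) * Rpower u (b - 1) * (C * Rpower (x * (1 + u)) (- m) * exp (- (1 / 2 * x)))).
    2:{ rewrite <- (Rpower_mult_distr x (1 + u) (- m)) by lra.
        replace (Rpower x (a / 2 - 1)) with (Rpower x (a + b - 1) * Rpower x (- m)).
        - ring.
        - rewrite <- Rpower_plus. f_equal. unfold m. field. }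
    apply Rmult_le_compat_l; [apply Rmult_le_pos; left; apply Rpower_pos|].
    replace (exp (- (x * (1 + u)))) with (exp (- (1 / 2 * (x * (1 + u)))) * exp (- (1 / 2 * (x * (1 + u))))).
    2:{ rewrite <- exp_plus. f_equal. field. }
    apply Rmult_le_compat; try (left; apply exp_pos); auto.
    apply exp_le. apply Ropp_le_contravar. apply Rmult_le_compat_l; [lra|]. nra. }
assert (Ex : forall x, 0 < x -> II (V := RC) 0 p_infty (f x) = Gamma b * (Rpower x (a - 1) * exp (- x))).
{ intros x Hx. apply (II_unique (V := RC)).
  assert (H := is_RInt_gen_scal (V := RC) _ (Rpower x (a + b - 1) * exp (- x)) _ (Gamma_scale b x Hb Hx)).
  replace (Gamma b * (Rpower x (a - 1) * exp (- x))) with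
    (scal (Rpower x (a + b - 1) * exp (- x)) (Rpower x (- b) * Gamma b : RC)).
  - revert H. apply (is_RInt_gen_ext_inn (V := RC)); [simpl; auto|]. intros u _.
    unfold f, scal; simpl; unfold mult; simpl.
    replace (- (x * (1 + u))) with (- x + - (x * u)) by ring. rewrite exp_plus.
    generalize (Rpower x (a + b - 1)) (exp (- x)) (exp (- (x * u))) (Rpower u (b - 1)).
    intros r1 r2 r3 r4. change (r1 * r2 * (r4 * r3) = r1 * r4 * (r2 * r3)). ring.
  - unfold scal; simpl; unfold mult; simpl.
    replace (Rpower x (a - 1)) with (Rpower x (a + b - 1) * Rpower x (- b)); [ring|].
    rewrite <- Rpower_plus. f_equal. ring. }
assert (EV : II (V := RC) 0 p_infty (fun x => II (V := RC) 0 p_infty (f x)) = Gamma b * Gamma a).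
{ apply (II_unique (V := RC)).
  generalize (is_RInt_gen_scal (V := RC) _ (Gamma b) _ (Gamma_correct a Ha)).
  apply (is_RInt_gen_ext_inn (V := RC)); [simpl; auto|]. intros x [Hx _]. symmetry. now apply Ex. }
assert (D := dominated_correct (V := RC) _ _ _ _ D2). rewrite <- E, EV in D.
assert (HG := Gamma_pos (a + b) ltac:(lra)).
apply (is_RInt_gen_scal (V := RC) _ (/ Gamma (a + b))) in D.
replace (Gamma a * Gamma b / Gamma (a + b)) with (/ Gamma (a + b) * (Gamma b * Gamma a)) by (field; lra).
revert D. apply (is_RInt_gen_ext_inn (V := RC)); [simpl; auto|]. intros u [Hu _]. simpl in Hu.
assert (EE : II (V := RC) 0 p_infty (fun x => f x u) = Gamma (a + b) * (Rpower u (b - 1) * Rpower (1 + u) (- (a + b)))).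
{ apply (II_unique (V := RC)).
  assert (Hab : 0 < a + b) by lra. assert (Hu1 : 0 < 1 + u) by lra.
  assert (H := is_RInt_gen_scal (V := RC) _ (Rpower u (b - 1)) _ (Gamma_scale (a + b) (1 + u) Hab Hu1)).
  replace (Gamma (a + b) * (Rpower u (b - 1) * Rpower (1 + u) (- (a + b)))) with
    (scal (Rpower u (b - 1)) (Rpower (1 + u) (- (a + b)) * Gamma (a + b) : RC)).
  - revert H. apply (is_RInt_gen_ext_inn (V := RC)); [simpl; auto|]. intros x _.
    unfold f, scal; simpl; unfold mult; simpl.
    replace (- (x * (1 + u))) with (- ((1 + u) * x)) by ring.
    generalize (Rpower x (a + b - 1)) (exp (- ((1 + u) * x))) (Rpower u (b - 1)).
    intros r1 r2 r3. change (r3 * (r1 * r2) = r1 * r3 * r2). ring.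
  - unfold scal; simpl; unfold mult; simpl. ring. }
refine (eq_trans (f_equal (scal (/ Gamma (a + b))) EE) _).
apply Rinv_cancel_r. lra.
Qed.

Lemma Gamma_1 : Gamma 1 = 1.
Proof.
rewrite <- (II_unique (V := RC) _ _ _ _ (Gamma_correct 1 Rlt_0_1)).
transitivity (minus 0 (- (1)) : R); [|unfold minus, plus, opp; simpl; ring]. apply (II_unique (V := RC)).
apply (is_RInt_gen_ftc (V := RC) 0 p_infty (fun t => Rpower t (1 - 1) * exp (- t)) (fun t => - exp (- t))); [simpl; auto| | |].
- intros t [Ht _]. simpl in Ht. split; [apply deriv_cont; unfold Rpower; auto_derive; auto|].
  replace (1 - 1) with 0 by ring. rewrite Rpower_O by auto. auto_derive; auto. ring.
- apply lo_filterlim_cont; [apply deriv_cont; auto_derive; auto|]. now rewrite Ropp_0, exp_0.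
- apply (filterlim_eps (V := RC)); [apply _|]. intros eps He.
  generalize (exp_small_oo 1 eps Rlt_0_1 He). apply filter_imp. intros r [Hr Hr2].
  unfold minus, plus, opp, norm, abs; simpl. rewrite Ropp_0, Rplus_0_r, Rabs_Ropp.
  rewrite Rabs_pos_eq by (left; apply exp_pos). now rewrite Rmult_1_l in Hr2.
Qed.

(** The Beta integral with parameters x and 1 is elementary. *)
Lemma Gamma_S x : 0 < x -> Gamma (x + 1) = x * Gamma x.
Proof.
intros Hx. assert (H1 := Gamma_pos x Hx). assert (H2 : 0 < Gamma (x + 1)) by (apply Gamma_pos; lra).
assert (H := II_unique (V := RC) _ _ _ _ (Beta_integral x 1 Hx Rlt_0_1)).
assert (E : II (V := RC) 0 p_infty (fun u => Rpower u (1 - 1) * Rpower (1 + u) (- (x + 1))) = minus 0 (- / x)).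
{ apply (II_unique (V := RC)).
  apply (is_RInt_gen_ftc (V := RC) 0 p_infty _ (fun u => - / x * Rpower (1 + u) (- x))); [simpl; auto| | |].
  - intros u [Hu _]. simpl in Hu. split; [apply deriv_cont; unfold Rpower; auto_derive; lra|].
    replace (1 - 1) with 0 by ring. rewrite Rpower_O by auto.
    replace (1 * Rpower (1 + u) (- (x + 1))) with (- / x * (- x * Rpower (1 + u) (- x - 1))).
    + apply is_derive_scal.
      assert (D := is_derive_comp (V := R_NormedModule) (fun z => Rpower z (- x)) (fun u => 1 + u) u _ 1 (is_derive_Rpower (1 + u) (- x) ltac:(lra))).
      assert (D1 : is_derive (fun u : R => 1 + u) u 1) by (auto_derive; auto; ring).
      apply D in D1. revert D1. unfold scal; simpl; unfold mult; simpl. now rewrite Rmult_1_l.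
    + replace (- (x + 1)) with (- x - 1) by ring. field. lra.
  - apply lo_filterlim_cont; [apply deriv_cont; unfold Rpower; auto_derive; lra|].
    rewrite Rplus_0_r, Rpower_1_l. apply Rmult_1_r.
  - apply (filterlim_eps (V := RC)); [apply _|]. intros eps He.
    generalize (small_pow_oo (/ x) x eps Hx He). apply filter_imp. intros r [Hr Hr2].
    unfold minus, plus, opp, norm, abs; simpl. rewrite Ropp_0, Rplus_0_r, <- Ropp_mult_distr_l, Rabs_Ropp.
    assert (Hix : 0 < / x) by now apply Rinv_0_lt_compat.
    rewrite Rabs_pos_eq by (apply Rmult_le_pos; [lra|left; apply Rpower_pos]).
    apply Rle_trans with (2 := Hr2). apply Rmult_le_compat_l; [lra|].
    rewrite !Rpower_Ropp. apply Rinv_le_contravar; [apply Rpower_pos|]. apply Rle_Rpower_l; lra. }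
rewrite E, Gamma_1 in H. unfold minus, plus, opp in H; simpl in H.
replace (0 + - - / x) with (/ x) in H by ring.
transitivity (x * (/ x * Gamma (x + 1))); [field; lra|]. rewrite H. field. lra.
Qed.

(** * Linear images of integrals *)

(** Riemann sums commute with linear maps. *)
Lemma is_RInt_linear {V W : RNM} (phi : V -> W) (f : R -> V) x y l :
  (forall u v, phi (plus u v) = plus (phi u) (phi v)) ->
  (forall (k : R) u, phi (scal k u) = scal k (phi u)) -> continuous phi l ->
  is_RInt f x y l -> is_RInt (fun s => phi (f s)) x y (phi l).
Proof.
intros Hp Hs Hc Hf.
assert (Hz : phi zero = zero).
{ transitivity (phi (scal 0 zero)); [f_equal; symmetry; exact (scal_zeroV 0)|].
  rewrite Hs. exact (scal_zero_l (phi zero)). }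
assert (HR : forall s, Riemann_sum (fun s => phi (f s)) s = phi (Riemann_sum f s)).
{ intros s. apply SF_cons_ind with (s := s); [intros x0; symmetry; exact Hz|].
  intros h0 s0 IH. rewrite !Riemann_sum_cons, IH, Hp, Hs. reflexivity. }
apply (filterlim_ext (fun ptd => phi (scal (sign (y - x)) (Riemann_sum f ptd)))).
{ intros ptd. now rewrite Hs, HR. }
exact (filterlim_comp _ _ _ _ phi _ _ _ Hf Hc).
Qed.

Lemma is_RInt_gen_linear {V W : RNM} (phi : V -> W) a b (f : R -> V) l :
  (forall u v, phi (plus u v) = plus (phi u) (phi v)) ->
  (forall (k : R) u, phi (scal k u) = scal k (phi u)) -> (forall u, continuous phi u) ->
  is_RInt_gen f (lo a) (hi b) l -> is_RInt_gen (fun s => phi (f s)) (lo a) (hi b) (phi l).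
Proof.
intros Hp Hs Hc Hf P HP.
generalize (Hf (fun l => P (phi l)) (Hc l P HP)). unfold filtermapi. apply filter_imp.
intros [x y] [v [Hv HPv]]. exists (phi v). split; [now apply is_RInt_linear|exact HPv].
Qed.

Lemma is_RInt_gen_Re a b (f : R -> C) (v : C) :
  is_RInt_gen (V := CC) f (lo a) (hi b) v ->
  is_RInt_gen (V := RC) (fun t => Re (f t)) (lo a) (hi b) (Re v).
Proof.
apply (is_RInt_gen_linear (V := CC) (W := RC) Re).
- intros u v0. reflexivity.
- intros k u. reflexivity.
- intros u. apply C_continuous_Re. apply continuous_id.
Qed.

Lemma is_RInt_gen_Im a b (f : R -> C) (v : C) :
  is_RInt_gen (V := CC) f (lo a) (hi b) v ->
  is_RInt_gen (V := RC) (fun t => Im (f t)) (lo a) (hi b) (Im v).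
Proof.
apply (is_RInt_gen_linear (V := CC) (W := RC) Im).
- intros u v0. reflexivity.
- intros k u. reflexivity.
- intros u. apply C_continuous_Im. apply continuous_id.
Qed.

Lemma is_RInt_gen_Cmult a b (f : R -> C) (v c : C) :
  is_RInt_gen (V := CC) f (lo a) (hi b) v ->
  is_RInt_gen (V := CC) (fun t => (c * f t)%C) (lo a) (hi b) (c * v)%C.
Proof.
apply (is_RInt_gen_linear (V := CC) (W := CC) (fun z => (c * z)%C)).
- exact (Cmult_plus_distr_l c).
- intros k [u1 u2]. destruct c as [c1 c2]. change (@eq C (c1 * (k * u1) - c2 * (k * u2), c1 * (k * u2) + c2 * (k * u1))%R (k * (c1 * u1 - c2 * u2), k * (c1 * u2 + c2 * u1))%R).
  f_equal; ring.
- intros u. apply (@continuous_Cmult CC); [apply continuous_const|apply continuous_id].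
Qed.

Lemma is_RInt_gen_RtoC a b (f : R -> R) v :
  is_RInt_gen (V := RC) f (lo a) (hi b) v ->
  is_RInt_gen (V := CC) (fun t => RtoC (f t)) (lo a) (hi b) (RtoC v).
Proof.
apply (is_RInt_gen_linear (V := RC) (W := CC) RtoC).
- exact RtoC_plus.
- intros k u. change (@eq C (RtoC (k * u)) (k * u, k * 0)). now rewrite Rmult_0_r.
- intros u. apply continuous_RtoC. apply continuous_id.
Qed.

(** * Rotation of rays *)

(** u^nu exp(t u - s u^al) du along the ray u = r e^(i phi). *)
Definition pol (nu t s al phi r : R) : C :=
  (RtoC (/ r) * fz (nu + 1) t s al (ln r, phi))%C.

Lemma Rpower_div x y : 0 < x -> / x * Rpower x (y + 1) = Rpower x y.
Proof.
intros H. rewrite Rpower_plus, Rpower_1 by auto. field. lra.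
Qed.

Lemma Cmod_pol nu t s al phi r : 0 < r ->
  Cmod (pol nu t s al phi r) =
  Rpower r nu * exp (t * (r * cos phi) - s * (Rpower r al * cos (al * phi))).
Proof.
intros Hr. unfold pol. rewrite Cmod_mult, Cmod_R, Cmod_fz_polar by auto.
rewrite Rabs_pos_eq by (left; now apply Rinv_0_lt_compat).
now rewrite <- Rmult_assoc, Rpower_div.
Qed.

Lemma jcont_polar r phi : 0 < r ->
  continuous (U := CC) (fun p : R * R => (ln (fst p), snd p)) (r, phi).
Proof.
intros Hr. apply C_continuous.
- apply (continuous_ln' (fun p : R * R => fst p)); [exact Hr|apply continuous_fst].
- apply continuous_snd.
Qed.

Lemma jcont_pol nu t s al r phi : 0 < r ->
  jcont (V := CC) (fun r phi => pol nu t s al phi r) r phi.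
Proof.
intros Hr. unfold jcont, pol. apply continuous_Cmult.
- apply continuous_RtoC. apply (continuous_Rcomp Rinv).
  + simpl. auto_derive. lra.
  + apply continuous_fst.
- apply (continuous_fz (nu + 1) t s al (fun p : R * R => (ln (fst p), snd p))).
  now apply jcont_polar.
Qed.

Lemma continuous_pol nu t s al phi r : 0 < r -> continuous (U := CC) (pol nu t s al phi) r.
Proof. intros Hr. exact (jcont_l (V := CC) _ _ _ (jcont_pol nu t s al r phi Hr)). Qed.

Lemma pol_dom nu t s al phi C a b : 0 < a -> 0 < b ->
  (forall r, 0 < r <= 1 -> Cmod (pol nu t s al phi r) <= C * Rpower r (a - 1)) ->
  (forall r, 1 <= r -> Cmod (pol nu t s al phi r) <= C * Rpower r (- 1 - b)) ->
  dominated (V := CC) 0 p_infty (pol nu t s al phi) (fun r => Cmod (pol nu t s al phi r)).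
Proof.
intros Ha Hb H0 H1.
assert (Hc : forall r, 0 < r -> continuous (U := CC) (pol nu t s al phi) r).
{ intros r Hr. now apply continuous_pol. }
split.
- apply Intg_powers with C a b; auto. intros r Hr. split; [|apply Cmod_ge_0].
  apply continuous_ext_loc with
    (fun r => Rpower r nu * exp (t * (r * cos phi) - s * (Rpower r al * cos (al * phi)))).
  + assert (Hi : inn 0 p_infty r) by (split; simpl; auto).
    generalize (locally_inn 0 p_infty r Hi). apply filter_imp. intros z [Hz _].
    symmetry. now apply Cmod_pol.
  + apply deriv_cont. unfold Rpower. auto_derive. auto.
- intros r [Hr _]. simpl in Hr. split; auto. rewrite norm_CC. lra.
Qed.

Lemma is_derive_log_r r phi : 0 < r ->
  is_derive (V := CC) (fun r => ((ln r, phi) : C)) r (RtoC (/ r)).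
Proof.
intros Hr. apply C_is_derive; simpl.
- auto_derive; auto. field. lra.
- apply (is_derive_const (V := R_NormedModule)).
Qed.

Lemma is_derive_log_phi r phi :
  is_derive (V := CC) (fun phi => ((ln r, phi) : C)) phi Ci.
Proof.
apply C_is_derive; simpl.
- apply (is_derive_const (V := R_NormedModule)).
- apply (is_derive_id (K := R_AbsRing)).
Qed.

(** In logarithmic coordinates the integrand is a closed form in r and phi;
    power bounds that are uniform between the two angles make the arcs at 0
    and at infinity disappear. *)
Lemma rotation nu t s al phi1 phi2 C a b : 0 < a -> 0 < b -> phi1 <= phi2 ->
  (forall phi r, phi1 <= phi <= phi2 -> 0 < r <= 1 ->
     Cmod (pol nu t s al phi r) <= C * Rpower r (a - 1)) ->
  (forall phi r, phi1 <= phi <= phi2 -> 1 <= r ->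
     Cmod (pol nu t s al phi r) <= C * Rpower r (- 1 - b)) ->
  is_RInt_gen (V := CC) (pol nu t s al phi1) (lo 0) (hi p_infty) (II (V := CC) 0 p_infty (pol nu t s al phi2)) /\
  is_RInt_gen (V := CC) (pol nu t s al phi2) (lo 0) (hi p_infty) (II (V := CC) 0 p_infty (pol nu t s al phi2)).
Proof.
intros Ha Hb Hphi H0 H1.
assert (D : forall phi, phi1 <= phi <= phi2 -> is_RInt_gen (V := CC) (pol nu t s al phi) (lo 0) (hi p_infty) (II (V := CC) 0 p_infty (pol nu t s al phi))).
{ intros phi Hp. apply (dominated_correct (V := CC) 0 p_infty _ (fun r => Cmod (pol nu t s al phi r))).
  apply pol_dom with C a b; auto. }
split; [|apply D; lra].
set (g := fun r phi => (Ci * fz (nu + 1) t s al (ln r, phi))%C).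
set (d := fun r phi => (RtoC (/ r) * (Ci * dfz (nu + 1) t s al (ln r, phi)))%C).
assert (Hg : forall r phi, 0 < r -> Cmod (g r phi) = r * Cmod (pol nu t s al phi r)).
{ intros r phi Hr. unfold g, pol. rewrite !Cmod_mult, Cmod_R.
  rewrite Rabs_pos_eq by (left; now apply Rinv_0_lt_compat).
  replace (Cmod Ci) with 1; [field; lra|].
  unfold Cmod, Ci; simpl. transitivity (sqrt 1); [symmetry; apply sqrt_1|]. f_equal. ring. }
rewrite <- (contour_shift (V := CC) (fun r phi => pol nu t s al phi r) g d 0 p_infty m_infty p_infty
  phi1 phi2 (II (V := CC) 0 p_infty (pol nu t s al phi1)) (II (V := CC) 0 p_infty (pol nu t s al phi2))); auto.
- apply D; lra.
- simpl; auto.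
- intros r phi [Hr _] _. simpl in Hr. split; [|split; [|split; [|split]]].
  + unfold pol, d.
    apply (is_derive_Cscal (RtoC (/ r)) (fun phi => fz (nu + 1) t s al (ln r, phi))).
    apply (is_derive_fz (nu + 1) t s al (fun phi => (ln r, phi))). apply is_derive_log_phi.
  + unfold g, d.
    replace (RtoC (/ r) * (Ci * dfz (nu + 1) t s al (ln r, phi)))%C with
      (Ci * (RtoC (/ r) * dfz (nu + 1) t s al (ln r, phi)))%C by ring.
    apply (is_derive_Cscal Ci (fun r => fz (nu + 1) t s al (ln r, phi))).
    apply (is_derive_fz (nu + 1) t s al (fun r => (ln r, phi))). now apply is_derive_log_r.
  + unfold jcont, d. apply continuous_Cmult; [|apply continuous_Cmult].
    * apply continuous_RtoC. apply (continuous_Rcomp Rinv).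
      -- simpl. auto_derive. lra.
      -- apply continuous_fst.
    * apply continuous_Cconst.
    * apply (continuous_dfz (nu + 1) t s al (fun p : R * R => (ln (fst p), snd p))).
      now apply jcont_polar.
  + now apply continuous_pol.
  + unfold g. apply continuous_Cmult; [apply continuous_Cconst|].
    apply (continuous_fz (nu + 1) t s al (fun phi => (ln r, phi))).
    apply C_continuous; [apply continuous_const|apply continuous_id].
- split; simpl; auto.
- split; simpl; auto.
- intros eps He. generalize (small_pow_0 C a eps Ha He). apply filter_imp.
  intros r [Hr Hr2] phi Hp. rewrite norm_CC, Hg by lra.
  apply Rle_trans with (2 := Hr2).
  apply Rle_trans with (r * (C * Rpower r (a - 1))).
  + apply Rmult_le_compat_l; [lra|auto].
  + right. replace (Rpower r a) with (Rpower r (a - 1) * Rpower r 1).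
    * rewrite Rpower_1 by lra. ring.
    * rewrite <- Rpower_plus. f_equal. ring.
- intros eps He. generalize (small_pow_oo C b eps Hb He). apply filter_imp.
  intros r [Hr Hr2] phi Hp. rewrite norm_CC, Hg by lra.
  apply Rle_trans with (2 := Hr2).
  apply Rle_trans with (r * (C * Rpower r (- 1 - b))).
  + apply Rmult_le_compat_l; [lra|auto].
  + right. replace (Rpower r (- b)) with (Rpower r (- 1 - b) * Rpower r 1).
    * rewrite Rpower_1 by lra. ring.
    * rewrite <- Rpower_plus. f_equal. ring.
- apply D; lra.
- apply D; lra.
Qed.

Lemma cos_ge x y : Rabs x <= y -> y <= PI -> cos y <= cos x.
Proof.
intros H1 H2. assert (HR := Rabs_pos x).
assert (E : cos x = cos (Rabs x)).
{ unfold Rabs. destruct (Rcase_abs x); [now rewrite cos_neg|reflexivity]. }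
rewrite E. apply cos_decr_1; lra.
Qed.

(** Rotating the Gamma integral inside the right half-plane. *)
Lemma cgamma_ray b phi al : 0 < b -> Rabs phi < PI / 2 ->
  is_RInt_gen (V := CC) (pol (b - 1) (-1) 0 al phi) (lo 0) (hi p_infty) (RtoC (Gamma b)).
Proof.
intros Hb Hphi. assert (HPI := PI_RGT_0).
set (k := cos (Rabs phi)).
assert (Hk : 0 < k).
{ apply cos_gt_0; generalize (Rabs_pos phi); lra. }
destruct (Rpower_le_exp (b + 1) k) as [C [HC HCx]]; try lra.
assert (B : forall psi r, Rabs psi <= Rabs phi -> 0 < r ->
  Cmod (pol (b - 1) (-1) 0 al psi r) <= Rpower r (b - 1) * exp (- (k * r))).
{ intros psi r Hpsi Hr. rewrite Cmod_pol by auto.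
  apply Rmult_le_compat_l; [left; apply Rpower_pos|]. apply exp_le.
  assert (k <= cos psi) by (apply cos_ge; lra).
  assert (k * r <= cos psi * r) by (apply Rmult_le_compat_r; lra). lra. }
assert (B0 : forall psi r, Rabs psi <= Rabs phi -> 0 < r <= 1 ->
  Cmod (pol (b - 1) (-1) 0 al psi r) <= (C + 1) * Rpower r (b - 1)).
{ intros psi r Hpsi Hr. apply Rle_trans with (1 := B psi r Hpsi (proj1 Hr)).
  rewrite Rmult_comm. apply Rmult_le_compat_r; [left; apply Rpower_pos|].
  apply Rle_trans with 1; [|lra]. rewrite <- exp_0. apply exp_le.
  assert (0 < k * r) by (apply Rmult_lt_0_compat; lra). lra. }
assert (B1 : forall psi r, Rabs psi <= Rabs phi -> 1 <= r ->
  Cmod (pol (b - 1) (-1) 0 al psi r) <= (C + 1) * Rpower r (- 1 - 1)).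
{ intros psi r Hpsi Hr. apply Rle_trans with (1 := B psi r Hpsi ltac:(lra)).
  replace (b - 1) with ((b + 1) + (- 1 - 1)) by ring. rewrite Rpower_plus.
  replace (Rpower r (b + 1) * Rpower r (-1 - 1) * exp (- (k * r))) with
    (Rpower r (b + 1) * exp (- (k * r)) * Rpower r (-1 - 1)) by ring.
  apply Rmult_le_compat_r; [left; apply Rpower_pos|].
  apply Rle_trans with (C * exp (k * r) * exp (- (k * r))).
  - apply Rmult_le_compat_r; [left; apply exp_pos|]. apply HCx. lra.
  - rewrite Rmult_assoc, <- exp_plus, Rplus_opp_r, exp_0. lra. }
assert (R0 : is_RInt_gen (V := CC) (pol (b - 1) (-1) 0 al 0) (lo 0) (hi p_infty) (RtoC (Gamma b))).
{ apply (is_RInt_gen_ext_inn (V := CC) 0 p_infty (fun r => RtoC (Rpower r (b - 1) * exp (- r)))).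
  - simpl; auto.
  - intros r [Hr _]. simpl in Hr. unfold pol, fz.
    replace (RtoC (b - 1 + 1) * (ln r, 0) + RtoC (-1) * cexp (ln r, 0) - RtoC 0 * cexp (RtoC al * (ln r, 0)))%C
      with (RtoC (b * ln r - r)).
    + rewrite cexp_RtoC, <- RtoC_mult. f_equal.
      replace (b * ln r - r) with ((b - 1 + 1) * ln r + - r) by ring.
      rewrite exp_plus.
      replace (exp ((b - 1 + 1) * ln r)) with (Rpower r (b - 1 + 1)) by reflexivity.
      rewrite <- Rmult_assoc, Rpower_div by auto. reflexivity.
    + change (ln r, 0) with (RtoC (ln r)). rewrite cexp_RtoC, exp_ln by auto.
      rewrite RtoC_minus, !RtoC_mult. replace (b - 1 + 1) with b by ring.
      replace (RtoC (-1)) with (- RtoC 1)%C by (rewrite <- RtoC_opp; reflexivity). ring.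
  - apply is_RInt_gen_RtoC. now apply Gamma_correct. }
destruct (Rle_dec 0 phi) as [Hp|Hp].
- destruct (rotation (b - 1) (-1) 0 al 0 phi (C + 1) b 1) as [Q1 Q2]; try lra.
  + intros psi r Hpsi Hr. apply B0; auto. rewrite !Rabs_pos_eq; lra.
  + intros psi r Hpsi Hr. apply B1; auto. rewrite !Rabs_pos_eq; lra.
  + rewrite <- (II_unique (V := CC) _ _ _ _ R0), (II_unique (V := CC) _ _ _ _ Q1). exact Q2.
- destruct (rotation (b - 1) (-1) 0 al phi 0 (C + 1) b 1) as [Q1 Q2]; try lra.
  + intros psi r Hpsi Hr. apply B0; auto. rewrite !Rabs_left1; lra.
  + intros psi r Hpsi Hr. apply B1; auto. rewrite !Rabs_left1; lra.
  + rewrite <- (II_unique (V := CC) _ _ _ _ R0). exact Q1.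
Qed.

(** The Gamma integral with a complex rate e^L of positive real part. *)
Lemma cgamma b (L : C) : 0 < b -> Rabs (Im L) < PI / 2 ->
  is_RInt_gen (V := CC) (fun v => (RtoC (Rpower v (b - 1)) * cexp (- (RtoC v * cexp L)))%C)
    (lo 0) (hi p_infty) (cexp (- (RtoC b * L)) * RtoC (Gamma b))%C.
Proof.
intros Hb HL. destruct L as [rho phi]. simpl in HL.
assert (H := cgamma_ray b phi 0 Hb HL).
apply (is_RInt_gen_scale (V := CC) _ _ (exp rho) (exp_pos rho)) in H.
2:{ intros x Hx. now apply continuous_pol. }
apply (is_RInt_gen_Cmult _ _ _ _ (cexp (- (RtoC b * (rho, phi))))) in H.
revert H. apply (is_RInt_gen_ext_inn (V := CC)); [simpl; auto|].
intros v [Hv _]. simpl in Hv. rewrite scal_R_Cmult. unfold pol, fz.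
assert (He := exp_pos rho).
assert (El : (ln (exp rho * v), phi) = (RtoC (ln v) + (rho, phi))%C).
{ rewrite ln_mult, ln_exp by auto. unfold Cplus, RtoC; simpl. f_equal; ring. }
rewrite El, cexp_plus, cexp_RtoC, exp_ln by auto.
replace (RtoC (b - 1 + 1)) with (RtoC b) by (f_equal; ring).
replace (RtoC b * (RtoC (ln v) + (rho, phi)) + RtoC (-1) * (RtoC v * cexp (rho, phi)) -
   RtoC 0 * cexp (RtoC 0 * (RtoC (ln v) + (rho, phi))))%C
 with (RtoC (b * ln v) + (RtoC b * (rho, phi) + - (RtoC v * cexp (rho, phi))))%C.
2:{ rewrite RtoC_mult. replace (RtoC (-1)) with (- RtoC 1)%C by (rewrite <- RtoC_opp; reflexivity). ring. }
rewrite cexp_plus, cexp_RtoC, cexp_plus.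
replace (cexp (- (RtoC b * (rho, phi))) * (RtoC (exp rho) * (RtoC (/ (exp rho * v)) *
   (RtoC (exp (b * ln v)) * (cexp (RtoC b * (rho, phi)) * cexp (- (RtoC v * cexp (rho, phi))))))))%C
 with ((cexp (- (RtoC b * (rho, phi))) * cexp (RtoC b * (rho, phi))) *
   (RtoC (exp rho) * RtoC (/ (exp rho * v)) * RtoC (exp (b * ln v))) * cexp (- (RtoC v * cexp (rho, phi))))%C by ring.
rewrite <- cexp_plus.
replace (- (RtoC b * (rho, phi)) + RtoC b * (rho, phi))%C with (RtoC 0) by ring.
rewrite cexp_RtoC, exp_0, <- !RtoC_mult.
replace (exp rho * / (exp rho * v) * exp (b * ln v)) with (Rpower v (b - 1)).
- now rewrite Rmult_1_l.
- replace (exp (b * ln v)) with (Rpower v (b - 1 + 1)) by (unfold Rpower; f_equal; ring).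
  rewrite Rinv_mult. replace (exp rho * (/ exp rho * / v) * Rpower v (b - 1 + 1))
    with ((exp rho * / exp rho) * (/ v * Rpower v (b - 1 + 1))) by ring.
  rewrite Rinv_r, Rpower_div by lra. ring.
Qed.

(** * The reflection formula *)

Lemma is_derive_cexp_lin (z : C) x :
  is_derive (V := CC) (fun x => cexp (- (RtoC x * z))) x (- z * cexp (- (RtoC x * z)))%C.
Proof.
apply (is_derive_cexp (fun x => (- (RtoC x * z))%C)).
destruct z as [p q]. apply C_is_derive; simpl; unfold Re, Im; simpl; auto_derive; auto; ring.
Qed.

Lemma Re_pos_neq0 z : 0 < Re z -> z <> RtoC 0.
Proof. intros H E. rewrite E in H. simpl in H. lra. Qed.

Lemma cexp_int (z : C) : 0 < Re z ->
  is_RInt_gen (V := CC) (fun x => cexp (- (RtoC x * z))%C) (lo 0) (hi p_infty) (/ z)%C.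
Proof.
intros Hz. assert (Hz0 := Re_pos_neq0 z Hz).
replace (/ z)%C with (RtoC 0 - (- / z))%C by ring.
apply (is_RInt_gen_ftc (V := CC) 0 p_infty (fun x => cexp (- (RtoC x * z))%C) (fun x => (- / z * cexp (- (RtoC x * z)))%C)).
- simpl; auto.
- intros x [Hx _]. split.
  + ccont. apply continuous_id.
  + replace (cexp (- (RtoC x * z))) with (- / z * (- z * cexp (- (RtoC x * z))))%C by (field; auto).
    apply is_derive_Cscal. apply is_derive_cexp_lin.
- apply (lo_filterlim_cont (V := CC)).
  + ccont. apply continuous_id.
  + replace (- (RtoC 0 * z))%C with (RtoC 0) by ring. rewrite cexp_RtoC, exp_0.
    change ((- / z * RtoC 1)%C = (- / z)%C). ring.
- apply (filterlim_eps (V := CC)); [apply _|]. intros eps He.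
  assert (HK : 0 < Cmod (- / z)%C + 1) by (generalize (Cmod_ge_0 (- / z)%C); lra).
  generalize (exp_small_oo (Re z) (eps / (Cmod (- / z)%C + 1)) Hz ltac:(now apply Rdiv_lt_0_compat)).
  apply filter_imp. intros x [Hx0 Hx].
  rewrite norm_CC. change (Cmod ((- / z * cexp (- (RtoC x * z))) - RtoC 0)%C <= eps).
  replace ((- / z * cexp (- (RtoC x * z))) - RtoC 0)%C with (- / z * cexp (- (RtoC x * z)))%C by ring.
  rewrite Cmod_mult, Cmod_cexp.
  replace (Re (- (RtoC x * z))) with (- (Re z * x)) by (destruct z; simpl; unfold Re; simpl; ring).
  apply Rle_trans with ((Cmod (- / z)%C + 1) * (eps / (Cmod (- / z)%C + 1))).
  + apply Rmult_le_compat; auto; [apply Cmod_ge_0|left; apply exp_pos|lra].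
  + right. field. lra.
Qed.

(** With E = e^(ih), integrate r^(a-1) E exp(-x(E + r/E)) in both orders.
    Over r it is a Gamma integral with the complex rate x/E, then over x one
    with the rate x E, which leaves the phase e^(2iha) times two Gamma factors;
    over x first it is the rational function r^(a-1)/(1 + r/E^2). *)
Lemma Gamma_sin_integral a h : 0 < a < 1 -> 0 < h < PI / 2 ->
  is_RInt_gen (V := RC) (fun r => Rpower r a * sin (2 * h) / (1 + 2 * r * cos (2 * h) + r ^ 2))
    (lo 0) (hi p_infty) (Gamma a * Gamma (1 - a) * sin (a * (2 * h))).
Proof.
intros Ha Hh. assert (HPI := PI_RGT_0).
set (E := cexp (0, h)). set (E' := cexp (0, - h)).
set (F := fun x r : R => (RtoC (Rpower r (a - 1)) * (E * cexp (- (RtoC x * (E + RtoC r * E')))))%C).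
assert (Ec : E = (cos h, sin h)).
{ unfold E, cexp; simpl. rewrite exp_0, !Rmult_1_l. reflexivity. }
assert (E'c : E' = (cos h, - sin h)).
{ unfold E', cexp; simpl. rewrite exp_0, !Rmult_1_l, cos_neg, sin_neg. reflexivity. }
assert (Hc : 0 < cos h) by (apply cos_gt_0; lra).
(* a < m < 1 makes both factors of the majorant integrable *)
set (m := (1 + a) / 2).
destruct (Rpower_le_exp m (cos h / 2)) as [K [HK HKx]]; [unfold m; lra|lra|].
assert (HcF : forall x r, 0 < r -> jcont (V := CC) F x r).
{ intros x r Hr. unfold jcont, F. ccont.
  - apply (continuous_Rpower' (fun p : R * R => snd p)); [exact Hr|apply continuous_snd].
  - apply continuous_fst.
  - apply continuous_snd. }
assert (HnF : forall x r, 0 < x -> 0 < r -> Cmod (F x r) <=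
   (K * (Rpower x (1 - m - 1) * exp (- (cos h / 2 * x)))) * (Rpower r (a - 1) * Rpower (1 + r) (- m))).
{ intros x r Hx Hr. unfold F. rewrite !Cmod_mult, Cmod_R, Cmod_cexp.
  rewrite Rabs_pos_eq by (left; apply Rpower_pos).
  assert (HE1 : Cmod E = 1) by (unfold E; rewrite Cmod_cexp; simpl; apply exp_0).
  rewrite HE1, Rmult_1_l.
  replace (Re (- (RtoC x * (E + RtoC r * E')))%C) with (- (cos h * (x * (1 + r)))).
  2:{ rewrite Ec, E'c. simpl. unfold Re. simpl. ring. }
  assert (Hxr : 0 < x * (1 + r)) by (apply Rmult_lt_0_compat; lra).
  assert (H1 := HKx _ Hxr).
  replace (K * (Rpower x (1 - m - 1) * exp (- (cos h / 2 * x))) * (Rpower r (a - 1) * Rpower (1 + r) (- m)))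
    with (Rpower r (a - 1) * (K * Rpower (x * (1 + r)) (- m) * exp (- (cos h / 2 * x)))).
  2:{ replace (1 - m - 1) with (- m) by ring.
      rewrite <- (Rpower_mult_distr x (1 + r) (- m)) by lra. ring. }
  apply Rmult_le_compat_l; [left; apply Rpower_pos|].
  apply Rle_trans with (K * Rpower (x * (1 + r)) (- m) * exp (- (cos h / 2 * (x * (1 + r))))).
  - replace (- (cos h * (x * (1 + r)))) with (- (cos h / 2 * (x * (1 + r))) + - (cos h / 2 * (x * (1 + r)))) by field.
    rewrite exp_plus. apply Rmult_le_compat_r; [left; apply exp_pos|].
    rewrite exp_Ropp, Rpower_Ropp.
    assert (He := exp_pos (cos h / 2 * (x * (1 + r)))). assert (Hp := Rpower_pos (x * (1 + r)) m).
    apply Rmult_le_reg_r with (exp (cos h / 2 * (x * (1 + r)))); auto.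
    rewrite Rinv_l by lra.
    apply Rmult_le_reg_r with (Rpower (x * (1 + r)) m); auto.
    replace (K * / Rpower (x * (1 + r)) m * exp (cos h / 2 * (x * (1 + r))) * Rpower (x * (1 + r)) m)
      with (K * exp (cos h / 2 * (x * (1 + r)))) by (field; lra). lra.
  - apply Rmult_le_compat_l.
    + apply Rmult_le_pos; [lra|left; apply Rpower_pos].
    + apply exp_le. apply Ropp_le_contravar. apply Rmult_le_compat_l; [lra|].
      rewrite <- (Rmult_1_r x) at 1. apply Rmult_le_compat_l; lra. }
assert (Hp : Intg 0 p_infty (fun x => K * (Rpower x (1 - m - 1) * exp (- (cos h / 2 * x))))).
{ apply Intg_scal; [lra|]. apply Intg_gamma; unfold m; lra. }
assert (Hq : Intg 0 p_infty (fun r => Rpower r (a - 1) * Rpower (1 + r) (- m))).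
{ apply Intg_powers with 1 a (m - a); [lra|unfold m; lra| | |].
  - intros r Hr. split.
    + apply deriv_cont. unfold Rpower. auto_derive. lra.
    + apply Rmult_le_pos; left; apply Rpower_pos.
  - intros r Hr. rewrite Rmult_1_l. rewrite <- (Rmult_1_r (Rpower r (a - 1))) at 2.
    apply Rmult_le_compat_l; [left; apply Rpower_pos|].
    rewrite Rpower_Ropp. apply Rle_trans with (/ 1); [|lra]. apply Rinv_le_contravar; [lra|].
    apply Rle_trans with (Rpower 1 m); [rewrite Rpower_1_l; lra|]. apply Rle_Rpower_l; unfold m; lra.
  - intros r Hr. rewrite Rmult_1_l.
    replace (- 1 - (m - a)) with ((a - 1) + - m) by ring. rewrite Rpower_plus.
    apply Rmult_le_compat_l; [left; apply Rpower_pos|].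
    rewrite !Rpower_Ropp. apply Rinv_le_contravar; [apply Rpower_pos|].
    apply Rle_Rpower_l; unfold m; lra. }
destruct (fubini (V := CC) 0 p_infty 0 p_infty F _ _ Hp Hq) as [_ [D2 EQ]].
{ intros x r [Hx _] [Hr _]. simpl in Hx, Hr. split; [now apply HcF|]. rewrite norm_CC. now apply HnF. }
assert (D := dominated_correct (V := CC) _ _ _ _ D2). rewrite <- EQ in D. clear D2 EQ Hp Hq HnF HcF.
assert (Er : forall x, 0 < x -> II (V := CC) 0 p_infty (F x) =
  (E * cexp (RtoC a * (0, h)) * RtoC (Gamma a) * (RtoC (Rpower x (1 - a - 1)) * cexp (- (RtoC x * E))))%C).
{ intros x Hx. apply (II_unique (V := CC)).
  assert (HL : Rabs (Im (ln x, (- h)%R)) < PI / 2) by (simpl; rewrite Rabs_Ropp, Rabs_pos_eq; lra).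
  assert (H := is_RInt_gen_Cmult _ _ _ _ (E * cexp (- (RtoC x * E)))%C (cgamma a (ln x, (- h)%R) ltac:(lra) HL)).
  assert (EL : (ln x, (- h)%R) = (RtoC (ln x) + (0, (- h)%R))%C) by (unfold Cplus, RtoC; simpl; f_equal; ring).
  assert (EL2 : cexp (ln x, (- h)%R) = (RtoC x * E')%C).
  { rewrite EL, cexp_plus, cexp_RtoC, exp_ln by auto. reflexivity. }
  replace (E * cexp (RtoC a * (0, h)) * RtoC (Gamma a) * (RtoC (Rpower x (1 - a - 1)) * cexp (- (RtoC x * E))))%C
    with (E * cexp (- (RtoC x * E)) * (cexp (- (RtoC a * (ln x, (- h)%R))) * RtoC (Gamma a)))%C.
  - revert H. apply (is_RInt_gen_ext_inn (V := CC)); [simpl; auto|].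
    intros r [Hr _]. unfold F. rewrite EL2.
    replace (- (RtoC x * (E + RtoC r * E')))%C with (- (RtoC x * E) + - (RtoC r * (RtoC x * E')))%C by ring.
    rewrite cexp_plus.
    match goal with |- ?u = ?v => change (@eq C u v) end. ring.
  - replace (- (RtoC a * (ln x, (- h)%R)))%C with (RtoC (- a * ln x) + RtoC a * (0, h))%C.
    + rewrite cexp_plus, cexp_RtoC. unfold Rpower. replace (1 - a - 1) with (- a) by ring. ring.
    + unfold Cplus, Cmult, Copp, RtoC; simpl. f_equal; ring. }
assert (Ev : II (V := CC) 0 p_infty (fun x => II (V := CC) 0 p_infty (F x)) =
   (RtoC (Gamma a * Gamma (1 - a)) * cexp (RtoC a * (0, (2 * h)%R)))%C).
{ apply (II_unique (V := CC)).
  assert (HL : Rabs (Im (0, h)) < PI / 2) by (simpl; rewrite Rabs_pos_eq; lra).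
  assert (H := is_RInt_gen_Cmult _ _ _ _ (E * cexp (RtoC a * (0, h)) * RtoC (Gamma a))%C (cgamma (1 - a) (0, h) ltac:(lra) HL)).
  replace (RtoC (Gamma a * Gamma (1 - a)) * cexp (RtoC a * (0, (2 * h)%R)))%C with
    (E * cexp (RtoC a * (0, h)) * RtoC (Gamma a) * (cexp (- (RtoC (1 - a) * (0, h))) * RtoC (Gamma (1 - a))))%C.
  - revert H. apply (is_RInt_gen_ext_inn (V := CC)); [simpl; auto|].
    intros x [Hx _]. symmetry. now apply Er.
  - rewrite RtoC_mult.
    replace (E * cexp (RtoC a * (0, h)) * RtoC (Gamma a) * (cexp (- (RtoC (1 - a) * (0, h))) * RtoC (Gamma (1 - a))))%C
    with ((E * cexp (RtoC a * (0, h)) * cexp (- (RtoC (1 - a) * (0, h)))) * (RtoC (Gamma a) * RtoC (Gamma (1 - a))))%C by ring.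
    unfold E. rewrite <- !cexp_plus.
    replace ((0, h) + RtoC a * (0, h) + - (RtoC (1 - a) * (0, h)))%C with (RtoC a * (0, (2 * h)%R))%C.
    + ring.
    + unfold Cplus, Cmult, Copp, RtoC; simpl. f_equal; ring. }
rewrite Ev in D. apply is_RInt_gen_Im in D.
replace (Gamma a * Gamma (1 - a) * sin (a * (2 * h))) with (Im (RtoC (Gamma a * Gamma (1 - a)) * cexp (RtoC a * (0, (2 * h)%R)))%C).
2:{ unfold cexp; simpl.
    replace (a * (2 * h) + 0 * 0) with (a * (2 * h)) by ring.
    replace (a * 0 - 0 * (2 * h)) with 0 by ring. rewrite exp_0. ring. }
revert D. apply (is_RInt_gen_ext_inn (V := RC)); [simpl; auto|].
intros r [Hr _]. simpl in Hr.
assert (Hz : 0 < Re (E + RtoC r * E')%C).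
{ rewrite Ec, E'c. simpl. unfold Re. simpl.
  assert (0 < r * cos h) by (now apply Rmult_lt_0_compat). lra. }
assert (Ex : II (V := CC) 0 p_infty (fun x => F x r) = (RtoC (Rpower r (a - 1)) * E * / (E + RtoC r * E'))%C).
{ apply (II_unique (V := CC)).
  assert (H := is_RInt_gen_Cmult _ _ _ _ (RtoC (Rpower r (a - 1)) * E)%C (cexp_int _ Hz)).
  revert H. apply (is_RInt_gen_ext_inn (V := CC)); [simpl; auto|].
  intros x _. unfold F. match goal with |- ?u = ?v => change (@eq C u v) end. ring. }
rewrite Ex, Ec, E'c.
assert (Epow : Rpower r a = r * Rpower r (a - 1)).
{ rewrite <- (Rpower_div r (a - 1)) by auto. replace (a - 1 + 1) with a by ring. field. lra. }
rewrite Epow, sin_2a, cos_2a.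
unfold Cmult, Cinv, Cplus, RtoC, Im; simpl.
assert (Hsc : sin h * sin h = 1 - cos h * cos h).
{ generalize (sin2_cos2 h). unfold Rsqr. lra. }
assert (Hden : 0 < (cos h + (r * cos h - 0 * - sin h)) * ((cos h + (r * cos h - 0 * - sin h)) * 1) +
   (sin h + (r * - sin h + 0 * cos h)) * ((sin h + (r * - sin h + 0 * cos h)) * 1)).
{ apply Rplus_lt_le_0_compat.
  - assert (0 < cos h + (r * cos h - 0 * - sin h)).
    { assert (0 < r * cos h) by (now apply Rmult_lt_0_compat). lra. }
    apply Rmult_lt_0_compat; lra.
  - rewrite Rmult_1_r. apply Rle_0_sqr. }
set (DD := (cos h + (r * cos h - 0 * - sin h)) * ((cos h + (r * cos h - 0 * - sin h)) * 1) +
   (sin h + (r * - sin h + 0 * cos h)) * ((sin h + (r * - sin h + 0 * cos h)) * 1)) in *.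
assert (EDD : 1 + 2 * r * (cos h * cos h - sin h * sin h) + r * (r * 1) = DD).
{ unfold DD. ring_simplify. replace (sin h ^ 2) with (1 - cos h * cos h) by (rewrite <- Hsc; ring). ring. }
rewrite EDD. field. lra.
Qed.

Lemma is_RInt_gen_extend_left {V : RNM} (f : R -> V) a (c : R) v : Rbar_lt a c ->
  (forall x, continuous f x) -> (forall x, x <= c -> f x = zero) ->
  is_RInt_gen f (lo c) (hi p_infty) v ->
  is_RInt_gen f (lo a) (hi p_infty) v.
Proof.
intros Hac Hc Hz Hv. apply lim_of_is_RInt_gen in Hv.
apply is_RInt_gen_of_lim; [now apply Rbar_lt_trans with c|auto|].
apply filterlim_eps; [apply _|]. intros eps He.
assert (Hex : forall x y, ex_RInt f x y).
{ intros x y. apply ex_RInt_continuous. auto. }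
assert (HcR : continuous (fun y => RInt f c y) c).
{ apply (continuous_RInt_1 (V := V) f c c (fun y => RInt f c y)).
  exists (mkposreal 1 Rlt_0_1). intros z _. apply RInt_correct. apply Hex. }
assert (H2 : lo c (fun y => norm (minus (RInt f c y) (RInt f c c)) <= eps / 2)).
{ generalize (filterlim_eps_inv (locally c) _ _ HcR (eps / 2) ltac:(lra)).
  intros [e Hle]. exists e. intros x Hx _. now apply Hle. }
assert (H1 := filterlim_eps_inv _ _ _ Hv (eps / 2) ltac:(lra)).
destruct H1 as [Q1 Q2 HQ1 HQ2 HQ].
destruct (filter_ex _ (filter_and _ _ HQ1 H2)) as [x' [Hx'1 Hx'2]].
assert (HI1 : lo a (fun x => x < c)).
{ destruct (inn_exists a c Hac) as [x0 Hx0]. generalize (lo_inn a c x0 Hx0). apply filter_imp.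
  intros x [[_ Hx] _]. exact Hx. }
apply Filter_prod with (1 := HI1) (2 := HQ2).
intros x y Hx Hy. simpl.
generalize (HQ x' y Hx'1 Hy). simpl. intros HN.
assert (Hzz : RInt f x c = zero).
{ transitivity (RInt (fun _ : R => zero : V) x c).
  - apply RInt_ext. intros z Hz'. rewrite Rmin_left, Rmax_right in Hz' by lra. apply Hz. lra.
  - rewrite (RInt_const (V := V)). exact (scal_zeroV (c - x)). }
assert (Ey : RInt f x y = RInt f c y).
{ rewrite <- (RInt_Chasles f x c y) by auto. rewrite Hzz.
  exact (plus_zero_l (RInt f c y)). }
rewrite Ey.
apply Rle_trans with (1 := norm_minus_tri _ (RInt f x' y) _).
apply Rle_trans with (eps / 2 + eps / 2); [|lra]. apply Rplus_le_compat; auto.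
rewrite <- (RInt_Chasles f c x' y) by auto.
replace (norm (minus (plus (RInt f c x') (RInt f x' y)) (RInt f x' y)))
  with (norm (minus (RInt f c x') (RInt f c c))); auto.
f_equal. rewrite RInt_point.
transitivity (RInt f c x'); [exact (minus_zero_r (RInt f c x'))|].
rewrite (plus_comm (RInt f c x')). symmetry.
exact (plus_minus_l (RInt f x' y) (RInt f c x')).
Qed.

(** Continuous on the whole line for 0 < a, unlike [Rpower]. *)
Definition ppow (a y : R) : R := if Rle_dec y 0 then 0 else Rpower y a.

Lemma ppow_pos a y : 0 < y -> ppow a y = Rpower y a.
Proof. intros H. unfold ppow. destruct (Rle_dec y 0); [lra|auto]. Qed.

Lemma ppow_neg a y : y <= 0 -> ppow a y = 0.
Proof. intros H. unfold ppow. destruct (Rle_dec y 0); [auto|lra]. Qed.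

Lemma ppow_ge_0 a y : 0 <= ppow a y.
Proof. unfold ppow. destruct (Rle_dec y 0); [lra|left; apply Rpower_pos]. Qed.

Lemma continuous_ppow a y : 0 < a -> continuous (ppow a) y.
Proof.
intros Ha. destruct (Rlt_dec 0 y) as [Hy|Hy]; [|destruct (Rlt_dec y 0) as [Hy'|Hy']].
- apply continuous_ext_loc with (fun y => Rpower y a); [|now apply cont_Rpower].
  assert (Hi : inn 0 p_infty y) by (split; simpl; auto).
  generalize (locally_inn 0 p_infty y Hi). apply filter_imp. intros z [Hz _].
  symmetry. now apply ppow_pos.
- apply continuous_ext_loc with (fun y => 0); [|apply continuous_const].
  assert (Hi : inn m_infty 0 y) by (split; simpl; auto).
  generalize (locally_inn m_infty 0 y Hi). apply filter_imp. intros z [_ Hz].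
  symmetry. apply ppow_neg. simpl in Hz. lra.
- assert (y = 0) by lra. subst y. apply (continuous_eps (V := RC)). intros eps He.
  rewrite (ppow_neg a 0) by lra.
  destruct (small_pow_0 1 a eps Ha He) as [d Hd]. exists d. intros z Hz.
  unfold minus, plus, opp, norm, abs; simpl. rewrite Ropp_0, Rplus_0_r.
  rewrite Rabs_pos_eq by apply ppow_ge_0.
  destruct (Rlt_dec 0 z) as [H|H].
  + rewrite ppow_pos by auto. rewrite <- (Rmult_1_l (Rpower z a)). now apply Hd.
  + rewrite ppow_neg by lra. lra.
Qed.

Lemma continuous_ppow' {T : UniformSpace} a (f : T -> R) x : 0 < a ->
  continuous f x -> continuous (fun t => ppow a (f t)) x.
Proof. intros Ha Hf. apply (continuous_comp f (ppow a)); auto. now apply continuous_ppow. Qed.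

Lemma Intg_one_plus a : a < 1 ->
  Intg m_infty p_infty (fun x => Rpower (1 + Rabs x) (a - 2)).
Proof.
intros Ha.
assert (Hc : forall x, continuous (fun x => Rpower (1 + Rabs x) (a - 2)) x).
{ intros x. apply (continuous_Rpower' (fun x => 1 + Rabs x)).
  - generalize (Rabs_pos x). lra.
  - apply continuous_Rplus; [apply continuous_const|]. apply continuous_Rabs. }
assert (HM : forall u, 1 <= u -> Rabs (/ (1 - a) * Rpower u (a - 1)) <= / (1 - a)).
{ intros u Hu. assert (0 < / (1 - a)) by (apply Rinv_0_lt_compat; lra).
  rewrite Rabs_pos_eq by (apply Rmult_le_pos; [lra|left; apply Rpower_pos]).
  apply Rle_trans with (/ (1 - a) * 1); [|lra]. apply Rmult_le_compat_l; [lra|].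
  replace (a - 1) with (- (1 - a)) by ring. rewrite Rpower_Ropp.
  apply Rle_trans with (/ 1); [|lra]. apply Rinv_le_contravar; [lra|].
  apply Rle_trans with (Rpower 1 (1 - a)); [rewrite Rpower_1_l; lra|]. apply Rle_Rpower_l; lra. }
apply Intg_split with 0.
- split; simpl; auto.
- auto.
- apply Intg_primitive with (fun x => / (1 - a) * Rpower (1 - x) (a - 1)) (/ (1 - a)); simpl; auto.
  + intros x _. split; [auto|left; apply Rpower_pos].
  + intros x [_ Hx]. simpl in Hx. rewrite Rabs_left by auto.
    unfold Rpower. auto_derive; [lra|].
    replace ((a - 2) * ln (1 + - x)) with ((a - 1) * ln (1 + - x) + - ln (1 + - x)) by ring.
    rewrite exp_plus, exp_Ropp, exp_ln by lra. replace (1 - x) with (1 + - x) by ring. field. split; lra.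
  + intros x [_ Hx]. simpl in Hx. apply HM. lra.
- apply Intg_primitive with (fun x => - (/ (1 - a) * Rpower (1 + x) (a - 1))) (/ (1 - a)); simpl; auto.
  + intros x _. split; [auto|left; apply Rpower_pos].
  + intros x [Hx _]. simpl in Hx. rewrite Rabs_pos_eq by lra.
    unfold Rpower. auto_derive; [lra|].
    replace ((a - 2) * ln (1 + x)) with ((a - 1) * ln (1 + x) + - ln (1 + x)) by ring.
    rewrite exp_plus, exp_Ropp, exp_ln by lra. field. split; lra.
  + intros x [Hx _]. simpl in Hx. rewrite Rabs_Ropp. apply HM. lra.
Qed.

Lemma filterlim_atan_p : filterlim atan (hi p_infty) (locally (PI / 2)).
Proof.
apply (filterlim_eps (V := RC)); [apply _|]. intros eps He.
set (e := Rmin eps (PI / 4)). assert (HPI := PI_RGT_0).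
assert (He1 : 0 < e) by (apply Rmin_glb_lt; lra).
assert (He2 : e <= eps) by apply Rmin_l.
assert (He3 : e <= PI / 4) by apply Rmin_r.
exists (tan (PI / 2 - e)). intros x Hx.
assert (H : PI / 2 - e < atan x).
{ rewrite <- (atan_tan (PI / 2 - e)) by lra. now apply atan_increasing. }
assert (HB := atan_bound x).
unfold minus, plus, opp, norm, abs; simpl. apply Rabs_le. lra.
Qed.

Lemma filterlim_atan_m : filterlim atan (lo m_infty) (locally (- (PI / 2))).
Proof.
apply (filterlim_eps (V := RC)); [apply _|]. intros eps He.
destruct (filterlim_eps_inv (V := RC) _ _ _ filterlim_atan_p eps He) as [M HM].
exists (- M). intros x Hx. assert (Hx' : M < - x) by lra.
generalize (HM (- x) Hx'). unfold minus, plus, opp, norm, abs; simpl.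
rewrite atan_opp. replace (atan x + - - (PI / 2)) with (- (- atan x + - (PI / 2))) by ring.
now rewrite Rabs_Ropp.
Qed.

Lemma int_atan : is_RInt_gen (V := RC) (fun x => / (1 + x ^ 2)) (lo m_infty) (hi p_infty) PI.
Proof.
replace PI with (minus (PI / 2) (- (PI / 2))) by (unfold minus, plus, opp; simpl; field).
apply (is_RInt_gen_ftc (V := RC) m_infty p_infty (fun x => / (1 + x ^ 2)) atan).
- simpl; auto.
- intros x _. split.
  + apply deriv_cont. auto_derive. nra.
  + apply is_derive_Reals. apply derivable_pt_lim_atan.
- apply filterlim_atan_m.
- apply filterlim_atan_p.
Qed.

(** Let the angle in the rational integral tend to PI. The substitution
    r = x sin phi - cos phi turns it into the integral of
    max(0, x sin phi - cos phi)^a / (1 + x^2) over the line, which tends to that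
    of 1 / (1 + x^2) by dominated convergence. *)
Lemma reflection a : 0 < a < 1 -> Gamma a * Gamma (1 - a) * sin (a * PI) = PI.
Proof.
intros Ha. assert (HPI := PI_RGT_0).
set (j := fun phi x => ppow a (x * sin phi - cos phi) * / (1 + x ^ 2)).
assert (Hq : forall x : R, 0 < 1 + x ^ 2) by (intros x; nra).
assert (Hj : forall phi x, jcont (V := RC) j phi x).
{ intros phi x. unfold jcont, j. apply continuous_Rmult.
  - apply continuous_ppow'; [lra|]. apply continuous_Rminus; [apply continuous_Rmult|].
    + apply continuous_snd.
    + apply (continuous_Rcomp sin); [auto_derive; auto|apply continuous_fst].
    + apply (continuous_Rcomp cos); [auto_derive; auto|apply continuous_fst].
  - apply (continuous_Rcomp (fun x => / (1 + x ^ 2))).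
    + simpl. auto_derive. generalize (Hq x). lra.
    + apply continuous_snd. }
assert (Hbound : forall phi x, norm (j phi x : RC) <= 2 * Rpower (1 + Rabs x) (a - 2)).
{ intros phi x. unfold norm, abs, j; simpl. rewrite (Rabs_pos_eq).
  2:{ apply Rmult_le_pos; [apply ppow_ge_0|]. left. apply Rinv_0_lt_compat. exact (Hq x). }
  assert (Hx := Rabs_pos x).
  assert (H1 : ppow a (x * sin phi - cos phi) <= Rpower (1 + Rabs x) a).
  { destruct (Rlt_dec 0 (x * sin phi - cos phi)) as [H|H].
    - rewrite ppow_pos by auto. apply Rle_Rpower_l; [lra|]. split; auto.
      apply Rle_trans with (1 := Rle_abs _).
      apply Rle_trans with (1 := Rabs_triang _ _). rewrite Rabs_Ropp, Rabs_mult.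
      assert (Hs : Rabs (sin phi) <= 1) by (apply Rabs_le; generalize (SIN_bound phi); lra).
      assert (Hcs : Rabs (cos phi) <= 1) by (apply Rabs_le; generalize (COS_bound phi); lra).
      assert (Rabs x * Rabs (sin phi) <= Rabs x * 1) by now apply Rmult_le_compat_l. lra.
    - rewrite ppow_neg by lra. left. apply Rpower_pos. }
  replace (2 * Rpower (1 + Rabs x) (a - 2)) with (Rpower (1 + Rabs x) a * (2 * / (1 + Rabs x) ^ 2)).
  2:{ unfold Rminus. rewrite Rpower_plus, Rpower_Ropp.
      replace (Rpower (1 + Rabs x) 2) with ((1 + Rabs x) ^ 2); [ring|].
      rewrite <- Rpower_pow by lra. f_equal. }
  assert (Hx2 : Rabs x * Rabs x = x * x).
  { rewrite <- Rabs_mult. apply Rabs_pos_eq. nra. }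
  apply Rmult_le_compat; [apply ppow_ge_0|left; apply Rinv_0_lt_compat; exact (Hq x)|auto|].
  apply Rmult_le_reg_r with (1 + x ^ 2); [exact (Hq x)|].
  replace (/ (1 + x * (x * 1)) * (1 + x ^ 2)) with 1 by (simpl; field; generalize (Hq x); simpl; lra).
  apply Rmult_le_reg_r with ((1 + Rabs x) ^ 2); [nra|].
  replace (2 * / (1 + Rabs x) ^ 2 * (1 + x ^ 2) * (1 + Rabs x) ^ 2) with (2 * (1 + x ^ 2)) by (field; lra).
  assert (0 <= (1 - Rabs x) ^ 2) by apply pow2_ge_0. nra. }
assert (Hcont : continuous (fun phi => II (V := RC) m_infty p_infty (j phi)) PI).
{ apply (II_continuous (V := RC)) with (fun x => 2 * Rpower (1 + Rabs x) (a - 2)).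
  - apply Intg_scal; [lra|]. apply Intg_one_plus. lra.
  - exists (mkposreal 1 Rlt_0_1). intros phi _ x _. split; [|apply Hbound].
    apply (jcont_r (V := RC)). apply Hj.
  - intros x _. apply Hj. }
assert (Hval : II (V := RC) m_infty p_infty (j PI) = PI).
{ apply (II_unique (V := RC)).
  apply (is_RInt_gen_ext_inn (V := RC) m_infty p_infty (fun x => / (1 + x ^ 2))); [simpl; auto| |apply int_atan].
  intros x _. unfold j. rewrite sin_PI, cos_PI, ppow_pos by lra.
  replace (x * 0 - -1) with 1 by ring. rewrite Rpower_1_l. symmetry. exact (Rmult_1_l _). }
assert (Hside : forall phi, PI / 2 < phi < PI ->
  II (V := RC) m_infty p_infty (j phi) = Gamma a * Gamma (1 - a) * sin (a * phi)).
{ intros phi Hphi. apply (II_unique (V := RC)).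
  assert (Hs : 0 < sin phi) by (apply sin_gt_0; lra).
  assert (Hc : cos phi < 0) by (apply cos_lt_0; lra).
  assert (Hh : 0 < phi / 2 < PI / 2) by lra.
  assert (H := Gamma_sin_integral a (phi / 2) Ha Hh).
  replace (2 * (phi / 2)) with phi in H by field.
  set (f := fun r => Rpower r a * sin phi / (1 + 2 * r * cos phi + r ^ 2)) in H.
  assert (Hsc : sin phi * sin phi = 1 - cos phi * cos phi).
  { generalize (sin2_cos2 phi). unfold Rsqr. lra. }
  assert (HD : forall r, 1 + 2 * r * cos phi + r ^ 2 = (r + cos phi) * (r + cos phi) + sin phi * sin phi).
  { intros r. rewrite Hsc. ring. }
  assert (HDp : forall r, 0 < 1 + 2 * r * cos phi + r ^ 2).
  { intros r. rewrite HD. apply Rplus_le_lt_0_compat; [apply Rle_0_sqr|now apply Rmult_lt_0_compat]. }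
  apply (is_RInt_gen_extend_left (V := RC) (j phi) m_infty (cos phi / sin phi)); [exact I| | |].
  - intros x. exact (jcont_r (V := RC) j phi x (Hj phi x)).
  - intros x Hx. unfold j. rewrite ppow_neg; [exact (Rmult_0_l _)|].
    apply Rmult_le_compat_r with (r := sin phi) in Hx; [|lra].
    replace (cos phi / sin phi * sin phi) with (cos phi) in Hx by (field; lra). lra.
  - apply (is_RInt_gen_ext_inn (V := RC) (cos phi / sin phi) p_infty
      (fun x => scal (sin phi) (f (x * sin phi - cos phi)))).
    + simpl; auto.
    + intros x [Hx _]. simpl in Hx.
      apply Rmult_lt_compat_r with (r := sin phi) in Hx; [|lra].
      replace (cos phi / sin phi * sin phi) with (cos phi) in Hx by (field; lra).
      unfold j, f. rewrite ppow_pos by lra. rewrite HD. unfold scal; simpl; unfold mult; simpl.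
      replace ((x * sin phi - cos phi + cos phi) * (x * sin phi - cos phi + cos phi) + sin phi * sin phi)
        with (sin phi * sin phi * (1 + x ^ 2)) by ring.
      assert (Hqx := Hq x). field. split; lra.
    + apply (is_RInt_gen_subst (V := RC) 0 p_infty (cos phi / sin phi) p_infty f
        (fun x => x * sin phi - cos phi) (fun _ => sin phi)).
      * simpl; auto.
      * intros x [Hx _]. simpl in Hx.
        apply Rmult_lt_compat_r with (r := sin phi) in Hx; [|lra].
        replace (cos phi / sin phi * sin phi) with (cos phi) in Hx by (field; lra).
        split; [split; simpl; auto; lra|]. split; [|apply continuous_const].
        auto_derive; auto. ring.
      * intros r [Hr _]. simpl in Hr. apply deriv_cont. unfold f, Rpower. auto_derive.
        split; auto. split; auto. generalize (HDp r). simpl. lra.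
      * intros P [e Hle].
        assert (Hd : 0 < e / sin phi) by (apply Rdiv_lt_0_compat; auto; apply cond_pos).
        exists (mkposreal _ Hd). intros x Hx Hx0.
        assert (Hx' : Rabs (x - cos phi / sin phi) < e / sin phi) by exact Hx.
        apply Rmult_lt_compat_r with (r := sin phi) in Hx0; [|lra].
        replace (cos phi / sin phi * sin phi) with (cos phi) in Hx0 by (field; lra).
        apply Hle; [|lra].
        change (Rabs (x * sin phi - cos phi - 0) < e).
        replace (x * sin phi - cos phi - 0) with (sin phi * (x - cos phi / sin phi)) by (field; lra).
        rewrite Rabs_mult, (Rabs_pos_eq (sin phi)) by lra.
        replace (pos e) with (sin phi * (e / sin phi)) by (field; lra).
        now apply Rmult_lt_compat_l.
      * intros P [M HM]. exists ((M + cos phi) / sin phi). intros x Hx. apply HM.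
        apply Rmult_lt_compat_r with (r := sin phi) in Hx; [|lra].
        replace ((M + cos phi) / sin phi * sin phi) with (M + cos phi) in Hx by (field; lra). lra.
      * exact H. }
assert (L1 : filterlim (fun phi => II (V := RC) m_infty p_infty (j phi)) (hi PI) (locally PI)).
{ rewrite <- Hval at 2. apply filterlim_filter_le_1 with (2 := Hcont). apply filter_le_within. }
assert (L2 : filterlim (fun phi => II (V := RC) m_infty p_infty (j phi)) (hi PI)
   (locally (Gamma a * Gamma (1 - a) * sin (a * PI)))).
{ apply filterlim_ext_loc with (fun phi => Gamma a * Gamma (1 - a) * sin (a * phi)).
  - assert (Hi : inn (PI / 2) PI (3 * PI / 4)) by (split; simpl; lra).
    generalize (hi_inn (PI / 2) PI _ Hi). apply filter_imp. intros phi [[H1 H2] _]. simpl in *.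
    symmetry. apply Hside. lra.
  - assert (Hc : continuous (fun phi => Gamma a * Gamma (1 - a) * sin (a * phi)) PI).
    { apply deriv_cont. auto_derive. auto. }
    apply filterlim_filter_le_1 with (2 := Hc). apply filter_le_within. }
exact (filterlim_locally_unique (V := R_NormedModule) _ _ _ L2 L1).
Qed.

Lemma Gamma_half : Gamma (1 / 2) = sqrt PI.
Proof.
assert (H := reflection (1 / 2) ltac:(lra)).
replace (1 / 2 * PI) with (PI / 2) in H by field. rewrite sin_PI2 in H.
replace (1 - 1 / 2) with (1 / 2) in H by field. rewrite Rmult_1_r in H.
assert (Hp := Gamma_pos (1 / 2) ltac:(lra)).
rewrite <- H. symmetry. apply sqrt_square. lra.
Qed.

Lemma sin_add_nPI b n : sin (- b + INR n * PI) = - (-1) ^ n * sin b.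
Proof.
induction n as [|n IH].
- simpl. rewrite Rmult_0_l, Rplus_0_r, sin_neg. ring.
- rewrite S_INR. replace (- b + (INR n + 1) * PI) with (- b + INR n * PI + PI) by ring.
  rewrite neg_sin, IH. simpl. ring.
Qed.

(** The reflection formula removes 1/Gamma at nonpositive arguments. *)
Lemma rGamma_neg z : 0 <= z -> rGamma (- z) = - sin (PI * z) * Gamma (z + 1) / PI.
Proof.
intros Hz. unfold rGamma. rewrite Ropp_involutive.
destruct (archimed z) as [H1 H2].
set (m := Z.to_nat (up z)).
assert (Hm : INR m = IZR (up z)).
{ unfold m. rewrite INR_IZR_INZ, Z2Nat.id; auto. apply le_IZR. lra. }
set (a := INR m - z).
assert (Ha : 0 < a <= 1) by (unfold a; rewrite Hm; lra).
replace (- z + INR m) with a by (unfold a; ring).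
assert (HPI := PI_RGT_0).
destruct (Req_dec a 1) as [Ha1|Ha1].
- (* z is an integer: both sides vanish *)
  assert (Ez : z = INR (m - 1)).
  { rewrite minus_INR. - simpl. unfold a in Ha1. lra.
    - apply INR_le. simpl. unfold a in Ha1. lra. }
  assert (Hr : forall n, (m - 1 < n)%nat -> rising (- z) n = 0).
  { induction n as [|n IH]; [lia|]. intros Hn. simpl.
    destruct (Nat.eq_dec n (m - 1)) as [->|Hne].
    - rewrite Ez. ring.
    - rewrite IH by lia. ring. }
  assert (Hm1 : (1 <= m)%nat) by (apply INR_le; simpl; unfold a in Ha1; lra).
  rewrite Hr by lia.
  replace (sin (PI * z)) with 0.
  + unfold Rdiv. ring.
  + rewrite Ez, Rmult_comm. symmetry. rewrite INR_IZR_INZ. apply sin_eq_0_1. eexists. reflexivity.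
- assert (Ha' : 0 < a < 1) by lra.
  assert (HR := reflection a Ha').
  assert (HG : forall n, (n <= m)%nat -> Gamma (z + 1) = (-1) ^ n * rising (- z) n * Gamma (z + 1 - INR n)).
  { induction n as [|n IH]; intros Hn.
    - simpl. rewrite Rminus_0_r. ring.
    - assert (Hn' : INR n + 1 <= INR m) by (rewrite <- S_INR; now apply le_INR).
      rewrite IH by lia.
      replace (z + 1 - INR n) with (z + 1 - INR (S n) + 1) by (rewrite S_INR; ring).
      rewrite Gamma_S.
      2:{ rewrite S_INR. unfold a in Ha'. lra. }
      simpl rising. rewrite S_INR. simpl pow. ring. }
  rewrite (HG m) by lia.
  replace (z + 1 - INR m) with (1 - a) by (unfold a; ring).
  assert (HS : sin (PI * z) = - (-1) ^ m * sin (a * PI)).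
  { replace (PI * z) with (- (a * PI) + INR m * PI) by (unfold a; ring).
    apply sin_add_nPI. }
  rewrite HS.
  assert (Hsq : (-1) ^ m * (-1) ^ m = 1).
  { rewrite <- Rpow_mult_distr. replace (-1 * -1) with 1 by ring. apply pow1. }
  assert (HGa := Gamma_pos a ltac:(lra)).
  transitivity (((-1) ^ m * (-1) ^ m) * rising (- z) m * (Gamma (1 - a) * sin (a * PI)) / PI).
  + rewrite Hsq. replace (Gamma (1 - a) * sin (a * PI)) with (PI / Gamma a).
    * field. split; lra.
    * rewrite <- HR at 1. field. lra.
  + unfold Rdiv. ring.
Qed.

(** * The Wright function as a contour integral *)

(** Im (e^(i theta) exp(rho e^(i psi))): its derivatives are of the same
    form, with a shifted angle. *)
Definition esin (psi theta rho : R) : R := exp (rho * cos psi) * sin (theta + rho * sin psi).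

Lemma is_derive_esin psi theta rho :
  is_derive (esin psi theta) rho (esin psi (theta + psi) rho).
Proof.
unfold esin. auto_derive; auto.
replace (theta + psi + rho * sin psi) with (theta + rho * sin psi + psi) by ring.
rewrite (sin_plus (theta + rho * sin psi) psi). ring.
Qed.

Lemma Derive_n_esin psi theta n rho :
  Derive_n (esin psi theta) n rho = esin psi (theta + INR n * psi) rho.
Proof.
revert rho. induction n as [|n IH]; intros rho.
- simpl. f_equal. ring.
- simpl Derive_n. rewrite (Derive_ext _ _ _ IH).
  rewrite (is_derive_unique _ _ _ (is_derive_esin psi (theta + INR n * psi) rho)).
  f_equal. rewrite S_INR. ring.
Qed.

Lemma ex_derive_n_esin psi theta n rho : ex_derive_n (esin psi theta) n rho.
Proof.
destruct n as [|n]; simpl; auto.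
apply ex_derive_ext with (esin psi (theta + INR n * psi)).
- intros t. symmetry. apply Derive_n_esin.
- eexists. apply is_derive_esin.
Qed.

Lemma esin_taylor psi theta rho N : 0 < rho ->
  Rabs (sum_f_R0 (fun m => rho ^ m / INR (fact m) * sin (theta + INR m * psi)) N - esin psi theta rho)
   <= rho ^ S N / INR (fact (S N)) * exp rho.
Proof.
intros Hr.
destruct (Taylor_Lagrange (esin psi theta) N 0 rho Hr) as [z [Hz Hu]].
- intros t Ht k Hk. apply ex_derive_n_esin.
- rewrite Hu, Rminus_0_r.
  rewrite (sum_eq _ (fun m => rho ^ m / INR (fact m) * Derive_n (esin psi theta) m 0)).
  2:{ intros i _. rewrite Derive_n_esin. unfold esin at 1. rewrite !Rmult_0_l, exp_0, Rplus_0_r. ring. }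
  match goal with |- Rabs (?S - (?S + ?T)) <= _ => replace (S - (S + T)) with (- T) by ring end.
  rewrite Rabs_Ropp, Rabs_mult, Derive_n_esin.
  assert (Hp : 0 <= rho ^ S N / INR (fact (S N))).
  { apply Rmult_le_pos; [apply pow_le; lra|]. left. apply Rinv_0_lt_compat, lt_0_INR, lt_O_fact. }
  rewrite Rabs_pos_eq by auto. apply Rmult_le_compat_l; auto.
  unfold esin. rewrite Rabs_mult, (Rabs_pos_eq (exp _)) by (left; apply exp_pos).
  rewrite <- (Rmult_1_r (exp rho)). apply Rmult_le_compat; try apply Rabs_pos.
  + left; apply exp_pos.
  + apply exp_le.
    assert (z * cos psi <= z * 1) by (apply Rmult_le_compat_l; [lra|apply COS_bound]). lra.
  + apply Rabs_le. generalize (SIN_bound (theta + INR (S N) * psi + z * sin psi)). lra.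
Qed.

Lemma exp_sum_le rho N : 0 <= rho -> sum_f_R0 (fun m => rho ^ m / INR (fact m)) N <= exp rho.
Proof.
intros Hr.
assert (H := is_exp_Reals rho). unfold is_pseries, is_series in H.
assert (HL : sum_n (fun k => scal (pow_n rho k) (/ INR (fact k))) N <= exp rho).
{ apply (is_lim_seq_incr_compare (sum_n (fun k => scal (pow_n rho k) (/ INR (fact k)))) (exp rho)); [exact H|].
  intros n. rewrite sum_Sn. rewrite pow_n_pow. unfold plus, scal; simpl. unfold mult; simpl.
  assert (0 <= rho ^ S n * / INR (fact (S n))); [|simpl in *; lra].
  apply Rmult_le_pos; [now apply pow_le|]. left. apply Rinv_0_lt_compat, lt_0_INR, lt_O_fact. }
rewrite sum_n_Reals in HL.
exact HL.
Qed.

Lemma pow_fact_lim x : is_lim_seq (fun n => x ^ n / INR (fact n)) 0.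
Proof.
apply ex_series_lim_0. exists (exp x).
apply is_series_ext with (2 := is_exp_Reals x). intros n. rewrite pow_n_pow. reflexivity.
Qed.

Lemma is_RInt_gen_sum a b (f : nat -> R -> R) (v : nat -> R) N :
  (forall n, is_RInt_gen (V := RC) (f n) (lo a) (hi b) (v n)) ->
  is_RInt_gen (V := RC) (fun x => sum_f_R0 (fun n => f n x) N) (lo a) (hi b) (sum_f_R0 v N).
Proof.
intros H. induction N as [|N IH]; simpl; auto.
exact (is_RInt_gen_plus (V := RC) _ _ _ _ IH (H (S N))).
Qed.

(** Coefficients of W_{-al,-nu}. *)
Definition wcoef (al nu : R) (n : nat) : R := rGamma (- al * INR n + - nu) / INR (fact n).

Lemma wcoef_eq al nu n : 0 < al -> 0 <= nu ->
  wcoef al nu n = - sin (PI * (al * INR n + nu)) * Gamma (al * INR n + nu + 1) / PI / INR (fact n).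
Proof.
intros Ha Hnu. unfold wcoef.
replace (- al * INR n + - nu) with (- (al * INR n + nu)) by ring.
rewrite rGamma_neg; auto. assert (0 <= al * INR n) by (apply Rmult_le_pos; [lra|apply pos_INR]). lra.
Qed.

Lemma Intg_pollard nu s al : - 1 < nu -> 0 <= s -> 0 < al < 1 ->
  Intg 0 p_infty (fun r => Rpower r nu * exp (- r) * exp (s * Rpower r al)).
Proof.
intros Hnu Hs Hal.
destruct (sublinear al s (1 / 2) Hal Hs) as [C HC]; [lra|].
apply Intg_le with (fun r => Rpower r (nu + 1 - 1) * exp (- (1 / 2 * r))) (exp C).
- apply Intg_gamma; lra.
- intros r [Hr _]. simpl in Hr. split.
  + apply deriv_cont. unfold Rpower. auto_derive. auto.
  + split.
    * repeat apply Rmult_le_pos; left; try apply Rpower_pos; apply exp_pos.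
    * replace (nu + 1 - 1) with nu by ring. rewrite Rmult_assoc, <- exp_plus.
      replace (exp C * (Rpower r nu * exp (- (1 / 2 * r)))) with (Rpower r nu * (exp C * exp (- (1 / 2 * r)))) by ring.
      rewrite <- exp_plus. apply Rmult_le_compat_l; [left; apply Rpower_pos|].
      apply exp_le. generalize (HC r Hr). lra.
Qed.

Lemma Im_pol_PI nu s al r : 0 < r ->
  Im (pol nu 1 s al PI r) =
  Rpower r nu * exp (- r) * esin (al * PI + PI) (PI * (nu + 1)) (s * Rpower r al).
Proof.
intros Hr. unfold pol, fz, esin.
assert (E : (RtoC (nu + 1) * (ln r, PI) + RtoC 1 * cexp (ln r, PI) - RtoC s * cexp (RtoC al * (ln r, PI)))%C =
   ((nu + 1) * ln r - r - s * Rpower r al * cos (al * PI),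
    (nu + 1) * PI - s * Rpower r al * sin (al * PI))).
{ unfold cexp, Rpower, Cplus, Cminus, Copp, Cplus, Cmult, RtoC, Re, Im; simpl. rewrite cos_PI, sin_PI, exp_ln by auto.
  replace (al * ln r - 0 * PI) with (al * ln r) by ring.
  replace (al * PI + 0 * ln r) with (al * PI) by ring. f_equal; ring. }
rewrite E. rewrite im_scal_l. unfold cexp; simpl.
rewrite neg_cos, neg_sin.
replace ((nu + 1) * ln r - r - s * Rpower r al * cos (al * PI)) with
  ((nu + 1) * ln r + (- r + s * Rpower r al * - cos (al * PI))) by ring.
rewrite !exp_plus.
replace (exp ((nu + 1) * ln r)) with (Rpower r (nu + 1)) by reflexivity.
replace (PI * (nu + 1) + s * Rpower r al * - sin (al * PI)) with ((nu + 1) * PI - s * Rpower r al * sin (al * PI)) by ring.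
rewrite <- (Rpower_div r nu Hr). ring.
Qed.

(** Expanding exp(- s u^al) on the negative real axis and integrating termwise
    gives Gamma factors, which the reflection formula turns into those of the
    power series of the Wright function. *)
Lemma wright_series al nu s : 0 < al < 1 -> 0 <= nu -> 0 < s ->
  is_pseries (wcoef al nu) (- s) (/ PI * II (V := RC) 0 p_infty (fun r => Im (pol nu 1 s al PI r))).
Proof.
intros Hal Hnu Hs. assert (HPI := PI_RGT_0).
set (c := fun n => (- s) ^ n / INR (fact n) * - sin (PI * (al * INR n + nu))).
set (f := fun N r => sum_f_R0 (fun n => c n * (Rpower r (al * INR n + nu) * exp (- r))) N).
assert (Hpos : forall n, 0 <= al * INR n) by (intros n; apply Rmult_le_pos; [lra|apply pos_INR]).
assert (HI : forall N, is_RInt_gen (V := RC) (f N) (lo 0) (hi p_infty)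
   (sum_f_R0 (fun n => c n * Gamma (al * INR n + nu + 1)) N)).
{ intros N. apply is_RInt_gen_sum. intros n.
  apply (is_RInt_gen_scal (V := RC)).
  generalize (Gamma_correct (al * INR n + nu + 1) ltac:(generalize (Hpos n); lra)).
  apply (is_RInt_gen_ext_inn (V := RC)); [simpl; auto|]. intros r _.
  do 2 f_equal. ring. }
assert (Hf : forall N r, 0 < r -> f N r = Rpower r nu * exp (- r) *
  sum_f_R0 (fun m => (s * Rpower r al) ^ m / INR (fact m) * sin (PI * (nu + 1) + INR m * (al * PI + PI))) N).
{ intros N r Hr. unfold f. rewrite scal_sum. apply sum_eq. intros n _. unfold c.
  rewrite Rpower_plus. rewrite <- Rpower_mult, Rpower_pow by apply Rpower_pos.
  replace (PI * (nu + 1) + INR n * (al * PI + PI)) with (- - (PI * (al * INR n + nu) + PI) + INR n * PI) by ring.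
  rewrite sin_add_nPI, sin_neg, neg_sin.
  replace (- s) with (-1 * s) by ring. rewrite !Rpow_mult_distr. field.
  apply not_0_INR, fact_neq_0. }
set (h := fun r => Rpower r nu * exp (- r) * exp (s * Rpower r al)).
assert (Hh : Intg 0 p_infty h) by (apply Intg_pollard; lra).
assert (Hw : forall r, 0 < Rpower r nu * exp (- r)).
{ intros r. apply Rmult_lt_0_compat; [apply Rpower_pos|apply exp_pos]. }
destruct (dominated_convergence (V := RC) eventually 0 p_infty f (fun r => Im (pol nu 1 s al PI r)) h Hh) as [_ HL].
- exists 0%nat. intros N _ r [Hr _]. simpl in Hr. split.
  + unfold f. clear -Hr. induction N as [|N IH]; simpl.
    * apply deriv_cont. unfold Rpower. auto_derive. auto.
    * apply continuous_Rplus; [exact IH|]. apply deriv_cont. unfold Rpower. auto_derive. auto.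
  + rewrite Hf by auto. unfold norm, abs; simpl. rewrite Rabs_mult, Rabs_pos_eq by (left; apply Hw).
    unfold h. apply Rmult_le_compat_l; [left; apply Hw|].
    assert (Hrho : 0 < s * Rpower r al) by (apply Rmult_lt_0_compat; auto; apply Rpower_pos).
    apply Rle_trans with (2 := exp_sum_le (s * Rpower r al) N ltac:(lra)).
    apply Rle_trans with (1 := Rsum_abs _ _). apply sum_Rle. intros n _.
    assert (Hp : 0 <= (s * Rpower r al) ^ n / INR (fact n)).
    { apply Rmult_le_pos; [apply pow_le; lra|]. left. apply Rinv_0_lt_compat, lt_0_INR, lt_O_fact. }
    rewrite Rabs_mult, (Rabs_pos_eq _ Hp). rewrite <- (Rmult_1_r (_ / _)) at 2.
    apply Rmult_le_compat_l; auto.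
    apply Rabs_le. generalize (SIN_bound (PI * (nu + 1) + INR n * (al * PI + PI))). lra.
- intros x y [Hx _] [Hy _] Hxy eps He. simpl in Hx, Hy.
  destruct (Rpower_bound nu x y Hx) as [K [HK HKx]].
  set (R0 := s * Rpower y al).
  assert (HR0 : 0 < R0) by (apply Rmult_lt_0_compat; auto; apply Rpower_pos).
  assert (He0 := exp_pos R0).
  assert (Hd : 0 < eps / (K * exp R0)).
  { apply Rdiv_lt_0_compat; auto. now apply Rmult_lt_0_compat. }
  assert (Hlim := filterlim_eps_inv (V := RC) _ _ _ (pow_fact_lim R0) _ Hd).
  destruct Hlim as [N0 HN0]. exists N0. intros N HN z Hz.
  assert (HN' : (N0 <= S N)%nat) by lia.
  assert (HN1 : Rabs (R0 ^ S N / INR (fact (S N)) - 0) <= eps / (K * exp R0)) by exact (HN0 (S N) HN').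
  rewrite Rminus_0_r in HN1.
  assert (Hz0 : 0 < z) by lra.
  assert (Hrho : 0 < s * Rpower z al) by (apply Rmult_lt_0_compat; auto; apply Rpower_pos).
  assert (Hrho2 : s * Rpower z al <= R0).
  { apply Rmult_le_compat_l; [lra|]. apply Rle_Rpower_l; lra. }
  assert (HTn := esin_taylor (al * PI + PI) (PI * (nu + 1)) (s * Rpower z al) N Hrho).
  change (Rabs (f N z - Im (pol nu 1 s al PI z)) <= eps).
  rewrite Im_pol_PI, Hf by auto. rewrite <- Rmult_minus_distr_l.
  rewrite Rabs_mult, Rabs_pos_eq by (left; apply Hw).
  apply Rle_trans with (K * (R0 ^ S N / INR (fact (S N)) * exp R0)).
  + apply Rmult_le_compat; [left; apply Hw|apply Rabs_pos| |].
    * rewrite <- (Rmult_1_r K). apply Rmult_le_compat; auto; [left; apply Rpower_pos|left; apply exp_pos|].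
      rewrite <- exp_0. apply exp_le. lra.
    * apply Rle_trans with (1 := HTn).
      assert (Hif : 0 < / INR (fact (S N))) by apply Rinv_0_lt_compat, lt_0_INR, lt_O_fact.
      apply Rmult_le_compat; [|left; apply exp_pos| |now apply exp_le].
      -- apply Rmult_le_pos; [apply pow_le|]; lra.
      -- apply Rmult_le_compat_r; [lra|]. apply pow_incr. lra.
  + apply Rle_trans with (K * (eps / (K * exp R0) * exp R0)); [|right; field; lra].
    apply Rmult_le_compat_l; [lra|]. apply Rmult_le_compat_r; [lra|].
    apply Rle_trans with (2 := HN1). apply Rle_abs.
- unfold is_pseries, is_series.
  assert (HL2 := filterlim_comp _ _ _ _ (fun v : R => / PI * v) _ _ _ HL
    (continuous_scal_r (V := R_NormedModule) (/ PI) (fun v => v) _ (continuous_id _))).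
  revert HL2. apply filterlim_ext. intros N.
  rewrite (II_unique (V := RC) _ _ _ _ (HI N)), sum_n_Reals, scal_sum.
  apply sum_eq. intros n _. rewrite wcoef_eq by lra. rewrite pow_n_pow.
  unfold c, scal; simpl. unfold mult; simpl. field. split; [lra|apply not_0_INR, fact_neq_0].
Qed.

Lemma wcoef_radius al nu : 0 < al < 1 -> 0 <= nu -> CV_radius (wcoef al nu) = p_infty.
Proof.
intros Hal Hnu.
assert (H : forall s, 0 < s -> Rbar_le s (CV_radius (wcoef al nu))).
{ intros s Hs. destruct (Rbar_lt_le_dec (CV_radius (wcoef al nu)) s) as [H|H]; auto.
  exfalso. apply (CV_disk_outside (wcoef al nu) (- s)).
  - rewrite Rabs_Ropp, Rabs_pos_eq by lra. exact H.
  - apply ex_series_lim_0. eexists.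
    apply is_series_ext with (2 := wright_series al nu s Hal Hnu Hs).
    intros n. rewrite pow_n_pow. apply Rmult_comm. }
destruct (CV_radius (wcoef al nu)) as [r| |]; auto.
- exfalso. generalize (H (Rabs r + 1) ltac:(generalize (Rabs_pos r); lra)). simpl.
  generalize (Rle_abs r). lra.
- destruct (H 1 Rlt_0_1).
Qed.

(** * Rotation to the imaginary axis *)

Lemma stretch_decay nu k al : - 2 < nu -> 0 < k -> 0 < al -> exists C, 0 < C /\
  forall r, 1 <= r -> Rpower r nu * exp (- (k * Rpower r al)) <= C * Rpower r (- 1 - 1).
Proof.
intros Hnu Hk Hal.
destruct (Rpower_le_exp ((nu + 2) / al) k) as [C [HC HCx]]; auto.
{ apply Rdiv_lt_0_compat; lra. }
exists C. split; auto. intros x Hx.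
assert (H := HCx (Rpower x al) (Rpower_pos x al)).
rewrite Rpower_mult in H. replace (al * ((nu + 2) / al)) with (nu + 2) in H by (field; lra).
replace (Rpower x nu) with (Rpower x (nu + 2) * Rpower x (- 1 - 1)).
2:{ rewrite <- Rpower_plus. f_equal. ring. }
rewrite exp_Ropp.
replace (Rpower x (nu + 2) * Rpower x (-1 - 1) * / exp (k * Rpower x al))
  with (Rpower x (nu + 2) * / exp (k * Rpower x al) * Rpower x (-1 - 1)) by ring.
apply Rmult_le_compat_r; [left; apply Rpower_pos|].
assert (He := exp_pos (k * Rpower x al)).
apply Rmult_le_reg_r with (exp (k * Rpower x al)); auto.
rewrite Rmult_assoc, Rinv_l, Rmult_1_r by lra. exact H.
Qed.

Lemma rotation_exp nu s al p1 p2 C0 k m : - 1 < nu -> 0 < k -> 0 < m -> p1 <= p2 ->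
  (forall phi r, p1 <= phi <= p2 -> 0 < r ->
    r * cos phi - s * (Rpower r al * cos (al * phi)) <= C0 - k * Rpower r m) ->
  is_RInt_gen (V := CC) (pol nu 1 s al p1) (lo 0) (hi p_infty) (II (V := CC) 0 p_infty (pol nu 1 s al p2)) /\
  is_RInt_gen (V := CC) (pol nu 1 s al p2) (lo 0) (hi p_infty) (II (V := CC) 0 p_infty (pol nu 1 s al p2)).
Proof.
intros Hnu Hk Hm Hp H.
destruct (stretch_decay nu k m) as [C [HC HCr]]; try lra.
assert (B : forall phi r, p1 <= phi <= p2 -> 0 < r ->
  Cmod (pol nu 1 s al phi r) <= exp C0 * (Rpower r nu * exp (- (k * Rpower r m)))).
{ intros phi r Hphi Hr. rewrite Cmod_pol by auto.
  replace (exp C0 * (Rpower r nu * exp (- (k * Rpower r m)))) with (Rpower r nu * (exp C0 * exp (- (k * Rpower r m)))) by ring.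
  rewrite <- exp_plus. apply Rmult_le_compat_l; [left; apply Rpower_pos|].
  apply exp_le. generalize (H phi r Hphi Hr). lra. }
assert (He := exp_pos C0).
apply (rotation nu 1 s al p1 p2 (exp C0 * (1 + C)) (nu + 1) 1); try lra.
- intros phi r Hphi Hr. apply Rle_trans with (1 := B phi r Hphi (proj1 Hr)).
  rewrite Rmult_assoc. apply Rmult_le_compat_l; [lra|].
  replace (nu + 1 - 1) with nu by ring.
  assert (Hp0 := Rpower_pos r nu).
  assert (exp (- (k * Rpower r m)) <= 1).
  { rewrite <- exp_0. apply exp_le.
    assert (0 < k * Rpower r m) by (apply Rmult_lt_0_compat; auto; apply Rpower_pos). lra. }
  rewrite Rmult_comm. apply Rmult_le_compat_r; lra.
- intros phi r Hphi Hr. apply Rle_trans with (1 := B phi r Hphi ltac:(lra)).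
  rewrite Rmult_assoc. apply Rmult_le_compat_l; [lra|].
  apply Rle_trans with (1 := HCr r Hr). apply Rmult_le_compat_r; [left; apply Rpower_pos|lra].
Qed.

(** An angle at which both exp(u) and exp(- s u^al) decay. *)
Definition phi1 (al : R) := PI / (1 + al).

Lemma phi1_bounds al : 0 < al < 1 ->
  PI / 2 < phi1 al < PI /\ 0 < cos (al * phi1 al) /\ cos (phi1 al) < 0 /\ 0 < al * phi1 al < PI / 2.
Proof.
intros Hal. assert (HPI := PI_RGT_0). unfold phi1.
assert (H1 : PI / 2 < PI / (1 + al)).
{ unfold Rdiv. apply Rmult_lt_compat_l; [lra|]. apply Rinv_lt_contravar; lra. }
assert (H2 : PI / (1 + al) < PI).
{ apply Rmult_lt_reg_r with (1 + al); [lra|]. unfold Rdiv. rewrite Rmult_assoc, Rinv_l by lra. nra. }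
assert (H3 : al * (PI / (1 + al)) < PI / 2).
{ apply Rmult_lt_reg_r with (1 + al); [lra|].
  replace (al * (PI / (1 + al)) * (1 + al)) with (al * PI) by (field; lra). nra. }
assert (H4 : 0 < al * (PI / (1 + al))) by (apply Rmult_lt_0_compat; lra).
split; [lra|]. split; [apply cos_gt_0; lra|]. split; [apply cos_lt_0; lra|]. lra.
Qed.

Lemma pol_PI_phi1 nu s al : 0 < al < 1 -> - 1 < nu -> 0 <= s ->
  is_RInt_gen (V := CC) (pol nu 1 s al (phi1 al)) (lo 0) (hi p_infty) (II (V := CC) 0 p_infty (pol nu 1 s al PI)) /\
  is_RInt_gen (V := CC) (pol nu 1 s al PI) (lo 0) (hi p_infty) (II (V := CC) 0 p_infty (pol nu 1 s al PI)).
Proof.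
intros Hal Hnu Hs. assert (HPI := PI_RGT_0).
destruct (phi1_bounds al Hal) as [H1 [H2 [H3 H4]]].
destruct (sublinear al s (- cos (phi1 al) / 2) Hal Hs) as [C HC]; [lra|].
apply (rotation_exp nu s al (phi1 al) PI C (- cos (phi1 al) / 2) 1); try lra.
intros phi r Hphi Hr. rewrite Rpower_1 by auto.
assert (Hc : cos phi <= cos (phi1 al)) by (apply cos_decr_1; lra).
assert (r * cos phi <= r * cos (phi1 al)) by (apply Rmult_le_compat_l; lra).
assert (HB := COS_bound (al * phi)). assert (Hp := Rpower_pos r al).
assert (- (s * (Rpower r al * cos (al * phi))) <= s * Rpower r al).
{ replace (- (s * (Rpower r al * cos (al * phi)))) with (s * (Rpower r al * - cos (al * phi))) by ring.
  apply Rmult_le_compat_l; auto. rewrite <- (Rmult_1_r (Rpower r al)) at 2. apply Rmult_le_compat_l; lra. }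
generalize (HC r Hr). lra.
Qed.

(** On the imaginary axis only exp(- s u^al) decays, hence the detour through
    the angle phi1. *)
Lemma pol_phi1_half nu s al : 0 < al < 1 -> - 1 < nu -> 0 < s ->
  is_RInt_gen (V := CC) (pol nu 1 s al (PI / 2)) (lo 0) (hi p_infty) (II (V := CC) 0 p_infty (pol nu 1 s al PI)).
Proof.
intros Hal Hnu Hs. assert (HPI := PI_RGT_0).
destruct (phi1_bounds al Hal) as [H1 [H2 [H3 H4]]].
destruct (pol_PI_phi1 nu s al Hal Hnu ltac:(lra)) as [Q _].
rewrite <- (II_unique (V := CC) _ _ _ _ Q).
apply (rotation_exp nu s al (PI / 2) (phi1 al) 0 (s * cos (al * phi1 al)) al); try lra.
{ now apply Rmult_lt_0_compat. }
intros phi r Hphi Hr.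
assert (Hc : cos phi <= 0).
{ rewrite <- cos_PI2. apply cos_decr_1; lra. }
assert (r * cos phi <= r * 0) by (apply Rmult_le_compat_l; lra).
assert (Hap : al * phi <= al * phi1 al) by (apply Rmult_le_compat_l; lra).
assert (Hap0 : 0 <= al * phi) by (apply Rmult_le_pos; lra).
assert (Hc2 : cos (al * phi1 al) <= cos (al * phi)) by (apply cos_decr_1; lra).
assert (Hp := Rpower_pos r al).
assert (s * (Rpower r al * cos (al * phi1 al)) <= s * (Rpower r al * cos (al * phi))).
{ apply Rmult_le_compat_l; [lra|]. apply Rmult_le_compat_l; lra. }
lra.
Qed.

(** * The vertical contour *)

(** log(c + i y) for y > 0; the formula is smooth up to c = 0. *)
Definition vlog (c y : R) : C := (/ 2 * ln (c ^ 2 + y ^ 2), PI / 2 - atan (c / y)).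

Lemma vlog_pos c y : 0 < y -> 0 < c ^ 2 + y ^ 2.
Proof. intros H. nra. Qed.

Lemma vlog_0 y : 0 < y -> vlog 0 y = (ln y, PI / 2).
Proof.
intros H. unfold vlog. f_equal.
- replace (0 ^ 2 + y ^ 2) with (y * y) by ring. rewrite ln_mult by auto. field.
- unfold Rdiv. rewrite Rmult_0_l, atan_0. ring.
Qed.

Lemma exp_half_ln x : 0 < x -> exp (/ 2 * ln x) = sqrt x.
Proof.
intros H. replace (/ 2 * ln x) with (ln x * / 2) by ring.
rewrite <- (Rpower_sqrt x H). unfold Rpower. f_equal. ring.
Qed.

Lemma cexp_vlog c y : 0 < y -> cexp (vlog c y) = (c, y).
Proof.
intros H. assert (Hp := vlog_pos c y H). unfold vlog, cexp, Re, Im, fst, snd.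
rewrite exp_half_ln by auto. rewrite cos_shift, sin_shift, sin_atan, cos_atan.
assert (E : sqrt (1 + (c / y)²) = sqrt (c ^ 2 + y ^ 2) / y).
{ replace (1 + (c / y)²) with ((c ^ 2 + y ^ 2) / (y ^ 2)) by (unfold Rsqr; field; lra).
  rewrite sqrt_div_alt by nra. f_equal. replace (y ^ 2) with (y * y) by ring. apply sqrt_square. lra. }
rewrite E. assert (Hs : 0 < sqrt (c ^ 2 + y ^ 2)) by now apply sqrt_lt_R0.
f_equal; field; lra.
Qed.

(** 1 / (c + i y) *)
Definition vlog' (c y : R) : C := (c / (c ^ 2 + y ^ 2), - y / (c ^ 2 + y ^ 2)).

Lemma is_derive_vlog_c c y : 0 < y ->
  is_derive (V := CC) (fun c => vlog c y) c (vlog' c y).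
Proof.
intros H. assert (Hp := vlog_pos c y H). apply C_is_derive; unfold vlog, vlog'; simpl Re; simpl Im.
- auto_derive; [simpl in *; lra|]. simpl in *. field. lra.
- auto_derive; [lra|]. assert (0 < 1 + (c / y) ^ 2) by nra. simpl in *. field.
  repeat split; nra.
Qed.

Lemma is_derive_vlog_y c y : 0 < y ->
  is_derive (V := CC) (fun y => vlog c y) y (Ci * vlog' c y)%C.
Proof.
intros H. assert (Hp := vlog_pos c y H). apply C_is_derive; unfold vlog, vlog'; simpl.
- auto_derive; [simpl in *; lra|]. simpl in *. field. lra.
- auto_derive; [lra|]. assert (0 < 1 + (c / y) ^ 2) by nra. simpl in *. field.
  repeat split; nra.
Qed.

Lemma jcont_vlog c y : 0 < y ->
  continuous (U := CC) (fun p : R * R => vlog (fst p) (snd p)) (c, y).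
Proof.
intros H. assert (Hp := vlog_pos c y H). apply C_continuous; unfold vlog; simpl.
- apply continuous_Rmult; [apply continuous_const|]. apply (continuous_ln' (fun p : R * R => fst p * (fst p * 1) + snd p * (snd p * 1))).
  + exact Hp.
  + repeat apply continuous_Rplus; repeat apply continuous_Rmult; try apply continuous_fst; try apply continuous_snd; apply continuous_const.
- apply continuous_Rminus; [apply continuous_const|].
  apply (continuous_Rcomp atan).
  + auto_derive. auto.
  + apply continuous_Rmult; [apply continuous_fst|]. apply (continuous_Rcomp Rinv).
    * simpl. auto_derive. lra.
    * apply continuous_snd.
Qed.

Lemma jcont_vlog' c y : 0 < y ->
  continuous (U := CC) (fun p : R * R => vlog' (fst p) (snd p)) (c, y).
Proof.
intros H. assert (Hp := vlog_pos c y H).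
assert (Hi : continuous (fun p : R * R => / (fst p * (fst p * 1) + snd p * (snd p * 1))) (c, y)).
{ apply (continuous_Rcomp Rinv (fun p : R * R => fst p * (fst p * 1) + snd p * (snd p * 1))).
  - simpl in *. auto_derive. lra.
  - repeat apply continuous_Rplus; repeat apply continuous_Rmult; try apply continuous_fst; try apply continuous_snd; apply continuous_const. }
apply C_continuous; unfold vlog'; simpl; apply continuous_Rmult; auto.
- apply continuous_fst.
- apply continuous_Ropp. apply continuous_snd.
Qed.

(** u^nu exp(t u - s u^al) at u = c + i y. *)
Definition ver (nu t s al c y : R) : C := fz nu t s al (vlog c y).

Lemma jcont_ver nu t s al c y : 0 < y -> jcont (V := CC) (fun y c => ver nu t s al c y) y c.
Proof.
intros H. apply (jcont_swap (V := CC) (fun c y => ver nu t s al c y)). unfold jcont, ver.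
apply continuous_fz. now apply jcont_vlog.
Qed.

(** These are two lower bounds for Re (c + i y)^al. *)
Lemma vlog_Re_lower c y al : 0 <= c -> 0 < y -> 0 < al < 1 ->
  cos (al * (PI / 2)) * Rpower y al <= exp (al * Re (vlog c y)) * cos (al * Im (vlog c y)) /\
  (0 < c -> Rpower c al <= exp (al * Re (vlog c y)) * cos (al * Im (vlog c y))).
Proof.
intros Hc Hy Hal. assert (HPI := PI_RGT_0).
assert (E := cexp_vlog c y Hy).
set (rho := Re (vlog c y)) in *. set (th := Im (vlog c y)) in *.
unfold cexp in E. fold rho th in E. injection E as E1 E2.
assert (Hth : 0 <= th <= PI / 2 /\ (0 < c -> th < PI / 2)).
{ unfold th, vlog; simpl. assert (HB := atan_bound (c / y)).
  assert (0 <= atan (c / y)).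
  { rewrite <- atan_0. destruct Hc as [Hc|<-].
    - left. apply atan_increasing. now apply Rdiv_lt_0_compat.
    - unfold Rdiv. rewrite Rmult_0_l. lra. }
  split; [lra|]. intros Hc'. assert (0 < atan (c / y)); [|lra].
  rewrite <- atan_0. apply atan_increasing. now apply Rdiv_lt_0_compat. }
destruct Hth as [Hth Hth'].
assert (Hath : 0 <= al * th <= al * (PI / 2)).
{ split; [apply Rmult_le_pos; lra|apply Rmult_le_compat_l; lra]. }
assert (HaP : al * (PI / 2) < PI / 2) by nra.
assert (Hcc : cos (al * (PI / 2)) <= cos (al * th)) by (apply cos_decr_1; lra).
assert (Hcp : 0 < cos (al * (PI / 2))) by (apply cos_gt_0; nra).
split.
- rewrite Rmult_comm. apply Rmult_le_compat; try lra.
  + left; apply Rpower_pos.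
  + unfold Rpower. apply exp_le. apply Rmult_le_compat_l; [lra|].
    rewrite <- (ln_exp rho). apply ln_le; auto.
    rewrite <- E2. apply Rle_trans with (exp rho * 1); [|lra]. apply Rmult_le_compat_l; [left; apply exp_pos|].
    apply SIN_bound.
- intros Hc'. specialize (Hth' Hc').
  assert (Hcth : 0 < cos th) by (apply cos_gt_0; lra).
  (* cos (al th) >= (cos th)^al, by monotonicity of the quotient of logarithms *)
  assert (Hlog : al * ln (cos th) <= ln (cos (al * th))).
  { destruct (Req_dec th 0) as [->|Hne].
    - rewrite Rmult_0_r, cos_0, ln_1. lra.
    - assert (Hpos : 0 < th) by lra.
      set (p := fun x => ln (cos (al * x)) - al * ln (cos x)).
      set (dp := fun x => al * (sin x / cos x - sin (al * x) / cos (al * x))).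
      assert (HM : exists x, 0 < x < th /\ p th - p 0 = dp x * (th - 0)).
      { destruct (MVT_cor2 p dp 0 th Hpos) as [x [Hx1 Hx2]].
        - intros x Hx. apply is_derive_Reals. unfold p, dp.
          assert (0 < cos x) by (apply cos_gt_0; lra).
          assert (al * x <= 1 * x) by (apply Rmult_le_compat_r; lra).
          assert (0 <= al * x) by (apply Rmult_le_pos; lra).
          assert (0 < cos (al * x)) by (apply cos_gt_0; lra).
          auto_derive; [lra|]. field. lra.
        - exists x. split; auto. }
      destruct HM as [x [Hx Hp]]. unfold p in Hp. rewrite Rmult_0_r, cos_0, ln_1 in Hp.
      assert (0 <= dp x * (th - 0)); [|lra].
      apply Rmult_le_pos; [|lra]. unfold dp. apply Rmult_le_pos; [lra|].
      assert (Hax : al * x < 1 * x) by (apply Rmult_lt_compat_r; lra).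
      assert (Hax0 : 0 < al * x) by (apply Rmult_lt_0_compat; lra).
      assert (tan (al * x) < tan x) by (apply tan_increasing; lra).
      unfold tan in *. lra. }
  replace (Rpower c al) with (exp (al * rho) * exp (al * ln (cos th))).
  + apply Rmult_le_compat_l; [left; apply exp_pos|].
    rewrite <- (exp_ln (cos (al * th))) by lra. now apply exp_le.
  + rewrite <- exp_plus. unfold Rpower. f_equal. replace (ln c) with (ln (exp rho * cos th)) by now rewrite E1.
    rewrite ln_mult, ln_exp; [ring|apply exp_pos|auto].
Qed.

Lemma vlog_Cmod_bound nu c y : 0 <= nu -> 0 <= c -> 0 < y ->
  exp (nu * Re (vlog c y)) <= Rpower (c + 1) nu * Rpower (1 + y) nu.
Proof.
intros Hnu Hc Hy. rewrite Rpower_mult_distr by lra. unfold Rpower. apply exp_le.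
apply Rmult_le_compat_l; auto. unfold vlog; simpl Re.
assert (Hp := vlog_pos c y Hy).
replace (ln ((c + 1) * (1 + y))) with (/ 2 * ln (((c + 1) * (1 + y)) * ((c + 1) * (1 + y)))).
- apply Rmult_le_compat_l; [lra|]. apply ln_le; auto. nra.
- rewrite ln_mult by nra. field.
Qed.

Lemma Cmod_ver nu t s al c y : 0 < y ->
  Cmod (ver nu t s al c y) =
  exp (nu * Re (vlog c y)) * exp (t * c - s * (exp (al * Re (vlog c y)) * cos (al * Im (vlog c y)))).
Proof.
intros Hy. unfold ver, fz. rewrite Cmod_cexp, <- exp_plus, cexp_vlog by auto. f_equal.
destruct (vlog c y) as [rho th]. unfold cexp; simpl. unfold Re, Im; simpl.
replace (al * rho - 0 * th) with (al * rho) by ring.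
replace (al * th + 0 * rho) with (al * th) by ring. ring.
Qed.

Definition kap (al : R) := cos (al * (PI / 2)).

Lemma kap_pos al : 0 < al < 1 -> 0 < kap al.
Proof. intros Hal. assert (HPI := PI_RGT_0). apply cos_gt_0; nra. Qed.

(** The part th of the decay is kept for the convergence of the integral, the
    rest gives the sharp exponential rate c^al. *)
Lemma ver_bound nu t s al c y th : 0 <= nu -> 0 < al < 1 -> 0 <= c -> 0 < y -> 0 <= s ->
  0 <= th <= 1 -> (c = 0 -> th = 1) ->
  Cmod (ver nu t s al c y) <=
  Rpower (c + 1) nu * exp (t * c - (1 - th) * (s * Rpower c al)) *
    (Rpower (1 + y) nu * exp (- (th * s * kap al * Rpower y al))).
Proof.
intros Hnu Hal Hc Hy Hs Hth Hc0. rewrite Cmod_ver by auto.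
destruct (vlog_Re_lower c y al Hc Hy Hal) as [H1 H2].
set (Q := exp (al * Re (vlog c y)) * cos (al * Im (vlog c y))) in *.
assert (HQ : (1 - th) * (s * Rpower c al) + th * s * kap al * Rpower y al <= s * Q).
{ assert (th * s * (kap al * Rpower y al) <= th * s * Q).
  { apply Rmult_le_compat_l; auto. apply Rmult_le_pos; lra. }
  assert ((1 - th) * (s * Rpower c al) <= (1 - th) * (s * Q)).
  { destruct Hc as [Hc|Hc].
    - apply Rmult_le_compat_l; [lra|]. apply Rmult_le_compat_l; auto.
    - rewrite (Hc0 (eq_sym Hc)). lra. }
  lra. }
replace (Rpower (c + 1) nu * exp (t * c - (1 - th) * (s * Rpower c al)) *
    (Rpower (1 + y) nu * exp (- (th * s * kap al * Rpower y al))))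
 with (Rpower (c + 1) nu * Rpower (1 + y) nu * (exp (t * c - (1 - th) * (s * Rpower c al)) * exp (- (th * s * kap al * Rpower y al)))) by ring.
rewrite <- (exp_plus (t * c - (1 - th) * (s * Rpower c al))).
apply Rmult_le_compat; try (left; apply exp_pos).
- now apply vlog_Cmod_bound.
- apply exp_le. lra.
Qed.

Lemma Intg_one_plus_stretch nu k al : 0 <= nu -> 0 < k -> 0 < al ->
  Intg 0 p_infty (fun y => Rpower (1 + y) nu * exp (- (k * Rpower y al))).
Proof.
intros Hnu Hk Hal.
destruct (stretch_decay nu k al) as [C [HC HCr]]; try lra.
assert (H2 := Rpower_pos 2 nu).
apply Intg_powers with (Rpower 2 nu * (1 + C)) 1 1; try lra.
- intros y Hy. split.
  + apply deriv_cont. unfold Rpower. auto_derive. lra.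
  + apply Rmult_le_pos; left; apply exp_pos.
- intros y Hy. replace (1 - 1) with 0 by ring. rewrite Rpower_O, Rmult_1_r by lra.
  apply Rmult_le_compat; try (left; apply exp_pos).
  + apply Rle_Rpower_l; lra.
  + apply Rle_trans with 1; [|lra]. rewrite <- exp_0. apply exp_le.
    assert (0 < k * Rpower y al) by (apply Rmult_lt_0_compat; auto; apply Rpower_pos). lra.
- intros y Hy.
  apply Rle_trans with (Rpower 2 nu * (Rpower y nu * exp (- (k * Rpower y al)))).
  + rewrite <- Rmult_assoc, Rpower_mult_distr by lra.
    apply Rmult_le_compat_r; [left; apply exp_pos|]. apply Rle_Rpower_l; lra.
  + rewrite Rmult_assoc. apply Rmult_le_compat_l; [lra|].
    apply Rle_trans with (1 := HCr y Hy). apply Rmult_le_compat_r; [left; apply Rpower_pos|lra].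
Qed.

Lemma Re_le_Cmod z : Rabs (Re z) <= Cmod z.
Proof. apply Rle_trans with (2 := Rmax_Cmod z). apply Rmax_l. Qed.

Lemma Im_le_Cmod z : Rabs (Im z) <= Cmod z.
Proof. apply Rle_trans with (2 := Rmax_Cmod z). apply Rmax_r. Qed.

Definition vint (nu t s al c : R) : R := II (V := RC) 0 p_infty (fun y => Re (ver nu t s al c y)).

(** psi_{al,-nu}(t,s), as the inverse Laplace integral of u^nu exp(- s u^al)
    along the imaginary axis. *)
Definition K (nu t s al : R) : R := / PI * vint nu t s al 0.

Lemma continuous_Re_ver nu t s al c y : 0 < y -> continuous (fun y => Re (ver nu t s al c y)) y.
Proof.
intros Hy. apply C_continuous_Re. exact (jcont_l (V := CC) _ _ _ (jcont_ver nu t s al c y Hy)).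
Qed.

Lemma dom_ver nu t s al c th : 0 <= nu -> 0 < al < 1 -> 0 <= c -> 0 < s -> 0 < th <= 1 ->
  (c = 0 -> th = 1) ->
  dominated (V := RC) 0 p_infty (fun y => Re (ver nu t s al c y))
   (fun y => Rpower (c + 1) nu * exp (t * c - (1 - th) * (s * Rpower c al)) *
      (Rpower (1 + y) nu * exp (- (th * s * kap al * Rpower y al)))).
Proof.
intros Hnu Hal Hc Hs Hth Hc0. assert (Hk := kap_pos al Hal). split.
- apply Intg_scal.
  + apply Rmult_le_pos; left; [apply Rpower_pos|apply exp_pos].
  + apply Intg_one_plus_stretch; try lra. repeat apply Rmult_lt_0_compat; lra.
- intros y [Hy _]. simpl in Hy. split; [now apply continuous_Re_ver|].
  apply Rle_trans with (1 := Re_le_Cmod _). apply ver_bound; auto; lra.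
Qed.

Lemma atan_le x : 0 <= x -> 0 <= atan x <= x.
Proof.
intros [Hx|<-]; [|rewrite atan_0; lra].
destruct (MVT_cor2 atan (fun x => / (1 + x ^ 2)) 0 x Hx) as [z [Hz1 Hz2]].
- intros z Hz. apply derivable_pt_lim_atan.
- rewrite atan_0 in Hz1. rewrite !Rminus_0_r in Hz1. rewrite Hz1.
  assert (0 < / (1 + z ^ 2)) by (apply Rinv_0_lt_compat; nra).
  assert (/ (1 + z ^ 2) <= / 1) by (apply Rinv_le_contravar; nra).
  split; [apply Rmult_le_pos; lra|]. rewrite <- (Rmult_1_l x) at 2. apply Rmult_le_compat_r; lra.
Qed.

Lemma Rpower_2_le p : 0 <= p <= 1 -> Rpower 2 p <= 2.
Proof.
intros Hp. apply Rle_trans with (Rpower 2 1); [apply Rle_Rpower; lra|]. rewrite Rpower_1; lra.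
Qed.

Lemma arg_small al c y : 0 < al < 1 -> 0 <= c -> 0 < y ->
  0 <= Im (vlog c y) /\ exp (al * Re (vlog c y)) * Im (vlog c y) <= 4 * Rpower y al.
Proof.
intros Hal Hc Hy. assert (Hp := vlog_pos c y Hy).
assert (Hr : exp (al * Re (vlog c y)) = Rpower (c ^ 2 + y ^ 2) (al / 2)).
{ unfold vlog, Rpower, Re, fst. f_equal. field. }
assert (Hy2 : forall x, 0 < x -> Rpower (x ^ 2) (al / 2) = Rpower x al).
{ intros x Hx. rewrite <- (Rpower_pow 2 x Hx), Rpower_mult. f_equal. simpl. field. }
assert (Hpy := Rpower_pos y al).
rewrite Hr. unfold vlog, Im, snd.
destruct (Rle_dec y c) as [Hyc|Hyc].
- assert (E : PI / 2 - atan (c / y) = atan (y / c)).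
  { replace (y / c) with (/ (c / y)) by (field; lra).
    rewrite atan_inv by (apply Rdiv_lt_0_compat; lra). reflexivity. }
  rewrite E. assert (Hyc0 : 0 <= y / c) by (apply Rmult_le_pos; [lra|left; apply Rinv_0_lt_compat; lra]).
  assert (HA := atan_le (y / c) Hyc0). split; [lra|].
  apply Rle_trans with (2 * Rpower c al * (y / c)).
  + apply Rmult_le_compat; try lra; [left; apply Rpower_pos|].
    apply Rle_trans with (Rpower ((2 * c) ^ 2) (al / 2)).
    * apply Rle_Rpower_l; [lra|]. split; [lra|]. nra.
    * rewrite Hy2, <- Rpower_mult_distr by lra. apply Rmult_le_compat_r; [left; apply Rpower_pos|].
      apply Rpower_2_le. lra.
  + assert (Hm : Rpower c al * (y / c) <= Rpower y al).
    { replace (Rpower c al * (y / c)) with (Rpower c (- (1 - al)) * y).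
      2:{ replace (- (1 - al)) with (al + Ropp 1) by ring. rewrite Rpower_plus, Rpower_Ropp, Rpower_1 by lra. field. lra. }
      replace (Rpower y al) with (Rpower y (- (1 - al)) * y).
      2:{ replace al with (- (1 - al) + 1) at 2 by ring. rewrite Rpower_plus, Rpower_1 by lra. ring. }
      apply Rmult_le_compat_r; [lra|]. rewrite !Rpower_Ropp. apply Rinv_le_contravar; [apply Rpower_pos|].
      apply Rle_Rpower_l; lra. }
    lra.
- assert (HB := atan_bound (c / y)). assert (HP4 := PI_4).
  assert (Hcy0 : 0 <= c / y) by (apply Rmult_le_pos; [lra|left; now apply Rinv_0_lt_compat]).
  assert (HA := atan_le (c / y) Hcy0). split; [lra|].
  replace (4 * Rpower y al) with (2 * Rpower y al * 2) by ring.
  apply Rmult_le_compat; try lra; [left; apply Rpower_pos|].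
  apply Rle_trans with (Rpower ((2 * y) ^ 2) (al / 2)).
  + apply Rle_Rpower_l; [lra|]. split; [lra|]. nra.
  + rewrite Hy2, <- Rpower_mult_distr by lra. apply Rmult_le_compat_r; [left; apply Rpower_pos|].
    apply Rpower_2_le. lra.
Qed.

Lemma sin_abs_le x : Rabs (sin x) <= Rabs x.
Proof.
assert (H : forall x, 0 < x -> Rabs (sin x) <= x).
{ clear. intros x Hx. apply Rabs_le. split.
  - destruct (MVT_cor2 sin cos 0 x Hx) as [z [Hz1 Hz2]].
    + intros z _. apply derivable_pt_lim_sin.
    + rewrite sin_0, !Rminus_0_r in Hz1. rewrite Hz1. generalize (COS_bound z). intros.
      replace (- x) with (-1 * x) by ring. apply Rmult_le_compat_r; lra.
  - left. now apply sin_lt_x. }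
destruct (Rtotal_order x 0) as [Hx|[->|Hx]].
- rewrite <- (Rabs_Ropp x), <- (Rabs_Ropp (sin x)), <- sin_neg. rewrite (Rabs_pos_eq (- x)) by lra. apply H. lra.
- rewrite sin_0. lra.
- rewrite (Rabs_pos_eq x) by lra. auto.
Qed.

(** The integrand is real on the positive axis. At height y the phase of the
    exponential is O(y^al); so is the phase of u^nu times its modulus, for
    nu = 0 and for nu = al, also near u = 0. *)
Lemma Im_ver_small nu t s al c c1 y : nu = 0 \/ nu = al -> 0 < al < 1 -> 0 <= c <= c1 -> 0 <= s ->
  0 < y <= 1 ->
  Rabs (Im (ver nu t s al c y)) <=
   exp (Rabs t * c1) * (4 + Rpower (c1 + 1) nu * Rpower 2 nu * (Rabs t + 4 * s)) * Rpower y al.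
Proof.
intros Hnu Hal Hc Hs Hy.
assert (Hnu0 : 0 <= nu) by (destruct Hnu; lra).
destruct (arg_small al c y Hal ltac:(lra) ltac:(lra)) as [Hth0 Hth].
destruct (vlog_Re_lower c y al ltac:(lra) ltac:(lra) Hal) as [HQ _].
assert (Hmod := vlog_Cmod_bound nu c y Hnu0 ltac:(lra) ltac:(lra)).
set (rho := Re (vlog c y)) in *. set (th := Im (vlog c y)) in *.
assert (E : Im (ver nu t s al c y) = exp (nu * rho) * exp (t * c - s * (exp (al * rho) * cos (al * th))) *
   sin (nu * th + t * y - s * exp (al * rho) * sin (al * th))).
{ unfold ver, fz. rewrite cexp_vlog by lra. rewrite <- exp_plus.
  replace (vlog c y) with (rho, th) by (unfold rho, th; destruct (vlog c y); reflexivity).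
  unfold cexp; simpl. unfold Re, Im; simpl.
  replace (al * rho - 0 * th) with (al * rho) by ring.
  replace (al * th + 0 * rho) with (al * th) by ring. f_equal; f_equal; ring. }
rewrite E, !Rabs_mult, !(Rabs_pos_eq (exp _)) by (left; apply exp_pos).
assert (Hy1 : Rpower y 1 <= Rpower y al).
{ unfold Rpower. apply exp_le.
  assert (ln y <= 0) by (rewrite <- ln_1; apply ln_le; lra). nra. }
rewrite Rpower_1 in Hy1 by lra.
assert (Hpy := Rpower_pos y al).
assert (H1 : exp (t * c - s * (exp (al * rho) * cos (al * th))) <= exp (Rabs t * c1)).
{ apply exp_le.
  assert (0 <= s * (exp (al * rho) * cos (al * th))).
  { apply Rmult_le_pos; auto. apply Rle_trans with (2 := HQ).
    apply Rmult_le_pos; [left; now apply kap_pos|lra]. }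
  assert (t * c <= Rabs t * c) by (apply Rmult_le_compat_r; [lra|apply Rle_abs]).
  assert (Rabs t * c <= Rabs t * c1) by (apply Rmult_le_compat_l; [apply Rabs_pos|lra]). lra. }
assert (H2 : exp (nu * rho) * (nu * th) <= 4 * Rpower y al).
{ destruct Hnu as [->| ->]; [lra|].
  apply Rle_trans with (2 := Hth). apply Rmult_le_compat_l; [left; apply exp_pos|].
  rewrite <- (Rmult_1_l th) at 2. apply Rmult_le_compat_r; lra. }
assert (H3 : exp (nu * rho) <= Rpower (c1 + 1) nu * Rpower 2 nu).
{ apply Rle_trans with (1 := Hmod). apply Rmult_le_compat; try (left; apply exp_pos); apply Rle_Rpower_l; lra. }
assert (H4 : Rabs (sin (nu * th + t * y - s * exp (al * rho) * sin (al * th))) <=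
   nu * th + (Rabs t * Rpower y al + s * (4 * Rpower y al))).
{ apply Rle_trans with (1 := sin_abs_le _). unfold Rminus.
  apply Rle_trans with (1 := Rabs_triang _ _). rewrite Rabs_Ropp.
  assert (A1 : Rabs (nu * th + t * y) <= nu * th + Rabs t * Rpower y al).
  { apply Rle_trans with (1 := Rabs_triang _ _). rewrite !Rabs_mult, (Rabs_pos_eq nu), (Rabs_pos_eq th), (Rabs_pos_eq y) by lra.
    apply Rplus_le_compat_l. apply Rmult_le_compat_l; [apply Rabs_pos|lra]. }
  assert (A2 : Rabs (s * exp (al * rho) * sin (al * th)) <= s * (4 * Rpower y al)).
  { rewrite !Rabs_mult, (Rabs_pos_eq s), (Rabs_pos_eq (exp _)) by (auto; left; apply exp_pos).
    rewrite Rmult_assoc. apply Rmult_le_compat_l; auto. apply Rle_trans with (2 := Hth).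
    apply Rmult_le_compat_l; [left; apply exp_pos|].
    apply Rle_trans with (1 := sin_abs_le _). rewrite Rabs_pos_eq by (apply Rmult_le_pos; lra).
    rewrite <- (Rmult_1_l th) at 2. apply Rmult_le_compat_r; lra. }
  lra. }
set (S := Rabs (sin (nu * th + t * y - s * exp (al * rho) * sin (al * th)))) in *.
assert (HS0 : 0 <= S) by apply Rabs_pos.
replace (exp (nu * rho) * exp (t * c - s * (exp (al * rho) * cos (al * th))) * S)
  with (exp (t * c - s * (exp (al * rho) * cos (al * th))) * (exp (nu * rho) * S)) by ring.
rewrite Rmult_assoc. apply Rmult_le_compat; auto; [left; apply exp_pos| |].
{ apply Rmult_le_pos; auto. left; apply exp_pos. }
apply Rle_trans with (exp (nu * rho) * (nu * th + (Rabs t * Rpower y al + s * (4 * Rpower y al)))).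
{ apply Rmult_le_compat_l; auto. left; apply exp_pos. }
rewrite Rmult_plus_distr_l, Rmult_plus_distr_r. apply Rplus_le_compat; auto.
apply Rle_trans with (Rpower (c1 + 1) nu * Rpower 2 nu * (Rabs t * Rpower y al + s * (4 * Rpower y al))).
- apply Rmult_le_compat_r; auto. apply Rplus_le_le_0_compat.
  + apply Rmult_le_pos; [apply Rabs_pos|lra].
  + apply Rmult_le_pos; lra.
- right. ring.
Qed.

(** The vertical line may be moved from Re u = 0 to Re u = c. *)
Lemma vint_indep nu t s al c : nu = 0 \/ nu = al -> 0 < al < 1 -> 0 < s -> 0 <= c ->
  vint nu t s al c = vint nu t s al 0.
Proof.
intros Hnu Hal Hs Hc.
assert (Hnu0 : 0 <= nu) by (destruct Hnu; lra).
assert (Hk := kap_pos al Hal).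
assert (D : forall c', 0 <= c' -> is_RInt_gen (V := RC) (fun y => Re (ver nu t s al c' y)) (lo 0) (hi p_infty) (vint nu t s al c')).
{ intros c' Hc'. eapply dominated_correct. apply (dom_ver nu t s al c' 1); auto; lra. }
symmetry.
apply (contour_shift (V := RC) (fun y c => Re (ver nu t s al c y)) (fun y c => Im (ver nu t s al c y))
  (fun y c => Re (vlog' c y * dfz nu t s al (vlog c y))%C) 0 p_infty m_infty p_infty 0 c).
- simpl; auto.
- intros y c' [Hy _] _. simpl in Hy. split; [|split; [|split; [|split]]].
  + apply (C_is_derive_Re (fun c => ver nu t s al c y)).
    apply (is_derive_fz nu t s al (fun c => vlog c y)). now apply is_derive_vlog_c.
  + replace (Re (vlog' c' y * dfz nu t s al (vlog c' y))%C) with (Im (Ci * vlog' c' y * dfz nu t s al (vlog c' y))%C).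
    * apply (C_is_derive_Im (fun y => ver nu t s al c' y)).
      apply (is_derive_fz nu t s al (fun y => vlog c' y)). now apply is_derive_vlog_y.
    * destruct (vlog' c' y). destruct (dfz nu t s al (vlog c' y)). unfold Cmult, Ci, Re, Im; simpl. ring.
  + apply (jcont_swap (V := RC) (fun c y => Re (vlog' c y * dfz nu t s al (vlog c y))%C)). unfold jcont.
    apply (C_continuous_Re (fun p : R * R => (vlog' (fst p) (snd p) * dfz nu t s al (vlog (fst p) (snd p)))%C)).
    apply continuous_Cmult; [now apply jcont_vlog'|]. apply continuous_dfz. now apply jcont_vlog.
  + now apply continuous_Re_ver.
  + apply (C_continuous_Im (fun c => ver nu t s al c y)).
    exact (jcont_r (V := CC) _ _ _ (jcont_ver nu t s al c' y Hy)).
- split; simpl; auto.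
- split; simpl; auto.
- exact Hc.
- intros eps He.
  generalize (small_pow_0 (exp (Rabs t * c) * (4 + Rpower (c + 1) nu * Rpower 2 nu * (Rabs t + 4 * s))) al eps ltac:(lra) He).
  apply filter_imp. intros y [Hy Hy2] c' Hc'.
  apply Rle_trans with (2 := Hy2). apply (Im_ver_small nu t s al c' c y); auto; lra.
- intros eps He.
  destruct (stretch_decay nu (s * kap al) al ltac:(lra) ltac:(now apply Rmult_lt_0_compat) ltac:(lra)) as [C [HC HCr]].
  generalize (small_pow_oo (Rpower (c + 1) nu * exp (Rabs t * c) * (Rpower 2 nu * C)) 1 eps Rlt_0_1 He).
  apply filter_imp. intros y [Hy Hy2] c' Hc'.
  apply Rle_trans with (2 := Hy2). apply Rle_trans with (1 := Im_le_Cmod _).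
  apply Rle_trans with (1 := ver_bound nu t s al c' y 1 Hnu0 Hal ltac:(lra) ltac:(lra) ltac:(lra) ltac:(lra) ltac:(auto)).
  rewrite (Rmult_assoc (Rpower (c + 1) nu * exp (Rabs t * c))).
  apply Rmult_le_compat.
  { apply Rmult_le_pos; left; [apply Rpower_pos|apply exp_pos]. }
  { apply Rmult_le_pos; left; [apply Rpower_pos|apply exp_pos]. }
  { apply Rmult_le_compat; try (left; apply exp_pos); [apply Rle_Rpower_l; lra|].
    apply exp_le. assert (t * c' <= Rabs t * c') by (apply Rmult_le_compat_r; [lra|apply Rle_abs]).
    assert (Rabs t * c' <= Rabs t * c) by (apply Rmult_le_compat_l; [apply Rabs_pos|lra]). lra. }
  rewrite Rmult_1_l.
  apply Rle_trans with (Rpower 2 nu * (Rpower y nu * exp (- (s * kap al * Rpower y al)))).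
  + rewrite <- Rmult_assoc, Rpower_mult_distr by lra.
    apply Rmult_le_compat_r; [left; apply exp_pos|]. apply Rle_Rpower_l; lra.
  + rewrite (Rmult_assoc (Rpower 2 nu)). apply Rmult_le_compat_l; [left; apply Rpower_pos|].
    apply Rle_trans with (1 := HCr y Hy). apply Rmult_le_compat_l; [lra|].
    apply Rle_Rpower; lra.
- apply D; lra.
- apply D; lra.
Qed.

(** * The scaled Wright kernels *)

Definition Hst (nu k al : R) : R :=
  II (V := RC) 0 p_infty (fun y => Rpower (1 + y) nu * exp (- (k * Rpower y al))).

Lemma II_scal a b (f : R -> R) k v : is_RInt_gen (V := RC) f (lo a) (hi b) v ->
  II (V := RC) a b (fun x => k * f x) = k * v.
Proof.
intros H. apply (II_unique (V := RC)). exact (is_RInt_gen_scal (V := RC) f k v H).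
Qed.

Lemma vint_bound nu t s al c th : 0 <= nu -> 0 < al < 1 -> 0 <= c -> 0 < s -> 0 < th <= 1 ->
  (c = 0 -> th = 1) ->
  Rabs (vint nu t s al c) <=
  Rpower (c + 1) nu * exp (t * c - (1 - th) * (s * Rpower c al)) * Hst nu (th * s * kap al) al.
Proof.
intros Hnu Hal Hc Hs Hth Hc0. assert (Hk := kap_pos al Hal).
assert (H := II_norm (V := RC) _ _ _ _ (dom_ver nu t s al c th Hnu Hal Hc Hs Hth Hc0)).
rewrite (II_scal _ _ _ _ (Hst nu (th * s * kap al) al)) in H; [exact H|].
eapply (dominated_correct (V := RC)). apply Intg_dominated. apply Intg_one_plus_stretch; try lra.
repeat apply Rmult_lt_0_compat; lra.
Qed.

(** Moving the contour to the right: there is no mass at negative times. *)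
Lemma K_neg nu t s al : nu = 0 \/ nu = al -> 0 < al < 1 -> 0 < s -> t <= 0 -> K nu t s al = 0.
Proof.
intros Hnu Hal Hs Ht. unfold K.
assert (Hnu0 : 0 <= nu) by (destruct Hnu; lra).
assert (Hk := kap_pos al Hal).
set (H0 := Hst nu (1 / 2 * s * kap al) al).
destruct (stretch_decay nu (s / 2) al) as [C [HC HCr]]; try lra.
assert (HB : forall c, 1 <= c -> Rabs (vint nu t s al 0) <= Rpower 2 nu * C * Rabs H0 * Rpower c (- (1))).
{ intros c Hc. rewrite <- (vint_indep nu t s al c) by (auto; lra).
  apply Rle_trans with (1 := vint_bound nu t s al c (1 / 2) Hnu0 Hal ltac:(lra) Hs ltac:(lra) ltac:(lra)).
  fold H0.
  assert (E1 : Rpower (c + 1) nu * exp (t * c - (1 - 1 / 2) * (s * Rpower c al)) <= Rpower 2 nu * C * Rpower c (- (1))).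
  { apply Rle_trans with (Rpower 2 nu * (Rpower c nu * exp (- (s / 2 * Rpower c al)))).
    - rewrite <- (Rmult_assoc (Rpower 2 nu)), Rpower_mult_distr by lra.
      apply Rmult_le_compat; try (left; apply exp_pos); [apply Rle_Rpower_l; lra|].
      apply exp_le. assert (t * c <= 0) by nra. lra.
    - rewrite (Rmult_assoc (Rpower 2 nu)). apply Rmult_le_compat_l; [left; apply Rpower_pos|].
      apply Rle_trans with (1 := HCr c Hc). apply Rmult_le_compat_l; [lra|]. apply Rle_Rpower; lra. }
  apply Rle_trans with (Rpower (c + 1) nu * exp (t * c - (1 - 1 / 2) * (s * Rpower c al)) * Rabs H0).
  - apply Rmult_le_compat_l; [|apply Rle_abs]. apply Rmult_le_pos; left; [apply Rpower_pos|apply exp_pos].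
  - replace (Rpower 2 nu * C * Rabs H0 * Rpower c (- (1))) with (Rpower 2 nu * C * Rpower c (- (1)) * Rabs H0) by ring.
    apply Rmult_le_compat_r; [apply Rabs_pos|auto]. }
assert (Hz : vint nu t s al 0 = 0); [|rewrite Hz; ring].
destruct (Req_dec (vint nu t s al 0) 0) as [Hz|Hz]; auto. exfalso.
assert (Hp := Rabs_pos_lt _ Hz).
destruct (filter_ex _ (small_pow_oo (Rpower 2 nu * C * Rabs H0) 1 (Rabs (vint nu t s al 0) / 2) Rlt_0_1 ltac:(lra))) as [c [Hc Hc2]].
generalize (HB c Hc). lra.
Qed.

Definition wr (al nu z : R) : R := PSeries (wcoef al nu) z.

Lemma Re_ver_pol nu s al y : 0 < y -> Re (ver nu 1 s al 0 y) = Im (pol nu 1 s al (PI / 2) y).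
Proof.
intros Hy. unfold ver, pol. rewrite vlog_0 by auto. rewrite <- fz_shift.
assert (E : cexp (RtoC 1 * (ln y, (PI / 2)%R))%C = (RtoC y * Ci)%C).
{ rewrite Cmult_1_l. unfold cexp, Re, Im, fst, snd. rewrite exp_ln, cos_PI2, sin_PI2 by auto.
  unfold Ci, Cmult, RtoC; simpl. f_equal; ring. }
rewrite E.
replace (RtoC (/ y) * (fz nu 1 s al (ln y, (PI / 2)%R) * (RtoC y * Ci)))%C with
  ((RtoC (/ y) * RtoC y) * (fz nu 1 s al (ln y, (PI / 2)%R) * Ci))%C by ring.
rewrite <- RtoC_mult, Rinv_l by lra.
destruct (fz nu 1 s al (ln y, (PI / 2)%R)). unfold Cmult, Ci, RtoC, Re, Im; simpl. ring.
Qed.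

(** The negative real axis, the ray at angle phi1 and the imaginary axis all
    carry the same integral. *)
Lemma K_wright nu s al : 0 <= nu -> 0 < al < 1 -> 0 < s -> K nu 1 s al = wr al nu (- s).
Proof.
intros Hnu Hal Hs. unfold K, wr. symmetry.
rewrite (is_pseries_unique _ _ _ (wright_series al nu s Hal Hnu Hs)). f_equal.
destruct (pol_PI_phi1 nu s al Hal ltac:(lra) ltac:(lra)) as [_ H1].
assert (H2 := pol_phi1_half nu s al Hal ltac:(lra) Hs).
apply is_RInt_gen_Im in H1. apply is_RInt_gen_Im in H2.
rewrite (II_unique (V := RC) _ _ _ _ H1). symmetry. apply (II_unique (V := RC)).
revert H2. apply (is_RInt_gen_ext_inn (V := RC)); [simpl; auto|].
intros y [Hy _]. symmetry. now apply Re_ver_pol.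
Qed.

(** Substitute y / t for y. *)
Lemma K_scale nu t s al : 0 <= nu -> 0 < al < 1 -> 0 < s -> 0 < t ->
  K nu t s al = Rpower t (- 1 - nu) * K nu 1 (s * Rpower t (- al)) al.
Proof.
intros Hnu Hal Hs Ht. unfold K.
set (s' := s * Rpower t (- al)).
assert (Hs' : 0 < s') by (apply Rmult_lt_0_compat; auto; apply Rpower_pos).
assert (H : is_RInt_gen (V := RC) (fun y => Re (ver nu 1 s' al 0 y)) (lo 0) (hi p_infty) (vint nu 1 s' al 0)).
{ eapply dominated_correct. apply (dom_ver nu 1 s' al 0 1); auto; lra. }
apply (is_RInt_gen_scale (V := RC) _ _ t Ht) in H.
2:{ intros y Hy. now apply continuous_Re_ver. }
apply (is_RInt_gen_scal (V := RC) _ (Rpower t (- 1 - nu))) in H.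
replace (Rpower t (- 1 - nu) * (/ PI * vint nu 1 s' al 0)) with (/ PI * (Rpower t (- 1 - nu) * vint nu 1 s' al 0)) by ring.
f_equal. apply (II_unique (V := RC)). revert H.
apply (is_RInt_gen_ext_inn (V := RC)); [simpl; auto|].
intros y [Hy _]. simpl in Hy.
change (Rpower t (- 1 - nu) * (t * Re (ver nu 1 s' al 0 (t * y))) = Re (ver nu t s al 0 y)).
unfold ver. rewrite !vlog_0 by (auto; now apply Rmult_lt_0_compat).
assert (E : fz nu 1 s' al (ln (t * y), (PI / 2)%R) = (RtoC (Rpower t nu) * fz nu t s al (ln y, (PI / 2)%R))%C).
{ unfold fz.
  assert (El : (ln (t * y), (PI / 2)%R) = (RtoC (ln t) + (ln y, (PI / 2)%R))%C).
  { rewrite ln_mult by auto. unfold Cplus, RtoC; simpl. f_equal; ring. }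
  rewrite El. unfold s'.
  replace (RtoC al * (RtoC (ln t) + (ln y, (PI / 2)%R)))%C with (RtoC (al * ln t) + RtoC al * (ln y, (PI / 2)%R))%C
    by (rewrite RtoC_mult; ring).
  transitivity (cexp (RtoC (nu * ln t) + (RtoC nu * (ln y, (PI / 2)%R) + RtoC t * cexp (ln y, (PI / 2)%R) -
     RtoC s * cexp (RtoC al * (ln y, (PI / 2)%R))))%C).
  2:{ rewrite cexp_plus, cexp_RtoC. reflexivity. }
  f_equal. rewrite !cexp_plus, !cexp_RtoC, exp_ln by auto.
  assert (HAB : Rpower t (- al) * exp (al * ln t) = 1).
  { unfold Rpower. rewrite <- exp_plus. replace (- al * ln t + al * ln t) with 0 by ring. apply exp_0. }
  set (A := Rpower t (- al)) in *. set (B := exp (al * ln t)) in *.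
  assert (HC : (RtoC A * RtoC B)%C = RtoC 1) by (rewrite <- RtoC_mult; now f_equal).
  rewrite !RtoC_mult. set (W := cexp (RtoC al * (ln y, (PI / 2)%R))%C).
  replace (RtoC s * RtoC A * (RtoC B * W))%C with (RtoC s * (RtoC A * RtoC B) * W)%C by ring.
  rewrite HC. ring. }
rewrite E, re_scal_l.
rewrite <- !Rmult_assoc.
replace (Rpower t (- 1 - nu) * t * Rpower t nu) with 1; [ring|].
replace t with (Rpower t 1) at 2 by (now apply Rpower_1).
rewrite <- !Rpower_plus. replace (-1 - nu + 1 + nu) with 0 by ring. now rewrite Rpower_O.
Qed.

(** On the line Re u = c the factor exp(t u) has modulus e^(tc), and
    exp(- s u^al) at most e^(- s c^al). *)
Lemma K_bound nu al c th s0 : nu = 0 \/ nu = al -> 0 < al < 1 -> 0 < c -> 0 < th < 1 -> 0 < s0 ->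
  exists C, 0 <= C /\ forall t s, s0 <= s -> Rabs (K nu t s al) <= C * exp (t * c - (1 - th) * (s * Rpower c al)).
Proof.
intros Hnu Hal Hc Hth Hs0. assert (Hk := kap_pos al Hal).
assert (Hnu0 : 0 <= nu) by (destruct Hnu; lra). assert (HPI := PI_RGT_0).
assert (Hpos : forall s, 0 < s -> Intg 0 p_infty (fun y => Rpower (1 + y) nu * exp (- (th * s * kap al * Rpower y al)))).
{ intros s Hs. apply Intg_one_plus_stretch; try lra. repeat apply Rmult_lt_0_compat; lra. }
exists (/ PI * Rpower (c + 1) nu * Hst nu (th * s0 * kap al) al). split.
{ repeat apply Rmult_le_pos; [left; now apply Rinv_0_lt_compat|left; apply Rpower_pos|].
  apply II_pos. auto. }
intros t s Hs. unfold K. rewrite Rabs_mult, (Rabs_pos_eq (/ PI)) by (left; now apply Rinv_0_lt_compat).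
rewrite !Rmult_assoc. apply Rmult_le_compat_l; [left; now apply Rinv_0_lt_compat|].
rewrite <- (vint_indep nu t s al c) by (auto; lra).
apply Rle_trans with (1 := vint_bound nu t s al c th Hnu0 Hal ltac:(lra) ltac:(lra) ltac:(lra) ltac:(lra)).
rewrite Rmult_assoc. apply Rmult_le_compat_l; [left; apply Rpower_pos|].
rewrite (Rmult_comm (Hst _ _ _)). apply Rmult_le_compat_l; [left; apply exp_pos|].
rewrite <- (Rmult_assoc th). unfold Hst.
refine (Rle_trans _ _ _ (Rle_abs _) (II_norm (V := RC) 0 p_infty (fun y => Rpower (1 + y) nu * exp (- (th * s * kap al * Rpower y al)))
  (fun y => Rpower (1 + y) nu * exp (- (th * s0 * kap al * Rpower y al))) _)).
split; [apply Hpos; lra|].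
intros y [Hy _]. simpl in Hy.
assert (Hpy := Rpower_pos y al).
split.
- apply deriv_cont. unfold Rpower. auto_derive. lra.
- unfold norm; simpl; unfold abs; simpl. rewrite Rabs_pos_eq by (apply Rmult_le_pos; left; apply exp_pos).
  apply Rmult_le_compat_l; [left; apply exp_pos|]. apply exp_le. apply Ropp_le_contravar.
  apply Rmult_le_compat_r; [lra|]. apply Rmult_le_compat_r; [lra|]. apply Rmult_le_compat_l; lra.
Qed.

(** Minus the derivative of psi_{al,0}(t, .); this is psi_{al,-al}. *)
Definition kker (al t s : R) : R := Rpower t (- 1 - al) * wr al al (- (s * Rpower t (- al))).

Lemma kker_K al t s : 0 < al < 1 -> 0 < t -> 0 < s -> kker al t s = K al t s al.
Proof.
intros Hal Ht Hs. unfold kker. rewrite K_scale, K_wright; auto; try lra.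
apply Rmult_lt_0_compat; auto. apply Rpower_pos.
Qed.

Lemma psi_wr al t s : 0 < al < 1 -> 0 < t -> psi al 0 t s = / t * wr al 0 (- (s * Rpower t (- al))).
Proof.
intros Hal Ht. unfold psi, Wright, wr. f_equal.
- replace (0 - 1) with (- (1)) by ring. rewrite Rpower_Ropp, Rpower_1; auto.
- replace (- s * Rpower t (- al)) with (- (s * Rpower t (- al))) by ring.
  apply PSeries_ext. intros n. unfold wcoef. now rewrite Ropp_0.
Qed.

Lemma is_derive_wr al nu z : 0 < al < 1 -> 0 <= nu ->
  is_derive (wr al nu) z (wr al (al + nu) z).
Proof.
intros Hal Hnu. unfold wr.
replace (PSeries (wcoef al (al + nu)) z) with (PSeries (PS_derive (wcoef al nu)) z).
- apply is_derive_PSeries. rewrite wcoef_radius by auto. simpl. auto.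
- apply PSeries_ext. intros n. unfold PS_derive, wcoef. rewrite S_INR.
  replace (- al * (INR n + 1) + - nu) with (- al * INR n + - (al + nu)) by ring.
  rewrite fact_simpl, mult_INR, S_INR. field. split.
  + apply not_0_INR, fact_neq_0.
  + generalize (pos_INR n). lra.
Qed.

Lemma continuous_wr al nu z : 0 < al < 1 -> 0 <= nu -> continuous (wr al nu) z.
Proof. intros Hal Hnu. apply deriv_cont. eexists. now apply is_derive_wr. Qed.

Lemma is_derive_psi al t s : 0 < al < 1 -> 0 < t -> is_derive (psi al 0 t) s (- kker al t s).
Proof.
intros Hal Ht.
apply (is_derive_ext (fun s => / t * wr al 0 (- (s * Rpower t (- al))))).
{ intros x. symmetry. now apply psi_wr. }
replace (- kker al t s) with (/ t * (- Rpower t (- al) * wr al (al + 0) (- (s * Rpower t (- al))))).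
- apply is_derive_scal.
  apply (is_derive_comp (V := R_NormedModule) (wr al 0) (fun s => - (s * Rpower t (- al)))).
  + apply is_derive_wr; auto; lra.
  + auto_derive; auto. ring.
- unfold kker. rewrite Rplus_0_r. unfold Rminus. rewrite Rpower_plus.
  replace (Rpower t (-1)) with (/ t); [ring|].
  rewrite <- (Rpower_1 t Ht) at 1. symmetry. exact (Rpower_Ropp t 1).
Qed.

Lemma continuous_psi al t s : 0 < al < 1 -> 0 < t -> continuous (psi al 0 t) s.
Proof. intros Hal Ht. apply deriv_cont. eexists. now apply is_derive_psi. Qed.

Lemma jcont_kker al t s : 0 < al < 1 -> 0 < t -> jcont (V := RC) (kker al) t s.
Proof.
intros Hal Ht. unfold jcont, kker. apply continuous_Rmult.
- apply (continuous_Rpower' (fun p : R * R => fst p)); [exact Ht|apply continuous_fst].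
- apply (continuous_comp (fun p : R * R => - (snd p * Rpower (fst p) (- al))) (wr al al)).
  + apply continuous_Ropp. apply continuous_Rmult; [apply continuous_snd|].
    apply (continuous_Rpower' (fun p : R * R => fst p)); [exact Ht|apply continuous_fst].
  + apply continuous_wr; auto; lra.
Qed.

(** The rate c^al in [K_bound] can be made arbitrarily large. *)
Lemma wr_decay al nu N : nu = 0 \/ nu = al -> 0 < al < 1 -> 0 < N ->
  exists C, 0 < C /\ forall x, 0 <= x -> Rabs (wr al nu (- x)) <= C * exp (- (N * x)).
Proof.
intros Hnu Hal HN. assert (Hnu0 : 0 <= nu) by (destruct Hnu; lra).
(* with th = 1/2 in K_bound the rate is c^al / 2 = N *)
set (c := Rpower (2 * N) (/ al)).
assert (Hc : 0 < c) by apply Rpower_pos.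
assert (Hca : Rpower c al = 2 * N).
{ unfold c. rewrite Rpower_mult, Rinv_l, Rpower_1; lra. }
destruct (K_bound nu al c (1 / 2) 1 Hnu Hal Hc ltac:(lra) Rlt_0_1) as [C1 [HC1 HB]].
destruct (continuity_ab_maj (fun x => Rabs (wr al nu (- x))) 0 1) as [m [Hm _]]; [lra| |].
{ intros x _. apply continuity_pt_filterlim. apply (continuous_comp (fun x => wr al nu (- x)) Rabs); [|apply continuous_Rabs].
  apply (continuous_comp Ropp (wr al nu)); [apply continuous_Ropp; apply continuous_id|]. now apply continuous_wr. }
set (M := Rabs (wr al nu (- m))). assert (HM : 0 <= M) by apply Rabs_pos.
assert (He1 := exp_pos N). assert (Hec := exp_pos c).
exists (C1 * exp c + M * exp N + 1). split.
{ assert (0 <= C1 * exp c) by (apply Rmult_le_pos; lra). assert (0 <= M * exp N) by (apply Rmult_le_pos; lra). lra. }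
intros x Hx.
assert (Hex := exp_pos (- (N * x))).
assert (P1 : 0 <= C1 * exp c) by (apply Rmult_le_pos; lra). assert (P2 : 0 <= M * exp N) by (apply Rmult_le_pos; lra).
destruct (Rle_dec x 1) as [Hx1|Hx1].
- apply Rle_trans with (1 := Hm x (conj Hx Hx1)). fold M.
  apply Rle_trans with (M * exp N * exp (- (N * x))).
  + rewrite Rmult_assoc, <- exp_plus. rewrite <- (Rmult_1_r M) at 1. apply Rmult_le_compat_l; auto.
    rewrite <- exp_0. apply exp_le. nra.
  + apply Rmult_le_compat_r; lra.
- rewrite <- K_wright by (auto; lra).
  apply Rle_trans with (1 := HB 1 x ltac:(lra)). rewrite Hca.
  apply Rle_trans with (C1 * exp c * exp (- (N * x))).
  + rewrite Rmult_assoc, <- exp_plus. right. do 2 f_equal. field.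
  + apply Rmult_le_compat_r; lra.
Qed.

(** * Fractional integration of the kernel *)

Lemma vlog_Im_bound c y : 0 < c -> 0 < y -> 0 < Im (vlog c y) < PI / 2.
Proof.
intros Hc Hy. unfold vlog, Im, snd. assert (HB := atan_bound (c / y)).
assert (0 < atan (c / y)); [|lra].
rewrite <- atan_0. apply atan_increasing. now apply Rdiv_lt_0_compat.
Qed.

Lemma ver_shift_s nu t s v al c y :
  ver nu t (s + v) al c y = (ver nu t s al c y * cexp (- (RtoC v * cexp (RtoC al * vlog c y))))%C.
Proof.
unfold ver, fz. rewrite <- cexp_plus. f_equal. rewrite RtoC_plus. ring.
Qed.

Lemma ver_shift_t nu t s v al c y :
  ver nu (t - v) s al c y = (ver nu t s al c y * cexp (- (RtoC v * cexp (vlog c y))))%C.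
Proof.
unfold ver, fz. rewrite <- cexp_plus. f_equal. rewrite RtoC_minus. ring.
Qed.

Lemma Re_RtoC_l r z : Re (RtoC r * z)%C = r * Re z.
Proof. destruct z; unfold Cmult, RtoC, Re; simpl; ring. Qed.

Lemma jcont_Re_ver nu al c y v (ft fs : R -> R) : 0 < y -> continuous ft v -> continuous fs v ->
  jcont (V := RC) (fun v y => Re (ver nu (ft v) (fs v) al c y)) v y.
Proof.
intros Hy Ht Hs. unfold jcont, ver, fz. apply C_continuous_Re.
assert (Hv : continuous (U := CC) (fun p : R * R => vlog c (snd p)) (v, y)).
{ apply (continuous_comp (fun p : R * R => snd p) (fun y => vlog c y) (v, y)); [apply continuous_snd|].
  exact (jcont_r (V := CC) _ _ _ (jcont_vlog c y Hy)). }
assert (H1 : continuous (fun p : R * R => ft (fst p)) (v, y)).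
{ apply (continuous_comp (fun p : R * R => fst p) ft (v, y)); [apply continuous_fst|exact Ht]. }
assert (H2 : continuous (fun p : R * R => fs (fst p)) (v, y)).
{ apply (continuous_comp (fun p : R * R => fst p) fs (v, y)); [apply continuous_fst|exact Hs]. }
ccont.
Qed.

(** A Gamma integral in v at each point of the vertical contour. *)
Lemma vertical_fubini b (L : R -> C) (M : R -> C) (S : R -> R) (p q : R -> R) (f : R -> R -> R) :
  0 < b ->
  Intg 0 p_infty p -> Intg 0 p_infty q ->
  (forall y, 0 < y -> Rabs (Im (L y)) < PI / 2) ->
  (forall v y, 0 < v -> 0 < y -> jcont (V := RC) f v y) ->
  (forall v y, 0 < v -> 0 < y -> Rabs (f v y) <= p v * q y) ->
  (forall v y, 0 < v -> 0 < y -> f v y = Re (M y * (RtoC (Rpower v (b - 1)) * cexp (- (RtoC v * cexp (L y)))))%C) ->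
  (forall v, 0 < v -> II (V := RC) 0 p_infty (f v) = S v) ->
  is_RInt_gen (V := RC) S (lo 0) (hi p_infty)
    (Gamma b * II (V := RC) 0 p_infty (fun y => Re (M y * cexp (- (RtoC b * L y)))%C)) /\
  (forall v, 0 < v -> continuous S v).
Proof.
intros Hb Hp Hq HL Hj Hbd Hf HS.
destruct (fubini (V := RC) 0 p_infty 0 p_infty f p q Hp Hq) as [D1 [D2 E]].
{ intros v y [Hv _] [Hy _]. split; [now apply Hj|now apply Hbd]. }
assert (EI : forall y, 0 < y -> II (V := RC) 0 p_infty (fun v => f v y) = Gamma b * Re (M y * cexp (- (RtoC b * L y)))%C).
{ intros y Hy. apply (II_unique (V := RC)).
  assert (H := is_RInt_gen_Cmult _ _ _ _ (M y) (cgamma b (L y) Hb (HL y Hy))).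
  apply is_RInt_gen_Re in H.
  replace (Gamma b * Re (M y * cexp (- (RtoC b * L y)))%C) with (Re (M y * (cexp (- (RtoC b * L y)) * RtoC (Gamma b)))%C).
  - revert H. apply (is_RInt_gen_ext_inn (V := RC)); [simpl; auto|].
    intros v [Hv _]. symmetry. now apply Hf.
  - rewrite <- Re_RtoC_l. f_equal. ring. }
assert (HG : is_RInt_gen (V := RC) (fun y => Gamma b * Re (M y * cexp (- (RtoC b * L y)))%C) (lo 0) (hi p_infty)
   (II (V := RC) 0 p_infty (fun v => II (V := RC) 0 p_infty (f v)))).
{ rewrite E. generalize (dominated_correct (V := RC) _ _ _ _ D2).
  apply (is_RInt_gen_ext_inn (V := RC)); [simpl; auto|]. intros y [Hy _]. now apply EI. }
assert (HG2 := is_RInt_gen_scal (V := RC) _ (/ Gamma b) _ HG).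
assert (HGp := Gamma_pos b Hb).
assert (EV : II (V := RC) 0 p_infty (fun v => II (V := RC) 0 p_infty (f v)) =
  Gamma b * II (V := RC) 0 p_infty (fun y => Re (M y * cexp (- (RtoC b * L y)))%C)).
{ rewrite (II_unique (V := RC) 0 p_infty (fun y => Re (M y * cexp (- (RtoC b * L y)))%C)
     (/ Gamma b * II (V := RC) 0 p_infty (fun v => II (V := RC) 0 p_infty (f v)))).
  - symmetry. apply Rinv_cancel_l. lra.
  - revert HG2. apply (is_RInt_gen_ext_inn (V := RC)); [simpl; auto|]. intros y _.
    apply Rinv_cancel_r. lra. }
split.
- rewrite <- EV. generalize (dominated_correct (V := RC) _ _ _ _ D1).
  apply (is_RInt_gen_ext_inn (V := RC)); [simpl; auto|]. intros v [Hv _]. now apply HS.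
- intros v Hv. apply continuous_ext_loc with (fun v => II (V := RC) 0 p_infty (f v)).
  + assert (Hi : inn 0 p_infty v) by (split; simpl; auto).
    generalize (locally_inn 0 p_infty v Hi). apply filter_imp. intros z [Hz _]. now apply HS.
  + apply D1. split; simpl; auto.
Qed.

Lemma vint_K nu t s al c : nu = 0 \/ nu = al -> 0 < al < 1 -> 0 < s -> 0 <= c ->
  vint nu t s al c = PI * K nu t s al.
Proof.
intros Hnu Hal Hs Hc. unfold K. rewrite vint_indep by auto. field. apply PI_neq0.
Qed.

Lemma II_ext_eq {V : RNM} a b (f g : R -> V) : (forall x, f x = g x) -> II a b f = II a b g.
Proof.
intros H. f_equal. apply FunctionalExtensionality.functional_extensionality. exact H.
Qed.

(** Fractional integration of order al*eta in t acts on the kernel as (right)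
    fractional integration of order eta in s: both multiply the integrand of
    the contour integral by u^(- al eta). *)
Lemma kernel_convolution al eta t r : 0 < al < 1 -> 0 < eta -> 0 < t -> 0 < r ->
  exists v : R,
    is_RInt_gen (V := RC) (fun s => g (al * eta) (t - s) * kker al s r) (lo 0) (hi t) v /\
    is_RInt_gen (V := RC) (fun v => g eta v * kker al t (r + v)) (lo 0) (hi p_infty) v.
Proof.
intros Hal Heta Ht Hr. assert (HPI := PI_RGT_0). assert (Hk := kap_pos al Hal).
set (b := al * eta). assert (Hb : 0 < b) by (unfold b; apply Rmult_lt_0_compat; lra).
set (M := fun y => ver al t r al 1 y).
set (W := II (V := RC) 0 p_infty (fun y => Re (M y * cexp (- (RtoC b * vlog 1 y)))%C)).
assert (Hq : Intg 0 p_infty (fun y => Rpower (1 + y) al * exp (- (1 / 2 * r * kap al * Rpower y al)))).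
{ apply Intg_one_plus_stretch; try lra. repeat apply Rmult_lt_0_compat; lra. }
assert (Hal1 : al = 0 \/ al = al) by (right; reflexivity).
destruct (vertical_fubini b (fun y => vlog 1 y) M (fun v => Rpower v (b - 1) * (PI * K al (t - v) r al))
  (fun v => Rpower (1 + 1) al * exp t * (Rpower v (b - 1) * exp (- (1 * v))))
  (fun y => Rpower (1 + y) al * exp (- (1 / 2 * r * kap al * Rpower y al)))
  (fun v y => Rpower v (b - 1) * Re (ver al (t - v) r al 1 y))) as [H1 C1]; auto.
{ apply Intg_scal; [|apply Intg_gamma; lra]. apply Rmult_le_pos; left; apply exp_pos. }
{ intros y Hy. destruct (vlog_Im_bound 1 y Rlt_0_1 Hy). rewrite Rabs_pos_eq; lra. }
{ intros v y Hv Hy. unfold jcont. apply continuous_Rmult.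
  - apply (continuous_Rpower' (fun p : R * R => fst p)); [exact Hv|apply continuous_fst].
  - apply (jcont_Re_ver al al 1 y v (fun v => t - v) (fun _ => r)); auto; [|apply continuous_const].
    apply continuous_Rminus; [apply continuous_const|apply continuous_id]. }
{ intros v y Hv Hy. rewrite Rabs_mult, (Rabs_pos_eq (Rpower _ _)) by (left; apply Rpower_pos).
  replace (Rpower (1 + 1) al * exp t * (Rpower v (b - 1) * exp (- (1 * v))) * (Rpower (1 + y) al * exp (- (1 / 2 * r * kap al * Rpower y al))))
   with (Rpower v (b - 1) * (Rpower (1 + 1) al * (exp t * exp (- (1 * v))) * (Rpower (1 + y) al * exp (- (1 / 2 * r * kap al * Rpower y al))))) by ring.
  apply Rmult_le_compat_l; [left; apply Rpower_pos|].
  apply Rle_trans with (1 := Re_le_Cmod _).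
  apply Rle_trans with (1 := ver_bound al (t - v) r al 1 y (1 / 2) ltac:(lra) Hal ltac:(lra) Hy ltac:(lra) ltac:(lra) ltac:(lra)).
  rewrite <- exp_plus. apply Rmult_le_compat_r; [apply Rmult_le_pos; left; apply exp_pos|].
  apply Rmult_le_compat_l; [left; apply Rpower_pos|]. apply exp_le. rewrite Rpower_1_l. lra. }
{ intros v y Hv Hy. rewrite ver_shift_t. fold (M y). rewrite <- Re_RtoC_l. f_equal. ring. }
{ intros v Hv. rewrite (II_scal _ _ _ _ (vint al (t - v) r al 1)).
  - now rewrite vint_K by (auto; lra).
  - eapply (dominated_correct (V := RC)). apply (dom_ver al (t - v) r al 1 1); auto; lra. }
destruct (vertical_fubini eta (fun y => (RtoC al * vlog 1 y)%C) M (fun v => Rpower v (eta - 1) * (PI * K al t (r + v) al))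
  (fun v => Rpower (1 + 1) al * exp t * (Rpower v (eta - 1) * exp (- (1 / 2 * v))))
  (fun y => Rpower (1 + y) al * exp (- (1 / 2 * r * kap al * Rpower y al)))
  (fun v y => Rpower v (eta - 1) * Re (ver al t (r + v) al 1 y))) as [H2 _]; auto.
{ apply Intg_scal; [|apply Intg_gamma; lra]. apply Rmult_le_pos; left; apply exp_pos. }
{ intros y Hy. destruct (vlog_Im_bound 1 y Rlt_0_1 Hy). rewrite im_scal_l.
  rewrite Rabs_pos_eq; [nra|]. apply Rmult_le_pos; lra. }
{ intros v y Hv Hy. unfold jcont. apply continuous_Rmult.
  - apply (continuous_Rpower' (fun p : R * R => fst p)); [exact Hv|apply continuous_fst].
  - apply (jcont_Re_ver al al 1 y v (fun _ => t) (fun v => r + v)); auto; [apply continuous_const|].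
    apply continuous_Rplus; [apply continuous_const|apply continuous_id]. }
{ intros v y Hv Hy. rewrite Rabs_mult, (Rabs_pos_eq (Rpower _ _)) by (left; apply Rpower_pos).
  replace (Rpower (1 + 1) al * exp t * (Rpower v (eta - 1) * exp (- (1 / 2 * v))) * (Rpower (1 + y) al * exp (- (1 / 2 * r * kap al * Rpower y al))))
   with (Rpower v (eta - 1) * (Rpower (1 + 1) al * (exp t * exp (- (1 / 2 * v))) * (Rpower (1 + y) al * exp (- (1 / 2 * r * kap al * Rpower y al))))) by ring.
  apply Rmult_le_compat_l; [left; apply Rpower_pos|].
  apply Rle_trans with (1 := Re_le_Cmod _).
  apply Rle_trans with (1 := ver_bound al t (r + v) al 1 y (1 / 2) ltac:(lra) Hal ltac:(lra) Hy ltac:(lra) ltac:(lra) ltac:(lra)).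
  rewrite <- (exp_plus t). apply Rmult_le_compat.
  - apply Rmult_le_pos; left; apply exp_pos.
  - apply Rmult_le_pos; left; apply exp_pos.
  - apply Rmult_le_compat_l; [left; apply Rpower_pos|]. apply exp_le. rewrite Rpower_1_l. lra.
  - apply Rmult_le_compat_l; [left; apply Rpower_pos|]. apply exp_le. apply Ropp_le_contravar.
    apply Rmult_le_compat_r; [left; apply Rpower_pos|]. apply Rmult_le_compat_r; lra. }
{ intros v y Hv Hy. rewrite ver_shift_s. fold (M y). rewrite <- Re_RtoC_l. f_equal. ring. }
{ intros v Hv. rewrite (II_scal _ _ _ _ (vint al t (r + v) al 1)).
  - rewrite vint_K by (auto; lra). reflexivity.
  - eapply (dominated_correct (V := RC)). apply (dom_ver al t (r + v) al 1 1); auto; lra. }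
assert (EW : II (V := RC) 0 p_infty (fun y => Re (M y * cexp (- (RtoC eta * (RtoC al * vlog 1 y))))%C) = W).
{ unfold W. apply II_ext_eq. intros y. unfold b. rewrite RtoC_mult. f_equal. f_equal. f_equal. ring. }
rewrite EW in H2. fold W in H1.
assert (HGb := Gamma_pos b Hb). assert (HGe := Gamma_pos eta Heta).
exists (/ PI * W). split.
- apply (is_RInt_gen_cut (V := RC) _ p_infty t _ Ht I) in H1.
  2:{ intros v [Hv _]. now apply C1. }
  2:{ intros v Hv. rewrite K_neg by (auto; lra). rewrite Rmult_0_r. exact (Rmult_0_r _). }
  apply (is_RInt_gen_reflect (V := RC) _ t _ Ht) in H1.
  2:{ intros v Hv. apply C1. lra. }
  apply (is_RInt_gen_scal (V := RC) _ (/ (PI * Gamma b))) in H1.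
  replace (/ PI * W) with (/ (PI * Gamma b) * (Gamma b * W)) by (field; lra).
  revert H1. apply (is_RInt_gen_ext_inn (V := RC)); [simpl; auto|].
  intros s [Hs Hst]. simpl in Hs, Hst.
  rewrite kker_K by auto. replace (t - (t - s)) with s by ring.
  assert (Q : forall P k : R, / (PI * Gamma b) * (P * (PI * k)) = P / Gamma b * k) by (intros; field; lra).
  apply Q.
- apply (is_RInt_gen_scal (V := RC) _ (/ (PI * Gamma eta))) in H2.
  replace (/ PI * W) with (/ (PI * Gamma eta) * (Gamma eta * W)) by (field; lra).
  revert H2. apply (is_RInt_gen_ext_inn (V := RC)); [simpl; auto|].
  intros v [Hv _]. simpl in Hv.
  rewrite kker_K by (auto; lra).
  assert (Q : forall P k : R, / (PI * Gamma eta) * (P * (PI * k)) = P / Gamma eta * k) by (intros; field; lra).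
  apply Q.
Qed.

(** The substitution u = s / (t - s) gives the Beta integral. *)
Lemma g_convolution a b t : 0 < a -> 0 < b -> 0 < t ->
  is_RInt_gen (V := RC) (fun s => g a (t - s) * g b s) (lo 0) (hi t) (g (a + b) t).
Proof.
intros Ha Hb Ht.
assert (HGa := Gamma_pos a Ha). assert (HGb := Gamma_pos b Hb). assert (HGab := Gamma_pos (a + b) ltac:(lra)).
assert (H : is_RInt_gen (V := RC) (fun s => scal (t / (t - s) ^ 2)
  (Rpower (s / (t - s)) (b - 1) * Rpower (1 + s / (t - s)) (- (a + b)))) (lo 0) (hi t)
  (Gamma a * Gamma b / Gamma (a + b))).
{ apply (is_RInt_gen_subst (V := RC) 0 p_infty 0 t
    (fun u => Rpower u (b - 1) * Rpower (1 + u) (- (a + b))) (fun s => s / (t - s)) (fun s => t / (t - s) ^ 2)).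
  - exact Ht.
  - intros s [Hs Hst]; simpl in Hs, Hst. split; [|split].
    + split; simpl; auto. apply Rdiv_lt_0_compat; lra.
    + auto_derive; [lra|field; lra].
    + apply deriv_cont. auto_derive. apply Rmult_integral_contrapositive. split; lra.
  - intros u [Hu _]; simpl in Hu. apply deriv_cont. unfold Rpower. auto_derive. lra.
  - intros P [e He].
    assert (Hd : 0 < Rmin (t / 2) (e * (t / 2))).
    { apply Rmin_glb_lt; [lra|]. apply Rmult_lt_0_compat; [apply cond_pos|lra]. }
    exists (mkposreal _ Hd). intros s Hs Hs0.
    assert (Hs' : Rabs (s - 0) < Rmin (t / 2) (e * (t / 2))) by exact Hs.
    rewrite Rminus_0_r, Rabs_pos_eq in Hs' by lra.
    assert (Hs1 : s < t / 2) by (apply Rlt_le_trans with (1 := Hs'); apply Rmin_l).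
    assert (Hs2 : s < e * (t / 2)) by (apply Rlt_le_trans with (1 := Hs'); apply Rmin_r).
    assert (Hsp : 0 < s / (t - s)) by (apply Rdiv_lt_0_compat; lra).
    apply He; auto. change (Rabs (s / (t - s) - 0) < e). rewrite Rminus_0_r, Rabs_pos_eq by lra.
    apply Rmult_lt_reg_r with (t - s); [lra|]. unfold Rdiv. rewrite Rmult_assoc, Rinv_l, Rmult_1_r by lra.
    apply Rlt_le_trans with (1 := Hs2). apply Rmult_le_compat_l; [left; apply cond_pos|lra].
  - intros P [M HM].
    assert (HM0 : 0 < Rabs M + 1) by (generalize (Rabs_pos M); lra).
    assert (Hi : inn 0 t (t - t / 2 / (Rabs M + 1))).
    { assert (0 < t / 2 / (Rabs M + 1)) by (apply Rdiv_lt_0_compat; lra).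
      assert (t / 2 / (Rabs M + 1) <= t / 2 / 1).
      { apply Rmult_le_compat_l; [lra|]. apply Rinv_le_contravar; [lra|]. generalize (Rabs_pos M); lra. }
      split; simpl; lra. }
    change (hi t (fun s => P (s / (t - s)))).
    generalize (hi_inn 0 t _ Hi). apply filter_imp. intros s [[Hs0 Hst] Hs]. simpl in Hs0, Hst.
    apply HM. apply Rle_lt_trans with (1 := Rle_abs M). apply Rlt_le_trans with (Rabs M + 1); [lra|].
    assert (Hs2 : t / 2 <= s).
    { apply Rle_trans with (2 := Hs).
      assert (t / 2 / (Rabs M + 1) <= t / 2 / 1).
      { apply Rmult_le_compat_l; [lra|]. apply Rinv_le_contravar; [lra|]. generalize (Rabs_pos M); lra. }
      lra. }
    apply Rmult_le_reg_r with (t - s); [lra|]. unfold Rdiv at 1. rewrite (Rmult_assoc s), Rinv_l, Rmult_1_r by lra.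
    apply Rle_trans with (2 := Hs2).
    replace (t / 2) with ((Rabs M + 1) * (t / 2 / (Rabs M + 1))) by (field; lra).
    apply Rmult_le_compat_l; lra.
  - now apply Beta_integral. }
apply (is_RInt_gen_scal (V := RC) _ (Rpower t (a + b - 1) / (Gamma a * Gamma b))) in H.
replace (g (a + b) t) with (Rpower t (a + b - 1) / (Gamma a * Gamma b) * (Gamma a * Gamma b / Gamma (a + b))).
2:{ unfold g. field. lra. }
revert H. apply (is_RInt_gen_ext_inn (V := RC)); [simpl; auto|].
intros s [Hs Hst]. simpl in Hs, Hst. unfold g, scal; simpl; unfold mult; simpl.
assert (Hts : 0 < t - s) by lra.
assert (E1 : 1 + s / (t - s) = t / (t - s)) by (field; lra). rewrite E1.
assert (E2 : forall c, Rpower (s / (t - s)) c = Rpower s c * Rpower (t - s) (- c)).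
{ intros c. unfold Rdiv. rewrite <- Rpower_mult_distr by (auto; now apply Rinv_0_lt_compat).
  f_equal. rewrite <- (Rpower_1 (t - s) Hts) at 1. rewrite <- Rpower_Ropp, Rpower_mult. f_equal. ring. }
assert (E3 : forall c, Rpower (t / (t - s)) c = Rpower t c * Rpower (t - s) (- c)).
{ intros c. unfold Rdiv. rewrite <- Rpower_mult_distr by (auto; now apply Rinv_0_lt_compat).
  f_equal. rewrite <- (Rpower_1 (t - s) Hts) at 1. rewrite <- Rpower_Ropp, Rpower_mult. f_equal. ring. }
rewrite E2, E3.
assert (E4 : t / ((t - s) * ((t - s) * 1)) = Rpower t 1 * Rpower (t - s) (- (2))).
{ rewrite Rpower_1, Rpower_Ropp by auto. replace 2 with (1 + 1) by ring. rewrite Rpower_plus, Rpower_1 by auto.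
  field. lra. }
rewrite E4.
assert (E5 : Rpower t (a + b - 1) * (Rpower t 1 * Rpower t (- (a + b))) = 1).
{ rewrite <- !Rpower_plus. replace (a + b - 1 + (1 + - (a + b))) with 0 by ring. now apply Rpower_O. }
assert (E6 : Rpower (t - s) (- (2)) * (Rpower (t - s) (- (b - 1)) * Rpower (t - s) (- - (a + b))) = Rpower (t - s) (a - 1)).
{ rewrite <- !Rpower_plus. f_equal. ring. }
rewrite <- E6.
generalize E5. clear E6 E5 E4 E3 E2 E1.
generalize (Rpower t (a + b - 1)) (Rpower t 1) (Rpower t (- (a + b))) (Rpower (t - s) (- (2)))
  (Rpower (t - s) (- (b - 1))) (Rpower (t - s) (- - (a + b))) (Rpower s (b - 1)).
intros t1 t2 t3 r1 r2 r3 s1 E.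
assert (Q : t1 / (Gamma a * Gamma b) * (t2 * r1 * (s1 * r2 * (t3 * r3))) = (t1 * (t2 * t3)) * (r1 * (r2 * r3) / Gamma a * (s1 / Gamma b))).
{ field. lra. }
refine (eq_trans Q _). rewrite E. apply Rmult_1_l.
Qed.

(** On the ray at angle phi1 the integral in s is a Gamma integral with the
    complex rate u^al, and leaves u^(- al eta) e^u; for al eta < 1 this is
    integrable at 0 and gives Gamma(1 - al eta), hence the claim by the
    reflection formula. The factor (1 + X)^(-m) with eta + 1 < m < 1 + 1/al
    splits the decay in X = s r^al between the two variables. *)
Lemma kernel_g_small_1 al eta : 0 < al < 1 -> 0 < eta -> al * eta < 1 ->
  is_RInt_gen (V := RC) (fun s => Rpower s eta * K al 1 s al) (lo 0) (hi p_infty)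
    (Gamma (eta + 1) / Gamma (al * eta)).
Proof.
intros Hal Heta Hb1. assert (HPI := PI_RGT_0).
set (b := al * eta) in *. assert (Hb : 0 < b) by (unfold b; apply Rmult_lt_0_compat; lra).
destruct (phi1_bounds al Hal) as [P1 [P2 [P3 P4]]].
set (ph := phi1 al) in *. set (kk := cos (al * ph)) in *. set (k := - cos ph).
set (m := 1 + (eta + / al) / 2).
assert (Hia : eta < / al).
{ apply Rmult_lt_reg_l with al; [lra|]. rewrite Rinv_r by lra. exact Hb1. }
assert (Hm1 : eta + 1 < m) by (unfold m; lra).
assert (Hm2 : m < 1 + / al) by (unfold m; lra).
destruct (exp_le_Rpower m kk) as [C [HC HCx]]; [lra|auto|].
set (C' := C * exp kk).
assert (HC' : 0 < C') by (apply Rmult_lt_0_compat; [lra|apply exp_pos]).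
assert (HX : forall X, 0 < X -> exp (- (kk * X)) <= C' * Rpower (1 + X) (- m)).
{ intros X HX. unfold C'. replace (- (kk * X)) with (kk + - (kk * (1 + X))) by ring. rewrite exp_plus.
  rewrite (Rmult_comm C), Rmult_assoc. apply Rmult_le_compat_l; [left; apply exp_pos|]. apply HCx. lra. }
set (p := fun r => C' * (Rpower r al * Rpower (1 + Rpower r (- al)) m * exp (- (k * r)))).
set (q := fun s => Rpower s eta * Rpower (1 + s) (- m)).
assert (Hq : Intg 0 p_infty q).
{ apply Intg_powers with 1 (eta + 1) (m - eta - 1); try lra.
  - intros u Hu. split.
    + apply deriv_cont. unfold q, Rpower. auto_derive. lra.
    + apply Rmult_le_pos; left; apply Rpower_pos.
  - intros u Hu. unfold q. rewrite Rmult_1_l. replace (eta + 1 - 1) with eta by ring.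
    apply Rle_trans with (Rpower u eta * 1); [|lra].
    apply Rmult_le_compat_l; [left; apply Rpower_pos|].
    rewrite Rpower_Ropp. apply Rle_trans with (/ 1); [|lra]. apply Rinv_le_contravar; [lra|].
    apply Rle_trans with (Rpower 1 m); [rewrite Rpower_1_l; lra|]. apply Rle_Rpower_l; lra.
  - intros u Hu. unfold q. rewrite Rmult_1_l.
    replace (- 1 - (m - eta - 1)) with (eta + - m) by ring. rewrite Rpower_plus.
    apply Rmult_le_compat_l; [left; apply Rpower_pos|].
    rewrite !Rpower_Ropp. apply Rinv_le_contravar; [apply Rpower_pos|].
    apply Rle_Rpower_l; lra. }
assert (Hp : Intg 0 p_infty p).
{ apply Intg_scal; [lra|].
  destruct (stretch_decay al k 1) as [D [HD HDr]]; try (unfold k; lra).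
  assert (H2m := Rpower_pos 2 m).
  assert (Ham : al * (m - 1) < 1).
  { apply Rlt_le_trans with (al * / al); [apply Rmult_lt_compat_l; lra|]. rewrite Rinv_r; lra. }
  assert (Hek : forall r, 0 < r -> exp (- (k * r)) <= 1).
  { intros r Hr. rewrite <- exp_0. apply exp_le. assert (0 < k * r) by (apply Rmult_lt_0_compat; unfold k; lra). lra. }
  apply Intg_powers with (Rpower 2 m * (1 + D)) (1 - al * (m - 1)) 1; try lra.
  - intros r Hr. split.
    + apply deriv_cont. unfold Rpower. auto_derive. split; auto. split; auto.
      assert (H := exp_pos (- al * ln r)). lra.
    + repeat apply Rmult_le_pos; left; apply exp_pos.
  - intros r Hr.
    assert (Hr1 : 1 <= Rpower r (- al)).
    { rewrite Rpower_Ropp. apply Rle_trans with (/ 1); [lra|]. apply Rinv_le_contravar; [apply Rpower_pos|].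
      apply Rpower_le_1; lra. }
    apply Rle_trans with (Rpower r al * Rpower (2 * Rpower r (- al)) m * 1).
    + apply Rmult_le_compat; [|left; apply exp_pos| |apply Hek; lra].
      * apply Rmult_le_pos; left; apply Rpower_pos.
      * apply Rmult_le_compat_l; [left; apply Rpower_pos|]. apply Rle_Rpower_l; lra.
    + rewrite Rmult_1_r, <- Rpower_mult_distr, Rpower_mult by (auto using Rpower_pos; lra).
      replace (Rpower r al * (Rpower 2 m * Rpower r (- al * m))) with (Rpower 2 m * (Rpower r al * Rpower r (- al * m))) by ring.
      rewrite <- Rpower_plus. replace (al + - al * m) with (1 - al * (m - 1) - 1) by ring.
      apply Rmult_le_compat_r; [left; apply Rpower_pos|].
      rewrite <- (Rmult_1_r (Rpower 2 m)) at 1. apply Rmult_le_compat_l; lra.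
  - intros r Hr.
    assert (Hr1 : Rpower r (- al) <= 1).
    { rewrite Rpower_Ropp. apply Rle_trans with (/ 1); [|lra]. apply Rinv_le_contravar; [lra|].
      apply Rle_trans with (Rpower 1 al); [rewrite Rpower_1_l; lra|]. apply Rle_Rpower_l; lra. }
    assert (Hrp := Rpower_pos r (- al)).
    apply Rle_trans with (Rpower 2 m * (Rpower r al * exp (- (k * Rpower r 1)))).
    + rewrite Rpower_1 by lra.
      replace (Rpower r al * Rpower (1 + Rpower r (- al)) m * exp (- (k * r))) with
       (Rpower (1 + Rpower r (- al)) m * (Rpower r al * exp (- (k * r)))) by ring.
      apply Rmult_le_compat_r; [apply Rmult_le_pos; left; apply exp_pos|]. apply Rle_Rpower_l; lra.
    + rewrite (Rmult_assoc (Rpower 2 m)). apply Rmult_le_compat_l; [lra|].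
      apply Rle_trans with (1 := HDr r Hr). apply Rmult_le_compat_r; [left; apply Rpower_pos|lra]. }
set (F := fun s r : R => (RtoC (Rpower s (eta + 1 - 1)) * pol al 1 s al ph r)%C).
assert (Epol : forall s r, pol al 1 s al ph r = (pol al 1 0 al ph r * cexp (- (RtoC s * cexp (RtoC al * (ln r, ph)))))%C).
{ intros s r. unfold pol, fz. rewrite <- Cmult_assoc, <- cexp_plus. f_equal. f_equal. ring. }
destruct (fubini (V := CC) 0 p_infty 0 p_infty F q p Hq Hp) as [D1 [D2 E]].
{ intros s r [Hs _] [Hr _]. simpl in Hs, Hr. split.
  - unfold jcont, F. apply continuous_Cmult.
    + apply continuous_RtoC. apply (continuous_Rpower' (fun p : R * R => fst p)); [exact Hs|apply continuous_fst].
    + apply continuous_ext with (fun p : R * R => (pol al 1 0 al ph (snd p) * cexp (- (RtoC (fst p) * cexp (RtoC al * (ln (snd p), ph)))))%C).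
      { intros [x y]. symmetry. apply Epol. }
      assert (Hl : continuous (U := CC) (fun p : R * R => (ln (snd p), ph)) (s, r)).
      { apply C_continuous; [|apply continuous_const].
        apply (continuous_ln' (fun p : R * R => snd p)); [exact Hr|apply continuous_snd]. }
      ccont.
      * apply (continuous_comp (fun p : R * R => snd p) (pol al 1 0 al ph)); [apply continuous_snd|]. now apply continuous_pol.
      * apply continuous_fst.
  - rewrite norm_CC. unfold F. rewrite Cmod_mult, Cmod_R, Cmod_pol by auto.
    rewrite Rabs_pos_eq by (left; apply Rpower_pos). fold kk.
    replace (eta + 1 - 1) with eta by ring. unfold p, q.
    assert (Hra := Rpower_pos r al). assert (Hrn := Rpower_pos r (- al)).
    assert (HXp : 0 < s * Rpower r al) by now apply Rmult_lt_0_compat.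
    assert (Hle : exp (- (kk * (s * Rpower r al))) <= C' * (Rpower (1 + s) (- m) * Rpower (1 + Rpower r (- al)) m)).
    { apply Rle_trans with (1 := HX _ HXp). apply Rmult_le_compat_l; [lra|].
      rewrite !Rpower_Ropp.
      apply Rmult_le_reg_r with (Rpower (1 + s * Rpower r al) m); [apply Rpower_pos|].
      rewrite Rinv_l by (apply Rgt_not_eq, Rpower_pos).
      apply Rmult_le_reg_l with (Rpower (1 + s) m); [apply Rpower_pos|].
      rewrite Rmult_1_r.
      replace (Rpower (1 + s) m * (/ Rpower (1 + s) m * Rpower (1 + / Rpower r al) m * Rpower (1 + s * Rpower r al) m))
        with (Rpower (1 + / Rpower r al) m * Rpower (1 + s * Rpower r al) m) by (field; apply Rgt_not_eq, Rpower_pos).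
      assert (Hir : 0 < / Rpower r al) by now apply Rinv_0_lt_compat.
      rewrite Rpower_mult_distr by lra.
      apply Rle_Rpower_l; [lra|]. split; [lra|].
      replace ((1 + / Rpower r al) * (1 + s * Rpower r al)) with (1 + s + (/ Rpower r al + s * Rpower r al)) by (field; lra).
      lra. }
    replace (1 * (r * cos ph) - s * (Rpower r al * kk)) with (- (k * r) + - (kk * (s * Rpower r al))) by (unfold k; ring).
    rewrite exp_plus.
    apply Rle_trans with (Rpower s eta * (Rpower r al * (exp (- (k * r)) * (C' * (Rpower (1 + s) (- m) * Rpower (1 + Rpower r (- al)) m))))).
    + apply Rmult_le_compat_l; [left; apply Rpower_pos|]. apply Rmult_le_compat_l; [lra|].
      apply Rmult_le_compat_l; [left; apply exp_pos|auto].
    + right. ring. }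
assert (EK : forall s, 0 < s -> Im (II (V := CC) 0 p_infty (F s)) = PI * (Rpower s eta * K al 1 s al)).
{ intros s Hs. unfold F.
  destruct (pol_PI_phi1 al s al Hal ltac:(lra) ltac:(lra)) as [Q _].
  refine (eq_trans (f_equal Im (II_unique (V := CC) _ _ _ _ (is_RInt_gen_Cmult _ _ _ _ (RtoC (Rpower s (eta + 1 - 1))) Q))) _).
  rewrite im_scal_l. replace (eta + 1 - 1) with eta by ring.
  assert (Q2 := pol_phi1_half al s al Hal ltac:(lra) Hs). apply is_RInt_gen_Im in Q2.
  assert (EV : vint al 1 s al 0 = Im (II (V := CC) 0 p_infty (pol al 1 s al PI))).
  { apply (II_unique (V := RC)). revert Q2. apply (is_RInt_gen_ext_inn (V := RC)); [simpl; auto|].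
    intros y [Hy _]. symmetry. now apply Re_ver_pol. }
  rewrite <- EV. unfold K. field. lra. }
assert (ES : forall r, 0 < r -> II (V := CC) 0 p_infty (fun s => F s r) =
  (RtoC (Gamma (eta + 1)) * cexp (0, ((1 - b) * PI)%R) * pol (- b) (-1) 0 al (ph - PI) r)%C).
{ intros r Hr. apply (II_unique (V := CC)).
  assert (HL : Rabs (Im (RtoC al * (ln r, ph))%C) < PI / 2).
  { rewrite im_scal_l. simpl. rewrite Rabs_pos_eq; lra. }
  assert (H := is_RInt_gen_Cmult _ _ _ _ (pol al 1 0 al ph r) (cgamma (eta + 1) _ ltac:(lra) HL)).
  replace (RtoC (Gamma (eta + 1)) * cexp (0, ((1 - b) * PI)%R) * pol (- b) (-1) 0 al (ph - PI) r)%C with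
    (pol al 1 0 al ph r * (cexp (- (RtoC (eta + 1) * (RtoC al * (ln r, ph)))) * RtoC (Gamma (eta + 1))))%C.
  - revert H. apply (is_RInt_gen_ext_inn (V := CC)); [simpl; auto|].
    intros s _. unfold F. rewrite (Epol s r).
    generalize (RtoC (Rpower s (eta + 1 - 1))) (pol al 1 0 al ph r) (cexp (- (RtoC s * cexp (RtoC al * (ln r, ph))))).
    intros z1 z2 z3. change ((z2 * (z1 * z3))%C = (z1 * (z2 * z3))%C). ring.
  - unfold pol, fz.
    set (X1 := (RtoC (al + 1) * (ln r, ph) + RtoC 1 * cexp (ln r, ph) - RtoC 0 * cexp (RtoC al * (ln r, ph)))%C).
    set (X2 := (RtoC (- b + 1) * (ln r, (ph - PI)%R) + RtoC (-1) * cexp (ln r, (ph - PI)%R) - RtoC 0 * cexp (RtoC al * (ln r, (ph - PI)%R)))%C).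
    transitivity (RtoC (/ r) * RtoC (Gamma (eta + 1)) * cexp (X1 + - (RtoC (eta + 1) * (RtoC al * (ln r, ph)))))%C.
    { rewrite cexp_plus. ring. }
    transitivity (RtoC (/ r) * RtoC (Gamma (eta + 1)) * cexp ((0, ((1 - b) * PI)%R) + X2))%C.
    2:{ rewrite cexp_plus. ring. }
    f_equal. f_equal. unfold X1, X2.
    assert (Ee : (RtoC (-1) * cexp (ln r, (ph - PI)%R))%C = cexp (ln r, ph)).
    { unfold cexp, Re, Im, fst, snd. rewrite cos_minus, sin_minus, cos_PI, sin_PI.
      unfold Cmult, RtoC; simpl. f_equal; ring. }
    assert (EX1 : X1 = (RtoC (al + 1) * (ln r, ph) + cexp (ln r, ph))%C) by (unfold X1; ring).
    assert (EX2 : X2 = (RtoC (- b + 1) * (ln r, (ph - PI)%R) + cexp (ln r, ph))%C).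
    { rewrite <- Ee. unfold X2. ring. }
    unfold X1, X2 in EX1, EX2. rewrite EX1, EX2.
    transitivity ((RtoC (al + 1) * (ln r, ph) - RtoC (eta + 1) * (RtoC al * (ln r, ph))) + cexp (ln r, ph))%C; [ring|].
    rewrite Cplus_assoc.
    f_equal. unfold b, Cplus, Cminus, Copp, Cplus, Cmult, RtoC; simpl. f_equal; ring. }
assert (D1' := dominated_correct (V := CC) _ _ _ _ D1).
assert (EV : II (V := CC) 0 p_infty (fun s => II (V := CC) 0 p_infty (F s)) =
  (RtoC (Gamma (eta + 1)) * cexp (0, ((1 - b) * PI)%R) * RtoC (Gamma (1 - b)))%C).
{ rewrite E. apply (II_unique (V := CC)).
  assert (Hph : Rabs (ph - PI) < PI / 2) by (rewrite Rabs_left; lra).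
  assert (H := cgamma_ray (1 - b) (ph - PI) al ltac:(lra) Hph).
  replace (1 - b - 1) with (- b) in H by ring.
  apply (is_RInt_gen_Cmult _ _ _ _ (RtoC (Gamma (eta + 1)) * cexp (0, ((1 - b) * PI)%R))%C) in H.
  revert H. apply (is_RInt_gen_ext_inn (V := CC)); [simpl; auto|].
  intros r [Hr _]. symmetry. now apply ES. }
rewrite EV in D1'. apply is_RInt_gen_Im in D1'.
apply (is_RInt_gen_scal (V := RC) _ (/ PI)) in D1'.
assert (HR := reflection b ltac:(lra)).
assert (HGb := Gamma_pos b Hb).
replace (Gamma (eta + 1) / Gamma b) with
  (/ PI * Im (RtoC (Gamma (eta + 1)) * cexp (0, ((1 - b) * PI)%R) * RtoC (Gamma (1 - b)))%C).
- revert D1'. apply (is_RInt_gen_ext_inn (V := RC)); [simpl; auto|].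
  intros s [Hs _]. simpl in Hs.
  refine (eq_trans (f_equal (scal (/ PI)) (EK s Hs)) _). apply Rinv_cancel_r. lra.
- assert (Ei : Im (RtoC (Gamma (eta + 1)) * cexp (0, ((1 - b) * PI)%R) * RtoC (Gamma (1 - b)))%C =
    Gamma (eta + 1) * (Gamma (1 - b) * sin (b * PI))).
  { rewrite im_scal_r, im_scal_l. unfold cexp, Im, Re, fst, snd. rewrite exp_0.
    replace ((1 - b) * PI) with (PI - b * PI) by ring. rewrite sin_PI_x. ring. }
  rewrite Ei. replace (Gamma (1 - b) * sin (b * PI)) with (PI / Gamma b).
  + field. lra.
  + rewrite <- HR at 1. field. lra.
Qed.

Lemma continuous_kker al t s : 0 < al < 1 -> 0 < t -> continuous (kker al t) s.
Proof. intros Hal Ht. exact (jcont_r (V := RC) _ _ _ (jcont_kker al t s Hal Ht)). Qed.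

Lemma kernel_g_small al eta t : 0 < al < 1 -> 0 < eta -> al * eta < 1 -> 0 < t ->
  is_RInt_gen (V := RC) (fun s => scal (kker al t s) (g (eta + 1) s)) (lo 0) (hi p_infty) (g (al * eta) t).
Proof.
intros Hal Heta Hb Ht.
assert (Hbp : 0 < al * eta) by (apply Rmult_lt_0_compat; lra).
assert (HG1 := Gamma_pos (eta + 1) ltac:(lra)). assert (HG2 := Gamma_pos (al * eta) Hbp).
set (k := Rpower t (- al)). assert (Hk : 0 < k) by apply Rpower_pos.
assert (H := kernel_g_small_1 al eta Hal Heta Hb).
assert (H1 : is_RInt_gen (V := RC) (fun s => Rpower s eta * wr al al (- s)) (lo 0) (hi p_infty) (Gamma (eta + 1) / Gamma (al * eta))).
{ revert H. apply (is_RInt_gen_ext_inn (V := RC)); [simpl; auto|]. intros s [Hs _]. simpl in Hs.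
  now rewrite K_wright by (auto; lra). }
apply (is_RInt_gen_scale (V := RC) _ _ k Hk) in H1.
2:{ intros x Hx. apply (continuous_Rmult (fun s => Rpower s eta) (fun s => wr al al (- s))); [now apply cont_Rpower|].
    apply (continuous_comp Ropp (wr al al)); [apply continuous_Ropp; apply continuous_id|]. apply continuous_wr; auto; lra. }
apply (is_RInt_gen_scal (V := RC) _ (Rpower t (- 1 - al) * Rpower k (- eta - 1) / Gamma (eta + 1))) in H1.
replace (g (al * eta) t) with (Rpower t (- 1 - al) * Rpower k (- eta - 1) / Gamma (eta + 1) * (Gamma (eta + 1) / Gamma (al * eta))).
- revert H1. apply (is_RInt_gen_ext_inn (V := RC)); [simpl; auto|]. intros s [Hs _]. simpl in Hs.
  unfold kker, g, scal; simpl; unfold mult; simpl. fold k. rewrite <- Rpower_mult_distr by auto.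
  rewrite (Rmult_comm s k).
  replace (Rpower s (eta + 1 - 1)) with (Rpower s eta) by (f_equal; ring).
  assert (E : Rpower k (- eta - 1) * (k * Rpower k eta) = 1).
  { rewrite <- (Rpower_1 k Hk) at 2. rewrite <- !Rpower_plus. replace (- eta - 1 + (1 + eta)) with 0 by ring. now apply Rpower_O. }
  generalize E. generalize (Rpower k (- eta - 1)) (Rpower k eta) (Rpower t (- 1 - al)) (wr al al (- (k * s))) (Rpower s eta).
  intros a1 a2 a3 a4 a5 Ea.
  assert (Q : a3 * a1 / Gamma (eta + 1) * (k * (a2 * a5 * a4)) = (a1 * (k * a2)) * (a3 * a4 * (a5 / Gamma (eta + 1)))).
  { field. lra. }
  refine (eq_trans Q _). rewrite Ea. apply Rmult_1_l.
- unfold g. replace (Rpower t (al * eta - 1)) with (Rpower t (- 1 - al) * Rpower k (- eta - 1)).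
  + field. lra.
  + unfold k. rewrite Rpower_mult, <- Rpower_plus. f_equal. ring.
Qed.

(** * Bounds on the kernel *)

Lemma kker_decay al N : 0 < al < 1 -> 0 < N -> exists C, 0 < C /\
  forall t s, 0 < t -> 0 <= s -> Rabs (kker al t s) <= C * (Rpower t (- 1 - al) * exp (- (N * (s * Rpower t (- al))))).
Proof.
intros Hal HN. destruct (wr_decay al al N (or_intror eq_refl) Hal HN) as [C [HC HCx]].
exists C. split; auto. intros t s Ht Hs. unfold kker.
rewrite Rabs_mult, (Rabs_pos_eq (Rpower _ _)) by (left; apply Rpower_pos).
apply Rle_trans with (Rpower t (- 1 - al) * (C * exp (- (N * (s * Rpower t (- al)))))); [|right; ring].
apply Rmult_le_compat_l; [left; apply Rpower_pos|]. apply HCx.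
apply Rmult_le_pos; auto. left; apply Rpower_pos.
Qed.

(** The factor s^(-k) trades a singularity at s = 0 for a weaker one at
    t = 0, which makes product majorants possible. *)
Lemma kker_decay_pow al m k t2 : 0 < al < 1 -> 0 < m -> 0 <= k -> 0 < t2 -> exists C, 0 < C /\
  forall t s, 0 < t <= t2 -> 0 < s ->
    Rabs (kker al t s) <= C * (Rpower t (- 1 - al + al * k) * (Rpower s (- k) * exp (- (m * s)))).
Proof.
intros Hal Hm Hk Ht2. set (N := m * Rpower t2 al).
assert (HN : 0 < N) by (apply Rmult_lt_0_compat; [auto|apply Rpower_pos]).
destruct (kker_decay al (N + 1) Hal ltac:(lra)) as [C [HC HCx]].
assert (HD : exists D, 0 < D /\ forall x, 0 < x -> exp (- x) <= D * Rpower x (- k)).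
{ destruct Hk as [Hk|<-].
  - destruct (exp_le_Rpower k 1 Hk Rlt_0_1) as [D [HD HDx]]. exists D. split; auto.
    intros x Hx. rewrite <- (Rmult_1_l x) at 1. auto.
  - exists 1. split; [lra|]. intros x Hx. rewrite Ropp_0, Rpower_O by auto. rewrite Rmult_1_r, <- exp_0. apply exp_le. lra. }
destruct HD as [D [HD HDx]].
exists (C * D). split; [now apply Rmult_lt_0_compat|]. intros t s Ht Hs.
apply Rle_trans with (1 := HCx t s ltac:(lra) ltac:(lra)).
set (x := s * Rpower t (- al)).
assert (Hx : 0 < x) by (apply Rmult_lt_0_compat; [auto|apply Rpower_pos]).
replace (- ((N + 1) * x)) with (- (N * x) + - x) by ring. rewrite exp_plus.
rewrite (Rmult_assoc C D). apply Rmult_le_compat_l; [lra|].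
apply Rle_trans with (Rpower t (- 1 - al) * (exp (- (m * s)) * (D * Rpower x (- k)))).
- apply Rmult_le_compat_l; [left; apply Rpower_pos|].
  apply Rmult_le_compat; try (left; apply exp_pos); [|now apply HDx].
  apply exp_le. apply Ropp_le_contravar. unfold N, x.
  replace (m * Rpower t2 al * (s * Rpower t (- al))) with (m * s * (Rpower t2 al * Rpower t (- al))) by ring.
  rewrite <- (Rmult_1_r (m * s)) at 1. apply Rmult_le_compat_l; [apply Rmult_le_pos; lra|].
  rewrite Rpower_Ropp. apply Rmult_le_reg_r with (Rpower t al); [apply Rpower_pos|].
  rewrite Rmult_assoc, Rinv_l by (apply Rgt_not_eq, Rpower_pos). rewrite Rmult_1_l, Rmult_1_r. apply Rle_Rpower_l; lra.
- unfold x. rewrite <- Rpower_mult_distr by (auto; apply Rpower_pos). rewrite Rpower_mult.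
  replace (- al * - k) with (al * k) by ring. rewrite (Rpower_plus (-1 - al)). right. ring.
Qed.

Lemma kker_decay_loc al m t1 t2 : 0 < al < 1 -> 0 < m -> 0 < t1 <= t2 -> exists C, 0 < C /\
  forall t s, t1 <= t <= t2 -> 0 < s -> Rabs (kker al t s) <= C * exp (- (m * s)).
Proof.
intros Hal Hm Ht12. destruct (kker_decay_pow al m 0 t2 Hal Hm (Rle_refl 0) ltac:(lra)) as [C [HC HCx]].
destruct (Rpower_bound (- 1 - al + al * 0) t1 t2 (proj1 Ht12)) as [D [HD HDx]].
exists (C * D). split; [now apply Rmult_lt_0_compat|]. intros t s Ht Hs.
apply Rle_trans with (1 := HCx t s ltac:(lra) Hs). rewrite Ropp_0, (Rpower_O s) by auto.
rewrite Rmult_1_l, <- Rmult_assoc. apply Rmult_le_compat_r; [left; apply exp_pos|].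
apply Rmult_le_compat_l; [lra|]. apply HDx; lra.
Qed.

(** For large t the growth rate in t is c, at the price of the decay rate
    c^al in s. *)
Lemma kker_growth al c k : 0 < al < 1 -> 0 < c -> 0 < k < Rpower c al -> exists C, 0 < C /\
  forall t s, 1 <= t -> 0 < s -> Rabs (kker al t s) <= C * (exp (c * t) * exp (- (k * s))).
Proof.
intros Hal Hc Hk. assert (Hca := Rpower_pos c al).
set (th := 1 - k / Rpower c al).
assert (Hq : 0 < k / Rpower c al < 1).
{ split; [apply Rdiv_lt_0_compat; lra|]. apply Rmult_lt_reg_r with (Rpower c al); auto.
  unfold Rdiv. rewrite Rmult_assoc, Rinv_l; lra. }
destruct (K_bound al al c th 1 (or_intror eq_refl) Hal Hc ltac:(unfold th; lra) Rlt_0_1) as [C1 [HC1 H1]].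
destruct (kker_decay al 1 Hal Rlt_0_1) as [C2 [HC2 H2]].
assert (Hek := exp_pos k).
exists (C1 + C2 * exp k). split; [apply Rplus_le_lt_0_compat; auto; now apply Rmult_lt_0_compat|].
intros t s Ht Hs. rewrite <- exp_plus. assert (He := exp_pos (c * t + - (k * s))).
assert (P2 : 0 <= C2 * exp k) by (apply Rmult_le_pos; lra).
destruct (Rle_dec 1 s) as [Hs1|Hs1].
- rewrite kker_K by (auto; lra). apply Rle_trans with (1 := H1 t s Hs1).
  replace (t * c - (1 - th) * (s * Rpower c al)) with (c * t + - (k * s)) by (unfold th; field; lra).
  apply Rmult_le_compat_r; lra.
- apply Rle_trans with (1 := H2 t s ltac:(lra) ltac:(lra)).
  apply Rle_trans with (C2 * exp k * exp (c * t + - (k * s))); [|apply Rmult_le_compat_r; lra].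
  rewrite Rmult_assoc. apply Rmult_le_compat_l; [lra|]. rewrite <- exp_plus.
  apply Rle_trans with (1 * 1).
  + apply Rmult_le_compat; try (left; apply exp_pos).
    * replace (- 1 - al) with (- (1 + al)) by ring. rewrite Rpower_Ropp.
      apply Rle_trans with (/ 1); [|lra]. apply Rinv_le_contravar; [lra|].
      apply Rle_trans with (Rpower 1 (1 + al)); [rewrite Rpower_1_l; lra|]. apply Rle_Rpower_l; lra.
    * apply Rle_trans with (exp 0); [|rewrite exp_0; lra]. apply exp_le. assert (0 < s * Rpower t (- al)) by (apply Rmult_lt_0_compat; auto; apply Rpower_pos). lra.
  + rewrite Rmult_1_l, <- exp_0. apply exp_le. nra.
Qed.

(** * Integration against the kernel *)

(** The bounds satisfied by the primitives, vanishing at 0, of the orbits of a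
    (g_eta,g_eta)-regularized resolvent family. *)
Definition growth {V : RNM} (eta mu a : R) (F : R -> V) :=
  0 <= a /\ (forall s, continuous F s) /\ (forall s, s <= 0 -> F s = zero) /\
  forall s, 0 < s -> norm (F s) <= a * (Rpower s eta * exp (mu * s)).

Definition kint {V : RNM} (al : R) (F : R -> V) (t : R) : V :=
  II 0 p_infty (fun s => scal (kker al t s) (F s)).

Lemma norm_scal_le {V : RNM} (k : R) (x : V) a b : Rabs k <= a -> norm x <= b -> norm (scal k x) <= a * b.
Proof.
intros Hk Hx. apply Rle_trans with (1 := norm_scal k x).
apply Rmult_le_compat; auto; [apply Rabs_pos|apply norm_ge_0].
Qed.

Lemma continuous_scal_R {V : RNM} {U : UniformSpace} (k : U -> R) (f : U -> V) x :
  continuous k x -> continuous f x -> continuous (fun y => scal (k y) (f y)) x.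
Proof. intros Hk Hf. exact (continuous_scal (K := R_AbsRing) k f x Hk Hf). Qed.

Lemma kint_dom {V : RNM} al eta mu a t1 t2 (F : R -> V) : 0 < al < 1 -> 0 < eta -> 0 <= mu ->
  growth eta mu a F -> 0 < t1 <= t2 -> exists C, 0 <= C /\ forall t, t1 <= t <= t2 ->
    dominated 0 p_infty (fun s => scal (kker al t s) (F s)) (fun s => C * (Rpower s (eta + 1 - 1) * exp (- (1 * s)))).
Proof.
intros Hal Heta Hmu [Ha [Hc [Hz Hg]]] Ht12.
destruct (kker_decay_loc al (mu + 1) t1 t2 Hal ltac:(lra) Ht12) as [C [HC HCx]].
exists (C * a). assert (HCa : 0 <= C * a) by (apply Rmult_le_pos; lra). split; auto. intros t Ht. split.
- apply Intg_scal; auto. apply Intg_gamma; lra.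
- intros s [Hs _]. simpl in Hs. split.
  + apply continuous_scal_R; [apply continuous_kker; auto; lra|auto].
  + apply Rle_trans with (1 := norm_scal_le _ _ _ _ (HCx t s Ht Hs) (Hg s Hs)).
    replace (eta + 1 - 1) with eta by ring.
    replace (- (1 * s)) with (- ((mu + 1) * s) + mu * s) by ring. rewrite exp_plus. right. ring.
Qed.

Lemma kint_correct {V : RNM} al eta mu a t (F : R -> V) : 0 < al < 1 -> 0 < eta -> 0 <= mu ->
  growth eta mu a F -> 0 < t ->
  is_RInt_gen (fun s => scal (kker al t s) (F s)) (lo 0) (hi p_infty) (kint al F t).
Proof.
intros Hal Heta Hmu HF Ht.
destruct (kint_dom al eta mu a t t F Hal Heta Hmu HF ltac:(lra)) as [C [HC HD]].
exact (dominated_correct _ _ _ _ (HD t ltac:(lra))).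
Qed.

Lemma kint_continuous {V : RNM} al eta mu a t (F : R -> V) : 0 < al < 1 -> 0 < eta -> 0 <= mu ->
  growth eta mu a F -> 0 < t -> continuous (kint al F) t.
Proof.
intros Hal Heta Hmu HF Ht.
destruct (kint_dom al eta mu a (t / 2) (2 * t) F Hal Heta Hmu HF ltac:(lra)) as [C [HC HD]].
apply (II_continuous 0 p_infty (fun t s => scal (kker al t s) (F s)) (fun s => C * (Rpower s (eta + 1 - 1) * exp (- (1 * s))))).
- exact (proj1 (HD t ltac:(lra))).
- assert (Hd : 0 < t / 2) by lra. exists (mkposreal _ Hd). intros t' Ht'.
  assert (H : Rabs (t' - t) < t / 2) by exact Ht'. apply Rabs_def2 in H.
  exact (proj2 (HD t' ltac:(lra))).
- intros s _. destruct HF as [_ [Hc _]]. unfold jcont.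
  apply continuous_scal_R; [exact (jcont_kker al t s Hal Ht)|].
  apply (continuous_comp (fun p : R * R => snd p) F (t, s)); [apply continuous_snd|auto].
Qed.

Lemma kint_small {V : RNM} al e1 e2 mu : 0 < al < 1 -> 0 < e1 -> 0 < e2 -> 0 <= mu -> exists C, 0 < C /\
  forall a1 a2 t (F : R -> V), 0 <= a1 -> 0 <= a2 -> 0 < t <= 1 ->
    (forall s, 0 < s -> continuous F s) ->
    (forall s, 0 < s -> norm (F s) <= (a1 * Rpower s e1 + a2 * Rpower s e2) * exp (mu * s)) ->
    norm (kint al F t) <= C * (a1 * Rpower t (al * e1 - 1) + a2 * Rpower t (al * e2 - 1)).
Proof.
intros Hal He1 He2 Hmu.
destruct (kker_decay al (mu + 1) Hal ltac:(lra)) as [C [HC HCx]].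
assert (HG1 := Gamma_pos (e1 + 1) ltac:(lra)). assert (HG2 := Gamma_pos (e2 + 1) ltac:(lra)).
set (G := Gamma (e1 + 1) + Gamma (e2 + 1)).
exists (C * G). split; [apply Rmult_lt_0_compat; unfold G; lra|].
intros a1 a2 t F Ha1 Ha2 Ht Hc Hg.
set (k := Rpower t (- al)). assert (Hk : 0 < k) by apply Rpower_pos.
assert (Hk1 : 1 <= k).
{ unfold k. rewrite Rpower_Ropp. apply Rle_trans with (/ 1); [lra|]. apply Rinv_le_contravar; [apply Rpower_pos|].
  apply Rpower_le_1; lra. }
set (T := Rpower t (- 1 - al)). assert (HT : 0 < T) by apply Rpower_pos.
assert (HP : forall e, 0 < e -> T * Rpower k (- (e + 1)) = Rpower t (al * e - 1)).
{ intros e He. unfold T, k. rewrite Rpower_mult, <- Rpower_plus. f_equal. ring. }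
set (h := fun s => C * T * (a1 * (Rpower s (e1 + 1 - 1) * exp (- (k * s))) + a2 * (Rpower s (e2 + 1 - 1) * exp (- (k * s))))).
assert (HCT : 0 <= C * T) by (apply Rmult_le_pos; lra).
assert (D : dominated 0 p_infty (fun s => scal (kker al t s) (F s)) h).
{ split.
  - apply Intg_scal; auto. apply Intg_plus; apply Intg_scal; auto; apply Intg_gamma; lra.
  - intros s [Hs _]. simpl in Hs. split.
    + apply continuous_scal_R; [apply continuous_kker; auto; lra|auto].
    + apply Rle_trans with (1 := norm_scal_le _ _ _ _ (HCx t s ltac:(lra) ltac:(lra)) (Hg s Hs)).
      fold k T. unfold h. replace (e1 + 1 - 1) with e1 by ring. replace (e2 + 1 - 1) with e2 by ring.
      assert (Ha : 0 <= a1 * Rpower s e1 + a2 * Rpower s e2).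
      { apply Rplus_le_le_0_compat; apply Rmult_le_pos; auto; left; apply Rpower_pos. }
      replace (C * (T * exp (- ((mu + 1) * (s * k)))) * ((a1 * Rpower s e1 + a2 * Rpower s e2) * exp (mu * s)))
        with (C * T * ((a1 * Rpower s e1 + a2 * Rpower s e2) * (exp (- ((mu + 1) * (s * k))) * exp (mu * s)))) by ring.
      apply Rmult_le_compat_l; auto.
      replace (a1 * (Rpower s e1 * exp (- (k * s))) + a2 * (Rpower s e2 * exp (- (k * s)))) with
        ((a1 * Rpower s e1 + a2 * Rpower s e2) * exp (- (k * s))) by ring.
      apply Rmult_le_compat_l; auto. rewrite <- exp_plus. apply exp_le.
      assert (0 <= mu * s * (k - 1)) by (apply Rmult_le_pos; [apply Rmult_le_pos|]; lra). nra. }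
apply Rle_trans with (1 := II_norm _ _ _ _ D).
assert (EI : II (V := RC) 0 p_infty h = C * T * (a1 * (Rpower k (- (e1 + 1)) * Gamma (e1 + 1)) + a2 * (Rpower k (- (e2 + 1)) * Gamma (e2 + 1)))).
{ apply (II_unique (V := RC)).
  assert (Q1 : 0 < e1 + 1) by lra. assert (Q2 : 0 < e2 + 1) by lra.
  assert (R1 := is_RInt_gen_scal (V := RC) _ a1 _ (Gamma_scale (e1 + 1) k Q1 Hk)).
  assert (R2 := is_RInt_gen_scal (V := RC) _ a2 _ (Gamma_scale (e2 + 1) k Q2 Hk)).
  exact (is_RInt_gen_scal (V := RC) _ (C * T) _ (is_RInt_gen_plus (V := RC) _ _ _ _ R1 R2)). }
rewrite EI, <- (HP e1 He1), <- (HP e2 He2).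
assert (P1 := Rpower_pos k (- (e1 + 1))). assert (P2 := Rpower_pos k (- (e2 + 1))).
assert (Q1 : 0 <= a1 * (T * Rpower k (- (e1 + 1)))) by (repeat apply Rmult_le_pos; lra).
assert (Q2 : 0 <= a2 * (T * Rpower k (- (e2 + 1)))) by (repeat apply Rmult_le_pos; lra).
apply Rle_trans with (C * (a1 * (T * Rpower k (- (e1 + 1))) * Gamma (e1 + 1) + a2 * (T * Rpower k (- (e2 + 1))) * Gamma (e2 + 1))).
- right. ring.
- rewrite (Rmult_assoc C G). apply Rmult_le_compat_l; [lra|]. unfold G. nra.
Qed.

(** The growth rate is c as soon as mu < c^al; the algebraic factor is the
    natural singularity at t = 0. *)
Lemma kint_bound {V : RNM} al eta mu c : 0 < al < 1 -> 0 < eta -> 0 <= mu -> 0 < c -> mu < Rpower c al ->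
  exists C, 0 < C /\ forall a (F : R -> V), growth eta mu a F -> forall t, 0 < t ->
    norm (kint al F t) <= C * a * (Rpower t (al * eta - 1) * exp (c * t)).
Proof.
intros Hal Heta Hmu Hc Hmc.
(* a rate c0 below c leaves room for the factor t^(al eta - 1) at infinity *)
set (m0 := (mu + Rpower c al) / 2). assert (Hm0 : mu < m0 < Rpower c al) by (unfold m0; lra).
set (c0 := Rpower m0 (/ al)). assert (Hc0 : 0 < c0) by apply Rpower_pos.
assert (E0 : Rpower c0 al = m0).
{ unfold c0. rewrite Rpower_mult, Rinv_l, Rpower_1; lra. }
assert (Hcc : c0 < c).
{ destruct (Rlt_le_dec c0 c) as [H|H]; auto. exfalso.
  assert (Rpower c al <= Rpower c0 al) by (apply Rle_Rpower_l; lra). lra. }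
set (k := (mu + m0) / 2).
destruct (kker_growth al c0 k Hal Hc0 ltac:(rewrite E0; unfold k; lra)) as [C2 [HC2 H2]].
destruct (kint_small (V := V) al eta eta mu Hal Heta Heta Hmu) as [C1 [HC1 H1]].
destruct (Rpower_le_exp (Rabs (1 - al * eta) + 1) (c - c0)) as [D [HD HDx]]; [generalize (Rabs_pos (1 - al * eta)); lra|lra|].
set (I := Rpower (k - mu) (- (eta + 1)) * Gamma (eta + 1)).
assert (HI : 0 < I) by (apply Rmult_lt_0_compat; [apply Rpower_pos|apply Gamma_pos; lra]).
exists (C1 + C2 * I * D). assert (HP2 : 0 < C2 * I * D) by (apply Rmult_lt_0_compat; [now apply Rmult_lt_0_compat|lra]). split; [lra|].
intros a F [Ha [HFc [_ HFg]]] t Ht.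
assert (Htp := Rpower_pos t (al * eta - 1)).
destruct (Rle_dec t 1) as [Ht1|Ht1].
- apply Rle_trans with (C1 * (a * Rpower t (al * eta - 1) + 0 * Rpower t (al * eta - 1))).
  + apply H1; auto; try lra. intros s Hs. rewrite Rmult_0_l, Rplus_0_r, Rmult_assoc. auto.
  + rewrite Rmult_0_l, Rplus_0_r.
    assert (He : 1 <= exp (c * t)) by (rewrite <- exp_0; apply exp_le; apply Rmult_le_pos; lra).
    assert (HA : 0 <= a * Rpower t (al * eta - 1)) by (apply Rmult_le_pos; lra).
    replace ((C1 + C2 * I * D) * a * (Rpower t (al * eta - 1) * exp (c * t))) with
      ((C1 + C2 * I * D) * ((a * Rpower t (al * eta - 1)) * exp (c * t))) by ring.
    apply Rmult_le_compat; try lra. nra.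
- assert (Dm : dominated 0 p_infty (fun s => scal (kker al t s) (F s))
     (fun s => C2 * exp (c0 * t) * a * (Rpower s (eta + 1 - 1) * exp (- ((k - mu) * s))))).
  { assert (He := exp_pos (c0 * t)). split.
    - apply Intg_scal; [repeat apply Rmult_le_pos; lra|]. apply Intg_gamma; unfold k; lra.
    - intros s [Hs _]. simpl in Hs. split.
      + apply continuous_scal_R; [apply continuous_kker; auto; lra|auto].
      + apply Rle_trans with (1 := norm_scal_le _ _ _ _ (H2 t s ltac:(lra) Hs) (HFg s Hs)).
        replace (eta + 1 - 1) with eta by ring.
        replace (- ((k - mu) * s)) with (- (k * s) + mu * s) by ring. rewrite exp_plus. right. ring. }
  apply Rle_trans with (1 := II_norm _ _ _ _ Dm).
  rewrite (II_scal _ _ _ _ _ (Gamma_scale (eta + 1) (k - mu) ltac:(lra) ltac:(unfold k; lra))). fold I.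
  assert (HE : exp (c0 * t) <= D * (Rpower t (al * eta - 1) * exp (c * t))).
  { replace (c * t) with (c0 * t + (c - c0) * t) by ring. rewrite exp_plus.
    replace (D * (Rpower t (al * eta - 1) * (exp (c0 * t) * exp ((c - c0) * t)))) with
      (exp (c0 * t) * (Rpower t (al * eta - 1) * (D * exp ((c - c0) * t)))) by ring.
    rewrite <- (Rmult_1_r (exp (c0 * t))) at 1. apply Rmult_le_compat_l; [left; apply exp_pos|].
    apply Rle_trans with (Rpower t (al * eta - 1) * Rpower t (Rabs (1 - al * eta) + 1)).
    - rewrite <- Rpower_plus. apply Rle_trans with (Rpower t 0); [rewrite Rpower_O; lra|]. apply Rle_Rpower; [lra|].
      generalize (Rle_abs (1 - al * eta)). lra.
    - apply Rmult_le_compat_l; [lra|auto]. }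
  assert (HA : 0 <= C2 * I * a) by (apply Rmult_le_pos; [apply Rmult_le_pos|]; lra).
  apply Rle_trans with (C2 * I * a * (D * (Rpower t (al * eta - 1) * exp (c * t)))).
  + apply Rle_trans with (C2 * I * a * exp (c0 * t)); [right; ring|]. now apply Rmult_le_compat_l.
  + assert (0 <= C1 * a * (Rpower t (al * eta - 1) * exp (c * t))) by (repeat apply Rmult_le_pos; try lra; left; apply exp_pos). lra.
Qed.

(** * Convolution with powers *)

Lemma is_RInt_gen_shift {V : RNM} (f : R -> V) v l : 0 < v ->
  (forall x, continuous f x) -> (forall x, x <= 0 -> f x = zero) ->
  is_RInt_gen f (lo 0) (hi p_infty) l ->
  is_RInt_gen (fun s => f (s - v)) (lo 0) (hi p_infty) l.
Proof.
intros Hv Hc Hz Hl.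
assert (Hcs : forall x, continuous (fun s : R => f (s - v)) x).
{ intros x. apply (continuous_comp (fun s : R => s - v) f); [|apply Hc].
  apply continuous_Rminus; [apply continuous_id|apply continuous_const]. }
apply (is_RInt_gen_extend_left _ 0 v); auto.
{ intros x Hx. apply Hz. lra. }
apply (is_RInt_gen_ext_inn v p_infty (fun s => scal 1 (f (s - v)))); [simpl; auto|intros; exact (scal_one (f (x - v)))|].
apply (is_RInt_gen_subst 0 p_infty v p_infty f (fun s => s - v) (fun _ => 1)); auto.
- simpl; auto.
- intros x [Hx _]. simpl in Hx. split; [split; simpl; auto; lra|]. split; [auto_derive; auto; ring|apply continuous_const].
- intros P [e He]. exists e. intros s Hs Hsv. apply He; [|lra].
  assert (Hs' : Rabs (s - v) < e) by exact Hs.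
  change (Rabs (s - v - 0) < e). now rewrite Rminus_0_r.
- intros P [M HM]. exists (M + v). intros s Hs. apply HM. lra.
Qed.

Lemma scal_comm_R {V : RNM} (a b : R) (x : V) : scal a (scal b x) = scal b (scal a x).
Proof.
transitivity (scal (a * b) x); [exact (scal_assoc a b x)|].
rewrite Rmult_comm. symmetry. exact (scal_assoc b a x).
Qed.

Lemma scal_assoc_R {V : RNM} (a b : R) (x : V) : scal a (scal b x) = scal (a * b) x.
Proof. exact (scal_assoc a b x). Qed.

Lemma is_RInt_gen_scal_vec {V : RNM} a b (f : R -> R) (x : V) w :
  is_RInt_gen (V := RC) f (lo a) (hi b) w -> is_RInt_gen (fun s => scal (f s) x) (lo a) (hi b) (scal w x).
Proof.
apply (is_RInt_gen_linear (V := RC) (fun r : R => scal r x)).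
- intros u v. exact (scal_distr_r u v x).
- intros k u. symmetry. exact (scal_assoc k u x).
- intros u. apply continuous_scal_R; [apply continuous_id|apply continuous_const].
Qed.

Lemma II_ext_dominated {V : RNM} a b (f g : R -> V) h : dominated a b f h -> (forall x, inn a b x -> f x = g x) ->
  II a b f = II a b g.
Proof.
intros D E. symmetry. apply II_unique. generalize (dominated_correct _ _ _ _ D).
apply is_RInt_gen_ext_inn; [exact (proj1 (proj1 D))|exact E].
Qed.

Lemma Rmult_le_self a b : 0 <= a -> b <= 1 -> a * b <= a.
Proof. intros. nra. Qed.

Lemma g_pos c t : 0 < c -> 0 < g c t.
Proof. intros Hc. apply Rdiv_lt_0_compat; [apply Rpower_pos|now apply Gamma_pos]. Qed.

Lemma continuous_g c t : 0 < t -> continuous (g c) t.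
Proof. intros Ht. apply continuous_Rmult; [now apply cont_Rpower|apply continuous_const]. Qed.

(** (g_a * f)(r) *)
Definition conv {V : RNM} (a : R) (f : R -> V) (r : R) : V :=
  II 0 r (fun v => scal (g a (r - v)) (f v)).

Lemma conv_unique {V : RNM} a (f : R -> V) r v :
  is_RInt_gen (fun v => scal (g a (r - v)) (f v)) (lo 0) (hi r) v -> conv a f r = v.
Proof. apply II_unique. Qed.

(** The inner interval of a double convolution can thus be taken independent
    of the outer variable, as Fubini's theorem requires. *)
Lemma conv_extended {V : RNM} a (b : Rbar) (f : R -> V) r : 0 < a -> 0 < r -> Rbar_le r b ->
  (forall s, continuous f s) -> (forall s, s <= 0 -> f s = zero) ->
  (exists h, dominated 0 b (fun u => scal (g a u) (f (r - u))) h) ->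
  II 0 b (fun u => scal (g a u) (f (r - u))) = conv a f r.
Proof.
intros Ha Hr Hrb Hc Hz [h D].
assert (Hcu : forall u, 0 < u -> continuous (fun u => scal (g a u) (f (r - u))) u).
{ intros u Hu. apply continuous_scal_R; [now apply continuous_g|].
  apply (continuous_comp (fun u => r - u) f); [|auto]. apply continuous_Rminus; [apply continuous_const|apply continuous_id]. }
assert (H := dominated_correct _ _ _ _ D).
assert (H2 : is_RInt_gen (fun u => scal (g a u) (f (r - u))) (lo 0) (hi r) (II 0 b (fun u => scal (g a u) (f (r - u))))).
{ destruct (Rbar_le_lt_or_eq_dec _ _ Hrb) as [Hlt|Heq].
  - apply is_RInt_gen_cut with b; auto.
    + intros x [Hx _]. now apply Hcu.
    + intros x Hx. rewrite Hz by lra. exact (scal_zeroV _).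
  - rewrite <- Heq in H |- *. exact H. }
symmetry. apply conv_unique. apply is_RInt_gen_reflect in H2; auto.
2:{ intros x Hx. apply Hcu. lra. }
revert H2. apply is_RInt_gen_ext_inn; [exact Hr|]. intros v _. now replace (r - (r - v)) with v by ring.
Qed.

Lemma growth_shift {V : RNM} eta mu a (F : R -> V) v s : 0 <= eta -> 0 <= mu -> growth eta mu a F -> 0 < v -> 0 < s ->
  norm (F (s - v)) <= a * (Rpower s eta * exp (mu * s)) * exp (- (mu * v)).
Proof.
intros Heta Hmu [Ha [_ [Hz Hg]]] Hv Hs.
assert (HP : 0 <= a * (Rpower s eta * exp (mu * s)) * exp (- (mu * v))).
{ apply Rmult_le_pos; [|left; apply exp_pos]. apply Rmult_le_pos; auto. apply Rmult_le_pos; left; apply exp_pos. }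
destruct (Rle_dec (s - v) 0) as [H|H].
- rewrite Hz by auto. rewrite norm_zeroV. exact HP.
- apply Rle_trans with (1 := Hg (s - v) ltac:(lra)).
  rewrite (Rmult_assoc a). apply Rmult_le_compat_l; auto.
  rewrite Rmult_assoc, <- exp_plus. replace (mu * s + - (mu * v)) with (mu * (s - v)) by ring.
  apply Rmult_le_compat_r; [left; apply exp_pos|]. apply Rle_Rpower_l; lra.
Qed.

Lemma jcont_shift {V : RNM} (F : R -> V) x y : (forall s, continuous F s) -> jcont (fun v s => F (s - v)) x y.
Proof.
intros Hc. apply (continuous_comp (fun p : R * R => snd p - fst p) F (x, y)); [|apply Hc].
apply continuous_Rminus; [apply continuous_snd|apply continuous_fst].
Qed.

(** Exchange the integrals in time and in s, apply the convolution identity of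
    the kernel, and move the fractional integral over to F by a translation,
    for which F is extended by 0. *)
Lemma kint_convolution {V : RNM} al eta mu a t (F : R -> V) : 0 < al < 1 -> 0 < eta -> 0 < mu ->
  growth eta mu a F -> 0 < t -> exists v : V,
  is_RInt_gen (fun s => scal (g (al * eta) (t - s)) (kint al F s)) (lo 0) (hi t) v /\
  is_RInt_gen (fun s => scal (kker al t s) (conv eta F s)) (lo 0) (hi p_infty) v.
Proof.
intros Hal Heta Hmu HF Ht. assert (HF' := HF). destruct HF' as [Ha [Hc [Hz Hg]]].
set (b := al * eta). assert (Hb : 0 < b) by (apply Rmult_lt_0_compat; lra).
assert (HGb := Gamma_pos b Hb). assert (HGe := Gamma_pos eta Heta).
assert (W : forall r, 0 < r -> exists w : R,
    is_RInt_gen (V := RC) (fun s => g b (t - s) * kker al s r) (lo 0) (hi t) w /\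
    is_RInt_gen (V := RC) (fun v => g eta v * kker al t (r + v)) (lo 0) (hi p_infty) w).
{ intros r Hr. exact (kernel_convolution al eta t r Hal Heta Ht Hr). }
(* the singularity at r = 0 is shared between the two variables *)
destruct (kker_decay_pow al (mu + 1) (1 + eta / 2) t Hal ltac:(lra) ltac:(lra) Ht) as [C1 [HC1 H1]].
set (f1 := fun s r => scal (g b (t - s)) (scal (kker al s r) (F r))).
set (p1 := fun s => C1 / Gamma b * (Rpower (t - s) (b - 1) * Rpower s (b / 2 - 1))).
set (q1 := fun r => a * (Rpower r (eta / 2 - 1) * exp (- (1 * r)))).
destruct (fubini 0 t 0 p_infty f1 p1 q1) as [D1 [D2 E1]].
{ apply Intg_scal; [apply Rlt_le, Rdiv_lt_0_compat; auto|]. apply Intg_beta; lra. }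
{ apply Intg_scal; auto. apply Intg_gamma; lra. }
{ intros s r [Hs Hst] [Hr _]. simpl in Hs, Hst, Hr. split.
  - unfold jcont, f1. apply continuous_scal_R; [|apply continuous_scal_R].
    + apply (continuous_comp (fun p : R * R => t - fst p) (g b) (s, r)); [|apply continuous_g; simpl; lra].
      apply continuous_Rminus; [apply continuous_const|apply continuous_fst].
    + exact (jcont_kker al s r Hal Hs).
    + apply (continuous_comp (fun p : R * R => snd p) F (s, r)); [apply continuous_snd|auto].
  - assert (Hgb : Rabs (g b (t - s)) <= / Gamma b * Rpower (t - s) (b - 1)).
    { rewrite Rabs_pos_eq by (left; now apply g_pos). unfold g. right. unfold Rdiv. ring. }
    apply Rle_trans with (1 := norm_scal_le _ _ _ _ Hgb (norm_scal_le _ _ _ _ (H1 s r ltac:(lra) Hr) (Hg r Hr))).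
    unfold p1, q1. replace (- 1 - al + al * (1 + eta / 2)) with (b / 2 - 1) by (unfold b; field).
    replace (Rpower r (eta / 2 - 1)) with (Rpower r (- (1 + eta / 2)) * Rpower r eta) by (rewrite <- Rpower_plus; f_equal; field).
    replace (- (1 * r)) with (- ((mu + 1) * r) + mu * r) by ring. rewrite exp_plus.
    right. unfold Rdiv. ring. }
assert (I1 : forall s, 0 < s -> II 0 p_infty (f1 s) = scal (g b (t - s)) (kint al F s)).
{ intros s Hs. apply II_unique.
  apply (is_RInt_gen_scal (V := V) _ (g b (t - s))). apply (kint_correct al eta mu a); auto; lra. }
destruct (kker_decay_loc al (mu + 1) t t Hal ltac:(lra) ltac:(lra)) as [C2 [HC2 H2]].
assert (H2' : forall s, 0 < s -> Rabs (kker al t s) <= C2 * exp (- ((mu + 1) * s))) by (intros; apply H2; lra).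
set (f2 := fun v r => scal (g eta v) (scal (kker al t (r + v)) (F r))).
set (p2 := fun v => / Gamma eta * (Rpower v (eta - 1) * exp (- (mu * v)))).
set (q2 := fun r => C2 * a * (Rpower r (eta + 1 - 1) * exp (- (1 * r)))).
assert (Hp2 : Intg 0 p_infty p2) by (apply Intg_scal; [left; now apply Rinv_0_lt_compat|apply Intg_gamma; lra]).
assert (Hq2 : Intg 0 p_infty q2) by (apply Intg_scal; [apply Rmult_le_pos; lra|apply Intg_gamma; lra]).
assert (Hge : forall v, Rabs (g eta v) <= / Gamma eta * Rpower v (eta - 1)).
{ intros v. rewrite Rabs_pos_eq by (left; now apply g_pos). unfold g. right. unfold Rdiv. ring. }
destruct (fubini 0 p_infty 0 p_infty f2 p2 q2 Hp2 Hq2) as [D3 [D4 E2]].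
{ intros v r [Hv _] [Hr _]. simpl in Hv, Hr. split.
  - unfold jcont, f2. apply continuous_scal_R; [|apply continuous_scal_R].
    + apply (continuous_comp (fun p : R * R => fst p) (g eta) (v, r)); [apply continuous_fst|now apply continuous_g].
    + apply (continuous_comp (fun p : R * R => snd p + fst p) (kker al t) (v, r)); [|now apply continuous_kker].
      apply continuous_Rplus; [apply continuous_snd|apply continuous_fst].
    + apply (continuous_comp (fun p : R * R => snd p) F (v, r)); [apply continuous_snd|auto].
  - apply Rle_trans with (1 := norm_scal_le _ _ _ _ (Hge v) (norm_scal_le _ _ _ _ (H2' (r + v) ltac:(lra)) (Hg r Hr))).
    unfold p2, q2. replace (eta + 1 - 1) with eta by ring.
    apply Rle_trans with (/ Gamma eta * (Rpower v (eta - 1) * exp (- (mu * v))) * (C2 * a * (Rpower r eta * exp (- (1 * r)))) * exp (- v)).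
    + replace (- ((mu + 1) * (r + v))) with (- (mu * v) + (- (1 * r) + (- (mu * r) + - v))) by ring.
      rewrite !exp_plus, (exp_Ropp (mu * r)). assert (H := exp_pos (mu * r)). right. field. lra.
    + assert (exp (- v) <= 1) by (rewrite <- exp_0; apply exp_le; lra).
      apply Rmult_le_self; auto.
      assert (0 < / Gamma eta) by now apply Rinv_0_lt_compat.
      repeat apply Rmult_le_pos; try lra; left; apply exp_pos. }
assert (E12 : forall r, 0 < r -> II 0 t (fun s => f1 s r) = II 0 p_infty (fun v => f2 v r)).
{ intros r Hr. destruct (W r Hr) as [w [W1 W2]].
  transitivity (scal w (F r)).
  - apply II_unique. generalize (is_RInt_gen_scal_vec _ _ _ (F r) _ W1).
    apply is_RInt_gen_ext_inn; [exact Ht|]. intros s _. symmetry. exact (scal_assoc_R _ _ _).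
  - symmetry. apply II_unique. generalize (is_RInt_gen_scal_vec _ _ _ (F r) _ W2).
    apply is_RInt_gen_ext_inn; [simpl; auto|]. intros s _. symmetry. exact (scal_assoc_R _ _ _). }
set (f3 := fun v s => scal (g eta v) (scal (kker al t s) (F (s - v)))).
destruct (fubini 0 p_infty 0 p_infty f3 p2 q2 Hp2 Hq2) as [D5 [D6 E3]].
{ intros v s [Hv _] [Hs _]. simpl in Hv, Hs. split.
  - unfold jcont, f3. apply continuous_scal_R; [|apply continuous_scal_R].
    + apply (continuous_comp (fun p : R * R => fst p) (g eta) (v, s)); [apply continuous_fst|now apply continuous_g].
    + apply (continuous_comp (fun p : R * R => snd p) (kker al t) (v, s)); [apply continuous_snd|now apply continuous_kker].
    + exact (jcont_shift F v s Hc).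
  - apply Rle_trans with (1 := norm_scal_le _ _ _ _ (Hge v) (norm_scal_le _ _ _ _ (H2' s Hs) (growth_shift eta mu a F v s ltac:(lra) ltac:(lra) HF Hv Hs))).
    unfold p2, q2. replace (eta + 1 - 1) with eta by ring.
    replace (- (1 * s)) with (- ((mu + 1) * s) + mu * s) by ring. rewrite exp_plus. right. ring. }
assert (E23 : forall v, 0 < v -> II 0 p_infty (f2 v) = II 0 p_infty (f3 v)).
{ intros v Hv.
  assert (Dv : dominated 0 p_infty (fun r => scal (kker al t (r + v)) (F r)) q2).
  { split; auto. intros r [Hr _]. simpl in Hr. split.
    - apply continuous_scal_R; [|auto].
      apply (continuous_comp (fun r => r + v) (kker al t)); [|now apply continuous_kker].
      apply continuous_Rplus; [apply continuous_id|apply continuous_const].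
    - apply Rle_trans with (1 := norm_scal_le _ _ _ _ (H2' (r + v) ltac:(lra)) (Hg r Hr)).
      unfold q2. replace (eta + 1 - 1) with eta by ring.
      replace (- ((mu + 1) * (r + v))) with (- (1 * r) + (- (mu * r) + - ((mu + 1) * v))) by ring.
      rewrite !exp_plus, (exp_Ropp (mu * r)). assert (H := exp_pos (mu * r)).
      apply Rle_trans with (C2 * a * (Rpower r eta * exp (- (1 * r))) * exp (- ((mu + 1) * v))); [right; field; lra|].
      apply Rle_trans with (C2 * a * (Rpower r eta * exp (- (1 * r))) * 1); [|lra].
      apply Rmult_le_compat_l; [repeat apply Rmult_le_pos; try lra; left; apply exp_pos|].
      apply Rle_trans with (exp 0); [|rewrite exp_0; lra]. apply exp_le. nra. }
  assert (Dc := dominated_correct _ _ _ _ Dv).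
  transitivity (scal (g eta v) (II 0 p_infty (fun r => scal (kker al t (r + v)) (F r)))).
  - apply II_unique. exact (is_RInt_gen_scal (V := V) _ (g eta v) _ Dc).
  - symmetry. apply II_unique. apply (is_RInt_gen_scal (V := V) _ (g eta v)).
    assert (Ds := is_RInt_gen_shift (fun r => scal (kker al t (r + v)) (F r)) v (II 0 p_infty (fun r => scal (kker al t (r + v)) (F r))) Hv).
    cbv beta in Ds. lapply Ds; [clear Ds; intros Ds; lapply Ds; [clear Ds; intros Ds|]|].
    + generalize (Ds Dc). apply is_RInt_gen_ext_inn; [simpl; auto|].
      intros s _. replace (s - v + v) with s by ring. reflexivity.
    + intros x Hx. rewrite Hz by auto. exact (scal_zeroV _).
    + intros x. apply continuous_scal_R; [|auto].
      apply (continuous_comp (fun r => r + v) (kker al t)); [|now apply continuous_kker].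
      apply continuous_Rplus; [apply continuous_id|apply continuous_const]. }
exists (II 0 p_infty (fun s => II 0 p_infty (fun v => f3 v s))). split.
- rewrite <- E3.
  replace (II 0 p_infty (fun v => II 0 p_infty (f3 v))) with (II 0 t (fun s => II 0 p_infty (f1 s))).
  + generalize (dominated_correct _ _ _ _ D1). apply is_RInt_gen_ext_inn; [exact Ht|].
    intros s [Hs _]. now apply I1.
  + rewrite E1, (II_ext_dominated _ _ _ _ _ D2 (fun r Hr => E12 r (proj1 Hr))), <- E2.
    exact (II_ext_dominated _ _ _ _ _ D3 (fun v Hv => E23 v (proj1 Hv))).
- generalize (dominated_correct _ _ _ _ D6). apply is_RInt_gen_ext_inn; [simpl; auto|].
  intros s [Hs _]. simpl in Hs.
  assert (Dg : dominated 0 p_infty (fun v => scal (g eta v) (F (s - v))) (fun v => a * (Rpower s eta * exp (mu * s)) * p2 v)).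
  { split.
    - apply Intg_scal; auto. apply Rmult_le_pos; auto. apply Rmult_le_pos; left; apply exp_pos.
    - intros v [Hv _]. simpl in Hv. split.
      + apply continuous_scal_R; [now apply continuous_g|].
        apply (continuous_comp (fun v => s - v) F); [|auto].
        apply continuous_Rminus; [apply continuous_const|apply continuous_id].
      + apply Rle_trans with (1 := norm_scal_le _ _ _ _ (Hge v) (growth_shift eta mu a F v s ltac:(lra) ltac:(lra) HF Hv Hs)).
        unfold p2. right. ring. }
  rewrite <- (conv_extended eta p_infty F s); auto; [|exact I|eexists; exact Dg].
  apply II_unique. generalize (is_RInt_gen_scal (V := V) _ (kker al t s) _ (dominated_correct _ _ _ _ Dg)).
  apply is_RInt_gen_ext_inn; [simpl; auto|]. intros v _. unfold f3. exact (scal_comm_R _ _ _).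
Qed.

(** The regularity of the orbits of a (g_rho,g_rho)-regularized resolvent
    family. *)
Definition sing {V : RNM} (rho : R) (f : R -> V) :=
  (forall s, 0 < s -> continuous f s) /\
  forall T, 0 < T -> exists k, 0 <= k /\ forall s, 0 < s <= T -> norm (f s) <= k * g rho s.

Lemma conv_bound {V : RNM} a rho k r (f : R -> V) : 0 < a -> 0 < rho -> 0 <= k -> 0 < r ->
  (forall s, 0 < s < r -> continuous f s) -> (forall s, 0 < s < r -> norm (f s) <= k * g rho s) ->
  is_RInt_gen (fun v => scal (g a (r - v)) (f v)) (lo 0) (hi r) (conv a f r) /\
  norm (conv a f r) <= k * g (a + rho) r.
Proof.
intros Ha Hrho Hk Hr Hc Hb.
assert (HGa := Gamma_pos a Ha). assert (HGr := Gamma_pos rho Hrho).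
assert (D : dominated 0 r (fun v => scal (g a (r - v)) (f v)) (fun v => k * (g a (r - v) * g rho v))).
{ split.
  - apply Intg_scal; auto. apply Intg_le with (1 := Intg_beta r a rho Hr Ha Hrho) (C := / Gamma a * / Gamma rho).
    intros x [Hx Hxr]. simpl in Hx, Hxr. split; [|split].
    + apply continuous_Rmult; [|now apply continuous_g].
      apply (continuous_comp (fun v => r - v) (g a)); [|apply continuous_g; lra].
      apply continuous_Rminus; [apply continuous_const|apply continuous_id].
    + apply Rmult_le_pos; left; now apply g_pos.
    + unfold g. right. unfold Rdiv. ring.
  - intros v [Hv Hvr]. simpl in Hv, Hvr. split.
    + apply continuous_scal_R; [|auto].
      apply (continuous_comp (fun v => r - v) (g a)); [|apply continuous_g; lra].
      apply continuous_Rminus; [apply continuous_const|apply continuous_id].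
    + apply Rle_trans with (g a (r - v) * (k * g rho v)); [|right; ring].
      apply norm_scal_le; auto. rewrite Rabs_pos_eq; [lra|left; now apply g_pos]. }
split; [exact (dominated_correct _ _ _ _ D)|].
apply Rle_trans with (1 := II_norm _ _ _ _ D). right.
apply II_scal. now apply g_convolution.
Qed.

Lemma conv_correct {V : RNM} a rho (f : R -> V) r : 0 < a -> 0 < rho -> 0 < r -> sing rho f ->
  is_RInt_gen (fun v => scal (g a (r - v)) (f v)) (lo 0) (hi r) (conv a f r).
Proof.
intros Ha Hrho Hr [Hc Hs]. destruct (Hs r Hr) as [k [Hk Hb]].
apply (conv_bound a rho k r f); auto.
- intros s Hs'. apply Hc. lra.
- intros s Hs'. apply Hb. lra.
Qed.

(** In the variable v = r u the interval of integration is fixed. *)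
Lemma conv_continuous {V : RNM} a rho (f : R -> V) r : 0 < a -> 0 < rho -> 0 < r -> sing rho f ->
  continuous (conv a f) r.
Proof.
intros Ha Hrho Hr HS. assert (HS' := HS). destruct HS' as [Hc Hs].
destruct (Hs (2 * r) ltac:(lra)) as [k [Hk Hb]].
assert (HGa := Gamma_pos a Ha). assert (HGr := Gamma_pos rho Hrho).
set (f1 := fun r u => scal (r * g a (r * (1 - u))) (f (r * u))).
assert (E : forall r', 0 < r' -> II 0 1 (f1 r') = conv a f r').
{ intros r' Hr'. apply II_unique. generalize (conv_correct a rho f r' Ha Hrho Hr' HS). intros HI.
  assert (HI2 : is_RInt_gen (fun u => scal r' (scal (g a (r' - r' * u)) (f (r' * u)))) (lo 0) (hi 1) (conv a f r')).
  { apply (is_RInt_gen_subst 0 r' 0 1 (fun v => scal (g a (r' - v)) (f v)) (fun u => r' * u) (fun _ => r')); auto.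
    - simpl; lra.
    - intros u [Hu Hu1]. simpl in Hu, Hu1. split; [split; simpl; nra|]. split; [auto_derive; auto; ring|apply continuous_const].
    - intros v [Hv Hv1]. simpl in Hv, Hv1. apply continuous_scal_R; [|now apply Hc].
      apply (continuous_comp (fun v => r' - v) (g a)); [|apply continuous_g; lra].
      apply continuous_Rminus; [apply continuous_const|apply continuous_id].
    - intros P [e He].
      assert (Hd : 0 < e / r') by (apply Rdiv_lt_0_compat; auto; apply cond_pos).
      exists (mkposreal _ Hd). intros u Hu Hu0.
      assert (Hu' : Rabs (u - 0) < e / r') by exact Hu. rewrite Rminus_0_r, Rabs_pos_eq in Hu' by lra.
      apply He; [|now apply Rmult_lt_0_compat]. change (Rabs (r' * u - 0) < e). rewrite Rminus_0_r, Rabs_pos_eq by nra.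
      apply Rmult_lt_compat_l with (r := r') in Hu'; auto. replace (r' * (e / r')) with (pos e) in Hu' by (field; lra). auto.
    - intros P [e He].
      assert (Hd : 0 < e / r') by (apply Rdiv_lt_0_compat; auto; apply cond_pos).
      exists (mkposreal _ Hd). intros u Hu Hu0.
      assert (Hu' : Rabs (u - 1) < e / r') by exact Hu. rewrite Rabs_left in Hu' by lra.
      apply He; [|nra]. change (Rabs (r' * u - r') < e). rewrite Rabs_left by nra.
      apply Rmult_lt_compat_l with (r := r') in Hu'; auto. replace (r' * (e / r')) with (pos e) in Hu' by (field; lra). lra. }
  revert HI2. apply is_RInt_gen_ext_inn; [simpl; lra|]. intros u _. unfold f1.
  replace (r' * (1 - u)) with (r' - r' * u) by ring. exact (scal_assoc_R _ _ _). }
apply (continuous_ext_loc _ (fun r' => II 0 1 (f1 r'))).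
{ assert (Hi : inn 0 p_infty r) by (split; simpl; auto).
  generalize (locally_inn 0 p_infty r Hi). apply filter_imp. intros r' [Hr' _]. now apply E. }
destruct (Rpower_bound (a + rho - 1) (r / 2) (2 * r) ltac:(lra)) as [D [HD HDx]].
set (h := fun u => k * D / (Gamma a * Gamma rho) * (Rpower (1 - u) (a - 1) * Rpower u (rho - 1))).
assert (Hh : Intg 0 1 h).
{ apply Intg_scal; [|apply Intg_beta; lra]. apply Rmult_le_pos; [apply Rmult_le_pos; lra|].
  left; apply Rinv_0_lt_compat; now apply Rmult_lt_0_compat. }
assert (Hcont : forall r' u, 0 < r' -> inn 0 1 u -> jcont f1 r' u).
{ intros r' u Hr' [Hu Hu1]. simpl in Hu, Hu1. unfold jcont, f1. apply continuous_scal_R.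
  - apply continuous_Rmult; [apply continuous_fst|].
    apply (continuous_comp (fun p : R * R => fst p * (1 - snd p)) (g a) (r', u)).
    + apply continuous_Rmult; [apply continuous_fst|]. apply continuous_Rminus; [apply continuous_const|apply continuous_snd].
    + apply continuous_g. simpl. apply Rmult_lt_0_compat; lra.
  - apply (continuous_comp (fun p : R * R => fst p * snd p) f (r', u)).
    + apply continuous_Rmult; [apply continuous_fst|apply continuous_snd].
    + apply Hc. simpl. now apply Rmult_lt_0_compat. }
apply (II_continuous 0 1 f1 h); auto.
assert (Hd : 0 < r / 2) by lra. exists (mkposreal _ Hd). intros r' Hr'.
assert (H : Rabs (r' - r) < r / 2) by exact Hr'. apply Rabs_def2 in H.
intros u Hu. split; [apply (jcont_r f1 r' u), Hcont; auto; lra|].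
destruct Hu as [Hu Hu1]; simpl in Hu, Hu1. unfold f1.
assert (Hru : 0 < r' * u <= 2 * r) by (split; nra).
assert (Hra : Rabs (r' * g a (r' * (1 - u))) <= r' * g a (r' * (1 - u))).
{ rewrite Rabs_pos_eq; [lra|]. apply Rmult_le_pos; [lra|left; now apply g_pos]. }
apply Rle_trans with (1 := norm_scal_le _ _ _ _ Hra (Hb _ Hru)).
unfold g, h. rewrite <- !Rpower_mult_distr by lra.
replace (r' * (Rpower r' (a - 1) * Rpower (1 - u) (a - 1) / Gamma a) * (k * (Rpower r' (rho - 1) * Rpower u (rho - 1) / Gamma rho)))
  with (k * (r' * (Rpower r' (a - 1) * Rpower r' (rho - 1))) / (Gamma a * Gamma rho) * (Rpower (1 - u) (a - 1) * Rpower u (rho - 1))) by (field; lra).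
apply Rmult_le_compat_r; [apply Rmult_le_pos; left; apply Rpower_pos|].
apply Rmult_le_compat_r; [left; apply Rinv_0_lt_compat; now apply Rmult_lt_0_compat|].
apply Rmult_le_compat_l; auto.
rewrite <- (Rpower_1 r') at 1 by lra. rewrite <- !Rpower_plus.
replace (1 + (a - 1 + (rho - 1))) with (a + rho - 1) by ring. apply HDx. lra.
Qed.

Lemma conv_sing {V : RNM} a rho (f : R -> V) : 0 < a -> 0 < rho -> sing rho f -> sing (a + rho) (conv a f).
Proof.
intros Ha Hrho HS. split.
- intros s Hs. now apply conv_continuous with rho.
- intros T HT. destruct HS as [Hc Hs]. destruct (Hs T HT) as [k [Hk Hb]]. exists k. split; auto.
  intros s Hs'. apply (conv_bound a rho k s f); auto; try lra.
  + intros; apply Hc; lra.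
  + intros; apply Hb; lra.
Qed.

(** Fubini: both orders are the integral of g_a(u) g_b(v) f(t - u - v). *)
Lemma conv_comm_cont {V : RNM} a b M t (f : R -> V) : 0 < a -> 0 < b -> 0 < t -> 0 <= M ->
  (forall s, continuous f s) -> (forall s, s <= 0 -> f s = zero) -> (forall s, s <= t -> norm (f s) <= M) ->
  conv a (conv b f) t = conv b (conv a f) t.
Proof.
assert (Half : forall a b M t (f : R -> V), 0 < a -> 0 < b -> 0 < t -> 0 <= M ->
  (forall s, continuous f s) -> (forall s, s <= 0 -> f s = zero) -> (forall s, s <= t -> norm (f s) <= M) ->
  let F := fun u v => scal (g a u) (scal (g b v) (f (t - u - v))) in
  conv a (conv b f) t = II 0 t (fun u => II 0 t (F u)) /\
  II 0 t (fun u => II 0 t (F u)) = II 0 t (fun v => II 0 t (fun u => F u v))).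
{ clear a b M t f. intros a b M t f Ha Hb Ht HM Hc Hz Hb' F.
  assert (HGa := Gamma_pos a Ha). assert (HGb := Gamma_pos b Hb).
  assert (Hg : forall c, 0 < c -> Intg 0 t (g c)).
  { intros c Hc'. assert (HGc := Gamma_pos c Hc').
    apply Intg_le with (1 := Intg_pow_0 t c Ht Hc') (C := / Gamma c). intros x [Hx _]. simpl in Hx.
    split; [now apply continuous_g|split; [left; now apply g_pos|right; unfold g, Rdiv; ring]]. }
  assert (Hga : forall c x, 0 < c -> Rabs (g c x) <= g c x).
  { intros c x Hc'. rewrite Rabs_pos_eq; [lra|left; now apply g_pos]. }
  destruct (fubini 0 t 0 t F (g a) (fun v => M * g b v)) as [D1 [D2 E]]; auto.
  { apply Intg_scal; auto. }
  { intros u v [Hu Hut] [Hv Hvt]. simpl in Hu, Hut, Hv, Hvt. split.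
    - unfold jcont, F. apply continuous_scal_R; [|apply continuous_scal_R].
      + apply (continuous_comp (fun p : R * R => fst p) (g a) (u, v)); [apply continuous_fst|now apply continuous_g].
      + apply (continuous_comp (fun p : R * R => snd p) (g b) (u, v)); [apply continuous_snd|now apply continuous_g].
      + apply (continuous_comp (fun p : R * R => t - fst p - snd p) f (u, v)); [|auto].
        apply continuous_Rminus; [apply continuous_Rminus; [apply continuous_const|apply continuous_fst]|apply continuous_snd].
    - apply Rle_trans with (g a u * (g b v * M)); [|right; ring].
      apply norm_scal_le; auto. apply norm_scal_le; auto. apply Hb'. lra. }
  split; [|exact E].
  assert (EI : forall u, inn 0 t u -> II 0 t (F u) = scal (g a u) (conv b f (t - u))).
  { intros u [Hu Hut]. simpl in Hu, Hut.
    assert (D : dominated 0 t (fun v => scal (g b v) (f (t - u - v))) (fun v => M * g b v)).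
    { split; [apply Intg_scal; auto|]. intros v [Hv Hvt]. simpl in Hv, Hvt. split.
      - apply continuous_scal_R; [now apply continuous_g|].
        apply (continuous_comp (fun v => t - u - v) f); [|auto]. apply continuous_Rminus; [apply continuous_const|apply continuous_id].
      - rewrite Rmult_comm. apply norm_scal_le; auto. apply Hb'. lra. }
    rewrite <- (conv_extended b t f (t - u)); auto; try lra; [|simpl; lra|eexists; exact D].
    apply II_unique. exact (is_RInt_gen_scal (V := V) _ (g a u) _ (dominated_correct _ _ _ _ D)). }
  apply conv_unique.
  assert (H := dominated_correct _ _ _ _ D1). apply is_RInt_gen_reflect in H; auto.
  2:{ intros x Hx. apply D1. split; simpl; lra. }
  revert H. apply is_RInt_gen_ext_inn; [exact Ht|]. intros s [Hs Hst]. simpl in Hs, Hst.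
  rewrite EI by (split; simpl; lra). now replace (t - (t - s)) with s by ring. }
intros Ha Hb Ht HM Hc Hz Hb'.
destruct (Half a b M t f Ha Hb Ht HM Hc Hz Hb') as [E1 E2].
destruct (Half b a M t f Hb Ha Ht HM Hc Hz Hb') as [E3 _].
rewrite E1, E2, E3. apply II_ext_eq. intros v. apply II_ext_eq. intros u.
replace (t - v - u) with (t - u - v) by ring. exact (scal_comm_R _ _ _).
Qed.

Lemma conv_minus {V : RNM} a rho (f h : R -> V) r : 0 < a -> 0 < rho -> 0 < r -> sing rho f -> sing rho h ->
  conv a (fun s => minus (f s) (h s)) r = minus (conv a f r) (conv a h r).
Proof.
intros Ha Hrho Hr Hf Hh. apply conv_unique.
generalize (is_RInt_gen_minus (V := V) _ _ _ _ (conv_correct a rho f r Ha Hrho Hr Hf) (conv_correct a rho h r Ha Hrho Hr Hh)).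
apply is_RInt_gen_ext_inn; [exact Hr|]. intros s _. symmetry. exact (scal_minus_distr_l (g a (r - s)) (f s) (h s)).
Qed.

Lemma sing_le {V : RNM} rho (f h : R -> V) : sing rho f -> (forall s, 0 < s -> continuous h s) ->
  (forall s, 0 < s -> norm (h s) <= norm (f s)) -> sing rho h.
Proof.
intros [Hc Hs] Hc' Hle. split; auto. intros T HT. destruct (Hs T HT) as [k [Hk Hb]].
exists k. split; auto. intros s Hs'. apply Rle_trans with (1 := Hle s (proj1 Hs')). auto.
Qed.

(** A cutoff reduces this to continuous f; replacing g_rho by g_(rho - kap)
    in the majorant leaves a factor d^kap to measure the error. *)
Lemma conv_comm {V : RNM} a b rho t (f : R -> V) : 0 < a -> 0 < b -> 0 < rho -> 0 < t -> sing rho f ->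
  conv a (conv b f) t = conv b (conv a f) t.
Proof.
intros Ha Hb Hrho Ht HS. assert (HS' := HS). destruct HS' as [Hc Hs].
destruct (Hs t Ht) as [k [Hk Hkb]].
(* any kap below 1 and rho would do *)
set (kap := Rmin 1 rho / 2).
assert (Hkap : 0 < kap < rho /\ kap < 1).
{ unfold kap. assert (0 < Rmin 1 rho) by (apply Rmin_glb_lt; lra). generalize (Rmin_l 1 rho) (Rmin_r 1 rho). lra. }
destruct Hkap as [Hkap Hkap1]. set (rh := rho - kap).
assert (HGr := Gamma_pos rho Hrho). assert (HGh := Gamma_pos rh ltac:(unfold rh; lra)).
(* the cutoff v / (v + d) makes f continuous at 0 *)
set (phi := fun d v : R => v / (v + d)).
set (fd := fun d v => if Rle_dec v 0 then zero else scal (phi d v) (f v)).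
assert (Hphi : forall d v, 0 < d -> 0 < v -> 0 < phi d v < 1).
{ intros d v Hd Hv. unfold phi. split; [apply Rdiv_lt_0_compat; lra|].
  apply Rmult_lt_reg_r with (v + d); [lra|]. unfold Rdiv. rewrite Rmult_assoc, Rinv_l; lra. }
assert (Hphid : forall d v, 0 < d -> 0 < v -> phi d v <= v / d).
{ intros d v Hd Hv. unfold phi. apply Rmult_le_compat_l; [lra|]. apply Rinv_le_contravar; lra. }
assert (Hpp : forall d v, 0 < d -> 0 < v -> 1 - phi d v <= Rpower d kap * Rpower v (- kap)).
{ intros d v Hd Hv. unfold phi. replace (1 - v / (v + d)) with (d / (v + d)) by (field; lra).
  assert (Hq : 0 < d / (v + d) <= 1).
  { split; [apply Rdiv_lt_0_compat; lra|]. apply Rmult_le_reg_r with (v + d); [lra|]. unfold Rdiv. rewrite Rmult_assoc, Rinv_l; lra. }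
  apply Rle_trans with (Rpower (d / (v + d)) kap).
  - rewrite <- (Rpower_1 (d / (v + d))) at 1 by lra.
    assert (Hln : ln (d / (v + d)) <= 0) by (rewrite <- ln_1; apply ln_le; lra).
    unfold Rpower. apply exp_le. nra.
  - rewrite Rpower_Ropp, <- (Rpower_Ropp v).
    apply Rle_trans with (Rpower (d / v) kap).
    + apply Rle_Rpower_l; [lra|]. split; [lra|]. apply Rmult_le_compat_l; [lra|]. apply Rinv_le_contravar; lra.
    + unfold Rdiv. rewrite <- Rpower_mult_distr by (auto; now apply Rinv_0_lt_compat).
      right. f_equal. rewrite <- (Rpower_1 v Hv) at 1. rewrite <- Rpower_Ropp, Rpower_mult. f_equal. ring. }
assert (Hfc : forall d v, 0 < d -> 0 < v -> continuous (fd d) v).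
{ intros d v Hd Hv. apply (continuous_ext_loc _ (fun v => scal (phi d v) (f v))).
  - assert (Hi : inn 0 p_infty v) by (split; simpl; auto).
    generalize (locally_inn 0 p_infty v Hi). apply filter_imp. intros z [Hz _]. simpl in Hz. unfold fd. destruct (Rle_dec z 0); [lra|auto].
  - apply continuous_scal_R; [|auto]. apply deriv_cont. unfold phi. auto_derive. lra. }
assert (Hfd : forall d v, 0 < d -> 0 < v -> fd d v = scal (phi d v) (f v)).
{ intros d v Hd Hv. unfold fd. destruct (Rle_dec v 0); [lra|auto]. }
assert (HfdS : forall d, 0 < d -> sing rho (fd d)).
{ intros d Hd. apply (sing_le rho f); auto. intros s Hs'. rewrite Hfd by auto.
  rewrite <- (Rmult_1_l (norm (f s))). apply norm_scal_le; [|lra]. destruct (Hphi d s Hd Hs'). rewrite Rabs_pos_eq; lra. }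
assert (Hpw : forall d v, 0 < d -> 0 < v <= t -> norm (fd d v) <= k / d / Gamma rho * Rpower v rho).
{ intros d v Hd Hv. rewrite Hfd by lra.
  assert (Hab : Rabs (phi d v) <= v / d) by (destruct (Hphi d v Hd ltac:(lra)); rewrite Rabs_pos_eq by lra; apply Hphid; lra).
  apply Rle_trans with (1 := norm_scal_le _ _ _ _ Hab (Hkb v Hv)).
  unfold g. replace (Rpower v rho) with (v * Rpower v (rho - 1)).
  - right. field. lra.
  - rewrite <- (Rpower_1 v) at 1 by lra. rewrite <- Rpower_plus. f_equal. ring. }
assert (Hfc0 : forall d v, 0 < d -> continuous (fd d) v).
{ intros d v Hd. destruct (Rtotal_order v 0) as [Hv|[->|Hv]]; [|  |auto].
  - apply (continuous_ext_loc _ (fun _ : R => zero : V)); [|apply continuous_const].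
    assert (Hi : inn m_infty 0 v) by (split; simpl; auto).
    generalize (locally_inn m_infty 0 v Hi). apply filter_imp. intros z [_ Hz]. simpl in Hz. unfold fd. destruct (Rle_dec z 0); [auto|lra].
  - apply continuous_eps. intros eps He.
    assert (E0 : fd d 0 = zero) by (unfold fd; destruct (Rle_dec 0 0); [auto|lra]).
    destruct (small_pow_0 (k / d / Gamma rho) rho eps Hrho He) as [e Hex].
    assert (Hm : 0 < Rmin e t) by (apply Rmin_glb_lt; [apply cond_pos|auto]).
    exists (mkposreal _ Hm). intros y Hy. assert (Hy' : Rabs (y - 0) < Rmin e t) by exact Hy.
    assert (Em : minus (fd d y) (fd d 0) = fd d y) by (rewrite E0; exact (minus_zero_r (fd d y))).
    apply Rle_trans with (norm (fd d y)); [right; exact (f_equal norm Em)|].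
    destruct (Rle_dec y 0) as [Hy0|Hy0].
    + unfold fd. destruct (Rle_dec y 0); [|lra]. apply Rle_trans with 0; [right; exact norm_zeroV|lra].
    + rewrite Rminus_0_r, Rabs_pos_eq in Hy' by lra.
      assert (y < e /\ y < t) by (generalize (Rmin_l e t) (Rmin_r e t); lra).
      apply Rle_trans with (1 := Hpw d y Hd ltac:(lra)).
      refine (proj2 (Hex y _ _)); [|lra]. change (Rabs (y - 0) < e). rewrite Rminus_0_r, Rabs_pos_eq; lra. }
assert (Ed : forall d, 0 < d -> conv a (conv b (fd d)) t = conv b (conv a (fd d)) t).
{ intros d Hd. assert (HP := Rpower_pos t rho).
  assert (HM : 0 <= k / d / Gamma rho).
  { repeat apply Rmult_le_pos; auto; left; now apply Rinv_0_lt_compat. }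
  apply (conv_comm_cont a b (k / d / Gamma rho * Rpower t rho)); auto.
  - apply Rmult_le_pos; lra.
  - intros s Hs0. unfold fd. destruct (Rle_dec s 0); [auto|lra].
  - intros s Hst. destruct (Rle_dec s 0) as [Hs0|Hs0].
    + unfold fd. destruct (Rle_dec s 0); [|lra]. apply Rle_trans with 0; [right; exact norm_zeroV|apply Rmult_le_pos; lra].
    + apply Rle_trans with (1 := Hpw d s Hd ltac:(lra)). apply Rmult_le_compat_l; auto. apply Rle_Rpower_l; lra. }
set (k' := k * Gamma rh / Gamma rho). assert (Hk' : 0 <= k').
{ unfold k'. repeat apply Rmult_le_pos; try lra. left; now apply Rinv_0_lt_compat. }
assert (Hdiff : forall d a' b', 0 < d -> 0 < a' -> 0 < b' ->
  norm (minus (conv a' (conv b' f) t) (conv a' (conv b' (fd d)) t)) <= k' * Rpower d kap * g (a' + (b' + rh)) t).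
{ intros d a' b' Hd Ha' Hb'.
  assert (HD : forall s, 0 < s <= t -> norm (minus (f s) (fd d s)) <= k' * Rpower d kap * g rh s).
  { intros s Hs'. rewrite Hfd by lra.
    assert (Es : minus (f s) (scal (phi d s) (f s)) = scal (1 - phi d s) (f s)).
    { transitivity (minus (scal 1 (f s)) (scal (phi d s) (f s))); [f_equal; symmetry; exact (scal_one (f s))|].
      symmetry. exact (scal_minus_distr_r 1 (phi d s) (f s)). }
    rewrite Es. assert (Hab : Rabs (1 - phi d s) <= Rpower d kap * Rpower s (- kap)).
    { destruct (Hphi d s Hd ltac:(lra)). rewrite Rabs_pos_eq by lra. apply Hpp; lra. }
    apply Rle_trans with (1 := norm_scal_le _ _ _ _ Hab (Hkb s Hs')).
    unfold g, k', rh. replace (rho - kap - 1) with (- kap + (rho - 1)) by ring. rewrite Rpower_plus.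
    right. field. fold rh. lra. }
  assert (Hrh : 0 < rh) by (unfold rh; lra).
  assert (HP : 0 <= k' * Rpower d kap) by (apply Rmult_le_pos; auto; left; apply Rpower_pos).
  assert (HScv : forall h : R -> V, sing rho h -> sing (b' + rho) (conv b' h)) by (intros; now apply conv_sing).
  rewrite <- (conv_minus a' (b' + rho)); auto; try lra.
  apply (conv_bound a' (b' + rh)); auto; try lra.
  - intros s Hs'. apply (continuous_minus (V := V)); apply HScv; auto; lra.
  - intros s Hs'. rewrite <- (conv_minus b' rho); auto; try lra.
    apply (conv_bound b' rh); auto; try lra.
    + intros v Hv. apply (continuous_minus (V := V)); [apply Hc; lra|auto].
    + intros v Hv. apply HD. lra. }
apply (eq_of_norm_le _ _ (k' * g (a + (b + rh)) t + k' * g (b + (a + rh)) t)).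
intros eps He. set (d := Rpower eps (/ kap)). assert (Hd : 0 < d) by apply Rpower_pos.
assert (Edk : Rpower d kap = eps).
{ unfold d. rewrite Rpower_mult, Rinv_l, Rpower_1; lra. }
apply Rle_trans with (1 := norm_minus_tri _ (conv a (conv b (fd d)) t) _).
apply Rle_trans with (k' * Rpower d kap * g (a + (b + rh)) t + k' * Rpower d kap * g (b + (a + rh)) t).
- apply Rplus_le_compat; [now apply Hdiff|]. rewrite norm_minus_sym, (Ed d Hd). now apply Hdiff.
- rewrite Edk. right. ring.
Qed.

(** Doubling eta lifts the restriction al eta < 1, as g_b * g_b = g_(2b). *)
Lemma kernel_g al eta t : 0 < al < 1 -> 0 < eta <= 2 -> 0 < t ->
  is_RInt_gen (V := RC) (fun s => scal (kker al t s) (g (eta + 1) s)) (lo 0) (hi p_infty) (g (al * eta) t).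
Proof.
intros Hal Heta Ht. set (e := eta / 2). assert (He : 0 < e) by (unfold e; lra).
assert (Hb : al * e < 1) by (unfold e; nra). assert (Hbp : 0 < al * e) by (apply Rmult_lt_0_compat; lra).
assert (HG := Gamma_pos (e + 1) ltac:(lra)).
set (G := fun s => ppow e s / Gamma (e + 1)).
assert (EG : forall s, 0 < s -> G s = g (e + 1) s).
{ intros s Hs. unfold G, g. rewrite ppow_pos by auto. now replace (e + 1 - 1) with e by ring. }
assert (HGr : growth (V := RC) e 1 (/ Gamma (e + 1)) G).
{ split; [left; now apply Rinv_0_lt_compat|]. split; [|split].
  - intros s. apply continuous_Rmult; [now apply continuous_ppow|apply continuous_const].
  - intros s Hs. unfold G. rewrite ppow_neg by auto. apply Rmult_0_l.
  - intros s Hs. unfold norm; simpl; unfold abs; simpl. unfold G. rewrite ppow_pos by auto.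
    assert (Hpp := Rpower_pos s e).
    rewrite Rabs_pos_eq by (left; now apply Rdiv_lt_0_compat). rewrite Rmult_1_l.
    unfold Rdiv. rewrite Rmult_comm. apply Rmult_le_compat_l; [left; now apply Rinv_0_lt_compat|].
    assert (1 <= exp s) by (rewrite <- exp_0; apply exp_le; lra). nra. }
assert (EK : forall s, 0 < s -> kint (V := RC) al G s = g (al * e) s).
{ intros s Hs. apply (II_unique (V := RC)). generalize (kernel_g_small al e s Hal He Hb Hs).
  apply (is_RInt_gen_ext_inn (V := RC)); [simpl; auto|]. intros r [Hr _]. now rewrite EG. }
destruct (kint_convolution (V := RC) al e 1 _ t G Hal He Rlt_0_1 HGr Ht) as [v [H1 H2]].
assert (Ev : v = g (al * eta) t).
{ rewrite <- (II_unique (V := RC) _ _ _ _ H1). apply (II_unique (V := RC)).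
  replace (al * eta) with (al * e + al * e) by (unfold e; field).
  generalize (g_convolution (al * e) (al * e) t Hbp Hbp Ht).
  apply (is_RInt_gen_ext_inn (V := RC)); [exact Ht|]. intros s [Hs _]. rewrite EK by auto. reflexivity. }
rewrite <- Ev. revert H2. apply (is_RInt_gen_ext_inn (V := RC)); [simpl; auto|]. intros s [Hs _]. simpl in Hs.
f_equal. apply (conv_unique (V := RC)).
replace (eta + 1) with (e + (e + 1)) by (unfold e; field).
generalize (g_convolution e (e + 1) s He ltac:(lra) Hs).
apply (is_RInt_gen_ext_inn (V := RC)); [exact Hs|]. intros r [Hr _]. rewrite EG by auto. reflexivity.
Qed.

Lemma psi_decay al t m : 0 < al < 1 -> 0 < t -> 0 < m -> exists C, 0 < C /\
  forall s, 0 <= s -> Rabs (psi al 0 t s) <= C * exp (- (m * s)).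
Proof.
intros Hal Ht Hm.
set (N := m * Rpower t al). assert (HN : 0 < N) by (apply Rmult_lt_0_compat; [auto|apply Rpower_pos]).
destruct (wr_decay al 0 N (or_introl eq_refl) Hal HN) as [C [HC HCx]].
assert (Hit : 0 < / t) by now apply Rinv_0_lt_compat.
exists (/ t * C). split; [now apply Rmult_lt_0_compat|]. intros s Hs.
rewrite psi_wr by auto. rewrite Rabs_mult, (Rabs_pos_eq (/ t)) by lra. rewrite Rmult_assoc.
apply Rmult_le_compat_l; [lra|].
replace (m * s) with (N * (s * Rpower t (- al))).
- apply HCx. apply Rmult_le_pos; auto. left; apply Rpower_pos.
- unfold N. replace (m * Rpower t al * (s * Rpower t (- al))) with (m * s * (Rpower t al * Rpower t (- al))) by ring.
  rewrite <- Rpower_plus, Rplus_opp_r, Rpower_O by auto. ring.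
Qed.

(** Integration by parts moves the integral from q to its primitive F, which
    unlike q is exponentially bounded. *)
Lemma kint_parts {V : RNM} al eta mu a t (q F : R -> V) : 0 < al < 1 -> 0 < eta -> 0 <= mu -> 0 < t ->
  growth eta mu a F -> (forall s, 0 < s -> continuous q s /\ is_derive F s (q s)) ->
  is_RInt_gen (fun s => scal (psi al 0 t s) (q s)) (lo 0) (hi p_infty) (kint al F t).
Proof.
intros Hal Heta Hmu Ht HF Hq. assert (HF' := HF). destruct HF' as [Ha [Hc [Hz Hg]]].
set (H := fun s => scal (psi al 0 t s) (F s)).
assert (E : kint al F t = plus (minus zero zero) (kint al F t)).
{ transitivity (plus zero (kint al F t)); [symmetry; exact (plus_zero_l (kint al F t))|].
  f_equal. symmetry. exact (minus_eq_zero zero). }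
rewrite E.
apply (is_RInt_gen_parts 0 p_infty (fun s => scal (psi al 0 t s) (q s)) (fun s => scal (kker al t s) (F s)) H).
- simpl; auto.
- intros s [Hs _]. apply continuous_scal_R; [now apply continuous_psi|now apply Hq].
- intros x y [Hx _] [Hy _] Hxy. simpl in Hx, Hy.
  assert (I1 : is_RInt (fun s => plus (scal (- kker al t s) (F s)) (scal (psi al 0 t s) (q s))) x y (minus (H y) (H x))).
  { apply (is_RInt_scal_derive (psi al 0 t) F (fun s => - kker al t s) q x y).
    - intros s _. now apply is_derive_psi.
    - intros s Hs. rewrite Rmin_left, Rmax_right in Hs by auto. apply Hq. lra.
    - intros s _. apply (continuous_opp (V := R_NormedModule)). now apply continuous_kker.
    - intros s Hs. rewrite Rmin_left, Rmax_right in Hs by auto. apply Hq. lra. }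
  assert (I2 : is_RInt (fun s => scal (kker al t s) (F s)) x y (RInt (fun s => scal (kker al t s) (F s)) x y)).
  { apply RInt_correct. apply ex_RInt_continuous. intros s _. apply continuous_scal_R; [now apply continuous_kker|auto]. }
  apply is_RInt_unique. generalize (is_RInt_plus (V := V) _ _ _ _ _ _ I1 I2). apply is_RInt_ext.
  intros s _.
  assert (Eo : scal (- kker al t s) (F s) = opp (scal (kker al t s) (F s))) by exact (scal_opp_l (kker al t s) (F s)).
  rewrite Eo. generalize (scal (kker al t s) (F s)) (scal (psi al 0 t s) (q s)). intros u v.
  rewrite (plus_comm (opp u)), <- plus_assoc.
  transitivity (plus v zero); [f_equal; exact (plus_opp_l u)|exact (plus_zero_r v)].
- apply lo_filterlim_cont.
  + apply continuous_scal_R; [now apply continuous_psi|auto].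
  + unfold H. rewrite Hz by lra. exact (scal_zeroV _).
- destruct (psi_decay al t (mu + 2) Hal Ht ltac:(lra)) as [C [HC HCx]].
  destruct (Rpower_le_exp eta 1 Heta Rlt_0_1) as [D [HD HDx]].
  apply filterlim_eps; [apply _|]. intros eps He.
  destruct (Rlt_le_dec 0 (C * a * D)) as [HP|HP].
  + exists (Rmax 0 (- ln (eps / (C * a * D)))). intros s Hs.
    assert (Hs0 : 0 < s) by (generalize (Rmax_l 0 (- ln (eps / (C * a * D)))); lra).
    assert (Hs1 : - s < ln (eps / (C * a * D))) by (generalize (Rmax_r 0 (- ln (eps / (C * a * D)))); lra).
    assert (Eh : minus (H s) zero = H s) by exact (minus_zero_r (H s)).
    apply Rle_trans with (norm (H s)); [right; exact (f_equal norm Eh)|].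
    apply Rle_trans with (1 := norm_scal_le _ _ _ _ (HCx s ltac:(lra)) (Hg s Hs0)).
    apply Rle_trans with (C * a * D * exp (- s)).
    * apply Rle_trans with (C * exp (- ((mu + 2) * s)) * (a * (D * exp (1 * s) * exp (mu * s)))).
      -- apply Rmult_le_compat_l; [apply Rmult_le_pos; [lra|left; apply exp_pos]|].
         apply Rmult_le_compat_l; auto. apply Rmult_le_compat_r; [left; apply exp_pos|auto].
      -- right. replace (- ((mu + 2) * s)) with (- (1 * s) + (- (mu * s) + - s)) by ring.
         rewrite !exp_plus, (exp_Ropp (1 * s)), (exp_Ropp (mu * s)).
         assert (H1 := exp_pos (1 * s)). assert (H2 := exp_pos (mu * s)). field. lra.
    * left. apply exp_increasing in Hs1. rewrite exp_ln in Hs1 by (now apply Rdiv_lt_0_compat).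
      apply Rmult_lt_compat_l with (r := C * a * D) in Hs1; auto.
      assert (EP : forall P, 0 < P -> P * (eps / P) = eps) by (intros; field; lra).
      rewrite EP in Hs1 by auto. exact Hs1.
  + exists 0. intros s Hs.
    assert (Ha0 : a = 0).
    { destruct (Rle_lt_or_eq_dec 0 a Ha) as [Hap|]; auto. exfalso.
      assert (0 < C * a * D) by (repeat apply Rmult_lt_0_compat; lra). lra. }
    assert (Eh : minus (H s) zero = H s) by exact (minus_zero_r (H s)).
    apply Rle_trans with (norm (H s)); [right; exact (f_equal norm Eh)|].
    apply Rle_trans with (1 := norm_scal_le _ _ _ _ (HCx s ltac:(lra)) (Hg s Hs)). rewrite Ha0. lra.
- now apply kint_correct with eta mu a.
Qed.

(** The kernel sends the leading term g_(eta+1) x of F to g_b x, with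
    b = al eta, and the remainder, which is small compared with s^eta at 0, to
    something small compared with g_b. *)
Lemma kint_initial {V : RNM} al eta mu a (F : R -> V) (x : V) : 0 < al < 1 -> 0 < eta <= 2 -> 0 <= mu ->
  growth eta mu a F ->
  (forall eps, 0 < eps -> exists d, 0 < d /\ forall s, 0 < s < d ->
     norm (minus (F s) (scal (g (eta + 1) s) x)) <= eps * Rpower s eta) ->
  filterlim (fun t => scal (/ g (al * eta) t) (kint al F t)) (at_right 0) (locally x).
Proof.
intros Hal Heta Hmu HF HL. assert (HF' := HF). destruct HF' as [Ha [Hc [Hz Hg]]].
set (b := al * eta). assert (Hb : 0 < b) by (apply Rmult_lt_0_compat; lra).
assert (HGb := Gamma_pos b Hb). assert (HGe := Gamma_pos (eta + 1) ltac:(lra)).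
destruct (kint_small (V := V) al eta (eta + 1) mu Hal ltac:(lra) ltac:(lra) Hmu) as [C0 [HC0 H0]].
apply filterlim_eps; [apply _|]. intros eps He.
set (ep := eps / (2 * (C0 * Gamma b))).
assert (HCG : 0 < C0 * Gamma b) by now apply Rmult_lt_0_compat.
assert (Hep : 0 < ep) by (apply Rdiv_lt_0_compat; lra).
destruct (HL ep Hep) as [d [Hd Hds]].
set (C := (a + norm x / Gamma (eta + 1)) / d).
assert (Hnx : 0 <= norm x / Gamma (eta + 1)) by (apply Rmult_le_pos; [apply norm_ge_0|left; now apply Rinv_0_lt_compat]).
assert (HC : 0 <= C) by (apply Rmult_le_pos; [lra|left; now apply Rinv_0_lt_compat]).
set (Rm := fun s => minus (F s) (scal (g (eta + 1) s) x)).
assert (HR : forall s, 0 < s -> norm (Rm s) <= (ep * Rpower s eta + C * Rpower s (eta + 1)) * exp (mu * s)).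
{ intros s Hs. assert (Hse := Rpower_pos s eta). assert (Hse1 := Rpower_pos s (eta + 1)).
  assert (He1 : 1 <= exp (mu * s)) by (rewrite <- exp_0; apply exp_le; apply Rmult_le_pos; lra).
  destruct (Rlt_le_dec s d) as [Hsd|Hsd].
  - apply Rle_trans with (1 := Hds s (conj Hs Hsd)).
    assert (0 <= C * Rpower s (eta + 1)) by (apply Rmult_le_pos; lra).
    assert (0 <= ep * Rpower s eta) by (apply Rmult_le_pos; lra). nra.
  - assert (Hn : norm (Rm s) <= a * (Rpower s eta * exp (mu * s)) + Rpower s eta / Gamma (eta + 1) * norm x).
    { unfold Rm, minus. apply Rle_trans with (1 := norm_tri _ _). rewrite norm_oppV.
      apply Rplus_le_compat; [auto|]. apply norm_scal_le; [|lra].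
      rewrite Rabs_pos_eq by (left; apply g_pos; lra). unfold g. replace (eta + 1 - 1) with eta by ring. lra. }
    apply Rle_trans with (1 := Hn).
    assert (HCs : (a + norm x / Gamma (eta + 1)) * Rpower s eta <= C * Rpower s (eta + 1)).
    { rewrite Rpower_plus, Rpower_1 by auto. unfold C.
      replace ((a + norm x / Gamma (eta + 1)) / d * (Rpower s eta * s)) with
        ((a + norm x / Gamma (eta + 1)) * Rpower s eta * (s / d)) by (field; lra).
      rewrite <- (Rmult_1_r (_ * Rpower s eta)) at 1. apply Rmult_le_compat_l; [apply Rmult_le_pos; lra|].
      apply Rmult_le_reg_r with d; auto. unfold Rdiv. rewrite Rmult_assoc, Rinv_l; lra. }
    apply Rle_trans with ((a + norm x / Gamma (eta + 1)) * Rpower s eta * exp (mu * s)).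
    + replace ((a + norm x / Gamma (eta + 1)) * Rpower s eta * exp (mu * s)) with
        (a * (Rpower s eta * exp (mu * s)) + Rpower s eta / Gamma (eta + 1) * norm x * exp (mu * s)) by (field; lra).
      apply Rplus_le_compat_l.
      assert (0 <= Rpower s eta / Gamma (eta + 1) * norm x).
      { apply Rmult_le_pos; [|apply norm_ge_0]. apply Rlt_le. now apply Rdiv_lt_0_compat. }
      nra.
    + apply Rmult_le_compat_r; [lra|]. assert (0 <= ep * Rpower s eta) by (apply Rmult_le_pos; lra). lra. }
destruct (small_pow_0 (C0 * Gamma b * C) al (eps / 2) ltac:(lra) ltac:(lra)) as [e Hex].
exists e. intros t Hte Ht. destruct (Hex t Hte Ht) as [Ht1 Ht2].
assert (EK : kint al Rm t = minus (kint al F t) (scal (g b t) x)).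
{ apply II_unique.
  assert (I1 := kint_correct al eta mu a t F Hal ltac:(lra) Hmu HF Ht).
  assert (I2 := is_RInt_gen_scal_vec _ _ _ x _ (kernel_g al eta t Hal Heta Ht)). fold b in I2.
  generalize (is_RInt_gen_minus (V := V) _ _ _ _ I1 I2).
  apply is_RInt_gen_ext_inn; [simpl; auto|]. intros s _. unfold Rm.
  transitivity (minus (scal (kker al t s) (F s)) (scal (kker al t s) (scal (g (eta + 1) s) x))).
  - f_equal. symmetry. exact (scal_assoc (kker al t s) (g (eta + 1) s) x).
  - symmetry. exact (scal_minus_distr_l (kker al t s) (F s) _). }
assert (Hgt : 0 < g b t) by now apply g_pos.
assert (Ex : minus (scal (/ g b t) (kint al F t)) x = scal (/ g b t) (kint al Rm t)).
{ rewrite EK. transitivity (minus (scal (/ g b t) (kint al F t)) (scal (/ g b t) (scal (g b t) x))).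
  - f_equal. transitivity (scal 1 x); [symmetry; exact (scal_one x)|].
    replace 1 with (/ g b t * g b t) by (field; lra). symmetry. exact (scal_assoc (/ g b t) (g b t) x).
  - symmetry. exact (scal_minus_distr_l (/ g b t) _ _). }
apply Rle_trans with (norm (scal (/ g b t) (kint al Rm t))); [right; exact (f_equal norm Ex)|].
assert (HcR : forall s, 0 < s -> continuous Rm s).
{ intros s Hs. apply (continuous_minus (V := V)); [apply Hc|]. apply continuous_scal_R; [now apply continuous_g|apply continuous_const]. }
assert (Hk := H0 ep C t Rm ltac:(lra) HC Ht1 HcR HR).
assert (Hgi : Rabs (/ g b t) <= Gamma b * Rpower t (1 - b)).
{ rewrite Rabs_pos_eq by (left; now apply Rinv_0_lt_compat). unfold g.
  replace (1 - b) with (- (b - 1)) by ring. rewrite Rpower_Ropp. assert (Hp := Rpower_pos t (b - 1)). right. field. lra. }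
apply Rle_trans with (1 := norm_scal_le _ _ _ _ Hgi Hk).
assert (E1 : Rpower t (1 - b) * Rpower t (al * eta - 1) = 1).
{ fold b. rewrite <- Rpower_plus. replace (1 - b + (b - 1)) with 0 by ring. now apply Rpower_O. }
assert (E2 : Rpower t (1 - b) * Rpower t (al * (eta + 1) - 1) = Rpower t al).
{ rewrite <- Rpower_plus. f_equal. unfold b. ring. }
replace (Gamma b * Rpower t (1 - b) * (C0 * (ep * Rpower t (al * eta - 1) + C * Rpower t (al * (eta + 1) - 1))))
 with (C0 * Gamma b * ep * (Rpower t (1 - b) * Rpower t (al * eta - 1)) + C0 * Gamma b * C * (Rpower t (1 - b) * Rpower t (al * (eta + 1) - 1))) by ring.
rewrite E1, E2.
replace (C0 * Gamma b * ep * 1) with (eps / 2) by (unfold ep; field; lra). lra.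
Qed.

Lemma norm_minus_le {V : RNM} (x y : V) : norm (minus x y) <= norm x + norm y.
Proof. apply Rle_trans with (1 := norm_tri x (opp y)). right. f_equal. exact (norm_oppV y). Qed.

(** * Primitives of orbits *)

Lemma g_1 x : 0 < x -> g 1 x = 1.
Proof. intros H. unfold g. replace (1 - 1) with 0 by ring. rewrite Rpower_O, Gamma_1 by auto. field. Qed.

(** At an end where f is continuous, the one-sided limit is attained. *)
Lemma is_RInt_gen_hi_point {V : RNM} (f : R -> V) a b x v : inn a b x ->
  (forall z, inn a b z -> continuous f z) ->
  is_RInt_gen f (lo a) (hi x) v -> is_RInt_gen f (lo a) (at_point x) v.
Proof.
intros Hx Hc Hv. apply lim_of_is_RInt_gen in Hv.
assert (Hax : Rbar_lt a x) by apply Hx.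
destruct (inn_exists a x Hax) as [z0 Hz0].
intros P [eps HP].
assert (He : 0 < eps / 2 / norm_factor (V := V)).
{ apply Rdiv_lt_0_compat; [generalize (cond_pos eps); lra|apply norm_factor_gt_0]. }
destruct (filterlim_eps_inv _ _ _ Hv (eps / 2) ltac:(generalize (cond_pos eps); lra)) as [Q1 Q2 HQ1 HQ2 HQ].
assert (HA : lo a (fun u => Q1 u /\ inn a x u)).
{ apply filter_and; auto. generalize (lo_inn a x z0 Hz0). apply filter_imp. now intros u [Hu _]. }
refine (Filter_prod _ _ _ (fun u => Q1 u /\ inn a x u) (fun y => y = x) HA eq_refl _).
intros u y [Hu [Hu1 Hu2]] ->. simpl. exists (RInt f u x).
assert (Hiu : inn a b u).
{ split; auto. apply Rbar_lt_trans with x; [exact Hu2|apply Hx]. }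
assert (Hex : forall y, inn a b y -> ex_RInt f u y) by (intros; now apply cont_ex_RInt with a b).
split; [apply RInt_correct; auto|].
apply HP. apply norm_compat1.
apply Rle_lt_trans with (eps / 2); [|generalize (cond_pos eps); lra].
apply (filterlim_norm_le (at_left x) (fun w => RInt f u w) (RInt f u x) v).
- assert (Hcx : continuous (fun w => RInt f u w) x).
  { apply (continuous_RInt_1 (V := V) f u x (fun y => RInt f u y)).
    generalize (locally_inn a b x Hx). apply filter_imp. intros y Hy. apply RInt_correct. auto. }
  apply filterlim_filter_le_1 with (2 := Hcx). apply filter_le_within.
- change (hi x (fun w => norm (minus (RInt f u w) v) <= eps / 2)).
  generalize HQ2. apply filter_imp. intros w Hw. exact (HQ u w Hu Hw).
Qed.

Lemma conv_1_correct {V : RNM} rho (q : R -> V) s : 0 < rho -> 0 < s -> sing rho q ->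
  is_RInt_gen q (lo 0) (hi s) (conv 1 q s).
Proof.
intros Hr Hs HS. generalize (conv_correct 1 rho q s Rlt_0_1 Hr Hs HS).
apply is_RInt_gen_ext_inn; [exact Hs|]. intros v [_ Hv]. simpl in Hv.
rewrite g_1 by lra. exact (scal_one (q v)).
Qed.

Lemma conv_1_split {V : RNM} rho (q : R -> V) x y : 0 < rho -> 0 < x -> 0 < y -> sing rho q ->
  conv 1 q y = plus (conv 1 q x) (RInt q x y).
Proof.
intros Hr Hx Hy HS.
assert (Hc : forall z, inn 0 p_infty z -> continuous q z) by (intros z [Hz _]; now apply HS).
assert (P : forall z, 0 < z -> is_RInt_gen q (lo 0) (at_point z) (conv 1 q z)).
{ intros z Hz. apply (is_RInt_gen_hi_point q 0 p_infty z); auto; [split; simpl; auto|]. now apply conv_1_correct with rho. }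
assert (I : is_RInt_gen q (at_point x) (at_point y) (RInt q x y)).
{ apply is_RInt_gen_at_point. apply RInt_correct. apply (cont_ex_RInt 0 p_infty); auto; split; simpl; auto. }
assert (H := is_RInt_gen_Chasles q x _ _ (P x Hx) I).
rewrite <- (is_RInt_gen_unique (V := V) _ _ (P y Hy)). now apply (is_RInt_gen_unique (V := V)).
Qed.

Definition prim {V : RNM} (q : R -> V) (s : R) : V := if Rle_dec s 0 then zero else conv 1 q s.

Lemma prim_pos {V : RNM} (q : R -> V) s : 0 < s -> prim q s = conv 1 q s.
Proof. intros H. unfold prim. destruct (Rle_dec s 0); [lra|auto]. Qed.

Lemma prim_neg {V : RNM} (q : R -> V) s : s <= 0 -> prim q s = zero.
Proof. intros H. unfold prim. destruct (Rle_dec s 0); [auto|lra]. Qed.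

Lemma prim_derive {V : RNM} rho (q : R -> V) s : 0 < rho -> 0 < s -> sing rho q -> is_derive (prim q) s (q s).
Proof.
intros Hr Hs HS.
assert (Hc : forall z, inn 0 p_infty z -> continuous q z) by (intros z [Hz _]; now apply HS).
assert (Hi : inn 0 p_infty s) by (split; simpl; auto).
apply (is_derive_ext_loc (fun y => plus (conv 1 q s) (RInt q s y))).
{ generalize (locally_inn 0 p_infty s Hi). apply filter_imp. intros y [Hy _]. simpl in Hy.
  rewrite prim_pos by auto. symmetry. now apply conv_1_split with rho. }
assert (E : plus zero (q s) = q s) by exact (plus_zero_l (q s)). rewrite <- E.
apply (is_derive_plus (V := V) (fun _ => conv 1 q s)); [exact (is_derive_const (conv 1 q s) s)|].
apply (is_derive_RInt q (fun y => RInt q s y) s).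
- generalize (locally_inn 0 p_infty s Hi). apply filter_imp. intros y Hy. apply RInt_correct. now apply (cont_ex_RInt 0 p_infty).
- now apply Hc.
Qed.

Lemma prim_bound {V : RNM} rho k s (q : R -> V) : 0 < rho -> 0 <= k -> 0 < s ->
  (forall v, 0 < v < s -> continuous q v) -> (forall v, 0 < v < s -> norm (q v) <= k * g rho v) ->
  norm (prim q s) <= k / Gamma (rho + 1) * Rpower s rho.
Proof.
intros Hr Hk Hs Hc Hb. rewrite prim_pos by auto.
destruct (conv_bound 1 rho k s q Rlt_0_1 Hr Hk Hs Hc Hb) as [_ H].
apply Rle_trans with (1 := H). unfold g. rewrite (Rplus_comm 1 rho). replace (rho + 1 - 1) with rho by ring.
right. unfold Rdiv. ring.
Qed.

Lemma prim_continuous {V : RNM} rho (q : R -> V) s : 0 < rho -> sing rho q -> continuous (prim q) s.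
Proof.
intros Hr HS. destruct (Rtotal_order s 0) as [Hs|[->|Hs]].
- apply (continuous_ext_loc _ (fun _ : R => zero : V)); [|apply continuous_const].
  assert (Hi : inn m_infty 0 s) by (split; simpl; auto).
  generalize (locally_inn m_infty 0 s Hi). apply filter_imp. intros z [_ Hz]. simpl in Hz. now rewrite prim_neg by lra.
- assert (HS' := HS). destruct HS' as [Hc Hb]. destruct (Hb 1 Rlt_0_1) as [k [Hk Hkb]].
  apply continuous_eps. intros eps He.
  destruct (small_pow_0 (k / Gamma (rho + 1)) rho eps Hr He) as [e Hex].
  assert (Hm : 0 < Rmin e 1) by (apply Rmin_glb_lt; [apply cond_pos|lra]).
  exists (mkposreal _ Hm). intros y Hy. assert (Hy' : Rabs (y - 0) < Rmin e 1) by exact Hy.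
  assert (Em : minus (prim q y) (prim q 0) = prim q y).
  { rewrite (prim_neg q 0) by lra. exact (minus_zero_r (prim q y)). }
  apply Rle_trans with (norm (prim q y)); [right; exact (f_equal norm Em)|].
  destruct (Rle_dec y 0) as [Hy0|Hy0].
  + rewrite prim_neg by auto. apply Rle_trans with 0; [right; exact norm_zeroV|lra].
  + rewrite Rminus_0_r, Rabs_pos_eq in Hy' by lra.
    assert (y < e /\ y < 1) by (generalize (Rmin_l e 1) (Rmin_r e 1); lra).
    apply Rle_trans with (k / Gamma (rho + 1) * Rpower y rho).
    * apply prim_bound; auto; try lra; intros; [apply Hc|apply Hkb]; lra.
    * refine (proj2 (Hex y _ _)); [|lra]. change (Rabs (y - 0) < e). rewrite Rminus_0_r, Rabs_pos_eq; lra.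
- apply (ex_derive_continuous (V := V)). exists (q s). now apply prim_derive with rho.
Qed.

(** F is the Stieltjes integral of e^(mu v) against the partial Laplace
    integral G, which is bounded even if the Laplace integral converges only
    conditionally. *)
Lemma prim_growth {V : RNM} eta mu (q : R -> V) l : 0 < eta -> 0 < mu -> sing eta q ->
  is_RInt_gen (fun s => scal (exp (- (mu * s))) (q s)) (lo 0) (hi p_infty) l ->
  exists a, growth eta mu a (prim q).
Proof.
intros Heta Hmu HS HL. assert (HS' := HS). destruct HS' as [Hc Hb].
set (h := fun s => scal (exp (- (mu * s))) (q s)).
assert (Hce : forall s, continuous (fun s => exp (- (mu * s))) s).
{ intros s. apply deriv_cont. auto_derive. auto. }
assert (Hch : forall s, 0 < s -> continuous h s).
{ intros s Hs. apply continuous_scal_R; auto. }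
assert (Hexh : forall x y, 0 < x -> 0 < y -> ex_RInt h x y).
{ intros x y Hx Hy. apply (cont_ex_RInt 0 p_infty); try (split; simpl; auto). intros z [Hz _]. now apply Hch. }
(* bounded near infinity by convergence, before by the bound on q *)
assert (HB : exists M, 0 <= M /\ forall s, 1 <= s -> norm (RInt h 1 s) <= M).
{ apply lim_of_is_RInt_gen in HL.
  destruct (filterlim_eps_inv _ _ _ HL 1 Rlt_0_1) as [Q1 Q2 HQ1 HQ2 HQ].
  assert (HI : inn 0 p_infty 1) by (split; simpl; auto; lra).
  destruct (filter_ex _ (filter_and _ _ HQ1 (lo_inn 0 p_infty 1 HI))) as [x0 [Hx0 [[Hx0p _] Hx01]]]. simpl in Hx0p.
  destruct HQ2 as [S HS2].
  set (S1 := Rmax 1 (S + 1)).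
  destruct (Hb S1 ltac:(apply Rlt_le_trans with 1; [lra|apply Rmax_l])) as [k [Hk Hkb]].
  destruct (Rpower_bound (eta - 1) 1 S1 Rlt_0_1) as [D [HD HDx]].
  assert (HGe := Gamma_pos eta Heta).
  set (N := k * (D / Gamma eta)). assert (HN : 0 <= N) by (apply Rmult_le_pos; auto; apply Rlt_le; now apply Rdiv_lt_0_compat).
  assert (HS1 : 1 <= S1) by apply Rmax_l.
  assert (Hin : forall s, 1 <= s <= S1 -> norm (RInt h 1 s) <= (S1 - 1) * N).
  { intros s Hs. apply Rle_trans with (Rabs (s - 1) * N).
    - apply norm_RInt_le_abs; [apply Hexh; lra|]. intros z Hz. rewrite Rmin_left, Rmax_right in Hz by lra.
      unfold h. rewrite <- (Rmult_1_l N). apply norm_scal_le.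
      + rewrite Rabs_pos_eq by (left; apply exp_pos). rewrite <- exp_0. apply exp_le.
        assert (0 <= mu * z) by (apply Rmult_le_pos; lra). lra.
      + apply Rle_trans with (1 := Hkb z ltac:(lra)). apply Rmult_le_compat_l; auto. unfold g.
        apply Rmult_le_compat_r; [left; now apply Rinv_0_lt_compat|]. apply HDx; lra.
    - rewrite Rabs_pos_eq by lra. apply Rmult_le_compat_r; lra. }
  assert (HP0 : 0 <= (S1 - 1) * N) by (apply Rmult_le_pos; lra).
  exists ((S1 - 1) * N + 2). split; [lra|]. intros s Hs.
  destruct (Rle_dec s S1) as [Hle|Hgt]; [apply Rle_trans with (1 := Hin s (conj Hs Hle)); lra|].
  assert (HSs : S < s /\ S < S1) by (generalize (Rmax_r 1 (S + 1)); fold S1; lra).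
  assert (E : RInt h 1 s = plus (RInt h 1 S1) (minus (RInt h x0 s) (RInt h x0 S1))).
  { assert (C1 : RInt h 1 s = plus (RInt h 1 S1) (RInt h S1 s)).
    { symmetry. apply (RInt_Chasles h 1 S1 s); apply Hexh; lra. }
    rewrite C1. f_equal.
    assert (C2 : RInt h x0 s = plus (RInt h x0 S1) (RInt h S1 s)).
    { symmetry. apply (RInt_Chasles h x0 S1 s); apply Hexh; lra. }
    rewrite C2. symmetry. exact (plus_minus_l (RInt h x0 S1) (RInt h S1 s)). }
  rewrite E. apply Rle_trans with (1 := norm_tri _ _). apply Rplus_le_compat; [apply Hin; lra|].
  apply Rle_trans with (1 := norm_minus_tri _ l _).
  apply Rle_trans with (1 + 1); [|lra]. apply Rplus_le_compat.
  - exact (HQ x0 s Hx0 (HS2 s (proj1 HSs))).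
  - rewrite norm_minus_sym. exact (HQ x0 S1 Hx0 (HS2 S1 (proj2 HSs))). }
destruct HB as [M [HM HMs]].
destruct (Hb 1 Rlt_0_1) as [k [Hk Hkb]].
assert (HG1 := Gamma_pos (eta + 1) ltac:(lra)).
set (a0 := k / Gamma (eta + 1)). assert (Ha0 : 0 <= a0) by (apply Rmult_le_pos; auto; left; now apply Rinv_0_lt_compat).
assert (H1 : forall s, 0 < s <= 1 -> norm (prim q s) <= a0 * Rpower s eta).
{ intros s Hs. apply prim_bound; auto; try lra; intros; [apply Hc|apply Hkb]; lra. }
exists (a0 + 2 * M). split; [lra|]. split; [intros s; now apply prim_continuous with eta|]. split; [apply prim_neg|].
intros s Hs. assert (Hsp := Rpower_pos s eta).
assert (He1 : 1 <= exp (mu * s)) by (rewrite <- exp_0; apply exp_le; apply Rmult_le_pos; lra).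
destruct (Rle_dec s 1) as [Hs1|Hs1].
- apply Rle_trans with (1 := H1 s (conj Hs Hs1)).
  apply Rmult_le_compat; try lra. rewrite <- (Rmult_1_r (Rpower s eta)) at 1. apply Rmult_le_compat_l; lra.
- assert (Hse : 1 <= Rpower s eta).
  { apply Rle_trans with (Rpower 1 eta); [rewrite Rpower_1_l; lra|]. apply Rle_Rpower_l; lra. }
  assert (Hq : norm (RInt q 1 s) <= 2 * M * exp (mu * s)).
  { set (G := fun v => RInt h 1 v).
    assert (HGd : forall v, 0 < v -> is_derive G v (h v)).
    { intros v Hv. assert (Hi : inn 0 p_infty v) by (split; simpl; auto).
      apply (is_derive_RInt h G 1 v); [|now apply Hch].
      generalize (locally_inn 0 p_infty v Hi). apply filter_imp. intros y [Hy _]. simpl in Hy. apply RInt_correct. apply Hexh; lra. }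
    assert (HGc : forall v, 0 < v -> continuous G v).
    { intros v Hv. apply (ex_derive_continuous (V := V)). exists (h v). auto. }
    assert (I1 := is_RInt_scal_derive (fun v => exp (mu * v)) G (fun v => mu * exp (mu * v)) h 1 s).
    assert (I1' : is_RInt (fun v => plus (scal (mu * exp (mu * v)) (G v)) (scal (exp (mu * v)) (h v))) 1 s (minus (scal (exp (mu * s)) (G s)) (scal (exp (mu * 1)) (G 1)))).
    { apply I1; intros v Hv; rewrite ?Rmin_left, ?Rmax_right in Hv by lra.
      - auto_derive; auto. ring.
      - apply HGd; lra.
      - apply deriv_cont. auto_derive. auto.
      - apply Hch; lra. }
    assert (EG1 : scal (exp (mu * 1)) (G 1) = zero).
    { unfold G. rewrite RInt_point. exact (scal_zeroV _). }
    assert (I2 : ex_RInt (fun v => scal (mu * exp (mu * v)) (G v)) 1 s).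
    { apply (cont_ex_RInt 0 p_infty); try (split; simpl; auto; lra). intros z [Hz _]. simpl in Hz.
      apply continuous_scal_R; [apply deriv_cont; auto_derive; auto|auto]. }
    assert (I3 : is_RInt q 1 s (minus (scal (exp (mu * s)) (G s)) (RInt (fun v => scal (mu * exp (mu * v)) (G v)) 1 s))).
    { rewrite EG1 in I1'.
      assert (E0 : minus (scal (exp (mu * s)) (G s)) zero = scal (exp (mu * s)) (G s)) by exact (minus_zero_r _).
      assert (I1'' := eq_ind _ (fun z => is_RInt _ 1 s z) I1' _ E0).
      generalize (is_RInt_minus (V := V) _ _ _ _ _ _ I1'' (RInt_correct _ _ _ I2)). apply is_RInt_ext.
      intros v Hv.
      transitivity (scal (exp (mu * v)) (h v)); [exact (plus_minus_l (scal (mu * exp (mu * v)) (G v)) _)|].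
      unfold h. rewrite scal_assoc_R, <- exp_plus, Rplus_opp_r, exp_0. exact (scal_one (q v)). }
    rewrite (is_RInt_unique _ _ _ _ I3). apply Rle_trans with (1 := norm_minus_le _ _).
    assert (B1 : norm (scal (exp (mu * s)) (G s)) <= exp (mu * s) * M).
    { apply norm_scal_le; [rewrite Rabs_pos_eq; [lra|left; apply exp_pos]|apply HMs; lra]. }
    assert (B2 : norm (RInt (fun v => scal (mu * exp (mu * v)) (G v)) 1 s) <= M * (exp (mu * s) - exp (mu * 1))).
    { assert (I4 : is_RInt (V := RC) (fun v => mu * exp (mu * v)) 1 s (exp (mu * s) - exp (mu * 1))).
      { apply (is_RInt_derive (V := RC) (fun v => exp (mu * v)) (fun v => mu * exp (mu * v))).
        - intros v _. auto_derive; auto. ring.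
        - intros v _. apply deriv_cont. auto_derive. auto. }
      apply (is_RInt_scal (V := RC) _ _ _ M) in I4.
      refine (norm_RInt_le (fun v => scal (mu * exp (mu * v)) (G v)) (fun v => M * (mu * exp (mu * v))) 1 s _ _ _ _ (RInt_correct _ _ _ I2) I4); [lra|].
      intros v Hv. apply Rle_trans with (mu * exp (mu * v) * M); [|right; ring]. apply norm_scal_le; [|apply HMs; lra].
      rewrite Rabs_pos_eq; [lra|]. apply Rmult_le_pos; [lra|left; apply exp_pos]. }
    assert (0 <= M * exp (mu * 1)) by (apply Rmult_le_pos; auto; left; apply exp_pos). lra. }
  rewrite prim_pos by auto. rewrite (conv_1_split eta q 1 s); auto; [|lra].
  apply Rle_trans with (1 := norm_tri _ _).
  assert (H11 := H1 1 ltac:(lra)). rewrite prim_pos, Rpower_1_l in H11 by lra.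
  apply Rle_trans with ((a0 + 2 * M) * exp (mu * s)).
  + assert (a0 * 1 <= a0 * exp (mu * s)) by (apply Rmult_le_compat_l; lra). lra.
  + apply Rmult_le_compat_l; [lra|]. rewrite <- (Rmult_1_l (exp (mu * s))) at 1. apply Rmult_le_compat_r; lra.
Qed.

Lemma g_vec_cv {V : RNM} eta s (x : V) : 0 < eta -> 0 < s -> conv 1 (fun v => scal (g eta v) x) s = scal (g (eta + 1) s) x.
Proof.
intros Heta Hs. apply conv_unique. rewrite Rplus_comm.
generalize (is_RInt_gen_scal_vec _ _ _ x _ (g_convolution 1 eta s Rlt_0_1 Heta Hs)).
apply is_RInt_gen_ext_inn; [exact Hs|]. intros v _. symmetry. exact (scal_assoc_R _ _ x).
Qed.

Lemma sing_g {V : RNM} eta (x : V) : 0 < eta -> sing eta (fun v => scal (g eta v) x).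
Proof.
intros Heta. split.
- intros s Hs. apply continuous_scal_R; [now apply continuous_g|apply continuous_const].
- intros T HT. exists (norm x). split; [apply norm_ge_0|]. intros s Hs. rewrite Rmult_comm.
  apply norm_scal_le; [|lra]. rewrite Rabs_pos_eq; [lra|left; now apply g_pos].
Qed.

Lemma prim_initial {V : RNM} eta (q : R -> V) x : 0 < eta -> sing eta q ->
  filterlim (fun t => scal (/ g eta t) (q t)) (at_right 0) (locally x) ->
  forall eps, 0 < eps -> exists d, 0 < d /\ forall s, 0 < s < d ->
     norm (minus (prim q s) (scal (g (eta + 1) s) x)) <= eps * Rpower s eta.
Proof.
intros Heta HS HL eps He. assert (HG := Gamma_pos (eta + 1) ltac:(lra)).
assert (Hep : 0 < eps * Gamma (eta + 1)) by now apply Rmult_lt_0_compat.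
destruct (filterlim_eps_inv (at_right 0) _ _ HL _ Hep) as [d Hd].
exists d. split; [apply cond_pos|]. intros s Hs.
rewrite prim_pos by lra. rewrite <- (g_vec_cv eta s x) by lra.
assert (Hgs := sing_g eta x Heta).
rewrite <- (conv_minus 1 eta); auto; try lra.
replace (eps * Rpower s eta) with (eps * Gamma (eta + 1) * g (1 + eta) s).
2:{ unfold g. rewrite (Rplus_comm 1 eta). replace (eta + 1 - 1) with eta by ring. field. lra. }
apply (conv_bound 1 eta); auto; try lra.
- intros v Hv. apply (continuous_minus (V := V)); [apply HS; lra|apply Hgs; lra].
- intros v Hv.
  assert (Hb : norm (minus (scal (/ g eta v) (q v)) x) <= eps * Gamma (eta + 1)).
  { apply Hd; [|lra]. change (Rabs (v - 0) < d). rewrite Rminus_0_r, Rabs_pos_eq; lra. }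
  assert (Hgv := g_pos eta v Heta).
  assert (E : minus (q v) (scal (g eta v) x) = scal (g eta v) (minus (scal (/ g eta v) (q v)) x)).
  { transitivity (minus (scal (g eta v) (scal (/ g eta v) (q v))) (scal (g eta v) x)).
    - f_equal. rewrite scal_assoc_R, Rinv_r by lra. symmetry. exact (scal_one (q v)).
    - symmetry. exact (scal_minus_distr_l (g eta v) _ x). }
  rewrite E, Rmult_comm. apply norm_scal_le; auto. rewrite Rabs_pos_eq; lra.
Qed.

(** * Closed operators and integrals *)

Section Closed.
Variables (X : CompleteNormedModule C_AbsRing) (A : linear_operator X).

Lemma op_zero : A zero = zero.
Proof.
assert (E : scal (zero : C_AbsRing) (zero : X) = zero) by exact (scal_zero_l (zero : X)).
rewrite <- E at 1. rewrite (op_scal X A); [exact (scal_zero_l (A zero))|apply dom_zero].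
Qed.

(** The pairs of Riemann sums of f and h belong to the graph. *)
Lemma closed_RInt (HA : closed_operator A) (f h : R -> X) x y v w :
  (forall s, dom A (f s) /\ A (f s) = h s) ->
  is_RInt (V := realify X) f x y v -> is_RInt (V := realify X) h x y w ->
  dom A v /\ A v = w.
Proof.
intros HD Hf Hh.
assert (HS : forall s, dom A (Riemann_sum (V := realify X) f s) /\
   A (Riemann_sum (V := realify X) f s) = Riemann_sum (V := realify X) h s).
{ intros s. apply SF_cons_ind with (s := s).
  - intros x0. split; [exact (dom_zero X A)|exact op_zero].
  - intros h0 s0 [I1 I2]. rewrite !Riemann_sum_cons. destruct (HD (snd h0)) as [D1 D2].
    assert (D3 := dom_scal X A (RtoC (SF_h s0 - fst h0)) _ D1).
    split; [exact (dom_plus X A _ _ D3 I1)|].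
    refine (eq_trans (op_plus X A _ _ D3 I1) _). rewrite I2. rewrite (op_scal X A _ _ D1), D2. reflexivity. }
assert (HC : (fun p : X * X => dom A (fst p) /\ snd p = A (fst p)) (v, w)).
{ apply HA. intros [e He].
  assert (B1 := Hf _ (locally_ball v e)). assert (B2 := Hh _ (locally_ball w e)).
  unfold filtermap in B1, B2. assert (B := filter_and (F := Riemann_fine x y) _ _ B1 B2).
  destruct (filter_ex (F := Riemann_fine x y) _ B) as [s [E1 E2]].
  apply (He (scal (RtoC (sign (y - x)) : C_AbsRing) (Riemann_sum (V := realify X) f s),
             scal (RtoC (sign (y - x)) : C_AbsRing) (Riemann_sum (V := realify X) h s))).
  - split; [exact E1|exact E2].
  - destruct (HS s) as [S1 S2]. simpl. split; [exact (dom_scal X A _ _ S1)|].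
    rewrite (op_scal X A _ _ S1). f_equal. symmetry. exact S2. }
destruct HC as [H1 H2]. split; auto.
Qed.

Lemma closed_RInt_gen (HA : closed_operator A) (f h : R -> X) a b v w : Rbar_lt a b ->
  (forall s, inn a b s -> dom A (f s) /\ A (f s) = h s) ->
  is_RInt_gen (V := realify X) f (lo a) (hi b) v -> is_RInt_gen (V := realify X) h (lo a) (hi b) w ->
  dom A v /\ A v = w.
Proof.
intros Hab HD Hf Hh.
set (ff := fun s => if excluded_middle_informative (inn a b s) then f s else zero).
set (hh := fun s => if excluded_middle_informative (inn a b s) then h s else zero).
assert (HF : is_RInt_gen (V := realify X) ff (lo a) (hi b) v).
{ revert Hf. apply (is_RInt_gen_ext_inn (V := realify X)); auto. intros s Hs. unfold ff.
  destruct (excluded_middle_informative (inn a b s)); [reflexivity|contradiction]. }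
assert (HH : is_RInt_gen (V := realify X) hh (lo a) (hi b) w).
{ revert Hh. apply (is_RInt_gen_ext_inn (V := realify X)); auto. intros s Hs. unfold hh.
  destruct (excluded_middle_informative (inn a b s)); [reflexivity|contradiction]. }
assert (HD' : forall s, dom A (ff s) /\ A (ff s) = hh s).
{ intros s. unfold ff, hh. destruct (excluded_middle_informative (inn a b s)); [auto|].
  split; [apply dom_zero|exact op_zero]. }
assert (HC : (fun p : X * X => dom A (fst p) /\ snd p = A (fst p)) (v, w)).
{ apply HA. intros [e He].
  assert (B1 := HF _ (locally_ball (v : realify X) e)). assert (B2 := HH _ (locally_ball (w : realify X) e)).
  unfold filtermapi in B1, B2. assert (B := filter_and (F := filter_prod (lo a) (hi b)) _ _ B1 B2).
  destruct (filter_ex (F := filter_prod (lo a) (hi b)) _ B) as [[x y] [[v' [I1 E1]] [w' [I2 E2]]]].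
  destruct (closed_RInt HA ff hh x y v' w' HD' I1 I2) as [S1 S2].
  apply (He (v', w')); [split; [exact E1|exact E2]|]. simpl. auto. }
destruct HC as [H1 H2]. split; auto.
Qed.
End Closed.

(** * The uniform boundedness principle *)

(** A gliding hump: if the bounds were not uniform,
    take L_n of norm at least 4^n and nearly norming vectors u_n; choosing the
    signs in x = sum +- 3^(-n) u_n so that L_n of the n-th partial sum is not
    smaller than 3^(-n) L_n u_n keeps L_n x of order (4/3)^n. *)
Lemma uniform_boundedness {V : RNM} (I : Type) (L : I -> V -> V) :
  (forall i x y, L i (plus x y) = plus (L i x) (L i y)) ->
  (forall i (k : R) x, L i (scal k x) = scal k (L i x)) ->
  (forall i, exists M, forall x, norm (L i x) <= M * norm x) ->
  (forall x, exists C, forall i, norm (L i x) <= C) ->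
  exists C, 0 < C /\ forall i x, norm (L i x) <= C * norm x.
Proof.
intros Hadd Hsc HM HC. apply NNPP. intros HN.
assert (Hopp : forall i x, L i (opp x) = opp (L i x)).
{ intros i x. transitivity (L i (scal (- (1)) x)).
  - f_equal. symmetry. transitivity (opp (scal 1 x)); [exact (scal_opp_l 1 x)|f_equal; exact (scal_one x)].
  - rewrite Hsc. transitivity (opp (scal 1 (L i x))); [exact (scal_opp_l 1 (L i x))|f_equal; exact (scal_one (L i x))]. }
assert (HS : forall n : nat, exists p : I * V * R, let '(i, u, N) := p in
  norm u <= 1 /\ 3 / 4 * N <= norm (L i u) /\ 4 ^ n <= N /\ forall x, norm (L i x) <= N * norm x).
{ intros n. assert (H4 : 0 < 4 ^ n) by (apply pow_lt; lra).
  assert (Hex : exists i x, 4 ^ n * norm x < norm (L i x)).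
  { apply NNPP. intros Hn. apply HN. exists (4 ^ n). split; auto. intros i x.
    apply Rnot_lt_le. intros Hlt. apply Hn. now exists i, x. }
  destruct Hex as [i [x0 Hx0]].
  destruct (HM i) as [M HMi].
  set (E := fun r => exists u : V, norm u <= 1 /\ r = norm (L i u)).
  assert (Hunit : forall x : V, 0 < norm x -> norm (scal (/ norm x) x) <= 1).
  { intros x Hx. apply Rle_trans with (/ norm x * norm x); [|rewrite Rinv_l; lra].
    apply norm_scal_le; [|lra]. rewrite Rabs_pos_eq; [lra|left; now apply Rinv_0_lt_compat]. }
  assert (Hx0p : 0 < norm x0).
  { destruct (Rle_lt_or_eq_dec 0 (norm x0) (norm_ge_0 x0)) as [|Hz]; auto. exfalso.
    rewrite <- Hz, Rmult_0_r in Hx0. generalize (HMi x0). rewrite <- Hz, Rmult_0_r. lra. }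
  destruct (completeness E) as [N [HN1 HN2]].
  { exists (Rabs M). intros r [u [Hu ->]]. apply Rle_trans with (1 := HMi u).
    apply Rle_trans with (Rabs M * norm u); [apply Rmult_le_compat_r; [apply norm_ge_0|apply Rle_abs]|].
    rewrite <- (Rmult_1_r (Rabs M)) at 2. apply Rmult_le_compat_l; [apply Rabs_pos|auto]. }
  { exists (norm (L i zero)), zero. split; auto. rewrite norm_zeroV. lra. }
  assert (HNb : forall x, norm (L i x) <= N * norm x).
  { intros x. destruct (Rle_lt_or_eq_dec 0 (norm x) (norm_ge_0 x)) as [Hx|Hx].
    - assert (H : norm (L i (scal (/ norm x) x)) <= N) by (apply HN1; exists (scal (/ norm x) x); split; [now apply Hunit|reflexivity]).
      assert (Ex : L i x = scal (norm x) (L i (scal (/ norm x) x))).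
      { rewrite <- Hsc. f_equal. rewrite scal_assoc_R, Rinv_r by lra. symmetry. exact (scal_one x). }
      rewrite Ex, Rmult_comm. apply norm_scal_le; auto. rewrite Rabs_pos_eq; lra.
    - generalize (HMi x). rewrite <- Hx, !Rmult_0_r. auto. }
  assert (HN4 : 4 ^ n <= N).
  { generalize (HNb x0). intros H. apply Rmult_le_reg_r with (norm x0); auto. lra. }
  assert (Hu : exists u, norm u <= 1 /\ 3 / 4 * N <= norm (L i u)).
  { apply NNPP. intros Hn. assert (H : N <= 3 / 4 * N); [|lra]. apply HN2. intros r [u [Hu ->]].
    apply Rnot_lt_le. intros Hlt. apply Hn. exists u. split; auto. lra. }
  destruct Hu as [u [Hu1 Hu2]]. exists (i, u, N). auto. }
set (pick := fun n => proj1_sig (constructive_indefinite_description _ (HS n))).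
set (ii := fun n => fst (fst (pick n))). set (uu := fun n => snd (fst (pick n))). set (NN := fun n => snd (pick n)).
assert (HP : forall n, norm (uu n) <= 1 /\ 3 / 4 * NN n <= norm (L (ii n) (uu n)) /\ 4 ^ n <= NN n /\
   forall x, norm (L (ii n) x) <= NN n * norm x).
{ intros n. unfold ii, uu, NN, pick. destruct (constructive_indefinite_description _ (HS n)) as [[[i u] N] H]. exact H. }
set (dl := fun n => (/ 3) ^ n). assert (Hdl : forall n, 0 < dl n) by (intros n; apply pow_lt; lra).
set (st := fun n y => if Rle_dec (norm (L (ii n) (minus y (scal (dl n) (uu n))))) (norm (L (ii n) (plus y (scal (dl n) (uu n)))))
   then plus y (scal (dl n) (uu n)) else minus y (scal (dl n) (uu n))).
set (xs := fix xs n := match n with O => zero | S k => st k (xs k) end).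
assert (Hst : forall n y, norm (minus (st n y) y) <= dl n).
{ intros n y. assert (Hb : norm (scal (dl n) (uu n)) <= dl n).
  { rewrite <- (Rmult_1_r (dl n)) at 2. apply norm_scal_le; [rewrite Rabs_pos_eq; [lra|left; apply Hdl]|apply HP]. }
  unfold st. destruct Rle_dec.
  - apply Rle_trans with (norm (scal (dl n) (uu n))); [|auto]. right. f_equal. exact (plus_minus_l y _).
  - apply Rle_trans with (norm (scal (dl n) (uu n))); [|auto]. right. refine (eq_trans (norm_minus_sym _ _) _). f_equal.
    unfold minus. generalize (scal (dl n) (uu n)). intros z.
    transitivity (plus y (plus (opp y) z)).
    { f_equal. transitivity (plus (opp y) (opp (opp z))); [exact (opp_plus y (opp z))|f_equal; exact (opp_opp z)]. }
    rewrite plus_assoc. transitivity (plus zero z); [f_equal; exact (plus_opp_r y)|exact (plus_zero_l z)]. }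
assert (Hbig : forall n y, dl n * (3 / 4 * NN n) <= norm (L (ii n) (st n y))).
{ intros n y. destruct (HP n) as [_ [Hu _]].
  set (p := plus y (scal (dl n) (uu n))). set (m := minus y (scal (dl n) (uu n))).
  assert (E : minus (L (ii n) p) (L (ii n) m) = scal (2 * dl n) (L (ii n) (uu n))).
  { unfold p, m, minus. rewrite !Hadd, Hopp, Hsc. generalize (L (ii n) y) (L (ii n) (uu n)). intros z w.
    transitivity (plus (scal (dl n) w) (scal (dl n) w)).
    2:{ transitivity (scal (dl n + dl n) w); [symmetry; exact (scal_distr_r (dl n) (dl n) w)|f_equal; ring]. }
    generalize (scal (dl n) w). intros q.
    transitivity (plus (plus z q) (plus (opp z) q)).
    { f_equal. transitivity (plus (opp z) (opp (opp q))); [exact (opp_plus z (opp q))|f_equal; exact (opp_opp q)]. }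
    rewrite (plus_comm z q), <- plus_assoc. f_equal. rewrite plus_assoc.
    transitivity (plus zero q); [f_equal; exact (plus_opp_r z)|exact (plus_zero_l q)]. }
  assert (E2 : 2 * dl n * norm (L (ii n) (uu n)) <= norm (minus (L (ii n) p) (L (ii n) m))).
  { assert (Hk : 0 < 2 * dl n) by (generalize (Hdl n); lra).
    assert (Hi : norm (L (ii n) (uu n)) <= / (2 * dl n) * norm (minus (L (ii n) p) (L (ii n) m))).
    { assert (Eu : scal (/ (2 * dl n)) (minus (L (ii n) p) (L (ii n) m)) = L (ii n) (uu n)).
      { rewrite E, scal_assoc_R, Rinv_l by lra. exact (scal_one _). }
      rewrite <- Eu at 1. apply norm_scal_le; [|lra]. rewrite Rabs_pos_eq; [lra|left; now apply Rinv_0_lt_compat]. }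
    apply Rmult_le_compat_l with (r := 2 * dl n) in Hi; [|lra].
    rewrite <- Rmult_assoc, Rinv_r, Rmult_1_l in Hi by lra. exact Hi. }
  assert (H1 := norm_minus_le (L (ii n) p) (L (ii n) m)).
  assert (H2 : dl n * (3 / 4 * NN n) <= dl n * norm (L (ii n) (uu n))) by (apply Rmult_le_compat_l; [left; apply Hdl|auto]).
  unfold st. fold p m. destruct Rle_dec; lra. }
assert (Hxs : forall n k, norm (minus (xs (n + k)%nat) (xs n)) <= 3 / 2 * (dl n - dl (n + k)%nat)).
{ intros n k. induction k as [|k IH].
  - rewrite Nat.add_0_r. apply Rle_trans with 0; [right|lra].
    transitivity (norm (zero : V)); [f_equal; exact (minus_eq_zero (xs n))|exact norm_zeroV].
  - apply Rle_trans with (1 := norm_minus_tri _ (xs (n + k)%nat) _).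
    rewrite Nat.add_succ_r. change (xs (S (n + k))) with (st (n + k)%nat (xs (n + k)%nat)).
    apply Rle_trans with (dl (n + k)%nat + 3 / 2 * (dl n - dl (n + k)%nat)).
    + apply Rplus_le_compat; [exact (Hst (n + k)%nat (xs (n + k)%nat))|exact IH].
    + assert (Ed : dl (S (n + k)) = / 3 * dl (n + k)%nat) by reflexivity. rewrite Ed. lra. }
assert (Hxs' : forall n m, (n <= m)%nat -> norm (minus (xs m) (xs n)) <= 3 / 2 * dl n).
{ intros n m Hnm. replace m with (n + (m - n))%nat by lia. apply Rle_trans with (1 := Hxs n (m - n)%nat).
  generalize (Hdl (n + (m - n))%nat). lra. }
assert (Hlim : exists x : V, filterlim xs eventually (locally x)).
{ apply (filterlim_locally_cauchy (F := eventually) xs). intros eps.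
  destruct (pow_lt_1_zero (/ 3) ltac:(rewrite Rabs_pos_eq; lra) (eps / 3) ltac:(generalize (cond_pos eps); lra)) as [n Hn].
  exists (fun m => (n <= m)%nat). split; [now exists n|]. intros u v Hu Hv. apply (norm_compat1 (V := V)).
  apply Rle_lt_trans with (1 := norm_minus_tri _ (xs n) _).
  apply Rle_lt_trans with (3 / 2 * dl n + 3 / 2 * dl n).
  - apply Rplus_le_compat; [exact (Hxs' n v Hv)|]. refine (Rle_trans _ _ _ _ (Hxs' n u Hu)). right. exact (norm_minus_sym _ _).
  - generalize (Hn n (Nat.le_refl n)). fold (dl n). rewrite Rabs_pos_eq by (left; apply Hdl). lra. }
destruct Hlim as [x Hx].
assert (Hxn : forall n, norm (minus x (xs n)) <= 3 / 2 * dl n).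
{ intros n. apply (filterlim_norm_le eventually xs x (xs n)); auto. exists n. intros m Hm. now apply Hxs'. }
destruct (HC x) as [C HCx].
assert (Hn : forall n, / 4 * (4 / 3) ^ n <= C).
{ intros n. apply Rle_trans with (2 := HCx (ii n)).
  assert (E : L (ii n) (xs (S n)) = minus (L (ii n) x) (L (ii n) (minus x (xs (S n))))).
  { unfold minus. rewrite Hadd, Hopp. generalize (L (ii n) x) (L (ii n) (xs (S n))). intros z w. symmetry.
    transitivity (plus z (plus (opp z) w)).
    { f_equal. transitivity (plus (opp z) (opp (opp w))); [exact (opp_plus z (opp w))|f_equal; exact (opp_opp w)]. }
    rewrite plus_assoc. transitivity (plus zero w); [f_equal; exact (plus_opp_r z)|exact (plus_zero_l w)]. }
  assert (H1 := Hbig n (xs n)). change (st n (xs n)) with (xs (S n)) in H1. rewrite E in H1.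
  assert (H2 := norm_minus_le (L (ii n) x) (L (ii n) (minus x (xs (S n))))).
  destruct (HP n) as [_ [_ [H4 Hb]]].
  assert (H3 : norm (L (ii n) (minus x (xs (S n)))) <= NN n * (/ 2 * dl n)).
  { apply Rle_trans with (1 := Hb _). assert (0 < 4 ^ n) by (apply pow_lt; lra). apply Rmult_le_compat_l; [lra|].
    generalize (Hxn (S n)). change (dl (S n)) with (/ 3 * dl n). lra. }
  assert (H5 : dl n * 4 ^ n <= dl n * NN n) by (apply Rmult_le_compat_l; [left; apply Hdl|auto]).
  assert (E4 : dl n * 4 ^ n = (4 / 3) ^ n).
  { unfold dl. rewrite <- Rpow_mult_distr. f_equal. field. }
  lra. }
destruct (INR_unbounded (12 * C)) as [n HnC].
generalize (Hn n) (poly n (1 / 3) ltac:(lra)). replace (1 + 1 / 3) with (4 / 3) by field. lra.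
Qed.

(** * Orbits of a resolvent family *)

Lemma scal_distr_R {V : RNM} (k : R) (x y : V) : scal k (plus x y) = plus (scal k x) (scal k y).
Proof. exact (scal_distr_l k x y). Qed.

Lemma scal_one_R {V : RNM} (x : V) : scal 1 x = x.
Proof. exact (scal_one x). Qed.

Lemma sing_of_initial {V : RNM} eta (q : R -> V) x : 0 < eta -> (forall s, 0 < s -> continuous q s) ->
  filterlim (fun t => scal (/ g eta t) (q t)) (at_right 0) (locally x) -> sing eta q.
Proof.
intros Heta Hc HL. split; auto. intros T HT.
destruct (filterlim_eps_inv (at_right 0) _ _ HL 1 Rlt_0_1) as [d Hd].
assert (Hdp := cond_pos d).
set (n := fun s => norm (q s) * / g eta s).
set (d2 := Rmin (d / 2) (T / 2)).
assert (Hd2 : 0 < d2 /\ d2 <= d / 2 /\ d2 <= T / 2).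
{ unfold d2. split; [apply Rmin_glb_lt; lra|split; [apply Rmin_l|apply Rmin_r]]. }
destruct (continuity_ab_maj n d2 T) as [m [Hm _]]; [lra| |].
{ intros s Hs. apply continuity_pt_filterlim. apply (continuous_Rmult (fun s => norm (q s)) (fun s => / g eta s)).
  - apply (continuous_comp q norm); [apply Hc; lra|exact (Hierarchy.filterlim_norm (q s))].
  - apply deriv_cont. unfold g, Rpower. assert (HG := Gamma_pos eta Heta). assert (He := exp_pos ((eta - 1) * ln s)).
    auto_derive. split; [lra|split; auto]. apply Rmult_integral_contrapositive. split; [lra|]. apply Rinv_neq_0_compat. lra. }
exists (norm x + 1 + Rabs (n m)). assert (Hnx := norm_ge_0 x). assert (Hnm := Rabs_pos (n m)).
split; [lra|]. intros s Hs. assert (Hg := g_pos eta s Heta).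
assert (Hns : n s <= norm x + 1 + Rabs (n m)).
{ destruct (Rlt_le_dec s d2) as [H|H].
  - assert (H1 : norm (minus (scal (/ g eta s) (q s)) x) <= 1).
    { apply Hd; [|lra]. change (Rabs (s - 0) < d). rewrite Rminus_0_r, Rabs_pos_eq; lra. }
    assert (H2 : norm (scal (/ g eta s) (q s)) <= norm x + 1).
    { assert (E : scal (/ g eta s) (q s) = plus x (minus (scal (/ g eta s) (q s)) x)).
      { generalize (scal (/ g eta s) (q s)). intros z. unfold minus. rewrite (plus_comm z), plus_assoc.
        symmetry. transitivity (plus zero z); [f_equal; exact (plus_opp_r x)|exact (plus_zero_l z)]. }
      rewrite E. apply Rle_trans with (1 := norm_tri _ _). apply Rplus_le_compat_l. exact H1. }
    assert (H3 : norm (q s) <= g eta s * norm (scal (/ g eta s) (q s))).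
    { assert (E : scal (g eta s) (scal (/ g eta s) (q s)) = q s) by (rewrite scal_assoc_R, Rinv_r by lra; exact (scal_one (q s))).
      rewrite <- E at 1. apply norm_scal_le; [|lra]. rewrite Rabs_pos_eq; lra. }
    change (norm (q s) * / g eta s <= norm x + 1 + Rabs (n m)).
    apply Rmult_le_reg_r with (g eta s); auto. rewrite Rmult_assoc, Rinv_l, Rmult_1_r by lra.
    apply Rle_trans with (1 := H3). rewrite Rmult_comm. apply Rmult_le_compat_r; lra.
  - apply Rle_trans with (n m); [apply Hm; lra|]. generalize (Rle_abs (n m)). lra. }
change (norm (q s) * / g eta s <= norm x + 1 + Rabs (n m)) in Hns. apply Rmult_le_compat_r with (r := g eta s) in Hns; [|lra].
rewrite Rmult_assoc, Rinv_l, Rmult_1_r in Hns by lra. exact Hns.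
Qed.

Lemma conv_ext {V : RNM} a rho (f h : R -> V) r : 0 < a -> 0 < rho -> 0 < r -> sing rho f ->
  (forall v, 0 < v < r -> f v = h v) -> conv a f r = conv a h r.
Proof.
intros Ha Hr Hr0 Hf E. symmetry. apply conv_unique.
generalize (conv_correct a rho f r Ha Hr Hr0 Hf). apply is_RInt_gen_ext_inn; [exact Hr0|].
intros v [Hv Hvr]. simpl in Hv, Hvr. now rewrite E.
Qed.

Lemma norm_scal_C (X : CompleteNormedModule C_AbsRing) (z : C) (x : X) a b :
  Cmod z <= a -> norm x <= b -> norm (scal (z : C_AbsRing) x) <= a * b.
Proof.
intros Hz Hx. apply Rle_trans with (1 := norm_scal (z : C_AbsRing) x).
apply Rmult_le_compat; auto; [apply Cmod_ge_0|apply norm_ge_0].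
Qed.

Lemma continuous_scal_const (X : CompleteNormedModule C_AbsRing) (c : C) (u : realify X) :
  continuous (T := realify X) (U := realify X) (fun x => scal (c : C_AbsRing) (x : X)) u.
Proof. exact (continuous_scal_r (K := C_AbsRing) (V := X) c (fun x => x) u (continuous_id u)). Qed.

(** Split into real and imaginary parts, as multiplication by i is continuous
    on the real space underlying X. *)
Lemma continuous_scal_C (X : CompleteNormedModule C_AbsRing) (z : R -> C) (f : R -> X) t :
  continuous (U := CC) z t -> continuous f t ->
  continuous (U := realify X) (fun s => scal (z s : C_AbsRing) (f s)) t.
Proof.
intros Hz Hf.
apply (continuous_ext (T := R_UniformSpace) (U := realify X)
  (fun s => plus (scal (Re (z s)) (f s : realify X)) (scal (Im (z s)) ((scal (Ci : C_AbsRing) (f s) : X) : realify X)))).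
- intros s. transitivity (plus (scal (RtoC (Re (z s)) : C_AbsRing) (f s)) (scal (mult (RtoC (Im (z s)) : C_AbsRing) (Ci : C_AbsRing)) (f s))).
  + apply (f_equal (plus (scal (RtoC (Re (z s)) : C_AbsRing) (f s)))). exact (scal_assoc (RtoC (Im (z s)) : C_AbsRing) (Ci : C_AbsRing) (f s)).
  + refine (eq_trans (eq_sym (scal_distr_r (RtoC (Re (z s)) : C_AbsRing) (mult (RtoC (Im (z s)) : C_AbsRing) (Ci : C_AbsRing)) (f s))) _).
    f_equal. destruct (z s) as [u v]. unfold plus, mult; simpl. unfold Cplus, Cmult, RtoC, Ci, Re, Im; simpl. f_equal; ring.
- apply (continuous_plus (V := realify X)).
  + apply (continuous_scal_R (V := realify X)); [now apply C_continuous_Re|exact Hf].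
  + apply (continuous_scal_R (V := realify X)); [now apply C_continuous_Im|].
    exact (continuous_comp (U := R_UniformSpace) (V := realify X) (W := realify X) f _ t Hf (continuous_scal_const X Ci (f t))).
Qed.

Section Subordination.

Variables (X : CompleteNormedModule C_AbsRing) (A : linear_operator X) (eta w : R) (S : R -> X -> X).
Hypotheses (Heta : 0 < eta <= 2) (Hw : 0 <= w) (HS : resolvent_family eta eta A S) (HLap : laplace_transformable w S).

Notation V := (realify X).
Definition orbit (x : X) (s : R) : V := S s x.

Lemma orbit_sing x : sing eta (orbit x).
Proof.
apply (sing_of_initial (V := V) eta (orbit x) x); [lra| |].
- intros s Hs. exact (resolvent_continuous _ _ _ _ HS x s Hs).
- exact (resolvent_initial _ _ _ _ HS x).
Qed.

Lemma orbit_plus x y s : 0 < s -> orbit (plus x y) s = plus (orbit x s) (orbit y s).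
Proof. intros Hs. exact (linear_plus _ (resolvent_bounded _ _ _ _ HS s Hs) x y). Qed.

Lemma orbit_scal c x s : 0 < s -> orbit (scal c x) s = scal (c : C_AbsRing) (orbit x s : X).
Proof. intros Hs. exact (linear_scal _ (resolvent_bounded _ _ _ _ HS s Hs) c x). Qed.

Lemma orbit_rscal (k : R) (x : V) s : 0 < s -> orbit (scal k x) s = scal k (orbit x s).
Proof. exact (orbit_scal (RtoC k) x s). Qed.

(** The initial condition bounds S(s)x / g_eta(s) for each x; uniform
    boundedness makes the bound linear in the norm of x. *)
Lemma orbit_bound T : 0 < T -> exists C, 0 < C /\ forall x s, 0 < s <= T -> norm (orbit x s) <= C * norm (x : V) * g eta s.
Proof.
intros HT.
destruct (uniform_boundedness (V := V) {s | 0 < s <= T} (fun i x => scal (/ g eta (proj1_sig i)) (orbit x (proj1_sig i)))) as [C [HC HCx]].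
- intros [s Hs] x y. simpl. rewrite orbit_plus by lra. exact (scal_distr_R (V := V) _ _ _).
- intros [s Hs] k x. simpl. rewrite orbit_rscal by lra. exact (scal_comm_R (V := V) _ _ _).
- intros [s Hs]. simpl. destruct (linear_norm _ (resolvent_bounded _ _ _ _ HS s (proj1 Hs))) as [M [HM HMx]].
  exists (Rabs (/ g eta s) * M). intros x. rewrite Rmult_assoc. apply (norm_scal_le (V := V)); [lra|exact (HMx x)].
- intros x. destruct (proj2 (orbit_sing x) T HT) as [k [Hk Hkb]]. exists k. intros [s Hs]. simpl.
  assert (Hg := g_pos eta s (proj1 Heta)).
  apply Rle_trans with (/ g eta s * (k * g eta s)); [|right; field; lra].
  apply (norm_scal_le (V := V)); auto. rewrite Rabs_pos_eq; [lra|left; now apply Rinv_0_lt_compat].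
- exists C. split; auto. intros x s Hs. assert (Hg := g_pos eta s (proj1 Heta)).
  generalize (HCx (exist _ s Hs) x). simpl. intros H.
  assert (E : orbit x s = scal (g eta s) (scal (/ g eta s) (orbit x s))).
  { rewrite scal_assoc_R, Rinv_r by lra. symmetry. exact (scal_one_R (V := V) _). }
  rewrite E. apply Rle_trans with (g eta s * (C * norm (x : V))); [|right; ring].
  apply (norm_scal_le (V := V)); auto. rewrite Rabs_pos_eq; lra.
Qed.

Lemma prim_orbit_correct x s : 0 < s -> is_RInt_gen (orbit x) (lo 0) (hi s) (prim (orbit x) s).
Proof. intros Hs. rewrite prim_pos by auto. apply conv_1_correct with eta; auto; [lra|apply orbit_sing]. Qed.

Lemma orbit_laplace mu x : w < mu -> exists l,
  is_RInt_gen (fun s => scal (exp (- (mu * s))) (orbit x s)) (lo 0) (hi p_infty) l.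
Proof.
intros Hmu. destruct (HLap x (RtoC mu) Hmu) as [l Hl]. exists l.
refine (is_RInt_gen_ext_inn (V := V) 0 p_infty _ _ _ I _ Hl). intros s _.
assert (E : cexp (- (RtoC mu * RtoC s))%C = RtoC (exp (- (mu * s)))).
{ rewrite <- cexp_RtoC. f_equal. now rewrite RtoC_opp, RtoC_mult. }
rewrite E. reflexivity.
Qed.

(** Uniform boundedness for the weighted primitives, which are bounded
    operators because the orbits are bounded near 0 uniformly in x. *)
Lemma prim_orbit_growth mu : w < mu -> exists C, 0 < C /\ forall x, growth eta mu (C * norm (x : V)) (prim (orbit x)).
Proof.
intros Hmu. assert (He : 0 < eta) by lra.
set (k := fun s => / (Rpower s eta * exp (mu * s))).
assert (Hk : forall s, 0 < Rpower s eta * exp (mu * s)) by (intros s; apply Rmult_lt_0_compat; apply exp_pos).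
destruct (uniform_boundedness (V := V) {s | 0 < s} (fun i x => scal (k (proj1_sig i)) (prim (orbit x) (proj1_sig i)))) as [C [HC HCx]].
- intros [s Hs] x y. simpl.
  assert (E : prim (orbit (plus x y)) s = plus (prim (orbit x) s) (prim (orbit y) s)).
  { rewrite (prim_pos (orbit (plus x y))) by auto. unfold conv. apply II_unique.
    generalize (is_RInt_gen_plus (V := V) _ _ _ _ (prim_orbit_correct x s Hs) (prim_orbit_correct y s Hs)).
    apply is_RInt_gen_ext_inn; [exact Hs|]. intros v [Hv Hvs]. simpl in Hv, Hvs. rewrite g_1 by lra.
    rewrite orbit_plus by auto. symmetry. exact (scal_one_R (V := V) _). }
  rewrite E. exact (scal_distr_R (V := V) _ _ _).
- intros [s Hs] c x. simpl.
  assert (E : prim (orbit (scal (c : R) x)) s = scal c (prim (orbit x) s)).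
  { rewrite (prim_pos (orbit (scal c x))) by auto. unfold conv. apply II_unique.
    generalize (is_RInt_gen_scal (V := V) _ c _ (prim_orbit_correct x s Hs)).
    apply is_RInt_gen_ext_inn; [exact Hs|]. intros v [Hv Hvs]. simpl in Hv, Hvs. rewrite g_1 by lra.
    rewrite orbit_rscal by auto. symmetry. exact (scal_one_R (V := V) _). }
  rewrite E. exact (scal_comm_R (V := V) _ _ _).
- intros [s Hs]. simpl. destruct (orbit_bound s Hs) as [M [HM HMx]].
  assert (HG := Gamma_pos (eta + 1) ltac:(lra)).
  exists (Rabs (k s) * (M / Gamma (eta + 1) * Rpower s eta)). intros x. rewrite Rmult_assoc.
  apply (norm_scal_le (V := V)); [lra|].
  apply Rle_trans with (M * norm (x : V) / Gamma (eta + 1) * Rpower s eta); [|right; unfold Rdiv; ring].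
  apply prim_bound; auto.
  + apply Rmult_le_pos; [lra|apply norm_ge_0].
  + intros v Hv. apply (orbit_sing x). lra.
  + intros v Hv. apply HMx. lra.
- intros x. destruct (orbit_laplace mu x Hmu) as [l Hl].
  destruct (prim_growth eta mu (orbit x) l He ltac:(lra) (orbit_sing x) Hl) as [a [Ha [_ [_ Hg]]]].
  exists a. intros [s Hs]. simpl. assert (H := Hk s).
  apply Rle_trans with (/ (Rpower s eta * exp (mu * s)) * (a * (Rpower s eta * exp (mu * s)))).
  + apply (norm_scal_le (V := V)); auto. unfold k. rewrite Rabs_pos_eq; [lra|left; now apply Rinv_0_lt_compat].
  + right. generalize dependent (Rpower s eta * exp (mu * s)). intros; field; lra.
- exists C. split; auto. intros x. split; [apply Rmult_le_pos; [lra|apply norm_ge_0]|]. split; [|split].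
  + intros s. apply prim_continuous with eta; auto. apply orbit_sing.
  + apply prim_neg.
  + intros s Hs. generalize (HCx (exist _ s Hs) x). simpl. intros H. assert (Hks := Hk s).
    assert (E : prim (orbit x) s = scal (Rpower s eta * exp (mu * s)) (scal (k s) (prim (orbit x) s))).
    { unfold k. rewrite scal_assoc_R, Rinv_r by lra. symmetry. exact (scal_one_R (V := V) _). }
    rewrite E. apply Rle_trans with ((Rpower s eta * exp (mu * s)) * (C * norm (x : V))); [|right; ring].
    apply (norm_scal_le (V := V)); auto. rewrite Rabs_pos_eq; lra.
Qed.

(** The resolvent equation of S, integrated from 0 to s; the integration
    commutes with the convolution by g_eta and with A. *)
Lemma integrated_resolvent x s : closed_operator A -> 0 < s ->
  dom A (conv eta (prim (orbit x)) s) /\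
  A (conv eta (prim (orbit x)) s) = minus (prim (orbit x) s) (scal (g (eta + 1) s) (x : V)).
Proof.
intros HA Hs. assert (He : 0 < eta) by lra. assert (Hq := orbit_sing x).
assert (E1 : conv eta (prim (orbit x)) s = conv 1 (conv eta (orbit x)) s).
{ transitivity (conv eta (conv 1 (orbit x)) s); [|apply conv_comm with eta; auto; lra].
  symmetry. apply conv_ext with (1 + eta); auto; [lra|apply conv_sing; auto; lra|]. intros v Hv. now rewrite prim_pos by lra. }
rewrite E1.
apply (closed_RInt_gen X A HA (conv eta (orbit x)) (fun r => minus (orbit x r) (scal (g eta r) (x : V))) 0 s); [exact Hs| | |].
- intros r [Hr _]. simpl in Hr. destruct (resolvent_equation _ _ _ _ HS r x Hr) as [y [Hy [Hd E]]].
  assert (Ey : conv eta (orbit x) r = y) by (apply conv_unique; exact Hy).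
  rewrite Ey. split; auto. unfold orbit at 1. rewrite E. symmetry.
  exact (plus_minus_l (scal (RtoC (g eta r) : C_AbsRing) x) (A y)).
- apply (conv_1_correct (V := V) (eta + eta)); auto; [lra|apply conv_sing; auto].
- generalize (is_RInt_gen_minus (V := V) _ _ _ _ (prim_orbit_correct x s Hs) (conv_1_correct (V := V) eta _ s He Hs (sing_g eta (x : V) He))).
  rewrite (g_vec_cv (V := V) eta s x He Hs). auto.
Qed.

End Subordination.

(** * The subordinated family *)

Lemma plus_minus_r {G : AbelianGroup} (u v : G) : plus u (minus v u) = v.
Proof.
unfold minus. rewrite (plus_comm v), plus_assoc, plus_opp_r, plus_zero_l. reflexivity.
Qed.

Lemma scal_comm_C (X : CompleteNormedModule C_AbsRing) (a b : C) (x : X) :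
  scal (a : C_AbsRing) (scal (b : C_AbsRing) x) = scal (b : C_AbsRing) (scal (a : C_AbsRing) x).
Proof.
transitivity (scal (mult (a : C_AbsRing) (b : C_AbsRing)) x); [exact (scal_assoc (a : C_AbsRing) (b : C_AbsRing) x)|].
transitivity (scal (mult (b : C_AbsRing) (a : C_AbsRing)) x); [|symmetry; exact (scal_assoc (b : C_AbsRing) (a : C_AbsRing) x)].
apply (f_equal (fun z : C_AbsRing => scal z x)). exact (Cmult_comm a b).
Qed.

Section Class.

Variables (X : CompleteNormedModule C_AbsRing) (A : linear_operator X) (eta w al : R) (S : R -> X -> X).
Hypotheses (HA : closed_operator A) (Heta : 0 < eta <= 2) (Hw : 0 <= w) (Hal : 0 < al < 1)
  (HS : resolvent_family eta eta A S) (HLap : laplace_transformable w S).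

Notation V := (realify X).
Notation q := (orbit X S).
Notation F := (fun x => prim (orbit X S x)).
Notation T := (kernel_int (psi al 0) S).

Lemma F_growth mu : w < mu -> exists C, 0 < C /\ forall x, growth eta mu (C * norm (x : V)) (F x).
Proof. exact (prim_orbit_growth X A eta w S Heta Hw HS HLap mu). Qed.

Lemma subordinate_int t x : 0 < t ->
  is_RInt_gen (V := V) (fun s => scal (psi al 0 t s) (q x s)) (lo 0) (hi p_infty) (kint al (F x) t).
Proof.
(* any mu > w would do *)
intros Ht. destruct (F_growth (w + 1) ltac:(lra)) as [C [HC HF]].
apply (kint_parts al eta (w + 1) (C * norm (x : V)) t (q x) (F x)); auto; try lra.
intros s Hs. assert (Hq := orbit_sing X A eta S Heta HS x). split; [now apply Hq|].
apply prim_derive with eta; auto; lra.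
Qed.

Lemma subordinate_unique t x v :
  is_RInt_gen (V := V) (fun s => scal (psi al 0 t s) (q x s)) (lo 0) (hi p_infty) v -> T t x = v.
Proof. exact (II_unique (V := V) 0 p_infty _ v). Qed.

Lemma subordinate_kint t x : 0 < t -> T t x = kint (V := V) al (F x) t.
Proof. intros Ht. now apply subordinate_unique, subordinate_int. Qed.

Lemma subordinate_correct t x : 0 < t ->
  is_RInt_gen (V := V) (fun s => scal (psi al 0 t s) (q x s)) (lo 0) (hi p_infty) (T t x).
Proof. intros Ht. rewrite subordinate_kint by auto. now apply subordinate_int. Qed.

Lemma subordinate_converges : kernel_converges (psi al 0) S.
Proof. intros t x Ht. exists (T t x). exact (subordinate_correct t x Ht). Qed.

Lemma subordinate_bound c : 0 < c -> w < Rpower c al -> exists C, 0 < C /\ forall t x, 0 < t ->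
  norm (T t x : V) <= C * norm (x : V) * (Rpower t (al * eta - 1) * exp (c * t)).
Proof.
intros Hc Hwc. set (mu := (w + Rpower c al) / 2). assert (Hmu : w < mu < Rpower c al) by (unfold mu; lra).
destruct (F_growth mu ltac:(lra)) as [C [HC HF]].
destruct (kint_bound (V := V) al eta mu c Hal ltac:(lra) ltac:(lra) Hc ltac:(lra)) as [D [HD HB]].
exists (D * C). split; [now apply Rmult_lt_0_compat|]. intros t x Ht.
rewrite subordinate_kint by auto. apply Rle_trans with (1 := HB _ _ (HF x) t Ht). right. ring.
Qed.

Lemma subordinate_continuous t x : 0 < t -> continuous (U := V) (fun s => T s x) t.
Proof.
intros Ht. destruct (F_growth (w + 1) ltac:(lra)) as [C [HC HF]].
apply (continuous_ext_loc (T := R_UniformSpace) (U := V) _ (kint (V := V) al (F x))).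
- assert (Hi : inn 0 p_infty t) by (split; simpl; auto).
  generalize (locally_inn 0 p_infty t Hi). apply filter_imp. intros s [Hs _]. symmetry. now apply subordinate_kint.
- apply (kint_continuous (V := V) al eta (w + 1) (C * norm (x : V))); auto; lra.
Qed.

Lemma subordinate_linear t : 0 < t -> is_linear (T t).
Proof.
intros Ht. constructor.
- intros x y. apply subordinate_unique.
  generalize (is_RInt_gen_plus (V := V) _ _ _ _ (subordinate_correct t x Ht) (subordinate_correct t y Ht)).
  apply (is_RInt_gen_ext_inn (V := V)); [simpl; auto|]. intros s [Hs _]. simpl in Hs.
  rewrite <- (scal_distr_R (V := V)). f_equal. symmetry. exact (orbit_plus X A eta S HS x y s Hs).
- intros c x. apply subordinate_unique.
  generalize (is_RInt_gen_linear (V := V) (W := V) (fun y => scal (c : C_AbsRing) (y : X)) 0 p_infty _ _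
    (fun u v => scal_distr_l (c : C_AbsRing) (u : X) (v : X))
    (fun k u => scal_comm_C X c (RtoC k) u)
    (continuous_scal_const X c) (subordinate_correct t x Ht)).
  apply (is_RInt_gen_ext_inn (V := V)); [simpl; auto|]. intros s [Hs _]. simpl in Hs.
  symmetry. refine (eq_trans (f_equal (fun y : X => scal (RtoC (psi al 0 t s) : C_AbsRing) y) (orbit_scal X A eta S HS c x s Hs)) _).
  exact (scal_comm_C X _ _ _).
- assert (Hc : 0 < Rpower (w + 1) (/ al)) by apply Rpower_pos.
  destruct (subordinate_bound (Rpower (w + 1) (/ al)) Hc) as [C [HC HB]].
  { rewrite Rpower_mult, Rinv_l, Rpower_1; lra. }
  set (E := Rpower t (al * eta - 1) * exp (Rpower (w + 1) (/ al) * t)) in *.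
  assert (HE : 0 < E) by (apply Rmult_lt_0_compat; apply exp_pos).
  exists (C * E). split; [now apply Rmult_lt_0_compat|]. intros x.
  apply Rle_trans with (1 := HB t x Ht). right. fold E. change (C * norm x * E = C * E * norm x). ring.
Qed.

(** Closedness of A is applied to the integral of the kernel against the
    integrated resolvent equation of S. *)
Lemma subordinate_resolvent : resolvent_family (al * eta) (al * eta) A T.
Proof.
assert (Hb : 0 < al * eta) by (apply Rmult_lt_0_compat; lra).
destruct (F_growth (w + 1) ltac:(lra)) as [C [HC HF]].
assert (He : 0 < eta) by lra. assert (Hm : 0 < w + 1) by lra. assert (Hm' : 0 <= w + 1) by lra.
constructor.
- exact subordinate_linear.
- intros x t Ht. exact (subordinate_continuous t x Ht).
- intros x.
  assert (H := kint_initial (V := V) al eta (w + 1) _ (F x) x Hal Heta Hm' (HF x)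
    (prim_initial (V := V) eta (q x) x He (orbit_sing X A eta S Heta HS x) (resolvent_initial _ _ _ _ HS x))).
  revert H. apply filterlim_ext_loc. exists (mkposreal 1 Rlt_0_1). intros t _ Ht.
  apply (f_equal (fun y : X => scal (RtoC (/ g (al * eta) t) : C_AbsRing) y)). symmetry. now apply subordinate_kint.
- intros t x Ht Hx.
  apply (closed_RInt_gen X A HA (fun s => scal (RtoC (psi al 0 t s) : C_AbsRing) (S s x))
    (fun s => scal (RtoC (psi al 0 t s) : C_AbsRing) (S s (A x))) 0 p_infty); [simpl; auto| |exact (subordinate_correct t x Ht)|exact (subordinate_correct t (A x) Ht)].
  intros s [Hs _]. simpl in Hs. destruct (resolvent_commute _ _ _ _ HS s x Hs Hx) as [D1 D2].
  split; [now apply dom_scal|]. rewrite op_scal by auto. now rewrite D2.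
- intros t x Ht.
  destruct (kint_convolution (V := V) al eta (w + 1) _ t (F x) Hal He Hm (HF x) Ht) as [y [H1 H2]].
  exists y. split; [|].
  { refine (is_RInt_gen_ext_inn (V := V) 0 t _ _ _ Ht _ H1). intros s [Hs _]. simpl in Hs.
    apply (f_equal (fun y : X => scal (RtoC (g (al * eta) (t - s)) : C_AbsRing) y)). symmetry. now apply subordinate_kint. }
  destruct (closed_RInt_gen X A HA (fun s => scal (RtoC (kker al t s) : C_AbsRing) (conv (V := V) eta (F x) s : X))
    (fun s => scal (RtoC (kker al t s) : C_AbsRing) (minus (F x s : X) (scal (RtoC (g (eta + 1) s) : C_AbsRing) x)))
    0 p_infty y (minus (T t x) (scal (RtoC (g (al * eta) t) : C_AbsRing) x))) as [D1 D2].
  + simpl; auto.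
  + intros s [Hs _]. simpl in Hs.
    destruct (integrated_resolvent X A eta S Heta HS x s HA Hs) as [D1 D2].
    split; [now apply dom_scal|]. rewrite op_scal by auto. now rewrite D2.
  + exact H2.
  + assert (I1 : is_RInt_gen (V := V) (fun s => scal (kker al t s) (F x s)) (lo 0) (hi p_infty) (T t x)).
    { rewrite subordinate_kint by auto. exact (kint_correct (V := V) al eta (w + 1) _ t (F x) Hal He Hm' (HF x) Ht). }
    assert (I2 := is_RInt_gen_scal_vec (V := V) _ _ _ x _ (kernel_g al eta t Hal Heta Ht)).
    refine (is_RInt_gen_ext_inn (V := V) 0 p_infty _ _ _ I _ (is_RInt_gen_minus (V := V) _ _ _ _ I1 I2)).
    intros s _.
    transitivity (minus (scal (kker al t s) (F x s)) (scal (kker al t s) (scal (g (eta + 1) s) (x : V)))).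
    * f_equal. symmetry. exact (scal_assoc (V := V) (kker al t s) (g (eta + 1) s) x).
    * symmetry. exact (scal_minus_distr_l (V := V) (kker al t s) (F x s) _).
  + split; auto. rewrite D2. symmetry. exact (plus_minus_r _ _).
Qed.

Lemma subordinate_L1 x : L1_loc (fun t => T t x).
Proof.
intros T0 HT0. assert (Hb : 0 < al * eta) by (apply Rmult_lt_0_compat; lra).
set (c := Rpower (w + 1) (/ al)). assert (Hc : 0 < c) by apply Rpower_pos.
destruct (subordinate_bound c Hc) as [C [HC HB]].
{ unfold c. rewrite Rpower_mult, Rinv_l, Rpower_1; lra. }
set (k := C * norm (x : V) * exp (c * T0)).
assert (Hk : 0 <= k) by (repeat apply Rmult_le_pos; [lra|apply norm_ge_0|left; apply exp_pos]).
assert (Hcn : forall t, 0 < t -> continuous (fun t => norm (T t x)) t).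
{ intros t Ht. apply (continuous_comp (fun t => T t x : V) norm); [now apply subordinate_continuous|].
  exact (Hierarchy.filterlim_norm (T t x)). }
assert (D : dominated (V := RC) 0 T0 (fun t => norm (T t x)) (fun t => k * Rpower t (al * eta - 1))).
{ split; [apply Intg_scal; auto; apply Intg_pow_0; auto|]. intros t [Ht HtT]. simpl in Ht, HtT. split; [now apply Hcn|].
  unfold norm at 1; simpl; unfold abs; simpl. rewrite Rabs_pos_eq by apply norm_ge_0.
  apply Rle_trans with (1 := HB t x Ht). unfold k.
  replace (C * norm (x : V) * exp (c * T0) * Rpower t (al * eta - 1)) with
    (C * norm (x : V) * (Rpower t (al * eta - 1) * exp (c * T0))) by ring.
  apply Rmult_le_compat_l; [apply Rmult_le_pos; [lra|apply norm_ge_0]|].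
  apply Rmult_le_compat_l; [left; apply Rpower_pos|]. apply exp_le. apply Rmult_le_compat_l; lra. }
eexists. apply (is_RInt_gen_hi_point (V := RC) _ 0 p_infty T0); [split; simpl; auto| |exact (dominated_correct (V := RC) _ _ _ _ D)].
intros t [Ht _]. now apply Hcn.
Qed.

(** A real c between w^(1/al) and Re l satisfies w < c^al, and is then a
    growth rate of T. *)
Lemma subordinate_laplace : laplace_transformable (rpow w (1 / al)) T.
Proof.
intros x l Hl. assert (Hb : 0 < al * eta) by (apply Rmult_lt_0_compat; lra).
set (c := (rpow w (1 / al) + Re l) / 2).
assert (Hr0 : 0 <= rpow w (1 / al)) by (unfold rpow; destruct (Rlt_dec 0 w); [left; apply Rpower_pos|lra]).
assert (Hc : 0 < c) by (unfold c; lra). assert (Hcl : c < Re l) by (unfold c; lra).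
assert (Hwc : w < Rpower c al).
{ unfold c, rpow in *. destruct (Rlt_dec 0 w) as [Hw0|Hw0].
  - assert (E : Rpower (Rpower w (1 / al)) al = w).
    { rewrite Rpower_mult. replace (1 / al * al) with 1 by (field; lra). now apply Rpower_1. }
    rewrite <- E at 1. apply Rlt_Rpower_l; [lra|]. split; [apply Rpower_pos|lra].
  - assert (w = 0) by lra. subst w. apply Rpower_pos. }
destruct (subordinate_bound c Hc Hwc) as [C [HC HB]].
assert (D : dominated (V := V) 0 p_infty (fun t => scal (cexp (- (l * RtoC t))%C : C_AbsRing) (T t x))
  (fun t => C * norm (x : V) * (Rpower t (al * eta - 1) * exp (- ((Re l - c) * t))))).
{ split.
  - apply Intg_scal; [apply Rmult_le_pos; [lra|apply norm_ge_0]|]. apply Intg_gamma; lra.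
  - intros t [Ht _]. simpl in Ht. split.
    + apply continuous_scal_C; [|exact (subordinate_continuous t x Ht)]. ccont. apply continuous_id.
    + assert (Hce : Cmod (cexp (- (l * RtoC t))%C) <= exp (- (Re l * t))).
      { rewrite Cmod_cexp. right. f_equal. destruct l as [l1 l2]. simpl. ring. }
      apply Rle_trans with (1 := norm_scal_C X _ _ _ _ Hce (HB t x Ht)).
      right. replace (- ((Re l - c) * t)) with (- (Re l * t) + c * t) by ring. rewrite exp_plus. ring. }
exists (II (V := V) 0 p_infty (fun t => scal (cexp (- (l * RtoC t))%C : C_AbsRing) (T t x))).
exact (dominated_correct (V := V) _ _ _ _ D).
Qed.

Theorem subordination :
  kernel_converges (psi al 0) S /\ generates_in_class (al * eta) (al * eta) (rpow w (1 / al)) A T.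
Proof.
split; [exact subordinate_converges|]. split; [exact subordinate_resolvent|].
split; [exact subordinate_L1|exact subordinate_laplace].
Qed.

End Class.

Lemma exp_bounded_class (X : CompleteNormedModule C_AbsRing) (A : linear_operator X) eta M w (S : R -> X -> X) :
  0 <= w -> 0 < M -> resolvent_family eta eta A S -> exp_bounded M w S ->
  generates_in_class eta eta w A S.
Proof.
intros Hw HM HS HE. split; [exact HS|]. split.
- intros x T HT.
  assert (Hcn : forall t, 0 < t -> continuous (fun t => norm (S t x)) t).
  { intros t Ht. apply (continuous_comp (fun t => S t x : realify X) norm); [exact (resolvent_continuous _ _ _ _ HS x t Ht)|].
    exact (Hierarchy.filterlim_norm (V := realify X) (S t x)). }
  assert (Hnx := norm_ge_0 (x : realify X)).
  assert (D : dominated (V := RC) 0 T (fun t => norm (S t x)) (fun t => (M * exp (w * T) * norm (x : realify X)) * Rpower t (1 - 1))).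
  { split.
    - apply Intg_scal; [repeat apply Rmult_le_pos; try lra; try exact Hnx; left; apply exp_pos|apply Intg_pow_0; lra].
    - intros t [Ht HtT]. simpl in Ht, HtT. split; [now apply Hcn|].
      unfold norm at 1; simpl; unfold abs; simpl. rewrite Rabs_pos_eq by apply norm_ge_0.
      apply Rle_trans with (1 := HE t x Ht). replace (1 - 1) with 0 by ring. rewrite Rpower_O, Rmult_1_r by auto.
      apply Rmult_le_compat_r; [exact Hnx|]. apply Rmult_le_compat_l; [lra|]. apply exp_le. apply Rmult_le_compat_l; lra. }
  eexists. apply (is_RInt_gen_hi_point (V := RC) _ 0 p_infty T); [split; simpl; auto| |exact (dominated_correct (V := RC) _ _ _ _ D)].
  intros t [Ht _]. now apply Hcn.
- intros x l Hl.
  assert (Hnx := norm_ge_0 (x : realify X)).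
  assert (D : dominated (V := realify X) 0 p_infty (fun t => scal (cexp (- (l * RtoC t))%C : C_AbsRing) (S t x))
    (fun t => M * norm (x : realify X) * (Rpower t (1 - 1) * exp (- ((Re l - w) * t))))).
  { split.
    - apply Intg_scal; [apply Rmult_le_pos; lra|]. apply Intg_gamma; lra.
    - intros t [Ht _]. simpl in Ht. split.
      + apply continuous_scal_C; [|exact (resolvent_continuous _ _ _ _ HS x t Ht)]. ccont. apply continuous_id.
      + assert (Hce : Cmod (cexp (- (l * RtoC t))%C) <= exp (- (Re l * t))).
        { rewrite Cmod_cexp. right. f_equal. destruct l as [l1 l2]. simpl. ring. }
        apply Rle_trans with (1 := norm_scal_C X _ _ _ _ Hce (HE t x Ht)).
        right. replace (1 - 1) with 0 by ring. rewrite Rpower_O by auto.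
        replace (- ((Re l - w) * t)) with (- (Re l * t) + w * t) by ring. rewrite exp_plus.
        change (exp (- (Re l * t)) * (M * exp (w * t) * norm (x : realify X)) =
          M * norm (x : realify X) * (1 * (exp (- (Re l * t)) * exp (w * t)))). ring. }
  exists (II (V := realify X) 0 p_infty (fun t => scal (cexp (- (l * RtoC t))%C : C_AbsRing) (S t x))).
  exact (dominated_correct (V := realify X) _ _ _ _ D).
Qed.

(** * The kernel of order one half is a Gaussian *)

(** Stated without division for the induction. *)
Lemma Gamma_half_integer k : Gamma (INR k + 3 / 2) * (2 * 4 ^ k * INR (fact k)) = sqrt PI * INR (fact (2 * k + 1)).
Proof.
induction k as [|k IH].
- replace (INR 0 + 3 / 2) with (1 / 2 + 1) by (simpl; field). rewrite Gamma_S, Gamma_half by lra. simpl. field.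
- replace (INR (S k) + 3 / 2) with ((INR k + 3 / 2) + 1) by (rewrite S_INR; ring).
  assert (Hk := pos_INR k). rewrite Gamma_S by lra.
  replace (2 * S k + 1)%nat with (S (S (2 * k + 1))) by lia.
  rewrite !fact_simpl, !mult_INR, !S_INR, plus_INR, mult_INR.
  change (4 ^ S k) with (4 * 4 ^ k).
  replace ((INR k + 3 / 2) * Gamma (INR k + 3 / 2) * (2 * (4 * 4 ^ k) * ((INR k + 1) * INR (fact k)))) with
    (Gamma (INR k + 3 / 2) * (2 * 4 ^ k * INR (fact k)) * (2 * (2 * INR k + 3) * (INR k + 1))) by field.
  rewrite IH. simpl (INR 2). simpl (INR 1). ring.
Qed.

Lemma wcoef_half_even k : wcoef (1 / 2) 0 (2 * k) = 0.
Proof.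
unfold wcoef. replace (- (1 / 2) * INR (2 * k) + - 0) with (- INR k) by (rewrite mult_INR; simpl; field).
rewrite rGamma_neg by apply pos_INR.
replace (PI * INR k) with (- 0 + INR k * PI) by ring. rewrite sin_add_nPI, sin_0. unfold Rdiv. ring.
Qed.

(** Only odd powers survive, and the factorials recombine into those of an
    exponential series in z^2. *)
Lemma wcoef_half_odd k : wcoef (1 / 2) 0 (2 * k + 1) = - (1 / (2 * sqrt PI)) * ((- (1 / 4)) ^ k * / INR (fact k)).
Proof.
assert (HPI := PI_RGT_0). assert (Hsq := sqrt_lt_R0 PI HPI).
assert (Hss : sqrt PI * sqrt PI = PI) by (apply sqrt_sqrt; lra).
assert (Hk := pos_INR k).
unfold wcoef. replace (- (1 / 2) * INR (2 * k + 1) + - 0) with (- (INR k + 1 / 2)) by (rewrite plus_INR, mult_INR; simpl; field).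
rewrite rGamma_neg by lra.
replace (PI * (INR k + 1 / 2)) with (- (- (PI / 2)) + INR k * PI) by field. rewrite sin_add_nPI, sin_neg, sin_PI2.
replace (INR k + 1 / 2 + 1) with (INR k + 3 / 2) by field.
assert (H4 : 0 < 4 ^ k) by (apply pow_lt; lra).
assert (Hf := INR_fact_lt_0 k). assert (Hf2 := INR_fact_lt_0 (2 * k + 1)).
assert (EG : Gamma (INR k + 3 / 2) = sqrt PI * INR (fact (2 * k + 1)) / (2 * 4 ^ k * INR (fact k))).
{ rewrite <- Gamma_half_integer. field. lra. }
rewrite EG. replace (- (1 / 4)) with (- (1) * / 4) by field. rewrite Rpow_mult_distr, pow_inv.
replace (- (1)) with (-1) by ring. unfold Rdiv.
replace (/ PI) with (/ (sqrt PI * sqrt PI)) by now rewrite Hss. field. lra.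
Qed.

Lemma wr_half z : wr (1 / 2) 0 z = - (z / (2 * sqrt PI)) * exp (- (z ^ 2 / 4)).
Proof.
assert (HPI := PI_RGT_0). assert (Hsq := sqrt_lt_R0 PI HPI).
unfold wr. apply is_pseries_unique.
replace (- (z / (2 * sqrt PI)) * exp (- (z ^ 2 / 4))) with (0 + z * (- (1 / (2 * sqrt PI)) * exp (- (z ^ 2 / 4)))) by (field; lra).
apply is_pseries_odd_even.
- apply is_pseries_R. apply (is_series_ext (fun _ => 0)).
  + intros n. rewrite wcoef_half_even. symmetry. apply Rmult_0_l.
  + apply filterlim_ext with (fun _ : nat => 0); [|apply filterlim_const].
    intros n. rewrite sum_n_const. symmetry. apply Rmult_0_r.
- apply is_pseries_R.
  apply (is_series_ext (fun n => scal (- (1 / (2 * sqrt PI))) (/ INR (fact n) * (- (z ^ 2 / 4)) ^ n))).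
  + intros n. rewrite wcoef_half_odd. unfold scal; simpl; unfold mult; simpl.
    replace (- (z * (z * 1) / 4)) with (- (1 / 4) * (z * (z * 1))) by field. rewrite Rpow_mult_distr.
    generalize ((- (1 / 4)) ^ n) ((z * (z * 1)) ^ n) (/ INR (fact n)) (- (1 / (2 * sqrt PI))). intros a b c d.
    change (d * (c * (a * b)) = d * (a * c) * b). ring.
  + apply (is_series_scal (V := R_NormedModule)). apply is_pseries_R. apply is_exp_Reals.
Qed.

Lemma psi_half t s : 0 < t ->
  psi (1 / 2) 0 t s = 1 / (2 * sqrt PI) * Rpower t (- (3 / 2)) * (s * exp (- s ^ 2 / (4 * t))).
Proof.
intros Ht. assert (HPI := PI_RGT_0). assert (Hsq := sqrt_lt_R0 PI HPI).
rewrite psi_wr by lra. rewrite wr_half.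
set (r := Rpower t (- (1 / 2))).
assert (Er : r * r = / t).
{ unfold r. rewrite <- Rpower_plus. replace (- (1 / 2) + - (1 / 2)) with (- (1)) by field. now rewrite (Rpower_Ropp t 1), Rpower_1. }
assert (E3 : Rpower t (- (3 / 2)) = / t * r).
{ unfold r. rewrite <- Er. unfold r. rewrite <- !Rpower_plus. f_equal. field. }
rewrite E3. replace (- ((- (s * r)) ^ 2 / 4)) with (- s ^ 2 / (4 * t)).
- field. lra.
- replace ((- (s * r)) ^ 2) with (s ^ 2 * (r * r)) by ring. rewrite Er. field. lra.
Qed.

(** * The growth bound of the Gaussian transform *)

Lemma gauss_le u : (1 + Rabs u) * exp (- (u ^ 2 / 4)) <= 3 / (1 + u ^ 2 / 8).
Proof.
assert (Hu : 0 <= u ^ 2) by apply pow2_ge_0.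
assert (He : exp (- (u ^ 2 / 4)) <= / ((1 + u ^ 2 / 8) * (1 + u ^ 2 / 8))).
{ replace (- (u ^ 2 / 4)) with (- (u ^ 2 / 8) + - (u ^ 2 / 8)) by field. rewrite exp_plus, exp_Ropp.
  rewrite <- Rinv_mult. apply Rinv_le_contravar; [apply Rmult_lt_0_compat; lra|].
  assert (H := exp_ineq1_le (u ^ 2 / 8)). apply Rmult_le_compat; lra. }
assert (Ha : 1 + Rabs u <= 3 * (1 + u ^ 2 / 8)).
{ assert (H : u ^ 2 = Rabs u * Rabs u) by (rewrite <- Rabs_mult, Rabs_pos_eq; [ring|apply Rle_0_sqr]).
  rewrite H. generalize (Rabs_pos u). generalize (Rabs u). intros r Hr. nra. }
assert (Hp : 0 <= 1 + Rabs u) by (generalize (Rabs_pos u); lra).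
apply Rle_trans with (3 * (1 + u ^ 2 / 8) * / ((1 + u ^ 2 / 8) * (1 + u ^ 2 / 8))).
- apply Rmult_le_compat; auto. left; apply exp_pos.
- right. field. lra.
Qed.

(** Completing the square in the exponent; u = (s - 2wt) / sqrt t is the
    centred variable, in which s is at most (1 + 2w) t (1 + |u|). *)
Lemma gauss_majorant w t s : 0 <= w -> 1 <= t -> 0 < s ->
  s * exp (- s ^ 2 / (4 * t)) * exp (w * s) <=
  exp (w ^ 2 * t) * (3 * (1 + 2 * w) * t / (1 + ((s - 2 * w * t) / sqrt t) ^ 2 / 8)).
Proof.
intros Hw Ht Hs. set (r := sqrt t). assert (Hr : 0 < r) by (apply sqrt_lt_R0; lra).
assert (Hrr : r * r = t) by (apply sqrt_sqrt; lra).
assert (Hr1 : 1 <= r) by (unfold r; rewrite <- sqrt_1; apply sqrt_le_1; lra).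
set (u := (s - 2 * w * t) / r).
assert (Eu : s = r * (u + 2 * w * r)).
{ unfold u. replace (r * ((s - 2 * w * t) / r + 2 * w * r)) with (s - 2 * w * t + 2 * w * (r * r)) by (field; lra). rewrite Hrr. ring. }
assert (Ee : exp (- s ^ 2 / (4 * t)) * exp (w * s) = exp (w ^ 2 * t) * exp (- (u ^ 2 / 4))).
{ rewrite <- !exp_plus. f_equal. rewrite Eu, <- Hrr. field. lra. }
rewrite Rmult_assoc, Ee.
replace (s * (exp (w ^ 2 * t) * exp (- (u ^ 2 / 4)))) with (exp (w ^ 2 * t) * (s * exp (- (u ^ 2 / 4)))) by ring.
apply Rmult_le_compat_l; [left; apply exp_pos|].
assert (Hsu : s <= (1 + 2 * w) * t * (1 + Rabs u)).
{ rewrite Eu at 1. rewrite <- Hrr. assert (Ha := Rle_abs u). assert (Hp := Rabs_pos u).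
  apply Rle_trans with (r * ((1 + 2 * w) * r * (1 + Rabs u))); [|right; ring].
  apply Rmult_le_compat_l; [lra|].
  assert (0 <= w * r) by (apply Rmult_le_pos; lra).
  assert (Rabs u <= r * (1 + Rabs u)) by nra.
  assert (0 <= w * r * Rabs u) by (apply Rmult_le_pos; lra). nra. }
apply Rle_trans with ((1 + 2 * w) * t * (1 + Rabs u) * exp (- (u ^ 2 / 4))).
- apply Rmult_le_compat_r; [left; apply exp_pos|auto].
- rewrite Rmult_assoc. replace (3 * (1 + 2 * w) * t / (1 + u ^ 2 / 8)) with ((1 + 2 * w) * t * (3 / (1 + u ^ 2 / 8))).
  + apply Rmult_le_compat_l; [apply Rmult_le_pos; lra|apply gauss_le].
  + field. assert (0 <= u ^ 2) by apply pow2_ge_0. lra.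
Qed.

Lemma Intg_cauchy m r k : 0 < r -> 0 <= k ->
  Intg 0 p_infty (fun s => k / (1 + ((s - m) / r) ^ 2 / 8)) /\
  forall x y, inn 0 p_infty x -> inn 0 p_infty y -> x <= y ->
    RInt (fun s => k / (1 + ((s - m) / r) ^ 2 / 8)) x y <= k * (r * (3 * PI)).
Proof.
intros Hr Hk. assert (HPI := PI_RGT_0).
set (c := sqrt 8). assert (Hc : 0 < c) by (apply sqrt_lt_R0; lra). assert (Hcc : c * c = 8) by (apply sqrt_sqrt; lra).
assert (Hc3 : c <= 3) by nra.
set (h := fun s => k / (1 + ((s - m) / r) ^ 2 / 8)).
set (H := fun s => k * (r * c * atan ((s - m) / (r * c)))).
assert (Hden : forall s, 0 < 1 + ((s - m) / r) ^ 2 / 8).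
{ intros s. generalize (pow2_ge_0 ((s - m) / r)). lra. }
assert (Hcont : forall s, continuous h s).
{ intros s. apply deriv_cont. unfold h. auto_derive. generalize (Hden s). unfold Rdiv, Rminus. simpl. lra. }
assert (Hder : forall s, is_derive H s (h s)).
{ intros s. assert (Hrc : 0 < r * c) by now apply Rmult_lt_0_compat.
  assert (Ha : is_derive (fun s => atan ((s - m) / (r * c))) s (scal (/ (r * c)) (/ (1 + ((s - m) / (r * c))²)))).
  { apply (is_derive_comp (V := R_NormedModule) atan (fun s => (s - m) / (r * c))); [apply is_derive_atan|]. auto_derive; auto. field. lra. }
  apply (is_derive_scal _ s (r * c)) in Ha. apply (is_derive_scal _ s k) in Ha.
  unfold H. replace (h s) with (k * (r * c * scal (/ (r * c)) (/ (1 + ((s - m) / (r * c))²)))); [exact Ha|].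
  unfold h, scal; simpl; unfold mult; simpl.
  assert (Ed : 1 + ((s - m) / (r * c))² = 1 + (s - m) / r * ((s - m) / r * 1) / 8).
  { unfold Rsqr. rewrite <- Hcc. field. lra. }
  rewrite Ed. rewrite (Rinv_cancel_l (r * c)) by lra. reflexivity. }
assert (Hb : forall s, Rabs (H s) <= k * (r * (3 * PI)) / 2).
{ intros s. unfold H. rewrite Rabs_mult, (Rabs_pos_eq k), Rabs_mult, (Rabs_pos_eq (r * c)) by (try apply Rmult_le_pos; lra).
  replace (k * (r * (3 * PI)) / 2) with (k * (r * 3 * (PI / 2))) by field.
  apply Rmult_le_compat_l; auto. apply Rmult_le_compat; [apply Rmult_le_pos; lra|apply Rabs_pos|apply Rmult_le_compat_l; lra|].
  apply Rabs_le. generalize (atan_bound ((s - m) / (r * c))). lra. }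
split.
- apply (Intg_primitive 0 p_infty h H (k * (r * (3 * PI)) / 2)); simpl; auto.
  intros s _. split; auto. unfold h. apply Rmult_le_pos; auto. left. now apply Rinv_0_lt_compat.
- intros x y _ _ _.
  assert (I : is_RInt h x y (minus (H y) (H x))) by (apply (is_RInt_derive (V := RC) H h); intros; auto).
  fold h. rewrite (is_RInt_unique _ _ _ _ I). unfold minus, plus, opp; simpl.
  generalize (Hb x) (Hb y) (Rle_abs (H y)) (Rle_abs (- H x)). rewrite (Rabs_Ropp (H x)). lra.
Qed.

Lemma resolvent_family_ext (X : CompleteNormedModule C_AbsRing) (A : linear_operator X) a b (S T : R -> X -> X) :
  (forall t x, 0 < t -> S t x = T t x) -> resolvent_family a b A S -> resolvent_family a b A T.
Proof.
intros E [H1 H2 H3 H4 H5]. constructor.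
- intros t Ht. apply (is_linear_ext (S t)); auto.
- intros x t Ht. apply (continuous_ext_loc (T := R_UniformSpace) (U := realify X) _ (fun s => S s x)); [|exact (H2 x t Ht)].
  assert (Hi : inn 0 p_infty t) by (split; simpl; auto).
  generalize (locally_inn 0 p_infty t Hi). apply filter_imp. intros s [Hs _]. now apply E.
- intros x. generalize (H3 x). apply filterlim_ext_loc. exists (mkposreal 1 Rlt_0_1). intros t _ Ht. now rewrite E.
- intros t x Ht Hx. rewrite <- !E by auto. auto.
- intros t x Ht. destruct (H5 t x Ht) as [y [Hy Hd]]. exists y. rewrite <- E by auto. split; auto.
  refine (is_RInt_gen_ext_inn (V := realify X) 0 t _ _ _ Ht _ Hy). intros s [Hs _]. now rewrite E.
Qed.

Section Sine.

Variables (X : CompleteNormedModule C_AbsRing) (A : linear_operator X) (w M : R) (S : R -> X -> X).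
Hypotheses (HA : closed_operator A) (Hw : 0 <= w) (HS : resolvent_family 2 2 A S) (HM : 0 < M) (HE : exp_bounded M w S).

Notation V := (realify X).
Notation T := (kernel_int (psi (1 / 2) 0) S).

(** For t <= 1 the linear growth of S at 0 is needed; for t >= 1 the
    Gaussian majorant has an integral of order t^(3/2) e^(w^2 t), and the rate
    w^2 is attained because no part of the decay is given away. *)
Lemma weierstrass_bound : exists M', 0 < M' /\ forall t x, 0 < t -> norm (T t x : V) <= M' * exp (w ^ 2 * t) * norm (x : V).
Proof.
assert (HPI := PI_RGT_0). assert (Hsq := sqrt_lt_R0 PI HPI).
destruct (exp_bounded_class X A 2 M w S Hw HM HS HE) as [_ [_ HLap]].
set (c := Rpower (w + 1) (/ (1 / 2))). assert (Hc : 0 < c) by apply Rpower_pos.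
assert (H2 : 0 < 2 <= 2) by lra. assert (H12 : 0 < 1 / 2 < 1) by lra.
destruct (subordinate_bound X A 2 w (1 / 2) S H2 Hw H12 HS HLap c Hc) as [C [HC HB]].
{ unfold c. rewrite Rpower_mult, Rinv_l, Rpower_1; lra. }
set (C2 := 1 / (2 * sqrt PI) * M * (3 * (1 + 2 * w)) * (3 * PI)).
assert (HC2 : 0 < C2).
{ assert (0 < 1 / (2 * sqrt PI)) by (apply Rdiv_lt_0_compat; lra).
  apply Rmult_lt_0_compat; [apply Rmult_lt_0_compat; [now apply Rmult_lt_0_compat|lra]|lra]. }
assert (HC1 : 0 < C * exp c) by (apply Rmult_lt_0_compat; auto; apply exp_pos).
exists (C * exp c + C2). split; [lra|]. intros t x Ht.
assert (Hnx : 0 <= norm (x : V)) by apply norm_ge_0.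
assert (Hew := exp_pos (w ^ 2 * t)).
destruct (Rle_dec t 1) as [Ht1|Ht1].
- apply Rle_trans with (1 := HB t x Ht). replace (1 / 2 * 2 - 1) with 0 by field. rewrite Rpower_O, Rmult_1_l by auto.
  assert (H1 : exp (c * t) <= exp c) by (apply exp_le; nra).
  assert (H3 : 1 <= exp (w ^ 2 * t)).
  { rewrite <- exp_0. apply exp_le. apply Rmult_le_pos; [apply pow2_ge_0|lra]. }
  apply Rle_trans with (C * exp c * norm (x : V)).
  + replace (C * norm (x : V) * exp (c * t)) with (C * exp (c * t) * norm (x : V)) by ring.
    apply Rmult_le_compat_r; auto. apply Rmult_le_compat_l; lra.
  + apply Rmult_le_compat_r; auto. nra.
- set (kc := 1 / (2 * sqrt PI) * Rpower t (- (3 / 2))).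
  assert (Hkc : 0 < kc) by (apply Rmult_lt_0_compat; [apply Rdiv_lt_0_compat; lra|apply Rpower_pos]).
  set (kk := kc * (M * norm (x : V)) * exp (w ^ 2 * t) * (3 * (1 + 2 * w) * t)).
  assert (Hkk : 0 <= kk).
  { apply Rmult_le_pos; [apply Rmult_le_pos; [apply Rmult_le_pos; [lra|apply Rmult_le_pos; lra]|lra]|].
    apply Rmult_le_pos; lra. }
  assert (Hst : 0 < sqrt t) by (apply sqrt_lt_R0; auto).
  destruct (Intg_cauchy (2 * w * t) (sqrt t) kk Hst Hkk) as [I1 I2].
  assert (D : dominated (V := V) 0 p_infty (fun s => scal (psi (1 / 2) 0 t s) (orbit X S x s))
     (fun s => kk / (1 + ((s - 2 * w * t) / sqrt t) ^ 2 / 8))).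
  { split; [exact I1|]. intros s [Hs _]. simpl in Hs. split.
    - apply (continuous_scal_R (V := V)); [apply continuous_psi; auto|exact (resolvent_continuous _ _ _ _ HS x s Hs)].
    - rewrite psi_half by auto. fold kc.
      assert (Hse : 0 <= s * exp (- s ^ 2 / (4 * t))) by (apply Rmult_le_pos; [lra|left; apply exp_pos]).
      assert (Hab : Rabs (kc * (s * exp (- s ^ 2 / (4 * t)))) <= kc * (s * exp (- s ^ 2 / (4 * t)))).
      { rewrite Rabs_pos_eq; [lra|]. apply Rmult_le_pos; lra. }
      apply Rle_trans with (1 := norm_scal_le (V := V) _ _ _ _ Hab (HE s x Hs)).
      apply Rle_trans with (kc * (M * norm (x : V)) * (s * exp (- s ^ 2 / (4 * t)) * exp (w * s))).
      + right. change (kc * (s * exp (- s ^ 2 / (4 * t))) * (M * exp (w * s) * norm (x : V)) =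
          kc * (M * norm (x : V)) * (s * exp (- s ^ 2 / (4 * t)) * exp (w * s))). ring.
      + apply Rle_trans with (kc * (M * norm (x : V)) * (exp (w ^ 2 * t) * (3 * (1 + 2 * w) * t / (1 + ((s - 2 * w * t) / sqrt t) ^ 2 / 8)))).
        * apply Rmult_le_compat_l; [apply Rmult_le_pos; [lra|apply Rmult_le_pos; lra]|]. apply gauss_majorant; lra.
        * right. unfold kk, Rdiv. ring. }
  assert (HT : norm (T t x : V) <= kk * (sqrt t * (3 * PI))).
  { exact (II_norm_M (V := V) _ _ _ _ _ D I2). }
  apply Rle_trans with (1 := HT).
  assert (E : Rpower t (- (3 / 2)) * t * sqrt t = 1).
  { rewrite <- (Rpower_sqrt t Ht). rewrite <- (Rpower_1 t Ht) at 2. rewrite <- !Rpower_plus.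
    replace (- (3 / 2) + 1 + / 2) with 0 by field. now apply Rpower_O. }
  replace (kk * (sqrt t * (3 * PI))) with (C2 * exp (w ^ 2 * t) * norm (x : V) * (Rpower t (- (3 / 2)) * t * sqrt t)).
  2:{ unfold kk, kc, C2. ring. }
  rewrite E, Rmult_1_r. apply Rmult_le_compat_r; auto. apply Rmult_le_compat_r; lra.
Qed.

End Sine.

Theorem corollary7 (X : CompleteNormedModule C_AbsRing) (A : linear_operator X)
    (eta alpha w : R) :
  0 < eta <= 2 -> 0 < alpha < 1 -> 0 <= w ->
  densely_defined A -> closed_operator A ->
  (forall S : R -> X -> X,
     generates_in_class eta eta w A S ->
     kernel_converges (psi alpha 0) S /\
     generates_in_class (alpha * eta) (alpha * eta) (rpow w (1 / alpha)) A
       (kernel_int (psi alpha 0) S))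
  /\
  (forall (T : R -> X -> X) (M : R),
     generates_semigroup A T -> 0 < M -> exp_bounded M w T ->
     kernel_converges (psi alpha 0) T /\
     generates_in_class alpha alpha (rpow w (1 / alpha)) A
       (kernel_int (psi alpha 0) T))
  /\
  (forall (beta : R) (S : R -> X -> X),
     1 < beta <= 2 ->
     generates_in_class beta beta w A S ->
     kernel_converges (psi (1 / beta) 0) S /\
     generates_semigroup A (kernel_int (psi (1 / beta) 0) S) /\
     generates_in_class 1 1 (rpow w beta) A
       (kernel_int (psi (1 / beta) 0) S))
  /\
  (forall (S : R -> X -> X) (M : R),
     generates_sine_function A S -> 0 < M -> exp_bounded M w S ->
     let k := fun t s : R => s * exp (- s ^ 2 / (4 * t)) in
     let T := fun (t : R) (x : X) =>
       scal (RtoC (1 / (2 * sqrt PI) * Rpower t (- (3 / 2))) : C_AbsRing)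
         (kernel_int k S t x) in
     kernel_converges k S /\
     generates_semigroup A T /\
     exists M' : R, 0 < M' /\ exp_bounded M' (w ^ 2) T).
Proof.
intros Heta Hal Hw _ HA. split; [|split; [|split]].
- intros S [HS [_ HL]]. exact (subordination X A eta w alpha S HA Heta Hw Hal HS HL).
- intros T M HT HM HE.
  destruct (exp_bounded_class X A 1 M w T Hw HM HT HE) as [_ [_ HL]].
  assert (H1 : 0 < 1 <= 2) by lra.
  generalize (subordination X A 1 w alpha T HA H1 Hw Hal HT HL). now rewrite Rmult_1_r.
- intros beta S Hbeta [HS [_ HL]].
  assert (Hb : 0 < beta <= 2) by lra.
  assert (Hib : 0 < 1 / beta < 1).
  { split; [apply Rdiv_lt_0_compat; lra|]. apply Rmult_lt_reg_r with beta; [lra|]. unfold Rdiv. rewrite Rmult_1_l, Rinv_l; lra. }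
  generalize (subordination X A beta w (1 / beta) S HA Hb Hw Hib HS HL).
  replace (1 / beta * beta) with 1 by (field; lra). replace (1 / (1 / beta)) with beta by (field; lra).
  intros [H1 H2]. split; [exact H1|]. split; [exact (proj1 H2)|exact H2].
- intros S M HS HM HE k T. assert (HPI := PI_RGT_0). assert (Hsq := sqrt_lt_R0 PI HPI).
  destruct (exp_bounded_class X A 2 M w S Hw HM HS HE) as [_ [_ HL]].
  assert (H2 : 0 < 2 <= 2) by lra. assert (H12 : 0 < 1 / 2 < 1) by lra.
  set (c := fun t => 1 / (2 * sqrt PI) * Rpower t (- (3 / 2))).
  assert (Hc : forall t, 0 < c t) by (intros t; apply Rmult_lt_0_compat; [apply Rdiv_lt_0_compat; lra|apply Rpower_pos]).
  assert (HI : forall t x, 0 < t -> is_RInt_gen (V := realify X) (fun s => scal (k t s) (orbit X S x s)) (lo 0) (hi p_infty)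
     (scal (/ c t) (kernel_int (psi (1 / 2) 0) S t x : realify X))).
  { intros t x Ht.
    refine (is_RInt_gen_ext_inn (V := realify X) 0 p_infty _ _ _ I _ (is_RInt_gen_scal (V := realify X) _ (/ c t) _
      (subordinate_correct X A 2 w (1 / 2) S H2 Hw H12 HS HL t x Ht))).
    intros s _. rewrite (scal_assoc_R (V := realify X)). f_equal. rewrite psi_half by auto. fold (c t).
    unfold k. field. apply Rgt_not_eq, Hc. }
  assert (ET : forall t x, 0 < t -> kernel_int (psi (1 / 2) 0) S t x = T t x).
  { intros t x Ht.
    assert (Ek : kernel_int k S t x = scal (/ c t) (kernel_int (psi (1 / 2) 0) S t x : realify X)) by exact (II_unique (V := realify X) 0 p_infty _ _ (HI t x Ht)).
    unfold T. rewrite Ek. symmetry.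
    refine (eq_trans (scal_assoc_R (V := realify X) (c t) (/ c t) _) _).
    rewrite Rinv_r by (apply Rgt_not_eq, Hc). exact (scal_one_R (V := realify X) _). }
  split; [|split].
  + intros t x Ht. eexists. exact (HI t x Ht).
  + apply (resolvent_family_ext X A 1 1 (kernel_int (psi (1 / 2) 0) S)); [exact ET|].
    generalize (subordinate_resolvent X A 2 w (1 / 2) S HA H2 Hw H12 HS HL). now replace (1 / 2 * 2) with 1 by field.
  + destruct (weierstrass_bound X A w M S Hw HS HM HE) as [M' [HM' HB]].
    exists M'. split; auto. intros t x Ht. rewrite <- ET by auto. exact (HB t x Ht).
Qed.
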